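(* Let $N\ge 1$. Fix any $\epsilon\in\mathcal{E}$. The function $\mathcal{L}_N:(\mathbb{C}\smallsetminus P_N)\times\widetilde{\mathcal{D}}_N\to\mathbb{C}$ given by $$\mathcal{L}_N(s,w,a,\theta):=\lim_{\omega\to 0,\ \omega<0}\mathcal{L}_{N,\epsilon}\big(s,\mathrm{e}^{i\omega}w,\mathrm{e}^{i\omega}a,\theta\big)$$ is well-defined (the limit exists) and independent of the choice of $\epsilon\in\mathcal{E}$. Furthermore: (i) for each fixed $(w,a,\theta)\in\widetilde{\mathcal{D}}_N$, the map $s\mapsto\mathcal{L}_N(s,w,a,\theta)$ defines a meromorphic function on $\mathbb{C}$ having at most simple poles at $P_N$; (ii) for each fixed $\theta\in\mathbb{R}^N$ and any $\Lambda\subseteq P_N$, the map $(s,w,a)\mapsto\mathcal{L}_N(s,w,a,\theta)$ is holomorphic on $(\mathbb{C}\smallsetminus P_N)\times p\big(T_\Lambda(\mathcal{T}_N^+)\big)$; (iii) for every $(s,w,a,\theta)\in(\mathbb{C}\smallsetminus P_N)\times\mathcal{C}\times\mathcal{C}^N\times\mathbb{R}^N$ we have $\mathcal{L}_N(s,w,a,\theta)=\zeta_N(s,w,a,\theta)$.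
   Context: Notation: $\mathrm{e}(z):=\mathrm{e}^{2\pi i z}$; $\mathbb{N}=\{0,1,2,\dots\}$; $P_N=\{1,\dots,N\}$; a vector $v\in\mathbb{C}^N$ is viewed as a function $P_N\to\mathbb{C}$, and $v^{-1}[S]=\{\ell\in P_N: v_\ell\in S\}$. For $\Lambda\subseteq P_N$, $\mathrm{Tr}(v,\Lambda):=\sum_{\ell\in\Lambda}v_\ell$. Let $\mathcal{C}:=\{z\in\mathbb{C}:\mathrm{Re}(z)>0\text{ or } z\in i\mathbb{R}_{>0}\}$. Let $\mathbb{D}_N:=\{(w,a,\theta)\in\mathbb{C}\times\mathbb{C}^N\times\mathbb{R}^N : a^{-1}[0]\subseteq\theta^{-1}[\mathbb{R}\smallsetminus\mathbb{Z}]\}$, $\pi(w,a,\theta):=w-\mathrm{Tr}(a,a^{-1}[-\mathcal{C}])$, and $\widetilde{\mathcal{D}}_N:=\{\delta\in\mathbb{D}_N:\pi(\delta)\in\mathcal{C}\}$. For $\Lambda\subseteq P_N$ let $d(\Lambda)$ be the diagonal $N\times N$ matrix with $(\ell,\ell)$-entry $-1$ if $\ell\in\Lambda$ and $1$ otherwise, and $T_\Lambda(w,a,\theta):=(w-\mathrm{Tr}(a,\Lambda),\,a\,d(\Lambda),\,\theta\,d(\Lambda))$ (vectors are rows). Let $p(w,a,\theta):=(w,a)$. Test function: $F_N(u,w,a,\theta):=\mathrm{e}^{-uw}\prod_{\ell=1}^N(1-\mathrm{e}(\theta_\ell)\mathrm{e}^{-ua_\ell})^{-1}$. Let $\mathcal{E}$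 be the set of functions $\epsilon:\mathbb{D}_N\to\mathbb{R}_{>0}$ such that for all $(w,a,\theta)\in\mathbb{D}_N$ and all $\ell\in P_N$ the equation $\mathrm{e}(\theta_\ell)=\mathrm{e}^{ua_\ell}$ has no solution $u$ with $0<|u|\le\epsilon(w,a,\theta)$. For $r>0$, the Hankel contour $C(r)$ runs along $[r,+\infty)$ from $+\infty$ to $r$, then counterclockwise around the circle $|u|=r$, then along $[r,+\infty)$ from $r$ to $+\infty$; on it $u^{s-1}=\mathrm{e}^{(s-1)(\log|u|+i\mathrm{Arg}(u))}$ with $\mathrm{Arg}(u)=0$ on the incoming ray, increasing from $0$ to $2\pi$ on the circle, and $\mathrm{Arg}(u)=2\pi$ on the outgoing ray. Define (formally) $\mathcal{L}_{N,\epsilon}(s,w,a,\theta):=\frac{1}{\Gamma(s)(\mathrm{e}(s)-1)}\int_{C(\epsilon(w,a,\theta))}F_N(u,w,a,\theta)u^{s-1}du$ (note $1/(\Gamma(s)(\mathrm{e}(s)-1))$ is meromorphic with poles only at positive integers). Barnes zeta: $\mathcal{T}_N^+:=\{(w,a,\theta)\in\mathbb{C}\times\mathbb{C}^N\times\mathbb{R}^N:\mathrm{Re}(w)>0,\ \mathrm{Re}(a_\ell)>0\ \forall\ell\}$; for $(w,a,\theta)\in\mathcal{T}_N^+$ and $\mathrm{Re}(s)>N$, $\zeta_N(s,w,a,\theta):=\sum_{m\in\mathbb{N}^N}\mathrm{e}(m\cdot\theta)(w+m\cdot a)^{-s}$ (principal branch), meromorphically continued in $s$ to $\mathbb{C}\smallsetminus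 P_N$. For $\omega\in(-\pi/2,\pi/2)$ let $\mathcal{T}_N^+(\omega):=\{(w,a,\theta):(\mathrm{e}^{i\omega}w,\mathrm{e}^{i\omega}a,\theta)\in\mathcal{T}_N^+\}$ and $\mathcal{T}^{\mathrm{ext}}_N:=\bigcup_\omega\mathcal{T}_N^+(\omega)$; $\zeta_N$ is extended (well-definedly) to $(\mathbb{C}\smallsetminus P_N)\times\mathcal{T}^{\mathrm{ext}}_N$ by $\zeta_N(s,w,a,\theta):=\mathrm{e}^{is\omega}\zeta_N(s,\mathrm{e}^{i\omega}w,\mathrm{e}^{i\omega}a,\theta)$ for $(w,a,\theta)\in\mathcal{T}_N^+(\omega)$. In (iii), $\zeta_N$ means this extended function. *)

(* Defs.v *)
From Stdlib Require Import Reals List Arith ClassicalEpsilon.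
From Coquelicot Require Import Coquelicot.
Import ListNotations.

Local Open Scope R_scope.

Definition cexp (z : C) : C :=
  (exp (Re z) * cos (Im z), exp (Re z) * sin (Im z)).

Definition ee (z : C) : C := cexp (2 * PI * Ci * z)%C.

Definition Carg (z : C) : R :=
  let x := Re z in let y := Im z in
  match Rlt_dec 0 x with
  | left _ => atan (y / x)
  | right _ =>
    match Rlt_dec x 0 with
    | left _ => match Rle_dec 0 y with
                | left _ => atan (y / x) + PI
                | right _ => atan (y / x) - PI
                end
    | right _ => match Rlt_dec 0 y with
                 | left _ => PI / 2
                 | right _ => match Rlt_dec y 0 with
                              | left _ => - (PI / 2)
                              | right _ => 0
                              end
                 end
    end
  end.

Definition Clog (z : C) : C := (ln (Cmod z), Carg z).
Definition cpow (z s : C) : C := cexp (s * Clog z)%C.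

Definition Cderivable (f : C -> C) (s : C) : Prop :=
  exists c : C, forall eta : R, 0 < eta -> exists delta : R, 0 < delta /\
    forall h : C, Cmod h < delta ->
      Cmod (f (s + h) - f s - c * h)%C <= eta * Cmod h.

Definition csum0 (n : nat) (f : nat -> C) : C :=
  fold_right Cplus (RtoC 0) (map f (seq 0 n)).

(** (joint) holomorphy on a set U of a function of the first n complex
    coordinates of z : nat -> C (coordinates j >= n are ignored/frozen):
    complex Frechet differentiability at every point of U. *)
Definition holo_on (n : nat) (U : (nat -> C) -> Prop) (f : (nat -> C) -> C) : Prop :=
  forall z, U z -> exists c : nat -> C, forall eta : R, 0 < eta ->
    exists delta : R, 0 < delta /\
    forall h : nat -> C, (forall j, (n <= j)%nat -> h j = RtoC 0) ->
      (forall j, (j < n)%nat -> Cmod (h j) < delta) ->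
      Cmod (f (fun j => z j + h j)%C - f z - csum0 n (fun j => c j * h j)%C)%C
        <= eta * fold_right Rplus 0 (map (fun j => Cmod (h j)) (seq 0 n)).

(** ** The objects of the paper.  Vectors in C^N / R^N are functions on nat,
    only the coordinates 1..N (= P_N) are relevant. *)

Definition inPN (N : nat) (l : nat) : Prop := (1 <= l <= N)%nat.

Definition PN (N : nat) (s : C) : Prop := exists k, inPN N k /\ s = RtoC (INR k).

Definition sumPN (N : nat) (f : nat -> C) : C :=
  fold_right Cplus (RtoC 0) (map f (seq 1 N)).

Definition Tr (N : nat) (v : nat -> C) (Lam : nat -> Prop) : C :=
  sumPN N (fun l => if excluded_middle_informative (Lam l) then v l else RtoC 0).

Definition Ccone (z : C) : Prop := 0 < Re z \/ (Re z = 0 /\ 0 < Im z).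

Definition DN (N : nat) (w : C) (a : nat -> C) (th : nat -> R) : Prop :=
  forall l, inPN N l -> a l = RtoC 0 -> ~ (exists k : Z, th l = IZR k).

Definition piD (N : nat) (w : C) (a : nat -> C) : C :=
  (w - Tr N a (fun l => Ccone (- a l)%C))%C.

Definition Dtilde (N : nat) (w : C) (a : nat -> C) (th : nat -> R) : Prop :=
  DN N w a th /\ Ccone (piD N w a).

Definition Tplus (N : nat) (w : C) (a : nat -> C) (th : nat -> R) : Prop :=
  0 < Re w /\ forall l, inPN N l -> 0 < Re (a l).

Definition pTLam (N : nat) (Lam : nat -> Prop) (w' : C) (a' : nat -> C) : Prop :=
  exists (w : C) (a : nat -> C) (th : nat -> R), Tplus N w a th /\
    w' = (w - Tr N a Lam)%C /\
    forall l, inPN N l ->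
      a' l = (if excluded_middle_informative (Lam l) then (- a l)%C else a l).

Definition FN (N : nat) (u w : C) (a : nat -> C) (th : nat -> R) : C :=
  (cexp (- u * w) *
   fold_right Cmult (RtoC 1)
     (map (fun l => / (1 - ee (RtoC (th l)) * cexp (- u * a l))) (seq 1 N)))%C.

Definition inE (N : nat) (eps : C -> (nat -> C) -> (nat -> R) -> R) : Prop :=
  (forall w a th, DN N w a th -> 0 < eps w a th) /\
  (forall w a th l (u : C), DN N w a th -> inPN N l ->
     0 < Cmod u -> Cmod u <= eps w a th -> ee (RtoC (th l)) <> cexp (u * a l)%C).

(** I is the value of the Hankel contour integral over C(r) of G(u) u^{s-1} du,
    with the branch of u^{s-1} prescribed in the paper.  Pieces: incoming ray
    (from +oo to r, Arg = 0), circle |u| = r counterclockwise (Arg from 0 to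
    2 pi), outgoing ray (from r to +oo, Arg = 2 pi); improper integrals are
    limits of Riemann integrals. *)
Definition hankel_is (r : R) (s : C) (G : C -> C) (I : C) : Prop :=
  exists I1 I2 I3 : C,
    is_RInt_gen (fun x : R => G (RtoC x) * cexp ((s - 1) * RtoC (ln x)))%C
      (at_point r) (Rbar_locally p_infty) I1 /\
    is_RInt (fun t : R =>
        G (RtoC r * cexp (Ci * RtoC t)) * cexp ((s - 1) * (ln r, t))
        * (Ci * RtoC r * cexp (Ci * RtoC t)))%C 0 (2 * PI) I2 /\
    is_RInt_gen (fun x : R => G (RtoC x) * cexp ((s - 1) * (ln x, (2 * PI)%R)))%C
      (at_point r) (Rbar_locally p_infty) I3 /\
    I = (- I1 + I2 + I3)%C.

(** g = 1/Gamma(s), via Gauss' limit: 1/Gamma(s) = lim s(s+1)...(s+n) / (n! n^s) *)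
Definition rgamma_is (s : C) (g : C) : Prop :=
  filterlim (fun n : nat =>
      (fold_right Cmult (RtoC 1) (map (fun j => s + RtoC (INR j)) (seq 0 (S n)))
       / (RtoC (INR (fact n)) * cexp (s * RtoC (ln (INR n)))))%C)
    eventually (locally g).

(** v is the value at s of the meromorphic function
      s |-> (1/(Gamma(s)(e(s)-1))) \int_{C(eps(w,a,theta))} F_N(u,w,a,theta) u^{s-1} du,
    i.e. the limit of that expression as s' -> s through non-integers
    (this is the value of the formula for non-integer s; at integers it is the
    value of the meromorphic function obtained by removing the removable
    singularity). *)
Definition LNeps_is (N : nat) (eps : C -> (nat -> C) -> (nat -> R) -> R)
    (s w : C) (a : nat -> C) (th : nat -> R) (v : C) : Prop :=
  forall eta : R, 0 < eta -> exists delta : R, 0 < delta /\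
    forall s' : C, 0 < Cmod (s' - s)%C -> Cmod (s' - s)%C < delta ->
      (forall k : Z, s' <> RtoC (IZR k)) ->
      exists g I : C, rgamma_is s' g /\
        hankel_is (eps w a th) s' (fun u => FN N u w a th) I /\
        Cmod (g * I / (ee s' - 1) - v)%C < eta.

Definition rot (om : R) (z : C) : C := (cexp (Ci * RtoC om) * z)%C.
Definition rotv (om : R) (a : nat -> C) : nat -> C := fun l => rot om (a l).

Definition set_coord (m : nat -> nat) (k j : nat) : nat -> nat :=
  fun i => if Nat.eqb i k then j else m i.

Fixpoint boxsum (k M : nat) (f : (nat -> nat) -> C) : C :=
  match k with
  | O => f (fun _ => O)
  | S k' => fold_right Cplus (RtoC 0)
              (map (fun j => boxsum k' M (fun m => f (set_coord m k j))) (seq 0 (S M)))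
  end.

Definition barnes_term (N : nat) (s w : C) (a : nat -> C) (th : nat -> R)
    (m : nat -> nat) : C :=
  (ee (RtoC (fold_right Rplus 0 (map (fun l => (INR (m l) * th l)%R) (seq 1 N))))
   * cpow (w + sumPN N (fun l => RtoC (INR (m l)) * a l)) (- s))%C.

(** the series  sum_{m in N^N} e(m.theta)(w+m.a)^{-s}  (absolutely convergent
    for Re s > N), as the limit of partial sums over growing boxes *)
Definition barnes_series_is (N : nat) (s w : C) (a : nat -> C) (th : nat -> R)
    (v : C) : Prop :=
  filterlim (fun M => boxsum N M (barnes_term N s w a th)) eventually (locally v).

Definition is_barnes_cont (N : nat) (Z : C -> C -> (nat -> C) -> (nat -> R) -> C) : Prop :=
  forall w a th, Tplus N w a th ->
    (forall s, ~ PN N s -> Cderivable (fun s => Z s w a th) s) /\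
    (forall s, INR N < Re s -> barnes_series_is N s w a th (Z s w a th)).

(** zeta_N on (C \ P_N) x T_N^+ : the (unique) continuation *)
Definition zetaN (N : nat) : C -> C -> (nat -> C) -> (nat -> R) -> C :=
  epsilon (inhabits (fun _ _ _ _ => RtoC 0)) (is_barnes_cont N).

(** extension to T^ext_N:  zeta_N(s,w,a,theta) = e^{i s omega} zeta_N(s, e^{i omega}w, e^{i omega}a, theta)
    for any omega in (-pi/2,pi/2) with the rotated point in T_N^+ *)
Definition zeta_ext (N : nat) (s w : C) (a : nat -> C) (th : nat -> R) : C :=
  let om := epsilon (inhabits 0)
              (fun om => - (PI / 2) < om < PI / 2 /\ Tplus N (rot om w) (rotv om a) th) in
  (cexp (Ci * s * RtoC om) * zetaN N s (rot om w) (rotv om a) th)%C.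

(** the a-part of a coordinate vector z = (s, w, a_1, ..., a_N) *)
Definition avec (N : nat) (z : nat -> C) : nat -> C :=
  fun l => if andb (Nat.leb 1 l) (Nat.leb l N) then z (S l) else RtoC 0.

(* Main.v *)
(** With [u = exp z] the integrand becomes [F_N(exp z) exp(s z) dz] and the Hankel contour becomes
    three sides of a half strip of height [2 pi]; Goursat's theorem for rectangles then performs all
    contour deformations. For [Re s > N] the Hankel integral is [(e(s) - 1)] times the convergent
    Mellin integral over the positive axis. Identities which are visible on the Mellin integral
    (independence of the radius, behaviour under rotation of [(w, a)], the Barnes series) extend to all
    [s] outside [P_N] because a function holomorphic there and zero for [Re s > N] is zero.

    Holomorphy of limits and integrals comes from a Vitali-type remark: a bounded holomorphic function
    has difference quotients that are Lipschitz with a constant depending only on the bound, and this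
    property passes to pointwise limits and to integrals. Osgood's lemma gives joint holomorphy.

    The reflections [T_Lambda] change [F_N] only by a constant factor, and a small negative rotation
    moves [T_Lambda] of a point of the domain to where [Re w > 0] and each [a_l] has positive real part
    or vanishes, so only such points need to be analysed. *)

Require Import Defs.
From Stdlib Require Import Reals List Arith ClassicalEpsilon.
From Stdlib Require Import ZArith Lia Lra Psatz FunctionalExtensionality PropExtensionality.
From Coquelicot Require Import Coquelicot.

Local Open Scope R_scope.

(** After reflection, [w] or some [a_l] may lie on the positive imaginary axis, where the integrand
    does not decay along the positive real axis; this is why the function is a limit over rotations
    by [omega < 0]. For all small negative [omega] the value at the rotated point is exactly
    [exp(- i s omega)] times a number independent of [omega], so the limit costs only continuity of
    the exponential. The second obstacle is the prefactor [1 / (Gamma(s) (e(s) - 1))]. At integers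
    [s <= 0] a zero of [1 / Gamma] cancels the zero of [e(s) - 1]. At positive integers the pole is
    genuine, and beyond [N] only the vanishing of the Hankel integral removes it. Hence the
    continuation is glued from the Mellin formula for [Re s > N] and the Hankel formula elsewhere;
    the first is regular on its half plane, the second off the positive integers, and the two
    regions cover the complement of [P_N]. Finally [1 / Gamma] is given as Gauss's limit and has to
    be tied to Euler's integral, which is done by Beta integrals. This link enters only in the
    comparison with the Barnes series. *)

Lemma Cmod_minus_le (a b : C) : Cmod (a - b)%C <= Cmod a + Cmod b.
Proof.
  replace (Cmod b) with (Cmod (- b)%C) by apply Cmod_opp. apply Cmod_triangle.
Qed.

Lemma Cmod_minus_sym (a b : C) : Cmod (a - b)%C = Cmod (b - a)%C.
Proof. rewrite <- Cmod_opp. f_equal. ring. Qed.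

Lemma Cmod_sub_ge (a b : C) : Cmod a - Cmod b <= Cmod (a - b)%C.
Proof.
  assert (H := Cmod_triangle (a - b)%C b).
  replace (a - b + b)%C with a in H by ring. lra.
Qed.

Lemma Re_le_Cmod (z : C) : Rabs (Re z) <= Cmod z.
Proof. apply Rle_trans with (2 := Rmax_Cmod z). apply Rmax_l. Qed.

Lemma Im_le_Cmod (z : C) : Rabs (Im z) <= Cmod z.
Proof. apply Rle_trans with (2 := Rmax_Cmod z). apply Rmax_r. Qed.

Lemma Cmod_le_ReIm (z : C) : Cmod z <= Rabs (Re z) + Rabs (Im z).
Proof.
  destruct z as [x y]. unfold Re, Im; simpl.
  replace (x, y) with (RtoC x + Ci * RtoC y)%C
    by (unfold Ci, RtoC, Cmult, Cplus; simpl; f_equal; ring).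
  eapply Rle_trans; [apply Cmod_triangle|].
  rewrite Cmod_mult, Cmod_Ci, !Cmod_R. lra.
Qed.

Lemma Cmod_zero_eq (a b : C) : (forall eps, 0 < eps -> Cmod (a - b)%C < eps) -> a = b.
Proof.
  intros H. apply Ceq_minus. apply Cmod_eq_0.
  destruct (Cmod_ge_0 (a - b)%C) as [H1|H1]; [|auto].
  specialize (H _ H1). lra.
Qed.

Lemma Ceq (a b : C) : Re a = Re b -> Im a = Im b -> a = b.
Proof. destruct a, b; unfold Re, Im; simpl; intros; subst; auto. Qed.

Lemma Rle_mult_eps (a eta e : R) : 0 <= a -> 0 < eta -> 0 < e -> e <= eta / (a + 1) -> e * a <= eta.
Proof.
  intros Ha He H0 H. apply Rle_trans with (eta / (a + 1) * (a + 1)).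
  - apply Rmult_le_compat; lra.
  - right. field. lra.
Qed.

Lemma div_pos (a b : R) : 0 < a -> 0 < b -> 0 < a / b.
Proof. intros. apply Rdiv_lt_0_compat; auto. Qed.

(** * Complex derivatives *)

(** The condition inside [Cderivable] with the derivative as a parameter: primitives and the
    fundamental theorem need its value, while most later arguments need only its existence. *)
Definition Cder (f : C -> C) (z c : C) : Prop :=
  forall eta : R, 0 < eta -> exists delta : R, 0 < delta /\
    forall h : C, Cmod h < delta ->
      Cmod (f (z + h) - f z - c * h)%C <= eta * Cmod h.

Lemma Cder_Cderivable (f : C -> C) (z : C) c : Cder f z c -> Cderivable f z.
Proof. intros H; exists c; exact H. Qed.

Lemma Cder_cont (f : C -> C) (z : C) c : Cder f z c ->
  forall eps, 0 < eps -> exists delta, 0 < delta /\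
    forall h, Cmod h < delta -> Cmod (f (z + h) - f z)%C < eps.
Proof.
  intros H eps He.
  destruct (H 1 Rlt_0_1) as [d [Hd H1]].
  assert (Hc := Cmod_ge_0 c).
  exists (Rmin d (eps / (Cmod c + 2))). split.
  - apply Rmin_pos; auto. apply div_pos; lra.
  - intros h Hh.
    assert (A := Rlt_le_trans _ _ _ Hh (Rmin_l _ _)).
    assert (B := Rlt_le_trans _ _ _ Hh (Rmin_r _ _)).
    specialize (H1 h A).
    replace (f (z + h) - f z)%C with ((f (z + h) - f z - c * h) + c * h)%C by ring.
    eapply Rle_lt_trans; [apply Cmod_triangle|].
    rewrite Cmod_mult.
    assert (C0 : (Cmod c + 2) * Cmod h < eps).
    { apply Rmult_lt_compat_l with (r := Cmod c + 2) in B; [|lra].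
      replace ((Cmod c + 2) * (eps / (Cmod c + 2))) with eps in B by (field; lra). auto. }
    assert (Hh0 := Cmod_ge_0 h). lra.
Qed.

Lemma Cder_ext_loc (f g : C -> C) (z : C) c r : 0 < r ->
  (forall h, Cmod h < r -> f (z + h)%C = g (z + h)%C) -> Cder f z c -> Cder g z c.
Proof.
  intros Hr He H eta Heta. destruct (H eta Heta) as [d [Hd H1]].
  assert (E0 : f z = g z).
  { replace z with (z + 0)%C by ring. apply He. rewrite Cmod_0; auto. }
  exists (Rmin d r); split; [apply Rmin_pos; auto|].
  intros h Hh. rewrite <- He, <- E0. apply H1.
  eapply Rlt_le_trans; [apply Hh|apply Rmin_l].
  eapply Rlt_le_trans; [apply Hh|apply Rmin_r].
Qed.

Lemma Cder_ext (f g : C -> C) (z : C) c : (forall u, f u = g u) -> Cder f z c -> Cder g z c.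
Proof. intros H. apply Cder_ext_loc with 1; [lra|auto]. Qed.

Lemma Cder_const a z : Cder (fun _ => a) z 0%C.
Proof.
  intros eta He. exists 1; split; [lra|]. intros h _.
  replace (a - a - 0 * h)%C with (RtoC 0) by ring. rewrite Cmod_0.
  assert (H := Cmod_ge_0 h). nra.
Qed.

Lemma Cder_id z : Cder (fun u => u) z 1%C.
Proof.
  intros eta He. exists 1; split; [lra|]. intros h _.
  replace (z + h - z - 1 * h)%C with (RtoC 0) by ring. rewrite Cmod_0.
  assert (H := Cmod_ge_0 h). nra.
Qed.

Lemma Cder_plus (f g : C -> C) (z : C) a b : Cder f z a -> Cder g z b ->
  Cder (fun u => f u + g u)%C z (a + b)%C.
Proof.
  intros Hf Hg eta He.
  destruct (Hf (eta / 2)) as [d1 [Hd1 H1]]; [lra|].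
  destruct (Hg (eta / 2)) as [d2 [Hd2 H2]]; [lra|].
  exists (Rmin d1 d2); split; [apply Rmin_pos; auto|]. intros h Hh.
  specialize (H1 h (Rlt_le_trans _ _ _ Hh (Rmin_l _ _))).
  specialize (H2 h (Rlt_le_trans _ _ _ Hh (Rmin_r _ _))).
  replace (f (z + h) + g (z + h) - (f z + g z) - (a + b) * h)%C
    with ((f (z + h) - f z - a * h) + (g (z + h) - g z - b * h))%C by ring.
  eapply Rle_trans; [apply Cmod_triangle|]. lra.
Qed.

Lemma Cder_mult (f g : C -> C) (z : C) a b : Cder f z a -> Cder g z b ->
  Cder (fun u => f u * g u)%C z (a * g z + f z * b)%C.
Proof.
  intros Hf Hg eta He.
  (* [G] bounds [g] near [z], and [K] adds up the factors that multiply [e] in the three error terms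
     of the product rule. *)
  set (G := Cmod (g z) + 1). set (K := G + Cmod a + Cmod (f z)).
  assert (P1 := Cmod_ge_0 (g z)). assert (P2 := Cmod_ge_0 a). assert (P3 := Cmod_ge_0 (f z)).
  assert (HK : 0 <= K) by (unfold K, G; lra).
  set (e := Rmin 1 (eta / (K + 1))).
  assert (Hepos : 0 < e) by (apply Rmin_pos; [lra| apply div_pos; lra]).
  assert (HeK : e * K <= eta) by (apply Rle_mult_eps; auto; apply Rmin_r).
  assert (He1 : e <= 1) by apply Rmin_l.
  destruct (Hf e Hepos) as [d1 [Hd1 H1]].
  destruct (Hg e Hepos) as [d2 [Hd2 H2]].
  destruct (Cder_cont _ _ _ Hg e Hepos) as [d3 [Hd3 H3]].
  exists (Rmin d1 (Rmin d2 d3)); split; [repeat apply Rmin_pos; auto|]. intros h Hh.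
  assert (A1 := Rlt_le_trans _ _ _ Hh (Rmin_l _ _)).
  assert (A2 := Rlt_le_trans _ _ _ Hh (Rmin_r _ _)).
  specialize (H1 h A1).
  specialize (H2 h (Rlt_le_trans _ _ _ A2 (Rmin_l _ _))).
  specialize (H3 h (Rlt_le_trans _ _ _ A2 (Rmin_r _ _))).
  assert (Hgh : Cmod (g (z + h)%C) <= G).
  { replace (g (z + h)%C) with ((g (z + h) - g z) + g z)%C by ring.
    eapply Rle_trans; [apply Cmod_triangle|]. unfold G; lra. }
  replace (f (z + h) * g (z + h) - f z * g z - (a * g z + f z * b) * h)%C with
    ((f (z + h) - f z - a * h) * g (z + h) + a * h * (g (z + h) - g z)
      + f z * (g (z + h) - g z - b * h))%C by ring.
  eapply Rle_trans; [apply Cmod_triangle|].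
  eapply Rle_trans; [apply Rplus_le_compat_r, Cmod_triangle|].
  rewrite !Cmod_mult. assert (Hh0 := Cmod_ge_0 h).
  apply Rle_trans with (e * K * Cmod h); [|apply Rmult_le_compat_r; auto].
  assert (Q1 : Cmod (f (z + h) - f z - a * h)%C * Cmod (g (z + h)%C) <= e * Cmod h * G)
    by (apply Rmult_le_compat; auto using Cmod_ge_0).
  assert (Q2 : Cmod a * Cmod h * Cmod (g (z + h) - g z)%C <= Cmod a * Cmod h * e)
    by (apply Rmult_le_compat_l; [apply Rmult_le_pos; auto | lra]).
  assert (Q3 : Cmod (f z) * Cmod (g (z + h) - g z - b * h)%C <= Cmod (f z) * (e * Cmod h))
    by (apply Rmult_le_compat_l; auto).
  unfold K. nra.
Qed.

Lemma Cder_comp (f g : C -> C) (z : C) a b : Cder g z a -> Cder f (g z) b ->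
  Cder (fun u => f (g u)) z (b * a)%C.
Proof.
  intros Hg Hf eta He.
  set (K := Cmod a + 1 + Cmod b).
  assert (P1 := Cmod_ge_0 a). assert (P2 := Cmod_ge_0 b).
  assert (HK : 0 <= K) by (unfold K; lra).
  set (e := Rmin 1 (eta / (K + 1))).
  assert (Hepos : 0 < e) by (apply Rmin_pos; [lra| apply div_pos; lra]).
  assert (HeK : e * K <= eta) by (apply Rle_mult_eps; auto; apply Rmin_r).
  assert (He1 : e <= 1) by apply Rmin_l.
  destruct (Hf e Hepos) as [d1 [Hd1 H1]].
  destruct (Hg e Hepos) as [d2 [Hd2 H2]].
  destruct (Cder_cont _ _ _ Hg d1 Hd1) as [d3 [Hd3 H3]].
  exists (Rmin d2 d3); split; [repeat apply Rmin_pos; auto|]. intros h Hh.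
  specialize (H2 h (Rlt_le_trans _ _ _ Hh (Rmin_l _ _))).
  specialize (H3 h (Rlt_le_trans _ _ _ Hh (Rmin_r _ _))).
  specialize (H1 _ H3).
  set (k := (g (z + h) - g z)%C) in *.
  replace (g z + k)%C with (g (z + h)%C) in H1 by (unfold k; ring).
  assert (Hh0 := Cmod_ge_0 h).
  assert (Hk : Cmod k <= (Cmod a + 1) * Cmod h).
  { replace k with ((k - a * h) + a * h)%C by ring.
    eapply Rle_trans; [apply Cmod_triangle|]. rewrite Cmod_mult. nra. }
  replace (f (g (z + h)) - f (g z) - b * a * h)%C with
    ((f (g (z + h)) - f (g z) - b * k) + b * (k - a * h))%C by ring.
  eapply Rle_trans; [apply Cmod_triangle|]. rewrite Cmod_mult.
  apply Rle_trans with (e * K * Cmod h); [|apply Rmult_le_compat_r; auto].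
  assert (Q : Cmod b * Cmod (k - a * h)%C <= Cmod b * (e * Cmod h))
    by (apply Rmult_le_compat_l; auto).
  unfold K. nra.
Qed.

Lemma Cder_Cinv (z : C) : z <> 0%C -> Cder Cinv z (- (/ z * / z))%C.
Proof.
  intros Hz eta He.
  assert (Hm : 0 < Cmod z) by (apply Cmod_gt_0; auto).
  set (m := Cmod z) in *.
  set (d := Rmin (m / 2) (eta * (m * m * m) / 2)).
  assert (Hmmm : 0 < m * m * m) by (repeat apply Rmult_lt_0_compat; auto).
  exists d; split; [apply Rmin_pos; nra|]. intros h Hh.
  assert (A1 := Rlt_le_trans _ _ _ Hh (Rmin_l _ _)).
  assert (A2 := Rlt_le_trans _ _ _ Hh (Rmin_r _ _)).
  assert (Hzh : m / 2 <= Cmod (z + h)%C).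
  { assert (T := Cmod_sub_ge z (- h)%C). rewrite Cmod_opp in T.
    replace (z - - h)%C with (z + h)%C in T by ring. fold m in T. lra. }
  assert (Hnz : (z + h)%C <> 0%C) by (apply Cmod_gt_0; lra).
  replace (/ (z + h) - / z - - (/ z * / z) * h)%C with (h * h / (z * z * (z + h)))%C
    by (field; auto).
  rewrite Cmod_div by (repeat apply Cmult_neq_0; auto).
  rewrite !Cmod_mult. fold m.
  assert (Hh0 := Cmod_ge_0 h).
  apply Rmult_le_reg_r with (m * m * Cmod (z + h)%C).
  { repeat apply Rmult_lt_0_compat; lra. }
  unfold Rdiv. rewrite Rmult_assoc, Rinv_l, Rmult_1_r.
  2:{ apply Rgt_not_eq. repeat apply Rmult_lt_0_compat; lra. }
  assert (B : m * m * (m / 2) <= m * m * Cmod (z + h)%C) by (apply Rmult_le_compat_l; nra).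
  apply Rle_trans with (eta * (m * m * m) / 2 * Cmod h); [nra|].
  apply Rle_trans with (eta * Cmod h * (m * m * (m / 2))); [right; field|].
  apply Rmult_le_compat_l; auto. nra.
Qed.

Lemma Cd_const a z : Cderivable (fun _ => a) z.
Proof. exact (Cder_Cderivable _ _ _ (Cder_const a z)). Qed.
Lemma Cd_id z : Cderivable (fun u => u) z.
Proof. exact (Cder_Cderivable _ _ _ (Cder_id z)). Qed.
Lemma Cd_plus (f g : C -> C) (z : C) : Cderivable f z -> Cderivable g z -> Cderivable (fun u => f u + g u)%C z.
Proof. intros [a Ha] [b Hb]; exact (Cder_Cderivable _ _ _ (Cder_plus _ _ _ _ _ Ha Hb)). Qed.
Lemma Cd_mult (f g : C -> C) (z : C) : Cderivable f z -> Cderivable g z -> Cderivable (fun u => f u * g u)%C z.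
Proof. intros [a Ha] [b Hb]; exact (Cder_Cderivable _ _ _ (Cder_mult _ _ _ _ _ Ha Hb)). Qed.
Lemma Cd_comp (f g : C -> C) (z : C) : Cderivable g z -> Cderivable f (g z) -> Cderivable (fun u => f (g u)) z.
Proof. intros [a Ha] [b Hb]; exact (Cder_Cderivable _ _ _ (Cder_comp _ _ _ _ _ Ha Hb)). Qed.
Lemma Cd_opp (f : C -> C) (z : C) : Cderivable f z -> Cderivable (fun u => - f u)%C z.
Proof.
  intros H. destruct (Cd_mult _ _ _ (Cd_const (-(1))%C z) H) as [c Hc].
  apply Cder_Cderivable with c. apply (Cder_ext (fun u => - (1) * f u)%C); [|exact Hc]. intros; simpl; ring.
Qed.
Lemma Cd_minus (f g : C -> C) (z : C) : Cderivable f z -> Cderivable g z -> Cderivable (fun u => f u - g u)%C z.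
Proof. intros H1 H2. apply (Cd_plus f (fun u => - g u)%C); auto using Cd_opp. Qed.
Lemma Cd_inv (f : C -> C) (z : C) : f z <> 0%C -> Cderivable f z -> Cderivable (fun u => / f u)%C z.
Proof. intros Hz H. apply (Cd_comp Cinv f); auto. exact (Cder_Cderivable _ _ _ (Cder_Cinv _ Hz)). Qed.
Lemma Cd_div (f g : C -> C) (z : C) : g z <> 0%C -> Cderivable f z -> Cderivable g z ->
  Cderivable (fun u => f u / g u)%C z.
Proof. intros Hz H1 H2. apply (Cd_mult f (fun u => / g u)%C); auto using Cd_inv. Qed.
Lemma Cd_ext_loc (f g : C -> C) (z : C) r : 0 < r ->
  (forall h, Cmod h < r -> f (z + h)%C = g (z + h)%C) -> Cderivable f z -> Cderivable g z.
Proof. intros Hr H [c Hc]. exact (Cder_Cderivable _ _ _ (Cder_ext_loc _ _ _ c _ Hr H Hc)). Qed.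
Lemma Cd_ext (f g : C -> C) (z : C) : (forall u, f u = g u) -> Cderivable f z -> Cderivable g z.
Proof. intros H. apply Cd_ext_loc with 1; [lra|auto]. Qed.

Lemma Cd_cont (f : C -> C) (z : C) : Cderivable f z ->
  forall eps, 0 < eps -> exists delta, 0 < delta /\
    forall u, Cmod (u - z)%C < delta -> Cmod (f u - f z)%C < eps.
Proof.
  intros [c Hc] eps He. destruct (Cder_cont _ _ _ Hc eps He) as [d [Hd H]].
  exists d; split; auto. intros u Hu. specialize (H _ Hu).
  replace (z + (u - z))%C with u in H by ring. exact H.
Qed.

Lemma Cd_nonzero_near (f : C -> C) (z : C) : Cderivable f z -> f z <> 0%C ->
  exists delta, 0 < delta /\ forall h, Cmod h < delta -> f (z + h)%C <> 0%C.
Proof.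
  intros Hf Hz. apply Cmod_gt_0 in Hz.
  destruct (Cd_cont f z Hf _ Hz) as [d [Hd H]]. exists d; split; auto.
  intros h Hh E. specialize (H (z + h)%C). rewrite E in H.
  replace (z + h - z)%C with h in H by ring. specialize (H Hh).
  replace (0 - f z)%C with (- f z)%C in H by ring. rewrite Cmod_opp in H. lra.
Qed.

(** * The complex exponential *)

Lemma cexp_plus a b : cexp (a + b)%C = (cexp a * cexp b)%C.
Proof.
  destruct a as [x y], b as [u v]. unfold cexp, Cmult, Cplus, Re, Im; simpl.
  rewrite exp_plus, cos_plus, sin_plus. f_equal; ring.
Qed.

Lemma cexp_0 : cexp 0%C = 1%C.
Proof. unfold cexp, RtoC; simpl. rewrite exp_0, cos_0, sin_0. f_equal; ring. Qed.

Lemma Cmod_cexp z : Cmod (cexp z) = exp (Re z).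
Proof.
  unfold Cmod, cexp; simpl. rewrite !Rmult_1_r.
  replace (exp (Re z) * cos (Im z) * (exp (Re z) * cos (Im z)) +
           exp (Re z) * sin (Im z) * (exp (Re z) * sin (Im z)))
    with (Rsqr (exp (Re z)) * (Rsqr (sin (Im z)) + Rsqr (cos (Im z))))
    by (unfold Rsqr; ring).
  rewrite sin2_cos2, Rmult_1_r. apply sqrt_Rsqr. left; apply exp_pos.
Qed.

Lemma cexp_nz z : cexp z <> 0%C.
Proof. apply Cmod_gt_0. rewrite Cmod_cexp. apply exp_pos. Qed.

Lemma cexp_opp z : cexp (- z)%C = (/ cexp z)%C.
Proof.
  assert (H : (cexp z * cexp (- z) = 1)%C).
  { rewrite <- cexp_plus. replace (z + - z)%C with (RtoC 0) by ring. apply cexp_0. }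
  assert (Hz := cexp_nz z).
  replace (cexp (- z)%C) with (/ cexp z * (cexp z * cexp (- z)))%C by (field; auto).
  rewrite H. ring.
Qed.

Lemma cexp_RtoC x : cexp (RtoC x) = RtoC (exp x).
Proof. unfold cexp, RtoC; simpl. rewrite cos_0, sin_0. f_equal; ring. Qed.

Lemma cexp_ln x : 0 < x -> cexp (RtoC (ln x)) = RtoC x.
Proof. intros H. rewrite cexp_RtoC, exp_ln; auto. Qed.

(** From [exp (- x) >= 1 - x] one gets [(1 - x) exp x <= 1], hence [(1 - x) (exp x - 1 - x) <= x^2];
    finally [1 - x >= 1/2]. *)
Lemma exp_minus_le_sq (x : R) : Rabs x <= 1 / 2 -> Rabs (exp x - 1 - x) <= 2 * (x * x).
Proof.
  intros Hx. assert (L := exp_ineq1_le x).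
  rewrite Rabs_right by lra.
  apply Rabs_le_between in Hx.
  assert (P := exp_pos x).
  assert (L2 := exp_ineq1_le (- x)). rewrite exp_Ropp in L2.
  assert (L3 : (1 - x) * exp x <= 1).
  { apply Rmult_le_compat_r with (r := exp x) in L2; [|lra].
    rewrite Rinv_l in L2 by lra. lra. }
  assert (0 <= (1 / 2 - x) * (exp x - 1 - x)) by (apply Rmult_le_pos; lra).
  nra.
Qed.

Lemma one_minus_cos_le (y : R) : 0 <= 1 - cos y <= y * y / 2.
Proof.
  assert (H := COS_bound y). split; [lra|].
  replace y with (2 * (y / 2)) at 1 by field. rewrite cos_2a_sin.
  assert (Rabs (sin (y / 2)) <= Rabs (y / 2)).
  { destruct (Rle_dec 0 (y / 2)) as [P|P].
    - rewrite (Rabs_right (y / 2)) by lra. apply Rabs_le. split.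
      + destruct (Rle_dec (y / 2) PI).
        * assert (0 <= sin (y / 2)) by (apply sin_ge_0; lra). lra.
        * assert (S := SIN_bound (y / 2)). assert (Q := PI2_1). lra.
      + destruct (Req_dec (y / 2) 0) as [E|E]; [rewrite E, sin_0; lra|].
        left; apply sin_lt_x; lra.
    - rewrite <- (Rabs_Ropp (sin _)), <- (Rabs_Ropp (y / 2)), <- sin_neg.
      rewrite (Rabs_right (- (y / 2))) by lra. apply Rabs_le. split.
      + destruct (Rle_dec (- (y / 2)) PI).
        * assert (0 <= sin (- (y / 2))) by (apply sin_ge_0; lra). lra.
        * assert (S := SIN_bound (- (y / 2))). assert (Q := PI2_1). lra.
      + left; apply sin_lt_x; lra. }
  assert (Rsqr (sin (y / 2)) <= Rsqr (y / 2)) by (apply Rsqr_le_abs_1; auto).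
  unfold Rsqr in *. nra.
Qed.

(** Real and imaginary parts are expanded separately. Every error term is quadratic in [h] except
    [sin y - y], for which the derivative of the sine at 0 is used; the bound [eta / 12] on [Cmod h]
    absorbs the quadratic ones. *)
Lemma Cder_cexp_0 : Cder cexp 0%C 1%C.
Proof.
  assert (Hs : forall eta, 0 < eta -> exists d, 0 < d /\ forall y, Rabs y < d ->
      Rabs (sin y - y) <= eta * Rabs y).
  { intros eta He. destruct (derivable_pt_lim_sin 0 eta He) as [d Hd].
    exists d; split; [apply cond_pos|]. intros y Hy.
    destruct (Req_dec y 0) as [E|E].
    - subst. rewrite sin_0, Rminus_0_r, Rabs_R0. lra.
    - specialize (Hd y E Hy). rewrite Rplus_0_l, sin_0, cos_0, Rminus_0_r in Hd.
      replace (sin y - y) with ((sin y / y - 1) * y) by (field; auto).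
      rewrite Rabs_mult. apply Rmult_le_compat_r; [apply Rabs_pos|lra]. }
  intros eta He. destruct (Hs (eta / 6)) as [d [Hd H]]; [lra|].
  exists (Rmin d (Rmin (1 / 2) (eta / 12))); split; [repeat apply Rmin_pos; lra|].
  intros h Hh.
  assert (A1 := Rlt_le_trans _ _ _ Hh (Rmin_l _ _)).
  assert (A2 := Rlt_le_trans _ _ _ Hh (Rmin_r _ _)).
  assert (A3 := Rlt_le_trans _ _ _ A2 (Rmin_l _ _)).
  assert (A4 := Rlt_le_trans _ _ _ A2 (Rmin_r _ _)).
  rewrite cexp_0, Cplus_0_l.
  assert (Mx := Re_le_Cmod h). assert (My := Im_le_Cmod h).
  destruct h as [x y]. unfold Re, Im in Mx, My; simpl in Mx, My.
  set (m := Cmod (x, y)) in *.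
  assert (E1 : Rabs (exp x - 1 - x) <= 2 * (x * x)) by (apply exp_minus_le_sq; lra).
  assert (E2 := one_minus_cos_le y).
  assert (E3 : Rabs (sin y - y) <= eta / 6 * Rabs y) by (apply H; lra).
  eapply Rle_trans; [apply Cmod_le_ReIm|].
  unfold cexp, Cminus, Copp, Cplus, Cmult, RtoC, Re, Im; simpl.
  replace (exp x * cos y + - (1) + - (1 * x - 0 * y)) with
    ((exp x - 1 - x) * cos y + (1 + x) * (cos y - 1)) by ring.
  replace (exp x * sin y + - 0 + - (1 * y + 0 * x)) with
    ((exp x - 1 - x) * sin y + x * sin y + (sin y - y)) by ring.
  assert (C1 : Rabs (cos y) <= 1) by (apply Rabs_le; assert (B := COS_bound y); lra).
  assert (S1 : Rabs (sin y) <= 1) by (apply Rabs_le; assert (B := SIN_bound y); lra).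
  assert (S2 : Rabs (sin y) <= (1 + eta / 6) * Rabs y).
  { replace (sin y) with ((sin y - y) + y) by ring.
    eapply Rle_trans; [apply Rabs_triang|]. lra. }
  assert (Hm : 0 <= m) by apply Cmod_ge_0.
  assert (X2 : x * x <= m * m).
  { rewrite <- (Rabs_right (x * x)) by nra. rewrite Rabs_mult.
    apply Rmult_le_compat; auto using Rabs_pos. }
  assert (Y2 : y * y <= m * m).
  { rewrite <- (Rabs_right (y * y)) by nra. rewrite Rabs_mult.
    apply Rmult_le_compat; auto using Rabs_pos. }
  assert (T1 : Rabs ((exp x - 1 - x) * cos y) <= 2 * (m * m)).
  { rewrite Rabs_mult. apply Rle_trans with (2 * (x * x) * 1); [|lra].
    apply Rmult_le_compat; auto using Rabs_pos. }
  assert (T2 : Rabs ((1 + x) * (cos y - 1)) <= m * m).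
  { rewrite Rabs_mult. apply Rle_trans with (2 * (y * y / 2)); [|lra].
    apply Rmult_le_compat; auto using Rabs_pos.
    - apply Rabs_le. apply Rabs_le_between in Mx. lra.
    - apply Rabs_le. lra. }
  assert (T3 : Rabs ((exp x - 1 - x) * sin y) <= 2 * (m * m)).
  { rewrite Rabs_mult. apply Rle_trans with (2 * (x * x) * 1); [|lra].
    apply Rmult_le_compat; auto using Rabs_pos. }
  assert (T4 : Rabs (x * sin y) <= m * ((1 + eta / 6) * m)).
  { rewrite Rabs_mult. apply Rmult_le_compat; auto using Rabs_pos.
    eapply Rle_trans; [exact S2|]. apply Rmult_le_compat_l; lra. }
  assert (T5 : Rabs (sin y - y) <= eta / 6 * m).
  { eapply Rle_trans; [exact E3|]. apply Rmult_le_compat_l; lra. }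
  eapply Rle_trans; [apply Rplus_le_compat; [apply Rabs_triang|]|].
  { eapply Rle_trans; [apply Rabs_triang|]. apply Rplus_le_compat_r, Rabs_triang. }
  assert (Q : m * m <= eta / 12 * m) by (apply Rmult_le_compat_r; lra).
  assert (Q' : m * m <= m) by nra.
  nra.
Qed.

Lemma Cder_cexp z : Cder cexp z (cexp z).
Proof.
  assert (H1 : Cder (fun u => u - z)%C z 1%C).
  { replace (RtoC 1) with (1 + 0)%C by ring.
    apply (Cder_plus (fun u => u) (fun _ => - z)%C); [apply Cder_id|apply Cder_const]. }
  assert (H2 : Cder (fun u => cexp (u - z))%C z (1 * 1)%C).
  { apply (Cder_comp cexp (fun u => u - z)%C); auto.
    replace (z - z)%C with (RtoC 0) by ring. apply Cder_cexp_0. }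
  assert (H3 := Cder_mult _ _ _ _ _ (Cder_const (cexp z) z) H2).
  apply Cder_ext with (f := fun u => (cexp z * cexp (u - z))%C).
  { intros u. rewrite <- cexp_plus. f_equal. ring. }
  cbv beta in H3.
  replace (0 * cexp (z - z) + cexp z * (1 * 1))%C with (cexp z) in H3 by ring. exact H3.
Qed.

Lemma Cd_cexp (f : C -> C) (z : C) : Cderivable f z -> Cderivable (fun u => cexp (f u)) z.
Proof. intros H. apply (Cd_comp cexp f); auto. exact (Cder_Cderivable _ _ _ (Cder_cexp _)). Qed.

Ltac cderiv := repeat first
  [ apply Cd_const | apply Cd_id | apply Cd_cexp | apply Cd_plus | apply Cd_minus
  | apply Cd_opp | apply Cd_mult ].

(** Quantitative form of the simple zero of [1 - exp z] at 0. The lower bound later controls the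
    denominators of [F_N] near [u = 0], the upper bound their perturbations. *)
Lemma one_minus_cexp_ge : exists rho, 0 < rho /\ forall z, Cmod z < rho ->
  Cmod z / 2 <= Cmod (1 - cexp z)%C /\ Cmod (1 - cexp z)%C <= 2 * Cmod z.
Proof.
  destruct (Cder_cexp_0 (1/2)) as [d [Hd H]]; [lra|].
  exists d; split; auto. intros z Hz. specialize (H z Hz).
  rewrite cexp_0, Cplus_0_l in H.
  assert (A := Cmod_ge_0 z). split.
  - assert (B := Cmod_sub_ge z (- (cexp z - 1 - 1 * z))%C).
    rewrite Cmod_opp in B.
    replace (z - - (cexp z - 1 - 1 * z))%C with (- (1 - cexp z))%C in B by ring.
    rewrite Cmod_opp in B. lra.
  - replace (1 - cexp z)%C with (- (cexp z - 1 - 1 * z) - z)%C by ring.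
    eapply Rle_trans; [apply Cmod_minus_le|]. rewrite Cmod_opp. lra.
Qed.

(** * Integrals of complex-valued functions of a real variable *)

Definition rcont (f : R -> C) (x : R) : Prop :=
  forall eps, 0 < eps -> exists d, 0 < d /\
    forall y, Rabs (y - x) < d -> Cmod (f y - f x)%C < eps.

(** Integration treats [C] as a complete normed space over the reals, so complex scalars need the
    componentwise argument of [cRI_scal]. *)
Definition cRI (f : R -> C) (a b : R) : C := RInt (V := C_R_CompleteNormedModule) f a b.

Lemma norm_C_R (x : C) : norm (K := R_AbsRing) (V := C_R_NormedModule) x = Cmod x.
Proof.
  destruct x as [x y]. unfold norm, Cmod; simpl. unfold prod_norm; simpl.
  unfold norm; simpl. unfold abs; simpl. f_equal.
  rewrite !Rmult_1_r, <- !Rabs_mult. rewrite !Rabs_right; nra.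
Qed.

Lemma scal_C_R (r : R) (x : C) :
  scal (K := R_AbsRing) (V := C_R_NormedModule) r x = (RtoC r * x)%C.
Proof. apply scal_R_Cmult. Qed.

Lemma rcont_continuous (f : R -> C) (x : R) : rcont f x <-> continuous (U := C_R_CompleteNormedModule) f x.
Proof.
  split.
  - intros H. apply filterlim_locally. intros eps.
    destruct (H eps (cond_pos eps)) as [d [Hd H1]].
    exists (mkposreal d Hd). intros y Hy. specialize (H1 y Hy). split.
    + apply Rle_lt_trans with (2 := H1). apply (Re_le_Cmod (f y - f x)%C).
    + apply Rle_lt_trans with (2 := H1). apply (Im_le_Cmod (f y - f x)%C).
  - intros H eps He. assert (H0 := proj1 (filterlim_locally f (f x)) H).
    destruct (H0 (mkposreal (eps / 2) ltac:(lra))) as [d Hd].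
    exists d. split; [apply cond_pos|]. intros y Hy. destruct (Hd y Hy) as [H1 H2].
    eapply Rle_lt_trans; [apply Cmod_le_ReIm|].
    change (Rabs (Re (f y - f x)%C) < eps / 2) in H1.
    change (Rabs (Im (f y - f x)%C) < eps / 2) in H2. lra.
Qed.

Lemma rcont_comp (f : C -> C) (g : R -> C) x :
  rcont g x -> Cderivable f (g x) -> rcont (fun t => f (g t)) x.
Proof.
  intros Hg Hf eps He. destruct (Cd_cont _ _ Hf eps He) as [d [Hd H]].
  destruct (Hg d Hd) as [d' [Hd' H']]. exists d'; split; auto.
Qed.

Lemma rcont_const c x : rcont (fun _ => c) x.
Proof.
  intros eps He. exists 1. split; [lra|]. intros.
  replace (c - c)%C with (RtoC 0) by ring. rewrite Cmod_0; auto.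
Qed.

Lemma rcont_plus (f g : R -> C) (x : R) : rcont f x -> rcont g x -> rcont (fun t => f t + g t)%C x.
Proof. rewrite !rcont_continuous. intros. apply (continuous_plus f g); auto. Qed.

Lemma rcont_RtoC (f : R -> R) x : continuity_pt f x -> rcont (fun t => RtoC (f t)) x.
Proof.
  intros H eps He. destruct (H eps He) as [d [Hd H1]]. exists d; split; auto.
  intros y Hy. rewrite <- RtoC_minus, Cmod_R.
  destruct (Req_dec x y) as [->|E].
  - rewrite Rminus_diag, Rabs_R0; auto.
  - apply (H1 y). split; [split; [exact I|auto]|exact Hy].
Qed.

Lemma rcont_mult (f g : R -> C) (x : R) : rcont f x -> rcont g x -> rcont (fun t => f t * g t)%C x.
Proof.
  intros Hf Hg eps He.
  set (K := Cmod (f x) + Cmod (g x) + 1).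
  assert (P1 := Cmod_ge_0 (f x)). assert (P2 := Cmod_ge_0 (g x)).
  set (e := Rmin 1 (eps / 2 / (K + 1))).
  assert (He0 : 0 < e) by (apply Rmin_pos; [lra|apply div_pos; unfold K; lra]).
  assert (HeK : e * K <= eps / 2)
    by (apply Rle_mult_eps; [unfold K; lra|lra|auto|apply Rmin_r]).
  assert (He1 : e <= 1) by apply Rmin_l.
  destruct (Hf e He0) as [d1 [Hd1 H1]]. destruct (Hg e He0) as [d2 [Hd2 H2]].
  exists (Rmin d1 d2); split; [apply Rmin_pos; auto|]. intros y Hy.
  specialize (H1 y (Rlt_le_trans _ _ _ Hy (Rmin_l _ _))).
  specialize (H2 y (Rlt_le_trans _ _ _ Hy (Rmin_r _ _))).
  replace (f y * g y - f x * g x)%C with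
    ((f y - f x) * (g y - g x) + (f y - f x) * g x + f x * (g y - g x))%C by ring.
  eapply Rle_lt_trans; [apply Cmod_triangle|].
  eapply Rle_lt_trans; [apply Rplus_le_compat_r, Cmod_triangle|].
  rewrite !Cmod_mult.
  assert (Q1 := Cmod_ge_0 (f y - f x)%C). assert (Q2 := Cmod_ge_0 (g y - g x)%C).
  unfold K in HeK. nra.
Qed.

Lemma rcont_ext (f g : R -> C) (x : R) : (forall t, f t = g t) -> rcont f x -> rcont g x.
Proof. intros E H eps He. destruct (H eps He) as [d [Hd H1]]. exists d; split; auto.
  intros; rewrite <- !E; auto. Qed.

Lemma rcont_opp (f : R -> C) (x : R) : rcont f x -> rcont (fun t => - f t)%C x.
Proof.
  intros H. apply rcont_ext with (fun t => (- (1) * f t)%C); [intros; ring|].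
  apply rcont_mult; auto. apply rcont_const.
Qed.

Lemma rcont_minus (f g : R -> C) (x : R) : rcont f x -> rcont g x -> rcont (fun t => f t - g t)%C x.
Proof. intros. apply (rcont_plus f (fun t => - g t)%C); auto using rcont_opp. Qed.

Lemma rcont_inv (f : R -> C) (x : R) : f x <> 0%C -> rcont f x -> rcont (fun t => / f t)%C x.
Proof.
  intros H Hf. apply (rcont_comp Cinv); auto.
  exact (Cder_Cderivable _ _ _ (Cder_Cinv _ H)).
Qed.

Lemma rcont_cexp (f : R -> C) (x : R) : rcont f x -> rcont (fun t => cexp (f t)) x.
Proof. intros Hf. apply (rcont_comp cexp); auto. exact (Cder_Cderivable _ _ _ (Cder_cexp _)). Qed.

Lemma rcont_id x : rcont (fun t => RtoC t) x.
Proof. apply (rcont_RtoC (fun t => t)). apply continuity_pt_id. Qed.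

Ltac rcontin := repeat first
  [ apply rcont_const | apply rcont_id | apply rcont_cexp | apply rcont_plus | apply rcont_minus
  | apply rcont_opp | apply rcont_mult ].

Lemma cRI_ex f a b : (forall x, Rmin a b <= x <= Rmax a b -> rcont f x) ->
  ex_RInt (V := C_R_CompleteNormedModule) f a b.
Proof. intros H. apply ex_RInt_continuous. intros. apply rcont_continuous; auto. Qed.

Lemma cRI_ex_le f a b : a <= b -> (forall x, a <= x <= b -> rcont f x) ->
  ex_RInt (V := C_R_CompleteNormedModule) f a b.
Proof. intros Hab H. apply cRI_ex. rewrite Rmin_left, Rmax_right; auto. Qed.

Lemma cRI_plus f g a b : a <= b -> (forall x, a <= x <= b -> rcont f x) ->
  (forall x, a <= x <= b -> rcont g x) ->
  cRI (fun x => f x + g x)%C a b = (cRI f a b + cRI g a b)%C.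
Proof. intros. apply (RInt_plus (V := C_R_CompleteNormedModule)); apply cRI_ex_le; auto. Qed.

Lemma cRI_scal c f a b : a <= b -> (forall x, a <= x <= b -> rcont f x) ->
  cRI (fun x => c * f x)%C a b = (c * cRI f a b)%C.
Proof.
  intros Hab Hf.
  assert (H := RInt_correct (V := C_R_CompleteNormedModule) f a b (cRI_ex_le _ _ _ Hab Hf)).
  fold (cRI f a b) in H. apply (is_RInt_unique (V := C_R_CompleteNormedModule)).
  assert (H1 := is_RInt_fct_extend_fst _ _ _ _ H).
  assert (H2 := is_RInt_fct_extend_snd _ _ _ _ H).
  apply (is_RInt_fct_extend_pair (fun x => c * f x)%C a b).
  - apply is_RInt_ext with (fun x => minus (scal (fst c) (fst (f x))) (scal (snd c) (snd (f x)))).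
    { intros; reflexivity. }
    apply (is_RInt_minus (V := R_NormedModule)); apply (is_RInt_scal (V := R_NormedModule)); auto.
  - apply is_RInt_ext with (fun x => plus (scal (fst c) (snd (f x))) (scal (snd c) (fst (f x)))).
    { intros; reflexivity. }
    apply (is_RInt_plus (V := R_NormedModule)); apply (is_RInt_scal (V := R_NormedModule)); auto.
Qed.

Lemma cRI_minus f g a b : a <= b -> (forall x, a <= x <= b -> rcont f x) ->
  (forall x, a <= x <= b -> rcont g x) ->
  cRI (fun x => f x - g x)%C a b = (cRI f a b - cRI g a b)%C.
Proof. intros. apply (RInt_minus (V := C_R_CompleteNormedModule)); apply cRI_ex_le; auto. Qed.

Lemma cRI_ext f g a b : a <= b -> (forall x, a < x < b -> f x = g x) -> cRI f a b = cRI g a b.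
Proof. intros Hab H. apply (RInt_ext (V := C_R_CompleteNormedModule)). rewrite Rmin_left, Rmax_right; auto. Qed.

Lemma cRI_chasles f a b c : a <= b <= c -> (forall x, a <= x <= c -> rcont f x) ->
  (cRI f a c = cRI f a b + cRI f b c)%C.
Proof.
  intros Habc H. symmetry.
  apply (RInt_Chasles (V := C_R_CompleteNormedModule)); apply cRI_ex_le; try lra;
    intros; apply H; lra.
Qed.

Lemma cRI_bound f a b M : a <= b -> (forall x, a <= x <= b -> rcont f x) ->
  (forall x, a <= x <= b -> Cmod (f x) <= M) -> Cmod (cRI f a b) <= M * (b - a).
Proof.
  intros Hab Hc HM. rewrite <- norm_C_R, Rmult_comm.
  apply (norm_RInt_le_const (V := C_R_NormedModule)) with (f := f); auto.
  - intros x Hx. rewrite norm_C_R. auto.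
  - apply (RInt_correct (V := C_R_CompleteNormedModule)). apply cRI_ex_le; auto.
Qed.

Lemma cRI_bound_fun f (g : R -> R) a b l : a <= b -> (forall x, a <= x <= b -> rcont f x) ->
  (forall x, a <= x <= b -> Cmod (f x) <= g x) -> is_RInt g a b l -> Cmod (cRI f a b) <= l.
Proof.
  intros Hab Hc HM Hg. rewrite <- norm_C_R.
  apply (norm_RInt_le (V := C_R_NormedModule)) with (f := f) (g := g) (a := a) (b := b); auto.
  - intros x Hx. rewrite norm_C_R. auto.
  - apply (RInt_correct (V := C_R_CompleteNormedModule)). apply cRI_ex_le; auto.
Qed.

Lemma cRI_const c a b : cRI (fun _ => c) a b = (RtoC (b - a) * c)%C.
Proof.
  unfold cRI. rewrite RInt_const. apply scal_C_R.
Qed.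

Lemma cRI_point f a : cRI f a a = 0%C.
Proof. apply (RInt_point (V := C_R_CompleteNormedModule)). Qed.

Lemma cRI_shift f v a b : a <= b -> (forall x, a + v <= x <= b + v -> rcont f x) ->
  cRI (fun x => f (x + v)) a b = cRI f (a + v) (b + v).
Proof.
  intros Hab H. unfold cRI.
  rewrite <- (Rmult_1_l a) at 2. rewrite <- (Rmult_1_l b) at 2.
  rewrite <- (RInt_comp_lin (V := C_R_CompleteNormedModule)).
  - apply (RInt_ext (V := C_R_CompleteNormedModule)). intros x _. etransitivity; [|symmetry; apply scal_C_R].
    rewrite Rmult_1_l. symmetry. apply Cmult_1_l.
  - rewrite !Rmult_1_l. apply cRI_ex_le; [lra|auto].
Qed.

Definition rder (F : R -> C) (x : R) (l : C) : Prop :=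
  forall eta, 0 < eta -> exists d, 0 < d /\ forall h, Rabs h < d ->
    Cmod (F (x + h)%R - F x - RtoC h * l)%C <= eta * Rabs h.

Lemma rder_is_derive F x l : rder F x l ->
  is_derive (K := R_AbsRing) (V := C_R_NormedModule) F x l.
Proof.
  intros H. split. { apply is_linear_scal_l. }
  intros y Hy. assert (E : x = y) by (apply (is_filter_lim_locally_unique x y); exact Hy).
  subst y. intros eps. destruct (H eps (cond_pos eps)) as [d [Hd H1]].
  exists (mkposreal d Hd). intros t Ht.
  assert (Ht' : Rabs (t - x) < d) by exact Ht.
  specialize (H1 _ Ht').
  assert (Et : x + (t - x) = t) by lra. rewrite Et in H1.
  rewrite norm_C_R. eapply Rle_trans; [|exact H1].
  right. f_equal. rewrite scal_C_R. reflexivity.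
Qed.

Lemma cRI_FTC F f a b : a <= b -> (forall x, a <= x <= b -> rder F x (f x)) ->
  (forall x, a <= x <= b -> rcont f x) -> cRI f a b = (F b - F a)%C.
Proof.
  intros Hab HF Hf.
  apply (is_RInt_unique (V := C_R_CompleteNormedModule)), (is_RInt_derive (V := C_R_CompleteNormedModule));
    rewrite Rmin_left, Rmax_right; auto.
  - intros. apply rder_is_derive; auto.
  - intros. apply rcont_continuous; auto.
Qed.

Lemma rder_comp (F : C -> C) (p v : C) (x : R) c : Cder F (p + RtoC x * v)%C c ->
  rder (fun t => F (p + RtoC t * v)%C) x (v * c)%C.
Proof.
  intros H eta He.
  assert (Hv := Cmod_ge_0 v).
  destruct (H (eta / (Cmod v + 1))) as [d [Hd H1]]; [apply div_pos; lra|].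
  exists (d / (Cmod v + 1)). split; [apply div_pos; lra|]. intros h Hh.
  assert (Hp := Rabs_pos h).
  assert (E : Cmod (RtoC h * v)%C = Rabs h * Cmod v) by (rewrite Cmod_mult, Cmod_R; auto).
  assert (B : Rabs h * (Cmod v + 1) < d).
  { apply Rmult_lt_compat_r with (r := Cmod v + 1) in Hh; [|lra].
    replace (d / (Cmod v + 1) * (Cmod v + 1)) with d in Hh by (field; lra). auto. }
  specialize (H1 (RtoC h * v)%C). rewrite E in H1. specialize (H1 ltac:(lra)).
  rewrite RtoC_plus.
  replace (p + (RtoC x + RtoC h) * v)%C with (p + RtoC x * v + RtoC h * v)%C by ring.
  replace (RtoC h * (v * c))%C with (c * (RtoC h * v))%C by ring.
  eapply Rle_trans; [exact H1|].
  replace (eta / (Cmod v + 1) * (Rabs h * Cmod v)) with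
    (eta * Rabs h * (Cmod v / (Cmod v + 1))) by (field; lra).
  rewrite <- (Rmult_1_r (eta * Rabs h)) at 2. apply Rmult_le_compat_l; [nra|].
  apply Rmult_le_reg_r with (Cmod v + 1); [lra|]. unfold Rdiv.
  rewrite Rmult_assoc, Rinv_l by lra. lra.
Qed.

(** The substitution [u = exp x] that carries integrals over the positive axis to integrals over the
    real line. *)
Lemma cRI_exp_subst (f : R -> C) a b : a <= b ->
  (forall x, exp a <= x <= exp b -> rcont f x) ->
  cRI (fun x => RtoC (exp x) * f (exp x))%C a b = cRI f (exp a) (exp b).
Proof.
  intros Hab H.
  assert (Hle : forall x y, x <= y -> exp x <= exp y).
  { intros x y [L| ->]; [left; apply exp_increasing; auto|lra]. }
  unfold cRI. rewrite <- (RInt_comp (V := C_R_CompleteNormedModule) f exp exp a b).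
  - apply (RInt_ext (V := C_R_CompleteNormedModule)). intros x _. symmetry. apply scal_C_R.
  - rewrite Rmin_left, Rmax_right by auto. intros x Hx. apply rcont_continuous, H.
    split; apply Hle; lra.
  - intros x _. split; [apply is_derive_exp|].
    apply (ex_derive_continuous exp). eexists; apply is_derive_exp.
Qed.

(** * Limits of complex sequences *)

Definition clim (u : nat -> C) (l : C) : Prop :=
  forall eps, 0 < eps -> exists n0, forall n, (n0 <= n)%nat -> Cmod (u n - l)%C < eps.

Lemma clim_unique u l l' : clim u l -> clim u l' -> l = l'.
Proof.
  intros H H'. apply Cmod_zero_eq. intros eps He.
  destruct (H (eps / 2)) as [n1 H1]; [lra|]. destruct (H' (eps / 2)) as [n2 H2]; [lra|].
  specialize (H1 (max n1 n2) (Nat.le_max_l _ _)). specialize (H2 (max n1 n2) (Nat.le_max_r _ _)).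
  replace (l - l')%C with (- (u (max n1 n2) - l) + (u (max n1 n2) - l'))%C by ring.
  eapply Rle_lt_trans; [apply Cmod_triangle|]. rewrite Cmod_opp. lra.
Qed.

Lemma clim_cauchy (u : nat -> C) :
  (forall eps, 0 < eps -> exists n0, forall n m, (n0 <= n)%nat -> (n0 <= m)%nat ->
     Cmod (u n - u m)%C < eps) -> exists l, clim u l.
Proof.
  intros H.
  assert (Hc : forall (p : C -> R), (forall z, Rabs (p z) <= Cmod z) ->
     (forall a b, p (a - b)%C = p a - p b) -> exists l, Un_cv (fun n => p (u n)) l).
  { intros p Hp Hm.
    assert (Cc : Cauchy_crit (fun n => p (u n))).
    { intros eps He. destruct (H eps He) as [n0 H0]. exists n0. intros n m Hn Hm'.
      unfold Rdist. rewrite <- Hm. eapply Rle_lt_trans; [apply Hp|]. apply H0; lia. }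
    destruct (Rcomplete.R_complete _ Cc) as [l Hl]. exists l; auto. }
  destruct (Hc Re Re_le_Cmod) as [x Hx]; [intros [] []; reflexivity|].
  destruct (Hc Im Im_le_Cmod) as [y Hy]; [intros [] []; reflexivity|].
  exists (x, y). intros eps He.
  destruct (Hx (eps / 2)) as [n1 H1]; [lra|]. destruct (Hy (eps / 2)) as [n2 H2]; [lra|].
  exists (max n1 n2). intros n Hn. specialize (H1 n ltac:(lia)). specialize (H2 n ltac:(lia)).
  eapply Rle_lt_trans; [apply Cmod_le_ReIm|].
  unfold Rdist in H1, H2.
  change (Re (u n - (x, y))%C) with (Re (u n) - x).
  change (Im (u n - (x, y))%C) with (Im (u n) - y). lra.
Qed.

Lemma clim_le u l M : clim u l -> (exists n0, forall n, (n0 <= n)%nat -> Cmod (u n) <= M) ->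
  Cmod l <= M.
Proof.
  intros H [n0 HM]. apply le_epsilon. intros eps He. destruct (H eps He) as [n1 H1].
  specialize (H1 (max n0 n1) ltac:(lia)). specialize (HM (max n0 n1) ltac:(lia)).
  replace l with (u (max n0 n1) - (u (max n0 n1) - l))%C by ring.
  eapply Rle_trans; [apply Cmod_minus_le|]. lra.
Qed.

Lemma clim_ext u v l : (forall n, u n = v n) -> clim u l -> clim v l.
Proof. intros E H eps He. destruct (H eps He) as [n0 H0]. exists n0. intros; rewrite <- E; auto. Qed.

Lemma clim_const c : clim (fun _ => c) c.
Proof.
  intros eps He; exists O; intros. replace (c - c)%C with (RtoC 0) by ring. rewrite Cmod_0; auto.
Qed.

Lemma clim_plus u v a b : clim u a -> clim v b -> clim (fun n => u n + v n)%C (a + b)%C.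
Proof.
  intros Hu Hv eps He.
  destruct (Hu (eps / 2)) as [n1 H1]; [lra|]. destruct (Hv (eps / 2)) as [n2 H2]; [lra|].
  exists (max n1 n2). intros n Hn. specialize (H1 n ltac:(lia)). specialize (H2 n ltac:(lia)).
  replace (u n + v n - (a + b))%C with ((u n - a) + (v n - b))%C by ring.
  eapply Rle_lt_trans; [apply Cmod_triangle|]. lra.
Qed.

Lemma clim_Cd (f : C -> C) u a : Cderivable f a -> clim u a -> clim (fun n => f (u n)) (f a).
Proof.
  intros Hf Hu eps He. destruct (Cd_cont _ _ Hf eps He) as [d [Hd H]].
  destruct (Hu d Hd) as [n0 H0]. exists n0; intros; auto.
Qed.

Lemma clim_scal c u a : clim u a -> clim (fun n => c * u n)%C (c * a)%C.
Proof. apply (clim_Cd (fun z => c * z)%C). cderiv. Qed.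

(** Polarization, [2 a b = (a + b)^2 - a^2 - b^2], reduces products to sums and to the continuity of
    the square. *)
Lemma clim_mult u v a b : clim u a -> clim v b -> clim (fun n => u n * v n)%C (a * b)%C.
Proof.
  intros Hu Hv.
  assert (H1 := clim_plus _ _ _ _ Hu Hv).
  apply (clim_Cd (fun z => z * z)%C) in H1; [|cderiv].
  apply (clim_Cd (fun z => z * z)%C) in Hu; [|cderiv].
  apply (clim_Cd (fun z => z * z)%C) in Hv; [|cderiv].
  assert (H2 := clim_plus _ _ _ _ Hu Hv). apply (clim_scal (-(1))%C) in H2.
  assert (H3 := clim_scal (/ 2)%C _ _ (clim_plus _ _ _ _ H1 H2)).
  replace (a * b)%C with (/ 2 * ((a + b) * (a + b) + - (1) * (a * a + b * b)))%C by field.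
  eapply clim_ext; [|exact H3]. intros n; simpl. field.
Qed.

(** * Goursat's theorem and its consequences *)

Definition cpt (x y : R) : C := (RtoC x + Ci * RtoC y)%C.

Lemma cpt_pair x y : cpt x y = (x, y).
Proof. unfold cpt, Ci, RtoC, Cplus, Cmult; simpl. f_equal; ring. Qed.

Lemma cpt_ReIm z : cpt (Re z) (Im z) = z.
Proof. rewrite cpt_pair. destruct z; reflexivity. Qed.

Lemma Re_cpt x y : Re (cpt x y) = x.
Proof. rewrite cpt_pair; reflexivity. Qed.
Lemma Im_cpt x y : Im (cpt x y) = y.
Proof. rewrite cpt_pair; reflexivity. Qed.

Definition holoR (f : C -> C) (a b c d : R) : Prop :=
  forall x y, a <= x <= b -> c <= y <= d -> Cderivable f (cpt x y).

Definition rectI (f : C -> C) (a b c d : R) : C :=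
  (cRI (fun x => f (cpt x c)) a b + Ci * cRI (fun y => f (cpt b y)) c d
   - cRI (fun x => f (cpt x d)) a b - Ci * cRI (fun y => f (cpt a y)) c d)%C.

Lemma rcont_cpt_x (f : C -> C) x y : Cderivable f (cpt x y) -> rcont (fun t => f (cpt t y)) x.
Proof. intros H. apply (rcont_comp f (fun t => cpt t y)); auto. unfold cpt; rcontin. Qed.

Lemma rcont_cpt_y (f : C -> C) x y : Cderivable f (cpt x y) -> rcont (fun t => f (cpt x t)) y.
Proof. intros H. apply (rcont_comp f (fun t => cpt x t)); auto. unfold cpt; rcontin. Qed.

Definition on_bdry (a b c d x y : R) : Prop :=
  (a <= x <= b /\ c <= y <= d) /\ (x = a \/ x = b \/ y = c \/ y = d).

(** Differentiability on the boundary only, because the integrands of Cauchy's formula are singular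
    inside the rectangle. *)
Definition bdryD (f : C -> C) (a b c d : R) : Prop :=
  forall x y, on_bdry a b c d x y -> Cderivable f (cpt x y).

Lemma holoR_bdryD f a b c d : holoR f a b c d -> bdryD f a b c d.
Proof. intros H x y [[Hx Hy] _]. auto. Qed.

Ltac bdry := unfold on_bdry; repeat split; try lra; auto.

(** The integral along the cut occurs twice with opposite signs and cancels as an algebraic term, so
    regularity is needed only on the outer boundary. *)
Lemma rectI_split_x f a m b c d : a <= m <= b -> c <= d -> bdryD f a b c d ->
  rectI f a b c d = (rectI f a m c d + rectI f m b c d)%C.
Proof.
  intros H1 H2 H. unfold rectI.
  rewrite (cRI_chasles (fun x => f (cpt x c)) a m b), (cRI_chasles (fun x => f (cpt x d)) a m b);
    auto; try (intros; apply rcont_cpt_x, H; bdry).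
  ring.
Qed.

Lemma rectI_split_y f a b c m d : a <= b -> c <= m <= d -> bdryD f a b c d ->
  rectI f a b c d = (rectI f a b c m + rectI f a b m d)%C.
Proof.
  intros H1 H2 H. unfold rectI.
  rewrite (cRI_chasles (fun y => f (cpt b y)) c m d), (cRI_chasles (fun y => f (cpt a y)) c m d);
    auto; try (intros; apply rcont_cpt_y, H; bdry).
  ring.
Qed.

Lemma rectI_minus f g a b c d : a <= b -> c <= d -> bdryD f a b c d -> bdryD g a b c d ->
  rectI (fun z => f z - g z)%C a b c d = (rectI f a b c d - rectI g a b c d)%C.
Proof.
  intros H1 H2 Hf Hg. unfold rectI.
  rewrite (cRI_minus (fun x => f (cpt x c)) (fun x => g (cpt x c))),
    (cRI_minus (fun x => f (cpt x d)) (fun x => g (cpt x d))),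
    (cRI_minus (fun x => f (cpt a x)) (fun x => g (cpt a x))),
    (cRI_minus (fun x => f (cpt b x)) (fun x => g (cpt b x))); auto;
    try (intros; apply rcont_cpt_x; (apply Hf || apply Hg); bdry);
    try (intros; apply rcont_cpt_y; (apply Hf || apply Hg); bdry).
  ring.
Qed.

Lemma rectI_scal k f a b c d : a <= b -> c <= d -> bdryD f a b c d ->
  rectI (fun z => k * f z)%C a b c d = (k * rectI f a b c d)%C.
Proof.
  intros H1 H2 Hf. unfold rectI.
  rewrite (cRI_scal k (fun x => f (cpt x c))), (cRI_scal k (fun x => f (cpt x d))),
    (cRI_scal k (fun x => f (cpt a x))), (cRI_scal k (fun x => f (cpt b x))); auto;
    try (intros; apply rcont_cpt_x; apply Hf; bdry);
    try (intros; apply rcont_cpt_y; apply Hf; bdry).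
  ring.
Qed.

Lemma rectI_bound f a b c d M : a <= b -> c <= d ->
  (forall x y, on_bdry a b c d x y -> Cderivable f (cpt x y)) ->
  (forall x y, on_bdry a b c d x y -> Cmod (f (cpt x y)) <= M) ->
  Cmod (rectI f a b c d) <= M * (2 * ((b - a) + (d - c))).
Proof.
  intros H1 H2 Hf HM. unfold rectI.
  assert (B1 : Cmod (cRI (fun x => f (cpt x c)) a b) <= M * (b - a)).
  { apply cRI_bound; auto; intros.
    - apply rcont_cpt_x, Hf. unfold on_bdry; repeat split; try lra; auto.
    - apply HM. unfold on_bdry; repeat split; try lra; auto. }
  assert (B2 : Cmod (cRI (fun x => f (cpt x d)) a b) <= M * (b - a)).
  { apply cRI_bound; auto; intros.
    - apply rcont_cpt_x, Hf. unfold on_bdry; repeat split; try lra; auto.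
    - apply HM. unfold on_bdry; repeat split; try lra; auto. }
  assert (B3 : Cmod (cRI (fun x => f (cpt a x)) c d) <= M * (d - c)).
  { apply cRI_bound; auto; intros.
    - apply rcont_cpt_y, Hf. unfold on_bdry; repeat split; try lra; auto.
    - apply HM. unfold on_bdry; repeat split; try lra; auto. }
  assert (B4 : Cmod (cRI (fun x => f (cpt b x)) c d) <= M * (d - c)).
  { apply cRI_bound; auto; intros.
    - apply rcont_cpt_y, Hf. unfold on_bdry; repeat split; try lra; auto.
    - apply HM. unfold on_bdry; repeat split; try lra; auto. }
  eapply Rle_trans; [apply Cmod_minus_le|].
  eapply Rle_trans; [apply Rplus_le_compat_r, Cmod_minus_le|].
  eapply Rle_trans; [apply Rplus_le_compat_r, Rplus_le_compat_r, Cmod_triangle|].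
  rewrite !Cmod_mult, !Cmod_Ci. lra.
Qed.

Lemma rder_ext (F G : R -> C) x l : (forall t, F t = G t) -> rder F x l -> rder G x l.
Proof.
  intros E H eta He. destruct (H eta He) as [d [Hd H1]]. exists d; split; auto.
  intros h Hh. rewrite <- !E. auto.
Qed.

Lemma rectI_primitive (F f : C -> C) a b c d : a <= b -> c <= d -> holoR f a b c d ->
  (forall x y, a <= x <= b -> c <= y <= d -> Cder F (cpt x y) (f (cpt x y))) ->
  rectI f a b c d = 0%C.
Proof.
  intros H1 H2 Hf HF. unfold rectI.
  assert (Hx : forall y, c <= y <= d ->
     cRI (fun x => f (cpt x y)) a b = (F (cpt b y) - F (cpt a y))%C).
  { intros y Hy. apply (cRI_FTC (fun x => F (cpt x y))); auto.
    - intros x Hx. specialize (HF x y Hx Hy).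
      replace (cpt x y) with (Ci * RtoC y + RtoC x * 1)%C in HF |- * by (unfold cpt; ring).
      apply rder_comp in HF. rewrite Cmult_1_l in HF.
      apply (rder_ext (fun t => F (Ci * y + RtoC t * 1)%C)); [|exact HF].
      intros t. f_equal. unfold cpt; ring.
    - intros; apply rcont_cpt_x, Hf; auto. }
  assert (Hy : forall x, a <= x <= b ->
     (Ci * cRI (fun y => f (cpt x y)) c d = F (cpt x d) - F (cpt x c))%C).
  { intros x Hx0. rewrite <- cRI_scal; auto.
    2:{ intros; apply rcont_cpt_y, Hf; auto. }
    apply (cRI_FTC (fun y => F (cpt x y))); auto.
    - intros y Hy. specialize (HF x y Hx0 Hy).
      replace (cpt x y) with (RtoC x + RtoC y * Ci)%C in HF |- * by (unfold cpt; ring).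
      apply rder_comp in HF.
      apply (rder_ext (fun t => F (RtoC x + RtoC t * Ci)%C)); [|exact HF].
      intros t. f_equal. unfold cpt; ring.
    - intros. apply rcont_mult; [apply rcont_const|]. apply rcont_cpt_y, Hf; auto. }
  rewrite (Hx c), (Hx d), (Hy a), (Hy b) by lra. ring.
Qed.

Lemma rectI_affine al be a b c d : a <= b -> c <= d ->
  rectI (fun z => al + be * z)%C a b c d = 0%C.
Proof.
  intros H1 H2. apply rectI_primitive with (fun z => al * z + be / 2 * (z * z))%C; auto.
  - intros x y _ _. cderiv.
  - intros x y _ _.
    assert (D := Cder_id (cpt x y)).
    assert (H := Cder_plus _ _ _ _ _
       (Cder_mult _ _ _ _ _ (Cder_const al (cpt x y)) D)
       (Cder_mult _ _ _ _ _ (Cder_const (be / 2)%C (cpt x y)) (Cder_mult _ _ _ _ _ D D))).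
    cbv beta in H.
    match type of H with Cder _ _ ?e => replace e with (al + be * cpt x y)%C in H by field end.
    exact H.
Qed.

Record box := Box { bxa : R; bxb : R; bya : R; byb : R }.
Definition boxI f q := rectI f (bxa q) (bxb q) (bya q) (byb q).

(** The four quarters add up to the whole, so one of them carries at least a quarter of the
    modulus. *)
Lemma goursat_step f q : bxa q <= bxb q -> bya q <= byb q ->
  holoR f (bxa q) (bxb q) (bya q) (byb q) ->
  exists q', Cmod (boxI f q) <= 4 * Cmod (boxI f q') /\
    bxb q' - bxa q' = (bxb q - bxa q) / 2 /\ byb q' - bya q' = (byb q - bya q) / 2 /\
    bxa q <= bxa q' /\ bxb q' <= bxb q /\ bya q <= bya q' /\ byb q' <= byb q.
Proof.
  destruct q as [a b c d]; unfold boxI; simpl. intros H1 H2 H.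
  set (m := (a + b) / 2). set (n := (c + d) / 2).
  assert (E : rectI f a b c d = (rectI f a m c n + rectI f a m n d
     + (rectI f m b c n + rectI f m b n d))%C).
  { rewrite (rectI_split_x f a m b c d), (rectI_split_y f a m c n d), (rectI_split_y f m b c n d);
      auto; unfold m, n; try lra; intros x y [[Hx Hy] _]; apply H; unfold m, n in *; lra. }
  set (M := Cmod (rectI f a b c d) / 4).
  destruct (Rle_dec M (Cmod (rectI f a m c n))) as [K|K1].
  { exists (Box a m c n); simpl; unfold M, m, n in *; repeat split; lra. }
  destruct (Rle_dec M (Cmod (rectI f a m n d))) as [K|K2].
  { exists (Box a m n d); simpl; unfold M, m, n in *; repeat split; lra. }
  destruct (Rle_dec M (Cmod (rectI f m b c n))) as [K|K3].
  { exists (Box m b c n); simpl; unfold M, m, n in *; repeat split; lra. }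
  exists (Box m b n d); simpl.
  assert (T : Cmod (rectI f a b c d) <= Cmod (rectI f a m c n) + Cmod (rectI f a m n d)
     + (Cmod (rectI f m b c n) + Cmod (rectI f m b n d))).
  { rewrite E. eapply Rle_trans; [apply Cmod_triangle|].
    apply Rplus_le_compat; apply Cmod_triangle. }
  unfold M, m, n in *; repeat split; lra.
Qed.

Lemma nested_point (u v : nat -> R) : (forall n, u n <= v n) ->
  (forall n, u n <= u (S n) /\ v (S n) <= v n) -> exists p, forall n, u n <= p <= v n.
Proof.
  intros H1 H2.
  assert (Hu : forall n k, u n <= u (n + k)%nat).
  { intros n k; induction k as [|k IH]; [rewrite Nat.add_0_r; lra|].
    rewrite Nat.add_succ_r. destruct (H2 (n + k)%nat); lra. }
  assert (Hv : forall n k, v (n + k)%nat <= v n).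
  { intros n k; induction k as [|k IH]; [rewrite Nat.add_0_r; lra|].
    rewrite Nat.add_succ_r. destruct (H2 (n + k)%nat); lra. }
  assert (Huv : forall n m, u n <= v m).
  { intros n m. specialize (Hu n m). specialize (Hv m n). rewrite Nat.add_comm in Hv.
    specialize (H1 (n + m)%nat). lra. }
  destruct (completeness (fun x => exists n, x = u n)) as [p [Hp1 Hp2]].
  - exists (v O). intros x [n ->]; auto.
  - exists (u O), O; auto.
  - exists p. intros n; split; [apply Hp1; eauto|].
    apply Hp2. intros x [k ->]; auto.
Qed.

Theorem goursat f a b c d : a <= b -> c <= d -> holoR f a b c d -> rectI f a b c d = 0%C.
Proof.
  intros Hab Hcd Hf.
  set (ok := fun q => bxa q <= bxb q /\ bya q <= byb q /\
     holoR f (bxa q) (bxb q) (bya q) (byb q)).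
  set (good := fun q q' => Cmod (boxI f q) <= 4 * Cmod (boxI f q') /\
    bxb q' - bxa q' = (bxb q - bxa q) / 2 /\ byb q' - bya q' = (byb q - bya q) / 2 /\
    bxa q <= bxa q' /\ bxb q' <= bxb q /\ bya q <= bya q' /\ byb q' <= byb q).
  (* The default [q] is irrelevant: on boxes satisfying [ok] the choice meets [good], and [ok] is
     preserved. *)
  set (next := fun q => epsilon (inhabits q) (good q)).
  assert (Hgood : forall q, ok q -> good q (next q)).
  { intros q [O1 [O2 O3]]. apply epsilon_spec. apply goursat_step; auto. }
  assert (Hok : forall q, ok q -> ok (next q)).
  { intros q Hq. destruct (Hgood q Hq) as [_ [G1 [G2 [G3 [G4 [G5 G6]]]]]].
    destruct Hq as [O1 [O2 O3]]. split; [lra|split; [lra|]].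
    intros x y Hx Hy. apply O3; lra. }
  set (Q := fun n => Nat.iter n next (Box a b c d)).
  assert (HQ : forall n, ok (Q n)).
  { induction n; simpl; [split; [|split]; simpl; auto|]. apply Hok; exact IHn. }
  assert (HG : forall n, good (Q n) (Q (S n))) by (intros n; apply Hgood, HQ).
  set (I0 := Cmod (rectI f a b c d)).
  set (L := (b - a) + (d - c)).
  assert (HL : 0 <= L) by (unfold L; lra).
  assert (HLL : 0 < 2 * L * L + 1) by (assert (0 <= L * L) by (apply Rmult_le_pos; auto); lra).
  assert (HI : forall n, I0 <= 4 ^ n * Cmod (boxI f (Q n)) /\
    bxb (Q n) - bxa (Q n) = (b - a) / 2 ^ n /\ byb (Q n) - bya (Q n) = (d - c) / 2 ^ n).
  { induction n as [|n [IH1 [IH2 IH3]]].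
    - unfold I0, boxI; simpl. repeat split; try lra; field.
    - destruct (HG n) as [G0 [G1 [G2 _]]]. rewrite G1, G2, IH2, IH3.
      assert (P := pow_lt 4 n ltac:(lra)). assert (P2 := pow_lt 2 n ltac:(lra)).
      split.
      { eapply Rle_trans; [exact IH1|]. change (4 ^ S n) with (4 * 4 ^ n).
        rewrite (Rmult_comm 4), Rmult_assoc. apply Rmult_le_compat_l; [lra|exact G0]. }
      split; simpl; field; lra. }
  destruct (nested_point (fun n => bxa (Q n)) (fun n => bxb (Q n))) as [px Hpx].
  { intros n; apply HQ. } { intros n. destruct (HG n) as [_ [_ [_ G]]]; lra. }
  destruct (nested_point (fun n => bya (Q n)) (fun n => byb (Q n))) as [py Hpy].
  { intros n; apply HQ. } { intros n. destruct (HG n) as [_ [_ [_ G]]]; lra. }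
  set (p := cpt px py).
  destruct (HQ O) as [_ [_ HO]]. destruct (HO px py (Hpx O) (Hpy O)) as [k Hk].
  fold p in Hk.
  apply Cmod_eq_0. fold I0.
  apply Rle_antisym; [|apply Cmod_ge_0].
  apply le_epsilon. intros eps He. rewrite Rplus_0_l.
  (* After [n] steps the sides add up to [L / 2^n], so [4^n] times the bound on the small box is
     [eta * 2 L^2]; the added 1 keeps the quotient meaningful when [L = 0]. *)
  destruct (Hk (eps / (2 * L * L + 1))) as [del [Hdel H1]]; [apply div_pos; lra|].
  set (eta := eps / (2 * L * L + 1)) in *.
  assert (Heta : 0 < eta) by (apply div_pos; lra).
  destruct (pow_lt_1_zero (1/2) ltac:(rewrite Rabs_right; lra) (del / (L + 1))) as [n Hn].
  { apply div_pos; lra. }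
  specialize (Hn n (Nat.le_refl n)). rewrite Rabs_right in Hn by (apply Rle_ge, pow_le; lra).
  destruct (HI n) as [J1 [J2 J3]]. destruct (HQ n) as [O1 [O2 O3]].
  assert (P2 := pow_lt 2 n ltac:(lra)).
  assert (Ed : (1 / 2) ^ n = / 2 ^ n) by (unfold Rdiv; rewrite Rmult_1_l, pow_inv; auto).
  assert (Hside : L / 2 ^ n < del).
  { rewrite Ed in Hn. unfold Rdiv.
    apply Rle_lt_trans with ((L + 1) * / 2 ^ n).
    - apply Rmult_le_compat_r; [left; apply Rinv_0_lt_compat; auto|lra].
    - apply Rmult_lt_compat_l with (r := L + 1) in Hn; [|lra].
      replace ((L + 1) * (del / (L + 1))) with del in Hn by (field; lra). auto. }
  assert (Hsum : (bxb (Q n) - bxa (Q n)) + (byb (Q n) - bya (Q n)) = L / 2 ^ n).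
  { rewrite J2, J3. unfold L. field. lra. }
  assert (HB : Cmod (boxI f (Q n)) <= eta * (L / 2 ^ n) * (2 * (L / 2 ^ n))).
  { unfold boxI.
    (* Subtracting the affine Taylor part changes nothing because its integral vanishes, and what
       remains is [o(|z - p|)] on the box. *)
    replace (rectI f (bxa (Q n)) (bxb (Q n)) (bya (Q n)) (byb (Q n))) with
      (rectI (fun z => f z - ((f p - k * p) + k * z))%C
         (bxa (Q n)) (bxb (Q n)) (bya (Q n)) (byb (Q n))).
    2:{ rewrite (rectI_minus f (fun z => (f p - k * p) + k * z)%C); auto.
        - rewrite rectI_affine; auto. ring.
        - apply holoR_bdryD; auto.
        - intros x y _. cderiv. }
    rewrite <- Hsum at 2. apply rectI_bound; auto.
    - intros x y [[Hx Hy] _]. apply Cd_minus; [apply O3; auto|cderiv].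
    - intros x y [[Hx Hy] _]. specialize (Hpx n). specialize (Hpy n). simpl in Hpx, Hpy.
      set (h := (cpt x y - p)%C).
      assert (Hh : Cmod h <= L / 2 ^ n).
      { eapply Rle_trans; [apply Cmod_le_ReIm|]. rewrite <- Hsum.
        unfold h, p. rewrite !cpt_pair. unfold Re, Im; simpl.
        apply Rplus_le_compat; apply Rabs_le; lra. }
      specialize (H1 h ltac:(lra)).
      replace (p + h)%C with (cpt x y) in H1 by (unfold h; ring).
      replace (f (cpt x y) - (f p - k * p + k * cpt x y))%C with
        (f (cpt x y) - f p - k * h)%C by (unfold h; ring).
      eapply Rle_trans; [exact H1|]. apply Rmult_le_compat_l; lra. }
  eapply Rle_trans; [exact J1|].
  assert (E4 : 4 ^ n = 2 ^ n * 2 ^ n) by (rewrite <- Rpow_mult_distr; f_equal; lra).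
  assert (P4 := pow_lt 4 n ltac:(lra)).
  apply Rle_trans with (4 ^ n * (eta * (L / 2 ^ n) * (2 * (L / 2 ^ n)))).
  { apply Rmult_le_compat_l; lra. }
  rewrite E4. replace (2 ^ n * 2 ^ n * (eta * (L / 2 ^ n) * (2 * (L / 2 ^ n)))) with
    (eta * (2 * L * L)) by (field; lra).
  apply Rle_trans with (eta * (2 * L * L + 1)); [nra|].
  right. unfold eta. field. lra.
Qed.

(** * Cauchy's integral formula and the estimates drawn from it *)

Lemma cpt_inj x y u v : cpt x y = cpt u v -> x = u /\ y = v.
Proof. rewrite !cpt_pair. intros E; injection E; auto. Qed.

(** Cutting off the four rectangles around the small square leaves boundary integrals that vanish by
    Goursat's theorem; the singular point stays inside the square. *)
Lemma rectI_deform g a b c d x0 y0 e : 0 < e ->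
  a <= x0 - e -> x0 + e <= b -> c <= y0 - e -> y0 + e <= d ->
  (forall x y, a <= x <= b -> c <= y <= d -> (x <> x0 \/ y <> y0) -> Cderivable g (cpt x y)) ->
  rectI g a b c d = rectI g (x0 - e) (x0 + e) (y0 - e) (y0 + e).
Proof.
  intros He H1 H2 H3 H4 H.
  rewrite (rectI_split_x g a (x0 - e) b), (rectI_split_x g (x0 - e) (x0 + e) b),
    (rectI_split_y g (x0 - e) (x0 + e) c (y0 - e) d),
    (rectI_split_y g (x0 - e) (x0 + e) (y0 - e) (y0 + e) d); try lra.
  - rewrite (goursat g a), (goursat g (x0 + e)), (goursat g (x0 - e) (x0 + e) c),
      (goursat g (x0 - e) (x0 + e) (y0 + e)); try lra; try ring;
      intros x y Hx Hy; apply H; try lra.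
  - intros x y [[Hx Hy] Hb]; apply H; lra.
  - intros x y [[Hx Hy] Hb]; apply H; lra.
  - intros x y [[Hx Hy] Hb]; apply H; lra.
  - intros x y [[Hx Hy] Hb]; apply H; lra.
Qed.

Lemma cRI_lin (f : R -> C) (e v a b : R) : 0 < e -> a <= b ->
  (forall x, e * a + v <= x <= e * b + v -> rcont f x) ->
  cRI (fun u => RtoC e * f (e * u + v)%R)%C a b = cRI f (e * a + v) (e * b + v).
Proof.
  intros He Hab H. unfold cRI.
  rewrite <- (RInt_comp_lin (V := C_R_CompleteNormedModule)).
  - apply (RInt_ext (V := C_R_CompleteNormedModule)). intros x _.
    symmetry. apply scal_C_R.
  - apply cRI_ex_le; [nra|auto].
Qed.

(** After rescaling each side to [[-1, 1]] the four integrands add up to [4 i / (1 + x^2)], whose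
    primitive is [4 i atan x]. *)
Lemma rectI_inv_square x0 y0 e : 0 < e ->
  rectI (fun z => / (z - cpt x0 y0))%C (x0 - e) (x0 + e) (y0 - e) (y0 + e) = (2 * PI * Ci)%C.
Proof.
  intros He. unfold rectI.
  assert (E : forall x0, x0 - e = e * -1 + x0 /\ x0 + e = e * 1 + x0) by (intros; lra).
  assert (Hnz : forall u v, (u <> 0 \/ v <> 0) -> cpt u v <> 0%C).
  { intros u v Huv E0. replace (RtoC 0) with (cpt 0 0) in E0 by (unfold cpt; ring).
    apply cpt_inj in E0. lra. }
  assert (Hsub : forall x y, (cpt x y - cpt x0 y0)%C = cpt (x - x0) (y - y0)).
  { intros. unfold cpt. rewrite !RtoC_minus. ring. }
  assert (Hcx : forall x y, y <> y0 -> rcont (fun t => / (cpt t y - cpt x0 y0))%C x).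
  { intros x y Hy. apply rcont_inv; [|unfold cpt; rcontin].
    rewrite Hsub. apply Hnz. right; lra. }
  assert (Hcy : forall x y, x <> x0 -> rcont (fun t => / (cpt x t - cpt x0 y0))%C y).
  { intros x y Hy. apply rcont_inv; [|unfold cpt; rcontin].
    rewrite Hsub. apply Hnz. left; lra. }
  assert (Kx : forall s, s <> 0 -> cRI (fun x => / (cpt x (y0 + s * e) - cpt x0 y0))%C (x0 - e) (x0 + e)
     = cRI (fun x => / cpt x s)%C (-1) 1).
  { intros s Hs. destruct (E x0) as [-> ->]. rewrite <- cRI_lin; auto; try lra.
    2:{ intros; apply Hcx. nra. }
    apply cRI_ext; [lra|]. intros x Hx. rewrite Hsub.
    replace (cpt (e * x + x0 - x0) (y0 + s * e - y0)) with (RtoC e * cpt x s)%C.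
    2:{ unfold cpt. rewrite !RtoC_minus, !RtoC_plus, !RtoC_mult. ring. }
    field. split; [apply Hnz; auto|]. intros Q; apply RtoC_inj in Q; lra. }
  assert (Ky : forall s, s <> 0 -> cRI (fun x => / (cpt (x0 + s * e) x - cpt x0 y0))%C (y0 - e) (y0 + e)
     = cRI (fun x => / cpt s x)%C (-1) 1).
  { intros s Hs. destruct (E y0) as [-> ->]. rewrite <- cRI_lin; auto; try lra.
    2:{ intros; apply Hcy. nra. }
    apply cRI_ext; [lra|]. intros x Hx. rewrite Hsub.
    replace (cpt (x0 + s * e - x0) (e * x + y0 - y0)) with (RtoC e * cpt s x)%C.
    2:{ unfold cpt. rewrite !RtoC_minus, !RtoC_plus, !RtoC_mult. ring. }
    field. split; [apply Hnz; auto|]. intros Q; apply RtoC_inj in Q; lra. }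
  assert (K1 := Kx (-1) ltac:(lra)). assert (K2 := Ky 1 ltac:(lra)).
  assert (K3 := Kx 1 ltac:(lra)). assert (K4 := Ky (-1) ltac:(lra)).
  replace (y0 + -1 * e) with (y0 - e) in K1 by ring.
  replace (x0 + -1 * e) with (x0 - e) in K4 by ring.
  rewrite Rmult_1_l in K2, K3. rewrite K1, K2, K3, K4.
  assert (Rx : forall s x, s <> 0 -> rcont (fun x => / cpt x s)%C x).
  { intros. apply rcont_inv; [apply Hnz; auto|unfold cpt; rcontin]. }
  assert (Ry : forall s x, s <> 0 -> rcont (fun x => / cpt s x)%C x).
  { intros. apply rcont_inv; [apply Hnz; auto|unfold cpt; rcontin]. }
  rewrite <- !cRI_scal by (try lra; intros; apply Ry; lra).
  rewrite <- cRI_plus, <- !cRI_minus; try lra; intros;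
    repeat first [apply rcont_minus | apply rcont_plus | apply rcont_mult; [apply rcont_const|]];
    try (apply Rx; lra); try (apply Ry; lra).
  assert (S : forall x, (/ cpt x (-1) + Ci * / cpt 1 x - / cpt x 1 - Ci * / cpt (-1) x
     = RtoC (/ (1 + x ^ 2)) * (4 * Ci))%C).
  { intros x. unfold Cinv. rewrite !cpt_pair.
    apply Ceq; unfold Re, Im, Ci, RtoC, Cmult, Cplus, Cminus, Copp; simpl; field; nra. }
  rewrite (cRI_FTC (fun x => RtoC (atan x) * (4 * Ci))%C).
  - replace (-1) with (- (1)) by lra. rewrite atan_opp, atan_1, RtoC_opp, RtoC_div by lra.
    field.
  - lra.
  - intros x Hx. rewrite S.
    intros eta Heta. destruct (derivable_pt_lim_atan x (eta / 4)) as [d Hd]; [lra|].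
    exists d. split; [apply cond_pos|]. intros h Hh.
    destruct (Req_dec h 0) as [->|Hh0].
    { rewrite Rplus_0_r, Rabs_R0, Rmult_0_r.
      match goal with |- Cmod ?a <= _ => replace a with (RtoC 0) by ring end.
      rewrite Cmod_0; lra. }
    specialize (Hd h Hh0 Hh).
    replace (RtoC (atan (x + h)) * (4 * Ci) - RtoC (atan x) * (4 * Ci)
       - RtoC h * (RtoC (/ (1 + x ^ 2)) * (4 * Ci)))%C
      with (RtoC (atan (x + h) - atan x - h * / (1 + x ^ 2)) * (4 * Ci))%C
      by (rewrite !RtoC_minus, RtoC_mult; ring).
    rewrite !Cmod_mult, Cmod_Ci, !Cmod_R, (Rabs_right 4) by lra.
    replace (atan (x + h) - atan x - h * / (1 + x ^ 2)) with
      (((atan (x + h) - atan x) / h - / (1 + x ^ 2)) * h) by (field; split; nra).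
    rewrite Rabs_mult. assert (P := Rabs_pos h).
    replace (1 / (1 + x²)) with (/ (1 + x ^ 2)) in Hd by (unfold Rsqr; field; nra). nra.
  - intros x Hx. 
    repeat first [apply rcont_minus | apply rcont_plus | apply rcont_mult; [apply rcont_const|]];
    try (apply Rx; lra); try (apply Ry; lra).
Qed.

Lemma two_pi_i_nz : (2 * PI * Ci)%C <> 0%C.
Proof.
  assert (P := PI_RGT_0).
  repeat apply Cmult_neq_0; try apply Ci_nz; intros Q; apply RtoC_inj in Q; lra.
Qed.

Lemma Cmod_2pii : Cmod (2 * PI * Ci)%C = 2 * PI.
Proof.
  assert (P := PI_RGT_0).
  rewrite !Cmod_mult, Cmod_Ci, !Cmod_R, !Rabs_right; lra.
Qed.

Lemma cauchy_formula f a b c d t : a < Re t < b -> c < Im t < d -> holoR f a b c d ->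
  rectI (fun z => f z / (z - t))%C a b c d = (2 * PI * Ci * f t)%C.
Proof.
  intros Hx Hy Hf.
  set (x0 := Re t) in *. set (y0 := Im t) in *.
  assert (Et : t = cpt x0 y0) by (symmetry; apply cpt_ReIm).
  assert (Hnz : forall x y, x <> x0 \/ y <> y0 -> (cpt x y - t)%C <> 0%C).
  { intros x y H E. assert (E' : cpt x y = t) by (apply Ceq_minus; auto).
    rewrite Et in E'. apply cpt_inj in E'. lra. }
  destruct (Hf x0 y0) as [k Hk]; [lra|lra|]. rewrite <- Et in Hk.
  set (r := Rmin (Rmin (x0 - a) (b - x0)) (Rmin (y0 - c) (d - y0))).
  assert (Hr : 0 < r) by (unfold r; repeat apply Rmin_pos; lra).
  assert (Hr1 : r <= x0 - a /\ r <= b - x0 /\ r <= y0 - c /\ r <= d - y0).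
  { unfold r. assert (A1 := Rmin_l (Rmin (x0 - a) (b - x0)) (Rmin (y0 - c) (d - y0))).
    assert (A2 := Rmin_r (Rmin (x0 - a) (b - x0)) (Rmin (y0 - c) (d - y0))).
    assert (A3 := Rmin_l (x0 - a) (b - x0)). assert (A4 := Rmin_r (x0 - a) (b - x0)).
    assert (A5 := Rmin_l (y0 - c) (d - y0)). assert (A6 := Rmin_r (y0 - c) (d - y0)). lra. }
  apply Cmod_zero_eq. intros eps Heps.
  destruct (Hk 1 Rlt_0_1) as [del [Hdel Hq]].
  (* Near [t] the difference quotient of [f] is bounded by [M]. The small square has perimeter
     [8 e], so [e <= eps / (16 M)] leaves at most [eps / 2]. *)
  set (M := Cmod k + 1). assert (HM : 0 < M) by (unfold M; assert (Z := Cmod_ge_0 k); lra).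
  set (e := Rmin r (Rmin (del / 4) (eps / (16 * M)))).
  assert (He : 0 < e) by (unfold e; repeat apply Rmin_pos; try lra; apply div_pos; lra).
  assert (He1 : e <= r) by apply Rmin_l.
  assert (He2 : e <= del / 4) by (eapply Rle_trans; [apply Rmin_r|apply Rmin_l]).
  assert (He3 : e <= eps / (16 * M)) by (eapply Rle_trans; [apply Rmin_r|apply Rmin_r]).
  assert (Dg : forall g : C -> C, holoR g a b c d -> forall x y, a <= x <= b -> c <= y <= d ->
     x <> x0 \/ y <> y0 -> Cderivable (fun z => g z / (z - t))%C (cpt x y)).
  { intros g Hg x y H1 H2 H3. apply Cd_div; [apply Hnz; auto|apply Hg; auto|cderiv]. }
  rewrite (rectI_deform _ a b c d x0 y0 e); try lra; [|apply Dg; auto].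
  assert (Hb : forall x y, on_bdry (x0 - e) (x0 + e) (y0 - e) (y0 + e) x y ->
     a <= x <= b /\ c <= y <= d /\ (x <> x0 \/ y <> y0)).
  { intros x y [[H1 H2] H3]. repeat split; try lra. }
  assert (HfT : holoR (fun z => f t) a b c d) by (intros x y _ _; cderiv).
  assert (Inv : rectI (fun z => / (z - t))%C (x0 - e) (x0 + e) (y0 - e) (y0 + e) = (2 * PI * Ci)%C).
  { rewrite Et. apply rectI_inv_square; auto. }
  assert (Heq : rectI (fun z => f z / (z - t))%C (x0 - e) (x0 + e) (y0 - e) (y0 + e) =
    (rectI (fun z => f z / (z - t) - f t * / (z - t)) (x0 - e) (x0 + e) (y0 - e) (y0 + e)
      + 2 * PI * Ci * f t)%C).
  { rewrite (rectI_minus (fun z => f z / (z - t))%C (fun z => f t * / (z - t))%C); try lra.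
    - rewrite (rectI_scal (f t) (fun z => / (z - t))%C); try lra.
      + rewrite Inv. ring.
      + intros x y H. destruct (Hb x y H) as [H1 [H2 H3]].
        apply Cd_inv; [apply Hnz; auto|cderiv].
    - intros x y H. destruct (Hb x y H) as [H1 [H2 H3]]. apply Dg; auto.
    - intros x y H. destruct (Hb x y H) as [H1 [H2 H3]]. apply (Dg (fun _ => f t)); auto. }
  rewrite Heq.
  replace (rectI (fun z => f z / (z - t) - f t * / (z - t)) (x0 - e) (x0 + e) (y0 - e) (y0 + e)
     + 2 * PI * Ci * f t - 2 * PI * Ci * f t)%C with
   (rectI (fun z => f z / (z - t) - f t * / (z - t))%C (x0 - e) (x0 + e) (y0 - e) (y0 + e)) by ring.
  eapply Rle_lt_trans; [apply (rectI_bound _ _ _ _ _ M); try lra|].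
  - intros x y H. destruct (Hb x y H) as [H1 [H2 H3]].
    apply Cd_minus; [apply Dg; auto|]. apply (Dg (fun _ => f t)); auto.
  - intros x y H. destruct (Hb x y H) as [H1 [H2 H3]].
    specialize (Hnz x y H3). set (h := (cpt x y - t)%C) in *.
    assert (Hh : Cmod h < del).
    { eapply Rle_lt_trans; [apply Cmod_le_ReIm|]. unfold h. rewrite Et, !cpt_pair.
      unfold Re, Im; simpl. destruct H as [[H4 H5] _].
      assert (Rabs (x + - x0) <= e) by (apply Rabs_le; lra).
      assert (Rabs (y + - y0) <= e) by (apply Rabs_le; lra). lra. }
    specialize (Hq h Hh). replace (t + h)%C with (cpt x y) in Hq by (unfold h; ring).
    assert (Hp : 0 < Cmod h) by (apply Cmod_gt_0; auto).
    replace (f (cpt x y) / h - f t * / h)%C with ((f (cpt x y) - f t) / h)%C by (field; auto).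
    rewrite Cmod_div by auto.
    apply Rmult_le_reg_r with (Cmod h); auto. unfold Rdiv. rewrite Rmult_assoc, Rinv_l by lra.
    replace (f (cpt x y) - f t)%C with ((f (cpt x y) - f t - k * h) + k * h)%C by ring.
    rewrite Rmult_1_r. eapply Rle_trans; [apply Cmod_triangle|]. rewrite Cmod_mult. unfold M. lra.
  - apply Rle_lt_trans with (M * 8 * e); [right; ring|].
    apply Rle_lt_trans with (M * 8 * (eps / (16 * M))); [apply Rmult_le_compat_l; lra|].
    replace (M * 8 * (eps / (16 * M))) with (eps / 2) by (field; lra). lra.
Qed.

Lemma Cmod_cpt_ge_x x y : Rabs x <= Cmod (cpt x y).
Proof. rewrite cpt_pair. apply (Re_le_Cmod (x, y)). Qed.
Lemma Cmod_cpt_ge_y x y : Rabs y <= Cmod (cpt x y).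
Proof. rewrite cpt_pair. apply (Im_le_Cmod (x, y)). Qed.

(** The coefficient is Cauchy's integral of [f(z) / z^2], and the remainder is that of
    [f(z) t^2 / (z^2 (z - t))]. The constants come from [|z| >= rho] and [|z - t| >= rho / 2] on the
    boundary, from the perimeter [8 rho], and from estimating [1 / (2 pi)] by 1. *)
Lemma cauchy_taylor f rho M : 0 < rho -> 0 <= M -> holoR f (- rho) rho (- rho) rho ->
  (forall x y, - rho <= x <= rho -> - rho <= y <= rho -> Cmod (f (cpt x y)) <= M) ->
  exists c, Cmod c <= 8 * M / rho /\ forall t, Cmod t <= rho / 2 ->
    Cmod (f t - f 0 - c * t)%C <= 16 * M / (rho * rho) * (Cmod t * Cmod t).
Proof.
  intros Hr HM Hf Hb.
  assert (Hpi : 1 < 2 * PI) by (assert (Q := PI2_1); lra).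
  set (R0 := fun g => rectI g (- rho) rho (- rho) rho).
  assert (Hz : forall x y, on_bdry (- rho) rho (- rho) rho x y -> rho <= Cmod (cpt x y)).
  { intros x y [_ [ -> | [ -> | [ -> | -> ]]]];
      try (eapply Rle_trans; [|apply Cmod_cpt_ge_x]; rewrite ?Rabs_Ropp, Rabs_right; lra);
      try (eapply Rle_trans; [|apply Cmod_cpt_ge_y]; rewrite ?Rabs_Ropp, Rabs_right; lra). }
  assert (Hz0 : forall x y, on_bdry (- rho) rho (- rho) rho x y -> cpt x y <> 0%C).
  { intros x y H. apply Cmod_gt_0. specialize (Hz x y H). lra. }
  assert (Hzt : forall t x y, Cmod t <= rho / 2 -> on_bdry (- rho) rho (- rho) rho x y ->
     rho / 2 <= Cmod (cpt x y - t)%C).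
  { intros t x y Ht H. assert (A := Cmod_sub_ge (cpt x y) t). specialize (Hz x y H). lra. }
  assert (Hzt0 : forall t x y, Cmod t <= rho / 2 -> on_bdry (- rho) rho (- rho) rho x y ->
     (cpt x y - t)%C <> 0%C).
  { intros t x y Ht H. apply Cmod_gt_0. specialize (Hzt t x y Ht H). lra. }
  assert (Hin : forall t, Cmod t <= rho / 2 -> - rho < Re t < rho /\ - rho < Im t < rho).
  { intros t Ht. assert (A := Re_le_Cmod t). assert (B := Im_le_Cmod t).
    apply Rabs_le_between in A. apply Rabs_le_between in B. lra. }
  assert (Hbf := holoR_bdryD _ _ _ _ _ Hf).
  assert (HCF : forall t, Cmod t <= rho / 2 -> R0 (fun z => f z / (z - t))%C = (2 * PI * Ci * f t)%C).
  { intros t Ht. destruct (Hin t Ht). unfold R0. exact (cauchy_formula f _ _ _ _ t H H0 Hf). }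
  set (c := (/ (2 * PI * Ci) * R0 (fun z => f z / (z * z)))%C).
  assert (D0 : forall t, Cmod t <= rho / 2 -> bdryD (fun z => f z / (z - t))%C (- rho) rho (- rho) rho).
  { intros t Ht x y H. apply Cd_div; [apply Hzt0; auto|apply Hbf; auto|cderiv]. }
  assert (D2 : bdryD (fun z => f z / (z * z))%C (- rho) rho (- rho) rho).
  { intros x y H. apply Cd_div; [apply Cmult_neq_0; apply Hz0; auto|apply Hbf; auto|cderiv]. }
  assert (Hinv : Cmod (/ (2 * PI * Ci))%C <= 1).
  { rewrite Cmod_inv by apply two_pi_i_nz. rewrite Cmod_2pii.
    rewrite <- Rinv_1. apply Rinv_le_contravar; lra. }
  exists c. split.
  - unfold c. rewrite Cmod_mult.
    apply Rle_trans with (1 * Cmod (R0 (fun z => f z / (z * z))%C)).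
    { apply Rmult_le_compat_r; auto using Cmod_ge_0. }
    rewrite Rmult_1_l.
    replace (8 * M / rho) with (M / (rho * rho) * (2 * ((rho - - rho) + (rho - - rho)))) by (field; lra).
    unfold R0. apply rectI_bound; [lra|lra|exact D2|].
    intros x y H. specialize (Hz x y H). destruct H as [[H1 H2] H3].
    rewrite Cmod_div by (apply Cmult_neq_0; apply Hz0; split; auto). rewrite Cmod_mult.
    apply Rmult_le_compat; auto using Cmod_ge_0.
    + left; apply Rinv_0_lt_compat; nra.
    + apply Rinv_le_contravar; nra.
  - intros t Ht.
    assert (Ht0 : Cmod 0%C <= rho / 2) by (rewrite Cmod_0; lra).
    assert (E : (f t - f 0 - c * t = / (2 * PI * Ci) *
      R0 (fun z => f z / (z - t) - f z / (z - 0) - t * (f z / (z * z))))%C).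
    { unfold R0. rewrite (rectI_minus (fun z => f z / (z - t) - f z / (z - 0))%C
        (fun z => t * (f z / (z * z)))%C); [|lra|lra| |].
      - rewrite (rectI_minus (fun z => f z / (z - t))%C (fun z => f z / (z - 0))%C);
          [|lra|lra|exact (D0 t Ht)|exact (D0 _ Ht0)].
        rewrite (rectI_scal t (fun z => f z / (z * z))%C); [|lra|lra|exact D2].
        fold (R0 (fun z => f z / (z - t))%C). fold (R0 (fun z => f z / (z - 0))%C).
        fold (R0 (fun z => f z / (z * z))%C).
        rewrite (HCF t Ht), (HCF _ Ht0). unfold c.
        clear - Ht. assert (Hk := two_pi_i_nz). generalize dependent (2 * PI * Ci)%C. intros k Hk.
        field. exact Hk.
      - intros x y H. apply Cd_minus; [exact (D0 t Ht x y H)|exact (D0 _ Ht0 x y H)].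
      - intros x y H. apply Cd_mult; [cderiv|exact (D2 x y H)]. }
    rewrite E, Cmod_mult.
    match goal with |- _ * ?b <= _ => apply Rle_trans with (1 * b) end.
    { apply Rmult_le_compat_r; auto using Cmod_ge_0. }
    rewrite Rmult_1_l.
    assert (Hta := Cmod_ge_0 t).
    apply Rle_trans with (M * (Cmod t * Cmod t) / (rho * rho * (rho / 2)) *
       (2 * ((rho - - rho) + (rho - - rho)))); [|right; field; lra].
    unfold R0. apply rectI_bound; [lra|lra| |].
    + intros x y H. apply Cd_minus; [apply Cd_minus; [exact (D0 t Ht x y H)|exact (D0 _ Ht0 x y H)]|].
      apply Cd_mult; [cderiv|exact (D2 x y H)].
    + intros x y H. set (z := cpt x y).
      assert (A := Hz x y H). assert (B := Hzt t x y Ht H).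
      assert (A0 := Hz0 x y H). assert (B0 := Hzt0 t x y Ht H).
      destruct H as [[H1 H2] H3]. specialize (Hb x y H1 H2). fold z in A, B, A0, B0, Hb.
      replace (f z / (z - t) - f z / (z - 0) - t * (f z / (z * z)))%C with
        (f z * (t * t) / (z * z * (z - t)))%C.
      2:{ field. split; assumption. }
      rewrite Cmod_div by (repeat apply Cmult_neq_0; auto). rewrite !Cmod_mult.
      apply Rmult_le_compat.
      * repeat apply Rmult_le_pos; auto using Cmod_ge_0.
      * left; apply Rinv_0_lt_compat; repeat apply Rmult_lt_0_compat; lra.
      * apply Rmult_le_compat_r; [nra|auto].
      * apply Rinv_le_contravar; [repeat apply Rmult_lt_0_compat; lra|].
        apply Rmult_le_compat; try nra.
Qed.

(** The condition [SD] expresses, without mentioning the derivative, that the difference quotients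
    of [f] at 0 vary by at most [K (|h| + |k|)]; it is therefore stable under limits and integrals. *)
Definition SD (f : C -> C) (K rho : R) : Prop :=
  forall h k, Cmod h <= rho -> Cmod k <= rho ->
    Cmod ((f h - f 0) * k - (f k - f 0) * h)%C <= K * (Cmod h * Cmod k * (Cmod h + Cmod k)).

(** The difference quotients along [rho / (n + 1)] form a Cauchy sequence by [SD]. Their limit is
    the derivative, and [SD] between a general [h] and the sequence gives the rate [K |h|]. *)
Lemma SD_Cderivable f K rho : 0 < rho -> 0 <= K -> SD f K rho -> Cderivable f 0%C.
Proof.
  intros Hr HK H.
  set (q := fun h => ((f h - f 0) / h)%C).
  assert (Hq : forall h k : C, h <> 0%C -> k <> 0%C -> Cmod h <= rho -> Cmod k <= rho ->
     Cmod (q h - q k)%C <= K * (Cmod h + Cmod k)).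
  { intros h k Hh Hk H1 H2. specialize (H h k H1 H2).
    assert (P1 : 0 < Cmod h) by (apply Cmod_gt_0; auto).
    assert (P2 : 0 < Cmod k) by (apply Cmod_gt_0; auto).
    replace (q h - q k)%C with (((f h - f 0) * k - (f k - f 0) * h) / (h * k))%C
      by (unfold q; field; auto).
    rewrite Cmod_div by (apply Cmult_neq_0; auto). rewrite Cmod_mult.
    apply Rmult_le_reg_r with (Cmod h * Cmod k); [nra|].
    unfold Rdiv. rewrite Rmult_assoc, Rinv_l by nra. nra. }
  set (e := fun n => RtoC (rho / (INR n + 1))).
  assert (Hn1 : forall n, 0 < INR n + 1) by (intros n; assert (Z := pos_INR n); lra).
  assert (He : forall n, e n <> 0%C /\ Cmod (e n) <= rho /\ Cmod (e n) = rho / (INR n + 1)).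
  { intros n. specialize (Hn1 n). assert (P : 0 < rho / (INR n + 1)) by (apply div_pos; auto).
    unfold e. rewrite Cmod_R, Rabs_right by lra. repeat split.
    - intros Q; apply RtoC_inj in Q; lra.
    - apply Rmult_le_reg_r with (INR n + 1); auto. unfold Rdiv. rewrite Rmult_assoc, Rinv_l by lra.
      assert (Z := pos_INR n). nra. }
  assert (Hsmall : forall eps, 0 < eps -> exists n0, forall n, (n0 <= n)%nat -> Cmod (e n) < eps).
  { intros eps Heps. destruct (INR_unbounded (rho / eps)) as [n0 Hn0]. exists n0. intros n Hn.
    destruct (He n) as [_ [_ ->]]. apply le_INR in Hn.
    apply Rmult_lt_reg_r with (INR n + 1); auto. unfold Rdiv. rewrite Rmult_assoc, Rinv_l by (specialize (Hn1 n); lra).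
    assert (rho / eps * eps < (INR n + 1) * eps) by (apply Rmult_lt_compat_r; lra).
    replace (rho / eps * eps) with rho in H0 by (field; lra). lra. }
  destruct (clim_cauchy (fun n => q (e n))) as [c Hc].
  { intros eps Heps. destruct (Hsmall (eps / (2 * K + 1) / 2)) as [n0 H0].
    { repeat apply div_pos; lra. }
    exists n0. intros n m Hn Hm. destruct (He n) as [A1 [A2 _]]. destruct (He m) as [B1 [B2 _]].
    eapply Rle_lt_trans; [apply Hq; auto|].
    assert (X1 := H0 n Hn). assert (X2 := H0 m Hm).
    apply Rle_lt_trans with (K * (eps / (2 * K + 1))); [apply Rmult_le_compat_l; lra|].
    apply Rmult_lt_reg_r with (2 * K + 1); [lra|].
    replace (K * (eps / (2 * K + 1)) * (2 * K + 1)) with (K * eps) by (field; lra). nra. }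
  assert (Hqc : forall h : C, h <> 0%C -> Cmod h <= rho -> Cmod (q h - c)%C <= K * Cmod h).
  { intros h Hh H1. apply le_epsilon. intros eps Heps.
    destruct (Hc (eps / 2)) as [n1 H2]; [lra|].
    destruct (Hsmall (eps / (2 * K + 1) / 2)) as [n2 H3]; [repeat apply div_pos; lra|].
    specialize (H2 (max n1 n2) ltac:(lia)). specialize (H3 (max n1 n2) ltac:(lia)).
    destruct (He (max n1 n2)) as [A1 [A2 _]]. specialize (Hq h _ Hh A1 H1 A2).
    replace (q h - c)%C with ((q h - q (e (max n1 n2))) + (q (e (max n1 n2)) - c))%C by ring.
    eapply Rle_trans; [apply Cmod_triangle|].
    assert (K * Cmod (e (max n1 n2)) <= eps / 2).
    { apply Rle_trans with (K * (eps / (2 * K + 1) / 2)); [apply Rmult_le_compat_l; lra|].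
      apply Rmult_le_reg_r with (2 * K + 1); [lra|].
      replace (K * (eps / (2 * K + 1) / 2) * (2 * K + 1)) with (K * eps / 2) by (field; lra). nra. }
    lra. }
  exists c. intros eta Heta. exists (Rmin rho (eta / (K + 1))). split.
  { apply Rmin_pos; auto. apply div_pos; lra. }
  intros h Hh. rewrite Cplus_0_l.
  destruct (Ceq_dec h 0%C) as [->|Hh0].
  { replace (f 0 - f 0 - c * 0)%C with (RtoC 0) by ring. rewrite Cmod_0. lra. }
  assert (A := Rlt_le_trans _ _ _ Hh (Rmin_l _ _)).
  assert (B := Rlt_le_trans _ _ _ Hh (Rmin_r _ _)).
  specialize (Hqc h Hh0 (Rlt_le _ _ A)).
  replace (f h - f 0 - c * h)%C with ((q h - c) * h)%C by (unfold q; field; auto).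
  rewrite Cmod_mult. apply Rmult_le_compat_r; [apply Cmod_ge_0|].
  eapply Rle_trans; [exact Hqc|].
  rewrite Rmult_comm. apply Rle_mult_eps; auto using Cmod_ge_0; try lra.
  apply Cmod_gt_0; auto.
Qed.

(** The square of half side [r / 3] fits in the disc of radius [r], so [cauchy_taylor] applies with
    [rho = r / 3]. In the expression of [SD] the linear coefficient cancels and only the two
    quadratic remainders survive. *)
Lemma SD_holo (f : C -> C) r M : 0 < r -> 0 <= M ->
  (forall h, Cmod h < r -> Cderivable f h) -> (forall h, Cmod h < r -> Cmod (f h) <= M) ->
  SD f (144 * M / (r * r)) (r / 6).
Proof.
  intros Hr HM Hf Hb.
  assert (Hin : forall x y, - (r / 3) <= x <= r / 3 -> - (r / 3) <= y <= r / 3 -> Cmod (cpt x y) < r).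
  { intros x y H1 H2. eapply Rle_lt_trans; [apply Cmod_le_ReIm|]. rewrite Re_cpt, Im_cpt.
    assert (Rabs x <= r / 3) by (apply Rabs_le; lra).
    assert (Rabs y <= r / 3) by (apply Rabs_le; lra). lra. }
  destruct (cauchy_taylor f (r / 3) M) as [c [_ Hc]]; try lra.
  { intros x y H1 H2. apply Hf; auto. }
  { intros x y H1 H2. apply Hb; auto. }
  intros h k Hh Hk.
  assert (A := Hc h ltac:(lra)). assert (B := Hc k ltac:(lra)).
  replace ((f h - f 0) * k - (f k - f 0) * h)%C with
    ((f h - f 0 - c * h) * k - (f k - f 0 - c * k) * h)%C by ring.
  eapply Rle_trans; [apply Cmod_minus_le|]. rewrite !Cmod_mult.
  replace (16 * M / (r / 3 * (r / 3))) with (144 * M / (r * r)) in A, B by (field; lra).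
  assert (P1 := Cmod_ge_0 h). assert (P2 := Cmod_ge_0 k).
  apply Rmult_le_compat_r with (r := Cmod k) in A; auto.
  apply Rmult_le_compat_r with (r := Cmod h) in B; auto.
  eapply Rle_trans; [apply Rplus_le_compat; eassumption|]. right; ring.
Qed.

(** With [rho = r / 3] and [|h| <= r / 6], the quadratic remainder and the linear term each
    contribute [24 M / r]. *)
Lemma holo_lipschitz (f : C -> C) r M : 0 < r -> 0 <= M ->
  (forall h, Cmod h < r -> Cderivable f h) -> (forall h, Cmod h < r -> Cmod (f h) <= M) ->
  forall h, Cmod h <= r / 6 -> Cmod (f h - f 0)%C <= 48 * M / r * Cmod h.
Proof.
  intros Hr HM Hf Hb h Hh.
  assert (Hin : forall x y, - (r / 3) <= x <= r / 3 -> - (r / 3) <= y <= r / 3 -> Cmod (cpt x y) < r).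
  { intros x y H1 H2. eapply Rle_lt_trans; [apply Cmod_le_ReIm|]. rewrite Re_cpt, Im_cpt.
    assert (Rabs x <= r / 3) by (apply Rabs_le; lra).
    assert (Rabs y <= r / 3) by (apply Rabs_le; lra). lra. }
  destruct (cauchy_taylor f (r / 3) M) as [c [Hc0 Hc]]; try lra.
  { intros x y H1 H2. apply Hf; auto. }
  { intros x y H1 H2. apply Hb; auto. }
  specialize (Hc h ltac:(lra)).
  replace (f h - f 0)%C with ((f h - f 0 - c * h) + c * h)%C by ring.
  eapply Rle_trans; [apply Cmod_triangle|]. rewrite Cmod_mult.
  assert (P := Cmod_ge_0 h).
  apply Rle_trans with (16 * M / (r / 3 * (r / 3)) * (Cmod h * (r / 6)) + 8 * M / (r / 3) * Cmod h).
  - apply Rplus_le_compat; [|apply Rmult_le_compat_r; auto].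
    eapply Rle_trans; [exact Hc|]. apply Rmult_le_compat_l; [|apply Rmult_le_compat_l; auto].
    apply Rmult_le_pos; [lra|]. left; apply Rinv_0_lt_compat; nra.
  - right. field. lra.
Qed.

Lemma Cd_translate f z : Cderivable (fun h => f (z + h)%C) 0%C -> Cderivable f z.
Proof.
  intros H. apply Cd_ext with (f := fun u => f (z + (u - z))%C).
  { intros u. f_equal. ring. }
  apply (Cd_comp (fun h => f (z + h)%C) (fun u => u - z)%C); [cderiv|].
  replace (z - z)%C with (RtoC 0) by ring. exact H.
Qed.

Lemma Cd_translate_r f z h : Cderivable f (z + h)%C -> Cderivable (fun k => f (z + k)%C) h.
Proof. intros H. apply (Cd_comp f (fun k => z + k)%C); [cderiv|auto]. Qed.

(** Bounded pointwise convergence is enough: [SD] involves only three values of the function, so it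
    passes to the limit with the constant common to all [u n]. *)
Lemma Cd_lim (u : nat -> C -> C) f z r M : 0 < r ->
  (forall n h, Cmod h < r -> Cderivable (u n) (z + h)%C) ->
  (forall n h, Cmod h < r -> Cmod (u n (z + h)%C) <= M) ->
  (forall h, Cmod h < r -> clim (fun n => u n (z + h)%C) (f (z + h)%C)) -> Cderivable f z.
Proof.
  intros Hr Hu HM Hl.
  assert (HM0 : 0 <= M).
  { eapply Rle_trans; [apply Cmod_ge_0|apply (HM O 0%C)]. rewrite Cmod_0; auto. }
  apply Cd_translate. apply SD_Cderivable with (144 * M / (r * r)) (r / 6); try lra.
  { apply Rmult_le_pos; [lra|]. left; apply Rinv_0_lt_compat; nra. }
  intros h k Hh Hk.
  apply clim_le with (u := fun n => ((u n (z + h) - u n (z + 0)) * k - (u n (z + k) - u n (z + 0)) * h)%C).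
  - assert (L1 := Hl h ltac:(lra)). assert (L2 := Hl k ltac:(lra)).
    assert (L3 := Hl 0%C ltac:(rewrite Cmod_0; lra)).
    apply (clim_scal k) in L1 as L1k. apply (clim_scal h) in L2 as L2h.
    apply (clim_scal (h - k)%C) in L3 as L3k.
    apply (clim_scal (-(1))%C) in L2h.
    assert (L := clim_plus _ _ _ _ (clim_plus _ _ _ _ L1k L2h) L3k).
    replace ((f (z + h) - f (z + 0)) * k - (f (z + k) - f (z + 0)) * h)%C with
      (k * f (z + h) + - (1) * (h * f (z + k)) + (h - k) * f (z + 0))%C by ring.
    eapply clim_ext; [|exact L]. intros n; simpl. ring.
  - exists O. intros n _.
    apply (SD_holo (fun h => u n (z + h)%C) r M Hr HM0); auto.
    intros h0 Hh0. apply Cd_translate_r. auto.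
Qed.

(** The expression in [SD] is linear in the function, so it may be integrated in the parameter [x];
    the constant is multiplied by the length of the interval. *)
Lemma Cd_int (phi : C -> R -> C) z r M a b : 0 < r -> a <= b ->
  (forall h x, Cmod h < r -> a <= x <= b -> Cderivable (fun s => phi s x) (z + h)%C) ->
  (forall h x, Cmod h < r -> a <= x <= b -> rcont (phi (z + h)%C) x) ->
  (forall h x, Cmod h < r -> a <= x <= b -> Cmod (phi (z + h)%C x) <= M) ->
  Cderivable (fun s => cRI (phi s) a b) z.
Proof.
  intros Hr Hab Hd Hc HM.
  assert (HM0 : 0 <= M).
  { eapply Rle_trans; [apply Cmod_ge_0|apply (HM 0%C a)]. rewrite Cmod_0; auto. lra. }
  set (K := 144 * M / (r * r)).
  assert (HK : 0 <= K).
  { apply Rmult_le_pos; [lra|]. left; apply Rinv_0_lt_compat; nra. }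
  apply Cd_translate. apply SD_Cderivable with (K * (b - a)) (r / 6); try lra.
  { apply Rmult_le_pos; lra. }
  intros h k Hh Hk.
  assert (H0r : Cmod 0%C < r) by (rewrite Cmod_0; auto).
  replace ((cRI (phi (z + h)) a b - cRI (phi (z + 0)) a b) * k -
           (cRI (phi (z + k)) a b - cRI (phi (z + 0)) a b) * h)%C
    with (cRI (fun x => k * (phi (z + h) x - phi (z + 0) x) - h * (phi (z + k) x - phi (z + 0) x))%C a b).
  2:{ rewrite (cRI_minus (fun x => k * (phi (z + h)%C x - phi (z + 0)%C x))%C
         (fun x => h * (phi (z + k)%C x - phi (z + 0)%C x))%C); auto;
        try (intros; apply rcont_mult; [apply rcont_const|];
             apply rcont_minus; apply Hc; auto; lra).
      rewrite (cRI_scal k (fun x => phi (z + h)%C x - phi (z + 0)%C x)%C),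
        (cRI_scal h (fun x => phi (z + k)%C x - phi (z + 0)%C x)%C); auto;
        try (intros; apply rcont_minus; apply Hc; auto; lra).
      rewrite (cRI_minus (phi (z + h)%C)), (cRI_minus (phi (z + k)%C)); auto;
        try (intros; apply Hc; auto; lra). ring. }
  replace (K * (b - a) * (Cmod h * Cmod k * (Cmod h + Cmod k))) with
    (K * (Cmod h * Cmod k * (Cmod h + Cmod k)) * (b - a)) by ring.
  apply cRI_bound; auto.
  - intros. apply rcont_minus; (apply rcont_mult; [apply rcont_const|]);
      apply rcont_minus; apply Hc; auto; lra.
  - intros x Hx.
    rewrite (Cmult_comm k), (Cmult_comm h).
    apply (SD_holo (fun h => phi (z + h)%C x) r M Hr HM0); auto.
    intros h0 Hh0. apply (Cd_translate_r (fun s => phi s x)). auto.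
Qed.

Lemma rcont_bounded (f : R -> C) a b : a <= b -> (forall x, a <= x <= b -> rcont f x) ->
  exists M, forall x, a <= x <= b -> Cmod (f x) <= M.
Proof.
  intros Hab H. destruct (continuity_ab_maj (fun x => Cmod (f x)) a b Hab) as [m [Hm _]].
  - intros x Hx eps He. destruct (H x Hx eps He) as [d [Hd H1]]. exists d; split; auto.
    intros y [_ Hy]. specialize (H1 y Hy). simpl. unfold Rdist.
    apply Rle_lt_trans with (2 := H1). apply Rabs_le. split.
    + assert (T := Cmod_sub_ge (f x) (f y)). rewrite Cmod_minus_sym in T. lra.
    + apply Cmod_sub_ge.
  - exists (Cmod (f m)). auto.
Qed.

Lemma exp_mult_small kappa eps : 0 < kappa -> 0 < eps -> exists n : nat, exp (- (INR n * kappa)) < eps.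
Proof.
  intros Hk He. destruct (INR_unbounded (/ (eps * kappa))) as [n Hn].
  assert (P : 0 < / (eps * kappa)) by (apply Rinv_0_lt_compat, Rmult_lt_0_compat; auto).
  exists n. rewrite exp_Ropp. assert (L := exp_ineq1_le (INR n * kappa)).
  assert (Q : / eps < INR n * kappa).
  { apply Rmult_lt_compat_r with (r := kappa) in Hn; auto.
    replace (/ (eps * kappa) * kappa) with (/ eps) in Hn by (field; lra). auto. }
  rewrite <- (Rinv_inv eps). apply Rinv_lt_contravar; [|lra].
  apply Rmult_lt_0_compat; [apply Rinv_0_lt_compat; auto|apply exp_pos].
Qed.

(** The kernel [exp (n (exp (mu (z - z0)) - 1))] equals 1 at [z0] and tends to 0 as [n] grows on the
    three sides of the rectangle where the function need not vanish, so that Cauchy's formula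
    gives the value 0 at [z0]. *)
Lemma vanish_left (D : C -> C) (X x0 y0 h : R) : 0 < h -> x0 < X ->
  holoR D (x0 - 1) X (y0 - h) (y0 + h) ->
  (forall y, y0 - h <= y <= y0 + h -> D (cpt X y) = 0%C) -> D (cpt x0 y0) = 0%C.
Proof.
  intros Hh HX HD H0.
  (* With this [mu] the real part of [exp (mu (z - z0))] vanishes on the two horizontal sides. On
     the left side, at distance 1, it is at most [exp (- mu)], whence the decay rate [kap]; on the
     right side [D] is zero. *)
  set (mu := PI / 2 / h). assert (Hpi := PI_RGT_0).
  assert (Hmu : 0 < mu) by (unfold mu; repeat apply div_pos; lra).
  set (z0 := cpt x0 y0).
  set (K := fun (n : nat) z => cexp (RtoC (INR n) * (cexp (RtoC mu * (z - z0)) - 1))%C).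
  assert (HKd : forall n z, Cderivable (K n) z) by (intros; unfold K; cderiv).
  assert (HK1 : forall n, K n z0 = 1%C).
  { intros n. unfold K. replace (mu * (z0 - z0))%C with (RtoC 0) by ring. rewrite cexp_0.
    replace (INR n * (1 - 1))%C with (RtoC 0) by ring. apply cexp_0. }
  assert (HKm : forall n x y, Cmod (K n (cpt x y)) =
     exp (INR n * (exp (mu * (x - x0)) * cos (mu * (y - y0)) - 1))).
  { intros n x y. unfold K. rewrite Cmod_cexp. f_equal.
    rewrite re_scal_l. f_equal.
    replace (mu * (cpt x y - z0))%C with (mu * (x - x0), mu * (y - y0))%R
      by (unfold z0; rewrite !cpt_pair; apply Ceq; unfold Re, Im, RtoC, Cmult, Cminus, Cplus, Copp; simpl; ring).
    unfold cexp, Re, Im; simpl. ring. }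
  set (kap := 1 - exp (- mu)).
  assert (Hem : 0 < exp (- mu) < 1).
  { split; [apply exp_pos|]. rewrite <- exp_0. apply exp_increasing. lra. }
  assert (Hkap : 0 < kap <= 1) by (unfold kap; lra).
  assert (Hcos : cos (mu * h) = 0 /\ cos (mu * - h) = 0).
  { replace (mu * h) with (PI / 2) by (unfold mu; field; lra).
    replace (mu * - h) with (- (PI / 2)) by (unfold mu; field; lra).
    rewrite cos_neg. split; apply cos_PI2. }
  assert (HB : exists M, 0 <= M /\ forall x y, on_bdry (x0 - 1) X (y0 - h) (y0 + h) x y -> Cmod (D (cpt x y)) <= M).
  { destruct (rcont_bounded (fun x => D (cpt x (y0 - h))) (x0 - 1) X) as [M1 H1]; [lra| |].
    { intros; apply rcont_cpt_x, HD; lra. }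
    destruct (rcont_bounded (fun x => D (cpt x (y0 + h))) (x0 - 1) X) as [M2 H2]; [lra| |].
    { intros; apply rcont_cpt_x, HD; lra. }
    destruct (rcont_bounded (fun y => D (cpt (x0 - 1) y)) (y0 - h) (y0 + h)) as [M3 H3]; [lra| |].
    { intros; apply rcont_cpt_y, HD; lra. }
    exists (Rabs M1 + Rabs M2 + Rabs M3).
    assert (A1 := Rle_abs M1). assert (A2 := Rle_abs M2). assert (A3 := Rle_abs M3).
    assert (B1 := Rabs_pos M1). assert (B2 := Rabs_pos M2). assert (B3 := Rabs_pos M3).
    split; [lra|]. intros x y [[Hx Hy] [E|[E|[E|E]]]]; subst.
    - specialize (H3 y Hy). lra.
    - rewrite H0 by auto. rewrite Cmod_0. lra.
    - specialize (H1 x Hx). simpl in H1. lra.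
    - specialize (H2 x Hx). simpl in H2. lra. }
  destruct HB as [M [HM0 HM]].
  set (m := Rmin 1 (Rmin (X - x0) h)).
  assert (Hm : 0 < m) by (unfold m; repeat apply Rmin_pos; lra).
  assert (Hm1 : m <= 1) by apply Rmin_l.
  assert (Hm2 : m <= X - x0) by (eapply Rle_trans; [apply Rmin_r|apply Rmin_l]).
  assert (Hm3 : m <= h) by (eapply Rle_trans; [apply Rmin_r|apply Rmin_r]).
  assert (Hdist : forall x y, on_bdry (x0 - 1) X (y0 - h) (y0 + h) x y -> m <= Cmod (cpt x y - z0)%C).
  { intros x y [[Hx Hy] Hb].
    assert (A := Re_le_Cmod (cpt x y - z0)%C). assert (B := Im_le_Cmod (cpt x y - z0)%C).
    unfold z0 in *. rewrite !cpt_pair in *. unfold Re, Im in A, B; simpl in A, B.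
    destruct Hb as [E|[E|[E|E]]]; subst.
    - rewrite Rabs_left in A by lra. lra.
    - rewrite Rabs_right in A by lra. lra.
    - rewrite Rabs_left in B by lra. lra.
    - rewrite Rabs_right in B by lra. lra. }
  assert (Hper : 0 < 2 * ((X - (x0 - 1)) + ((y0 + h) - (y0 - h)))) by lra.
  set (per := 2 * ((X - (x0 - 1)) + ((y0 + h) - (y0 - h)))) in *.
  assert (HC : forall n, 2 * PI * Cmod (D z0) <= exp (- (INR n * kap)) * M / m * per).
  { intros n. rewrite <- Cmod_2pii, <- Cmod_mult.
    replace (2 * PI * Ci * D z0)%C with (2 * PI * Ci * (D z0 * K n z0))%C by (rewrite HK1; ring).
    rewrite <- (cauchy_formula (fun z => D z * K n z)%C (x0 - 1) X (y0 - h) (y0 + h) z0).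
    - apply rectI_bound; try lra.
      + intros x y Hb. apply Cd_div.
        * apply Cmod_gt_0. specialize (Hdist x y Hb). lra.
        * apply Cd_mult; auto. destruct Hb as [[Hx Hy] _]. apply HD; auto.
        * cderiv.
      + intros x y Hb. specialize (Hdist x y Hb).
        rewrite Cmod_div by (apply Cmod_gt_0; lra). rewrite Cmod_mult, HKm.
        apply Rmult_le_compat; [|left; apply Rinv_0_lt_compat; lra| |apply Rinv_le_contravar; lra].
        { apply Rmult_le_pos; [apply Cmod_ge_0|left; apply exp_pos]. }
        destruct (Req_dec x X) as [E|E].
        { subst. destruct Hb as [[Hx Hy] _]. rewrite H0, Cmod_0 by auto. rewrite Rmult_0_l.
          apply Rmult_le_pos; [left; apply exp_pos|auto]. }
        rewrite Rmult_comm. apply Rmult_le_compat; [left; apply exp_pos|apply Cmod_ge_0| |apply HM; auto].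
        assert (L : exp (mu * (x - x0)) * cos (mu * (y - y0)) <= exp (- mu)).
        { destruct Hb as [[Hx Hy] [F|[F|[F|F]]]]; subst; try lra.
          - replace (mu * (x0 - 1 - x0)) with (- mu) by ring.
            rewrite <- (Rmult_1_r (exp (- mu))) at 2. apply Rmult_le_compat_l; [lra|apply COS_bound].
          - replace (y0 - h - y0) with (- h) by ring. rewrite (proj2 Hcos). lra.
          - replace (y0 + h - y0) with h by ring. rewrite (proj1 Hcos). lra. }
        assert (HnR := pos_INR n).
        destruct (Req_dec (INR n * (exp (mu * (x - x0)) * cos (mu * (y - y0)) - 1)) (- (INR n * kap))) as [F|F].
        { rewrite F; lra. }
        left. apply exp_increasing.
        assert (INR n * (exp (mu * (x - x0)) * cos (mu * (y - y0)) - 1) <= INR n * (- kap))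
          by (apply Rmult_le_compat_l; unfold kap; lra). lra.
    - unfold z0; rewrite Re_cpt; lra.
    - unfold z0; rewrite Im_cpt; lra.
    - intros x y Hx Hy. apply Cd_mult; auto. }
  apply Cmod_eq_0. apply Rle_antisym; [|apply Cmod_ge_0].
  apply le_epsilon. intros eps He. rewrite Rplus_0_l.
  destruct (exp_mult_small kap (eps * m / (M * per + 1))) as [n Hn]; [lra| |].
  { apply div_pos; [nra|]. assert (0 <= M * per) by (apply Rmult_le_pos; lra). lra. }
  specialize (HC n).
  assert (HMp : 0 <= M * per) by (apply Rmult_le_pos; lra).
  assert (Hpi2 : 1 <= 2 * PI) by (assert (Q := PI2_1); lra).
  assert (Hfin : exp (- (INR n * kap)) * M / m * per <= eps).
  { replace (exp (- (INR n * kap)) * M / m * per) with (exp (- (INR n * kap)) * (M * per) / m) by (field; lra).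
    apply Rmult_le_reg_r with m; auto. unfold Rdiv. rewrite Rmult_assoc, Rinv_l, Rmult_1_r by lra.
    apply Rle_mult_eps; auto; [nra|apply exp_pos|]. lra. }
  assert (Z := Cmod_ge_0 (D z0)). nra.
Qed.

(** * Uniqueness of the continuation from [Re s > N] to the complement of [P_N] *)

Lemma PN_real N s : PN N s -> Im s = 0 /\ Re s <= INR N.
Proof.
  intros [k [[H1 H2] ->]]. split; [reflexivity|]. simpl. apply le_INR; auto.
Qed.

Lemma PN_isolated N s : exists d, 0 < d /\ forall u, Cmod (u - s)%C < d -> u <> s -> ~ PN N u.
Proof.
  induction N as [|N [d [Hd H]]].
  - exists 1. split; [lra|]. intros u _ _ [k [[H1 H2] _]]. lia.
  - destruct (Ceq_dec s (RtoC (INR (S N)))) as [E|E].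
    + exists d. split; auto. intros u Hu Hne [k [[H1 H2] Hk]].
      destruct (Nat.eq_dec k (S N)) as [F|F]; [subst; auto|].
      apply (H u Hu Hne). exists k. split; [split; lia|auto].
    + set (e := Cmod (RtoC (INR (S N)) - s)%C).
      assert (He : 0 < e).
      { apply Cmod_gt_0. intros Q. apply E. symmetry. apply Ceq_minus; auto. }
      exists (Rmin d e). split; [apply Rmin_pos; auto|]. intros u Hu Hne [k [[H1 H2] Hk]].
      destruct (Nat.eq_dec k (S N)) as [F|F].
      * subst. assert (A := Rlt_le_trans _ _ _ Hu (Rmin_r _ _)). unfold e in A. lra.
      * apply (H u (Rlt_le_trans _ _ _ Hu (Rmin_l _ _)) Hne). exists k. split; [split; lia|auto].
Qed.

(** [P_N] is real, so for a nonreal [s] the horizontal strip of half height [|Im s| / 2] around it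
    avoids [P_N], and [vanish_left] moves from [Re s > N] to [s]. The remaining real points are
    limits of the nonreal points [s + i d / 2]. *)
Lemma continuation_unique N (f g : C -> C) :
  (forall s, ~ PN N s -> Cderivable f s) -> (forall s, ~ PN N s -> Cderivable g s) ->
  (forall s, INR N < Re s -> f s = g s) -> forall s, ~ PN N s -> f s = g s.
Proof.
  intros Hf Hg E.
  assert (HD : forall s, ~ PN N s -> Cderivable (fun s => f s - g s)%C s)
    by (intros; apply Cd_minus; auto).
  assert (Hoff : forall s, Im s <> 0 -> f s = g s).
  { intros s Hs. destruct (Rlt_dec (INR N) (Re s)) as [L|L]; [auto|].
    apply Ceq_minus. rewrite <- (cpt_ReIm s) at 1 2.
    apply (vanish_left (fun s => f s - g s)%C (INR N + 1) (Re s) (Im s) (Rabs (Im s) / 2)); try lra.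
    - assert (P := Rabs_pos_lt _ Hs). lra.
    - intros x y Hx Hy. apply HD. intros Q. apply PN_real in Q. rewrite Im_cpt in Q.
      destruct Q as [Q _]. subst y. destruct (Rle_dec 0 (Im s)).
      + rewrite Rabs_right in Hy by lra. lra.
      + rewrite Rabs_left in Hy by lra. lra.
    - intros y Hy. rewrite E; [ring|]. rewrite Re_cpt. lra. }
  intros s Hs. destruct (Req_dec (Im s) 0) as [Z|Z]; [|auto].
  apply Cmod_zero_eq. intros eps He.
  destruct (Cd_cont _ _ (HD s Hs) eps He) as [d [Hd H]].
  specialize (H (s + Ci * RtoC (d / 2))%C).
  replace (s + Ci * (d / 2)%R - s)%C with (Ci * RtoC (d / 2))%C in H by ring.
  rewrite Cmod_mult, Cmod_Ci, Cmod_R, Rabs_right in H by lra.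
  specialize (H ltac:(lra)).
  rewrite (Hoff (s + Ci * RtoC (d / 2))%C) in H.
  - replace (g (s + Ci * (d / 2)%R) - g (s + Ci * (d / 2)%R) - (f s - g s))%C with (- (f s - g s))%C in H by ring.
    rewrite Cmod_opp in H. auto.
  - destruct s as [x y]; unfold Im in *; simpl in *. lra.
Qed.

(** * Joint holomorphy from boundedness and holomorphy along lines *)

Definition rsum (n : nat) (f : nat -> R) : R := fold_right Rplus 0 (map f (seq 0 n)).

Lemma fold_Rplus_app l l' : fold_right Rplus 0 (l ++ l') = fold_right Rplus 0 l + fold_right Rplus 0 l'.
Proof. induction l as [|x l IH]; simpl; [lra|rewrite IH; lra]. Qed.

Lemma fold_Cplus_app (l l' : list C) :
  fold_right Cplus (RtoC 0) (l ++ l') = (fold_right Cplus (RtoC 0) l + fold_right Cplus (RtoC 0) l')%C.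
Proof. induction l as [|x l IH]; simpl; [ring|rewrite IH; ring]. Qed.

Lemma rsum_S n f : rsum (S n) f = rsum n f + f n.
Proof. unfold rsum. rewrite seq_S, map_app, fold_Rplus_app. simpl. lra. Qed.

Lemma csum0_S n f : csum0 (S n) f = (csum0 n f + f n)%C.
Proof. unfold csum0. rewrite seq_S, map_app, fold_Cplus_app. simpl. ring. Qed.

Lemma rsum_nonneg n f : (forall j, (j < n)%nat -> 0 <= f j) -> 0 <= rsum n f.
Proof.
  induction n as [|n IH]; intros H; [unfold rsum; simpl; lra|]. rewrite rsum_S.
  assert (0 <= rsum n f) by auto. assert (0 <= f n) by auto. lra.
Qed.

Lemma rsum_mono n m f : (forall j, 0 <= f j) -> (n <= m)%nat -> rsum n f <= rsum m f.
Proof. intros H L. induction L; [lra|]. rewrite rsum_S. specialize (H m). lra. Qed.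

Lemma rsum_term n j f : (forall j, 0 <= f j) -> (j < n)%nat -> f j <= rsum n f.
Proof.
  intros H L. apply Rle_trans with (rsum (S j) f).
  - rewrite rsum_S. assert (0 <= rsum j f) by (apply rsum_nonneg; auto). lra.
  - apply rsum_mono; auto.
Qed.

Lemma rsum_le_const n f M : (forall j, (j < n)%nat -> f j <= M) -> rsum n f <= INR n * M.
Proof.
  induction n as [|n IH]; intros H; [unfold rsum; simpl; lra|]. rewrite rsum_S, S_INR.
  assert (rsum n f <= INR n * M) by auto. assert (f n <= M) by auto. lra.
Qed.

Definition supp (n : nat) (h : nat -> C) : Prop := forall j, (n <= j)%nat -> h j = RtoC 0.

Section Osgood.
Variables (n : nat) (f : (nat -> C) -> C) (z : nat -> C) (r M : R).
Hypothesis Hr : 0 < r.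
Hypothesis HM : forall h, supp n h -> (forall j, (j < n)%nat -> Cmod (h j) < r) ->
  Cmod (f (fun j => z j + h j)%C) <= M.
Hypothesis HD : forall p v, supp n p -> supp n v -> (forall j, (j < n)%nat -> Cmod (p j) < r) ->
  Cderivable (fun t => f (fun j => z j + (p j + t * v j))%C) 0%C.

Let e (k : nat) : nat -> C := fun j => if Nat.eqb j k then RtoC 1 else RtoC 0.
(** [trunc k h] keeps the coordinates of index below [k]: the increment of [f] is telescoped along
    the path through these truncations. *)
Let trunc (k : nat) (h : nat -> C) : nat -> C := fun j => if Nat.ltb j k then h j else RtoC 0.

Lemma osgood_M_pos : 0 <= M.
Proof.
  eapply Rle_trans; [apply Cmod_ge_0|apply (HM (fun _ => RtoC 0))].
  - intros j _; auto.
  - intros j _; rewrite Cmod_0; auto.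
Qed.

Lemma osgood_line p v t : supp n p -> supp n v -> (forall j, (j < n)%nat -> Cmod (p j + t * v j)%C < r) ->
  Cderivable (fun t => f (fun j => z j + (p j + t * v j))%C) t.
Proof.
  intros Hp Hv H. apply Cd_translate.
  apply Cd_ext with (f := fun h => f (fun j => z j + ((p j + t * v j) + h * v j))%C).
  { intros u. f_equal. apply functional_extensionality; intros j. ring. }
  apply HD; auto. intros j Hj. rewrite Hp, Hv by auto. ring.
Qed.

Lemma supp_e k : (k < n)%nat -> supp n (e k).
Proof. intros H j Hj. unfold e. destruct (Nat.eqb_spec j k); [lia|auto]. Qed.

Lemma supp_trunc k h : supp n h -> supp n (trunc k h).
Proof. intros H j Hj. unfold trunc. rewrite H by auto. destruct (Nat.ltb j k); auto. Qed.

Lemma osgood_coef k : (k < n)%nat -> exists c, forall t, Cmod t <= r / 6 ->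
  Cmod (f (fun j => z j + t * e k j)%C - f z - c * t)%C <= 144 * M / (r * r) * (Cmod t * Cmod t).
Proof.
  intros Hk. assert (HM0 := osgood_M_pos).
  set (g := fun t => f (fun j => z j + (0 + t * e k j))%C).
  assert (Hin : forall t j, Cmod t < r -> Cmod (0 + t * e k j)%C < r).
  { intros t j Ht. unfold e. destruct (Nat.eqb j k).
    - replace (0 + t * 1)%C with t by ring; auto.
    - replace (0 + t * 0)%C with (RtoC 0) by ring. rewrite Cmod_0; auto. }
  assert (Hs := supp_e k Hk).
  assert (Hsq : forall x y, - (r / 3) <= x <= r / 3 -> - (r / 3) <= y <= r / 3 -> Cmod (cpt x y) < r).
  { intros x y H1 H2. eapply Rle_lt_trans; [apply Cmod_le_ReIm|]. rewrite Re_cpt, Im_cpt.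
    assert (Rabs x <= r / 3) by (apply Rabs_le; lra).
    assert (Rabs y <= r / 3) by (apply Rabs_le; lra). lra. }
  destruct (cauchy_taylor g (r / 3) M) as [c [_ Hc]]; try lra.
  - intros x y H1 H2. apply (osgood_line (fun _ => RtoC 0) (e k)); auto. intros j _; auto.
  - intros x y H1 H2. apply HM; auto. intros j Hj. rewrite Hs by auto. ring.
  - exists c. intros t Ht. specialize (Hc t ltac:(lra)).
    replace (16 * M / (r / 3 * (r / 3))) with (144 * M / (r * r)) in Hc by (field; lra).
    unfold g in Hc.
    replace (fun j => (z j + (0 + t * e k j))%C) with (fun j => (z j + t * e k j)%C) in Hc
      by (apply functional_extensionality; intros; ring).
    replace (fun j => (z j + (0 + 0 * e k j))%C) with z in Hc
      by (apply functional_extensionality; intros; ring).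
    exact Hc.
Qed.

(** A mixed second difference is of second order. The Lipschitz estimate along [v] is applied on a
    disc of radius [r / (2 S)], which gives a bound of order [S]; the resulting function of the
    coordinate [k] is holomorphic, and a second Lipschitz estimate gives the factor [|h k|]. *)
Lemma osgood_mixed k h S : (k < n)%nat -> supp n h -> 0 < S -> S <= r / 24 ->
  (forall j, (j < n)%nat -> Cmod (h j) <= S) ->
  Cmod (f (fun j => z j + trunc (Datatypes.S k) h j) - f (fun j => z j + trunc k h j)
        - (f (fun j => z j + h k * e k j) - f z))%C
    <= 18432 * M / (r * r) * S * Cmod (h k).
Proof.
  intros Hk Hh HS HSr Hb. assert (HM0 := osgood_M_pos).
  set (v := trunc k h).
  assert (Hv := supp_trunc k h Hh : supp n v). assert (He := supp_e k Hk).
  assert (Hvb : forall j, (j < n)%nat -> Cmod (v j) <= S).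
  { intros j Hj. unfold v, trunc. destruct (Nat.ltb j k); auto. rewrite Cmod_0; lra. }
  assert (Heb : forall j, Cmod (e k j) <= 1).
  { intros j. unfold e. destruct (Nat.eqb j k); [rewrite Cmod_1|rewrite Cmod_0]; lra. }
  assert (Hin : forall tau sig j, (j < n)%nat -> Cmod tau * S < r / 2 -> Cmod sig < r / 2 ->
     Cmod (sig * e k j + tau * v j)%C < r).
  { intros tau sig j Hj H1 H2. eapply Rle_lt_trans; [apply Cmod_triangle|]. rewrite !Cmod_mult.
    specialize (Hvb j Hj). specialize (Heb j).
    assert (P1 := Cmod_ge_0 tau). assert (P2 := Cmod_ge_0 sig). nra. }
  assert (Hse : forall (c : C), supp n (fun j => c * e k j)%C).
  { intros c j Hj. rewrite He by auto. ring. }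
  assert (Lip : forall sig, Cmod sig < r / 2 ->
     Cmod (f (fun j => z j + (sig * e k j + 1 * v j)) - f (fun j => z j + (sig * e k j + 0 * v j)))%C
       <= 96 * M / r * S).
  { intros sig Hsig.
    assert (L := holo_lipschitz (fun tau => f (fun j => z j + (sig * e k j + tau * v j))%C) (r / (2 * S)) M).
    assert (E : r / (2 * S) * S = r / 2) by (field; lra).
    replace (96 * M / r * S) with (48 * M / (r / (2 * S)) * Cmod 1)
      by (rewrite Cmod_1; field; lra).
    apply L; auto.
    - apply div_pos; lra.
    - intros tau Ht. apply osgood_line; auto. intros j Hj. apply Hin; auto.
      apply Rmult_lt_compat_r with (r := S) in Ht; auto. lra.
    - intros tau Ht. apply HM.
      + intros j Hj. rewrite He, Hv by auto. ring.
      + intros j Hj. apply Hin; auto.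
        apply Rmult_lt_compat_r with (r := S) in Ht; auto. lra.
    - rewrite Cmod_1. apply Rmult_le_reg_r with S; auto.
      replace (r / (2 * S) / 6 * S) with (r / 12) by (field; lra). lra. }
  set (H := fun sig => (f (fun j => z j + (1 * v j + sig * e k j)) - f (fun j => z j + (0 + sig * e k j)))%C).
  assert (L := holo_lipschitz H (r / 2) (96 * M / r * S)).
  assert (HK0 : 0 <= 96 * M / r * S).
  { apply Rmult_le_pos; [|lra]. apply Rmult_le_pos; [lra|]. left; apply Rinv_0_lt_compat; auto. }
  assert (S1 : Cmod 1 * S < r / 2) by (rewrite Cmod_1; lra).
  specialize (L ltac:(lra) HK0).
  assert (L1 : forall h0, Cmod h0 < r / 2 -> Cderivable H h0).
  { intros sig Hsig. apply Cd_minus.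
    - apply (osgood_line (fun j => 1 * v j)%C (e k)); auto.
      + intros j Hj. rewrite Hv by auto. ring.
      + intros j Hj. rewrite Cplus_comm. apply Hin; auto.
    - apply (osgood_line (fun _ => RtoC 0) (e k)); auto.
      + intros j Hj; auto.
      + intros j Hj. replace (0 + sig * e k j)%C with (sig * e k j + 0 * v j)%C by ring. apply Hin; auto.
        rewrite Cmod_0; lra. }
  assert (L2 : forall h0, Cmod h0 < r / 2 -> Cmod (H h0) <= 96 * M / r * S).
  { intros sig Hsig. specialize (Lip sig Hsig). unfold H.
    replace (fun j => (z j + (1 * v j + sig * e k j))%C) with (fun j => (z j + (sig * e k j + 1 * v j))%C)
      by (apply functional_extensionality; intros; ring).
    replace (fun j => (z j + (0 + sig * e k j))%C) with (fun j => (z j + (sig * e k j + 0 * v j))%C)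
      by (apply functional_extensionality; intros; ring).
    exact Lip. }
  specialize (L L1 L2 (h k)).
  assert (Hhk : Cmod (h k) <= r / 2 / 6) by (specialize (Hb k Hk); lra).
  specialize (L Hhk). unfold H in L.
  replace (fun j => (z j + (1 * v j + h k * e k j))%C) with (fun j => (z j + trunc (Datatypes.S k) h j)%C) in L.
  2:{ apply functional_extensionality; intros j. f_equal. unfold v, trunc, e.
      destruct (Nat.ltb_spec j k), (Nat.ltb_spec j (Datatypes.S k)), (Nat.eqb_spec j k); try lia; subst; ring. }
  replace (fun j => (z j + (1 * v j + 0 * e k j))%C) with (fun j => (z j + v j)%C) in L
    by (apply functional_extensionality; intros; ring).
  replace (fun j => (z j + (0 + h k * e k j))%C) with (fun j => (z j + h k * e k j)%C) in L
    by (apply functional_extensionality; intros; ring).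
  replace (fun j => (z j + (0 + 0 * e k j))%C) with z in L
    by (apply functional_extensionality; intros; ring).
  match goal with |- Cmod ?a <= _ => match type of L with Cmod ?b <= _ => replace a with b by ring end end.
  eapply Rle_trans; [exact L|].
  apply Rmult_le_compat_r; [apply Cmod_ge_0|].
  replace (48 * (96 * M / r * S) / (r / 2)) with (9216 * M / (r * r) * S) by (field; lra).
  apply Rmult_le_compat_r; [lra|]. apply Rmult_le_compat_r; [left; apply Rinv_0_lt_compat; nra|lra].
Qed.

(** Changing one coordinate at a time, each increment is the increment at [z] itself plus a mixed
    difference. The former is linear up to a quadratic error by [osgood_coef], the latter is small
    by [osgood_mixed]. *)
Lemma osgood : exists c : nat -> C, forall eta : R, 0 < eta ->
    exists delta : R, 0 < delta /\
    forall h : nat -> C, (forall j, (n <= j)%nat -> h j = RtoC 0) ->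
      (forall j, (j < n)%nat -> Cmod (h j) < delta) ->
      Cmod (f (fun j => z j + h j)%C - f z - csum0 n (fun j => c j * h j)%C)%C
        <= eta * fold_right Rplus 0 (map (fun j => Cmod (h j)) (seq 0 n)).
Proof.
  assert (HM0 := osgood_M_pos).
  set (P := fun k c => forall t, Cmod t <= r / 6 ->
    Cmod (f (fun j => z j + t * e k j)%C - f z - c * t)%C <= 144 * M / (r * r) * (Cmod t * Cmod t)).
  set (c := fun k => epsilon (inhabits (RtoC 0)) (P k)).
  assert (Hc : forall k, (k < n)%nat -> P k (c k)).
  { intros k Hk. apply epsilon_spec. apply osgood_coef; auto. }
  exists c. intros eta Heta.
  (* A round number above [18432 + 144], the constants of the mixed differences and of the
     one-variable remainders. *)
  set (K := 20000 * M / (r * r)).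
  assert (Hrr : 0 < / (r * r)) by (apply Rinv_0_lt_compat; nra).
  assert (HK : 0 <= K) by (apply Rmult_le_pos; lra).
  set (nn := INR n + 1). assert (Hnn : 1 <= nn) by (unfold nn; assert (Z := pos_INR n); lra).
  exists (Rmin (r / 24 / nn) (eta / (K + 1) / nn)). split.
  { apply Rmin_pos; repeat apply div_pos; lra. }
  intros h Hh Hd. fold (rsum n (fun j => Cmod (h j))).
  set (S := rsum n (fun j => Cmod (h j))).
  assert (Hpos : forall j, 0 <= Cmod (h j)) by (intros; apply Cmod_ge_0).
  assert (HS0 : 0 <= S) by (apply rsum_nonneg; auto).
  assert (Hb : forall j, (j < n)%nat -> Cmod (h j) <= S) by (intros j Hj; apply (rsum_term n j (fun j => Cmod (h j))); auto).
  assert (HSm : S <= nn * Rmin (r / 24 / nn) (eta / (K + 1) / nn)).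
  { assert (Q : 0 < Rmin (r / 24 / nn) (eta / (K + 1) / nn)) by (apply Rmin_pos; repeat apply div_pos; lra).
    apply Rle_trans with (INR n * Rmin (r / 24 / nn) (eta / (K + 1) / nn)); [|unfold nn in *; nra].
    apply rsum_le_const. intros j Hj. left. auto. }
  assert (HS1 : S <= r / 24).
  { eapply Rle_trans; [exact HSm|]. apply Rle_trans with (nn * (r / 24 / nn)); [|right; field; lra].
    apply Rmult_le_compat_l; [lra|apply Rmin_l]. }
  assert (HS2 : S <= eta / (K + 1)).
  { eapply Rle_trans; [exact HSm|]. apply Rle_trans with (nn * (eta / (K + 1) / nn)); [|right; field; lra].
    apply Rmult_le_compat_l; [lra|apply Rmin_r]. }
  assert (Etr : forall h', trunc 0 h' = fun _ => RtoC 0) by reflexivity.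
  assert (Ez : (fun j => (z j + trunc 0 h j)%C) = z)
    by (apply functional_extensionality; intros; rewrite Etr; ring).
  assert (En : (fun j => (z j + h j)%C) = (fun j => (z j + trunc n h j)%C)).
  { apply functional_extensionality; intros j. f_equal. unfold trunc.
    destruct (Nat.ltb_spec j n); auto. }
  (* The case [S = 0] is separated because [osgood_mixed] divides by [S]; then all increments
     vanish. *)
  destruct HS0 as [HS0|HS0].
  2:{ replace (fun j => (z j + h j)%C) with z.
      2:{ apply functional_extensionality; intros j.
          destruct (Nat.lt_ge_cases j n) as [L|L].
          - assert (Q : h j = 0%C) by (apply Cmod_eq_0; specialize (Hb j L); specialize (Hpos j); lra).
            rewrite Q. ring.
          - rewrite Hh by auto. ring. }
      assert (Q : forall k, (k <= n)%nat -> csum0 k (fun j => c j * h j)%C = 0%C).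
      { induction k as [|k IH]; intros Hk; [reflexivity|]. rewrite csum0_S, IH by lia.
        replace (h k) with (RtoC 0); [ring|]. symmetry. apply Cmod_eq_0.
        specialize (Hb k ltac:(lia)). specialize (Hpos k). lra. }
      rewrite Q by lia. replace (f z - f z - 0)%C with (RtoC 0) by ring. rewrite Cmod_0, <- HS0. lra. }
  assert (Main : forall k, (k <= n)%nat ->
     Cmod (f (fun j => z j + trunc k h j) - f z - csum0 k (fun j => c j * h j))%C
       <= K * S * rsum k (fun j => Cmod (h j))).
  { induction k as [|k IH]; intros Hk.
    - rewrite Ez. unfold csum0, rsum; simpl. replace (f z - f z - 0)%C with (RtoC 0) by ring.
      rewrite Cmod_0. lra.
    - specialize (IH ltac:(lia)). rewrite csum0_S, rsum_S.
      assert (A := osgood_mixed k h S ltac:(lia) Hh HS0 HS1 Hb).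
      assert (Hhk : Cmod (h k) <= S) by (apply Hb; lia).
      assert (B := Hc k ltac:(lia) (h k) ltac:(lra)).
      match goal with |- Cmod ?a <= _ => replace a with
        ((f (fun j => z j + trunc k h j)%C - f z - csum0 k (fun j => c j * h j)%C) +
         ((f (fun j => z j + trunc (Datatypes.S k) h j) - f (fun j => z j + trunc k h j)
        - (f (fun j => z j + h k * e k j) - f z)) +
         (f (fun j => z j + h k * e k j) - f z - c k * h k)))%C by ring end.
      eapply Rle_trans; [apply Cmod_triangle|]. rewrite Rmult_plus_distr_l.
      apply Rplus_le_compat; auto.
      eapply Rle_trans; [apply Cmod_triangle|].
      apply Rle_trans with (18432 * M / (r * r) * S * Cmod (h k) + 144 * M / (r * r) * S * Cmod (h k)).
      + apply Rplus_le_compat; auto. eapply Rle_trans; [exact B|].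
        rewrite Rmult_assoc. apply Rmult_le_compat_l; [apply Rmult_le_pos; lra|].
        apply Rmult_le_compat_r; auto.
      + unfold K, Rdiv. specialize (Hpos k).
        assert (0 <= M * / (r * r) * (S * Cmod (h k))) by (repeat apply Rmult_le_pos; lra). lra. }
  rewrite En. eapply Rle_trans; [apply Main; auto|]. fold S.
  apply Rmult_le_compat_r; [lra|]. rewrite Rmult_comm. apply Rle_mult_eps; auto.
Qed.
End Osgood.

(** * Improper integrals of exponentially decaying functions *)

Lemma exp_le_mono x y : x <= y -> exp x <= exp y.
Proof. intros [L| ->]; [left; apply exp_increasing; auto|lra]. Qed.

Lemma exp_small tau eps : 0 < tau -> 0 < eps -> exists X, 0 <= X /\ forall Y, X <= Y -> exp (- (tau * Y)) < eps.
Proof.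
  intros Ht He. destruct (exp_mult_small tau eps Ht He) as [n Hn].
  exists (INR n). split; [apply pos_INR|]. intros Y HY.
  eapply Rle_lt_trans; [|exact Hn]. apply exp_le_mono. nra.
Qed.

Lemma INR_ge (X : R) : exists n0, forall n, (n0 <= n)%nat -> X <= INR n.
Proof.
  destruct (INR_unbounded X) as [n Hn]. exists n. intros m Hm. apply le_INR in Hm. lra.
Qed.

Definition dom (f : R -> C) (K tau : R) : Prop := forall x, Cmod (f x) <= K * exp (- (tau * Rabs x)).

Lemma is_RInt_exp k a b : k <> 0 -> is_RInt (fun x => exp (k * x)) a b ((exp (k * b) - exp (k * a)) / k).
Proof.
  intros Hk.
  replace ((exp (k * b) - exp (k * a)) / k) with (minus (exp (k * b) / k) (exp (k * a) / k))
    by (unfold minus, plus, opp; simpl; field; auto).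
  apply (is_RInt_derive (fun x => exp (k * x) / k)).
  - intros x _. auto_derive; auto. field; auto.
  - intros x _. apply (ex_derive_continuous (fun x => exp (k * x))). auto_derive; auto.
Qed.

Lemma cRI_tail_right f K tau a b : 0 < tau -> 0 <= K -> a <= b -> (forall x, a <= x <= b -> rcont f x) ->
  (forall x, a <= x <= b -> Cmod (f x) <= K * exp (- (tau * x))) ->
  Cmod (cRI f a b) <= K / tau * exp (- (tau * a)).
Proof.
  intros Ht HK Hab Hc Hb.
  apply Rle_trans with (K * ((exp (- tau * b) - exp (- tau * a)) / (- tau))).
  - apply (cRI_bound_fun f (fun x => K * exp (- tau * x))); auto.
    + intros x Hx. replace (- tau * x) with (- (tau * x)) by ring. auto.
    + apply (is_RInt_scal (V := R_NormedModule) (fun x => exp (- tau * x)) a b K).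
      apply is_RInt_exp. lra.
  - replace (- tau * a) with (- (tau * a)) by ring.
    replace (K * ((exp (- tau * b) - exp (- (tau * a))) / - tau)) with
      (K / tau * exp (- (tau * a)) - K / tau * exp (- tau * b)) by (field; lra).
    assert (0 <= K / tau * exp (- tau * b)); [|lra].
    apply Rmult_le_pos; [|left; apply exp_pos].
    apply Rmult_le_pos; auto. left; apply Rinv_0_lt_compat; auto.
Qed.

Lemma cRI_tail_left f K tau a b : 0 < tau -> 0 <= K -> a <= b -> (forall x, a <= x <= b -> rcont f x) ->
  (forall x, a <= x <= b -> Cmod (f x) <= K * exp (tau * x)) ->
  Cmod (cRI f a b) <= K / tau * exp (tau * b).
Proof.
  intros Ht HK Hab Hc Hb.
  apply Rle_trans with (K * ((exp (tau * b) - exp (tau * a)) / tau)).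
  - apply (cRI_bound_fun f (fun x => K * exp (tau * x))); auto.
    apply (is_RInt_scal (V := R_NormedModule) (fun x => exp (tau * x)) a b K).
    apply is_RInt_exp. lra.
  - replace (K * ((exp (tau * b) - exp (tau * a)) / tau)) with
      (K / tau * exp (tau * b) - K / tau * exp (tau * a)) by (field; lra).
    assert (0 <= K / tau * exp (tau * a)); [|lra].
    apply Rmult_le_pos; [|left; apply exp_pos].
    apply Rmult_le_pos; auto. left; apply Rinv_0_lt_compat; auto.
Qed.

Lemma dom_K_pos f K tau : dom f K tau -> 0 <= K.
Proof.
  intros H. specialize (H 0). rewrite Rabs_R0, Rmult_0_r, Ropp_0, exp_0, Rmult_1_r in H.
  eapply Rle_trans; [apply Cmod_ge_0|exact H].
Qed.

Lemma dom_pos f K tau x : dom f K tau -> 0 <= x -> Cmod (f x) <= K * exp (- (tau * x)).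
Proof. intros H Hx. specialize (H x). rewrite Rabs_right in H by lra. exact H. Qed.

Lemma dom_neg f K tau x : dom f K tau -> x <= 0 -> Cmod (f x) <= K * exp (tau * x).
Proof.
  intros H Hx. specialize (H x). rewrite Rabs_left1 in H by lra.
  replace (- (tau * - x)) with (tau * x) in H by ring. exact H.
Qed.

Lemma cRI_dom_diff f K tau A B A' B' : 0 < tau -> (forall x, rcont f x) -> dom f K tau ->
  0 <= A <= A' -> 0 <= B <= B' ->
  Cmod (cRI f (- A') B' - cRI f (- A) B)%C <= K / tau * (exp (- (tau * A)) + exp (- (tau * B))).
Proof.
  intros Ht Hc Hd HA HB. assert (HK := dom_K_pos _ _ _ Hd).
  rewrite (cRI_chasles f (- A') (- A) B') by (auto; lra).
  rewrite (cRI_chasles f (- A) B B') by (auto; lra).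
  replace (cRI f (- A') (- A) + (cRI f (- A) B + cRI f B B') - cRI f (- A) B)%C
    with (cRI f (- A') (- A) + cRI f B B')%C by ring.
  eapply Rle_trans; [apply Cmod_triangle|]. rewrite Rmult_plus_distr_l.
  apply Rplus_le_compat.
  - replace (- (tau * A)) with (tau * - A) by ring. apply cRI_tail_left; auto; try lra.
    intros x Hx. apply dom_neg; auto; lra.
  - apply cRI_tail_right; auto; try lra. intros x Hx. apply dom_pos; auto; lra.
Qed.

(** A limit over symmetric integer intervals. For the exponentially dominated functions used below
    it agrees with the limit over arbitrary intervals, which is [LI_limit]. *)
Definition isLI (f : R -> C) (l : C) : Prop := clim (fun n => cRI f (- INR n) (INR n)) l.
Definition LI (f : R -> C) : C := epsilon (inhabits (RtoC 0)) (isLI f).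

Lemma LI_unique f l : isLI f l -> LI f = l.
Proof.
  intros H. assert (H' : isLI f (LI f)) by (apply (epsilon_spec (inhabits (RtoC 0)) (isLI f)); eauto).
  exact (clim_unique _ _ _ H' H).
Qed.

Lemma LI_correct f K tau : 0 < tau -> (forall x, rcont f x) -> dom f K tau -> isLI f (LI f).
Proof.
  intros Ht Hc Hd. apply (epsilon_spec (inhabits (RtoC 0)) (isLI f)). apply clim_cauchy. intros eps He.
  assert (HK := dom_K_pos _ _ _ Hd).
  assert (HKt : 0 <= K / tau) by (apply Rmult_le_pos; [auto|left; apply Rinv_0_lt_compat; auto]).
  destruct (exp_small tau (eps / (K / tau + 1) / 2)) as [X [HX0 HX]]; auto.
  { repeat apply div_pos; lra. }
  destruct (INR_ge X) as [n0 Hn0]. exists n0.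
  assert (W : forall n m, (n0 <= n)%nat -> (n <= m)%nat ->
    Cmod (cRI f (- INR m) (INR m) - cRI f (- INR n) (INR n))%C < eps).
  { intros n m Hn Hm. assert (P := pos_INR n). apply le_INR in Hm.
    eapply Rle_lt_trans; [apply (cRI_dom_diff f K tau); auto; lra|].
    specialize (HX (INR n) (Hn0 n Hn)).
    set (E := exp (- (tau * INR n))) in *. set (q := K / tau) in *.
    apply Rlt_le_trans with ((q + 1) * (eps / (q + 1))); [|right; field; lra].
    assert (0 < E) by apply exp_pos. nra. }
  intros n m Hn Hm. destruct (Nat.le_gt_cases n m).
  - rewrite Cmod_minus_sym. apply W; auto.
  - apply W; auto; lia.
Qed.

Lemma LI_approx f K tau A B : 0 < tau -> (forall x, rcont f x) -> dom f K tau -> 0 <= A -> 0 <= B ->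
  Cmod (LI f - cRI f (- A) B)%C <= K / tau * (exp (- (tau * A)) + exp (- (tau * B))).
Proof.
  intros Ht Hc Hd HA HB.
  apply clim_le with (u := fun n => (cRI f (- INR n) (INR n) - cRI f (- A) B)%C).
  - apply (clim_plus (fun n => cRI f (- INR n) (INR n)) (fun _ => (- cRI f (- A) B)%C)).
    + apply (LI_correct f K tau); auto.
    + apply clim_const.
  - destruct (INR_ge (Rmax A B)) as [n0 H0]. exists n0. intros n Hn. specialize (H0 n Hn).
    assert (M1 := Rmax_l A B). assert (M2 := Rmax_r A B).
    apply cRI_dom_diff; auto; lra.
Qed.

Lemma LI_bound f K tau : 0 < tau -> (forall x, rcont f x) -> dom f K tau -> Cmod (LI f) <= 2 * K / tau.
Proof.
  intros Ht Hc Hd.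
  assert (H := LI_approx f K tau 0 0 Ht Hc Hd (Rle_refl 0) (Rle_refl 0)).
  rewrite Ropp_0, cRI_point, Rmult_0_r, Ropp_0, exp_0 in H.
  replace (LI f - 0)%C with (LI f) in H by ring. lra.
Qed.

Lemma isLI_plus f g a b : (forall x, rcont f x) -> (forall x, rcont g x) -> isLI f a -> isLI g b ->
  isLI (fun x => f x + g x)%C (a + b)%C.
Proof.
  intros Hf Hg Ha Hb. eapply clim_ext; [|exact (clim_plus _ _ _ _ Ha Hb)].
  intros n. assert (P := pos_INR n). simpl. rewrite cRI_plus; auto. lra.
Qed.

Lemma isLI_scal c f a : (forall x, rcont f x) -> isLI f a -> isLI (fun x => c * f x)%C (c * a)%C.
Proof.
  intros Hf Ha. eapply clim_ext; [|exact (clim_scal c _ _ Ha)].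
  intros n. assert (P := pos_INR n). simpl. rewrite cRI_scal; auto. lra.
Qed.

Lemma isLI_ext f g a : (forall x, f x = g x) -> isLI f a -> isLI g a.
Proof. intros E. replace g with f; auto. apply functional_extensionality; auto. Qed.

Lemma LI_limit f K tau : 0 < tau -> (forall x, rcont f x) -> dom f K tau ->
  forall eps, 0 < eps -> exists X, 0 <= X /\ forall A B, X <= A -> X <= B -> Cmod (cRI f (- A) B - LI f)%C < eps.
Proof.
  intros Ht Hc Hd eps He. assert (HK := dom_K_pos _ _ _ Hd).
  assert (HKt : 0 <= K / tau) by (apply Rmult_le_pos; [auto|left; apply Rinv_0_lt_compat; auto]).
  destruct (exp_small tau (eps / (K / tau + 1) / 2)) as [X [HX0 HX]]; auto.
  { repeat apply div_pos; lra. }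
  exists X. split; auto. intros A B HA HB. rewrite Cmod_minus_sym.
  eapply Rle_lt_trans; [apply (LI_approx f K tau); auto; lra|].
  assert (E1 := HX A HA). assert (E2 := HX B HB).
  set (q := K / tau) in *. assert (P1 := exp_pos (- (tau * A))). assert (P2 := exp_pos (- (tau * B))).
  apply Rlt_le_trans with ((q + 1) * (eps / (q + 1))); [|right; field; lra]. nra.
Qed.

Lemma LI_shift f K tau v : 0 < tau -> (forall x, rcont f x) -> dom f K tau ->
  isLI (fun x => f (x + v)) (LI f).
Proof.
  intros Ht Hc Hd eps He. destruct (LI_limit f K tau Ht Hc Hd eps He) as [X [HX0 HX]].
  destruct (INR_ge (X + Rabs v)) as [n0 H0]. exists n0. intros n Hn. specialize (H0 n Hn).
  assert (A := Rle_abs v). assert (B := Rle_abs (- v)). rewrite Rabs_Ropp in B.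
  assert (P := pos_INR n).
  rewrite cRI_shift; [|lra|auto]. replace (- INR n + v) with (- (INR n - v)) by ring.
  apply HX; lra.
Qed.

(** Goursat's theorem on [[-n, n] x [y1, y2]]: the vertical sides have fixed length, and the
    integrand on them decays like [exp (- tau n)]. *)
Lemma LI_line_shift (f : C -> C) K tau y1 y2 : 0 < tau -> y1 <= y2 ->
  (forall x y, y1 <= y <= y2 -> Cderivable f (cpt x y)) ->
  (forall y, y1 <= y <= y2 -> dom (fun x => f (cpt x y)) K tau) ->
  LI (fun x => f (cpt x y1)) = LI (fun x => f (cpt x y2)).
Proof.
  intros Ht Hy Hf Hd.
  assert (Hc : forall y, y1 <= y <= y2 -> forall x, rcont (fun x => f (cpt x y)) x)
    by (intros; apply rcont_cpt_x; auto).
  assert (HK := dom_K_pos _ _ _ (Hd y1 ltac:(lra))).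
  apply LI_unique.
  assert (L2 := LI_correct _ K tau Ht (Hc y2 ltac:(lra)) (Hd y2 ltac:(lra))).
  intros eps He. destruct (L2 (eps / 2)) as [n1 H1]; [lra|].
  set (q := K * (y2 - y1)). assert (Hq : 0 <= q) by (apply Rmult_le_pos; lra).
  destruct (exp_small tau (eps / (q + 1) / 4) Ht) as [X [HX0 HX]].
  { repeat apply div_pos; lra. }
  destruct (INR_ge X) as [n2 H2]. exists (max n1 n2). intros n Hn.
  specialize (H1 n ltac:(lia)). specialize (H2 n ltac:(lia)). specialize (HX _ H2).
  assert (P := pos_INR n).
  assert (G := goursat f (- INR n) (INR n) y1 y2 ltac:(lra) Hy).
  unfold rectI in G. specialize (G ltac:(intros x y _ Hxy; auto)).
  set (E := exp (- (tau * INR n))) in *.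
  assert (Hv : forall x, Rabs x = INR n -> Cmod (cRI (fun y => f (cpt x y)) y1 y2) <= q * E).
  { intros x Hx. unfold q. rewrite Rmult_assoc, (Rmult_comm _ E), <- Rmult_assoc.
    apply cRI_bound; auto.
    - intros; apply rcont_cpt_y; auto.
    - intros y Hy'. specialize (Hd y Hy' x). simpl in Hd. rewrite Hx in Hd. exact Hd. }
  set (I1 := cRI (fun x => f (cpt x y1)) (- INR n) (INR n)) in *.
  set (I2 := cRI (fun x => f (cpt x y2)) (- INR n) (INR n)) in *.
  assert (V1 := Hv (INR n) ltac:(rewrite Rabs_right; lra)).
  assert (V2 := Hv (- INR n) ltac:(rewrite Rabs_Ropp, Rabs_right; lra)).
  set (J1 := cRI (fun y => f (cpt (INR n) y)) y1 y2) in *.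
  set (J2 := cRI (fun y => f (cpt (- INR n) y)) y1 y2) in *.
  replace (I1 - LI (fun x => f (cpt x y2)))%C with
    ((I2 - LI (fun x => f (cpt x y2))) + (Ci * J2 - Ci * J1))%C.
  2:{ replace I1 with ((I1 + Ci * J1 - I2 - Ci * J2) + (I2 + (Ci * J2 - Ci * J1)))%C by ring.
      rewrite G. ring. }
  eapply Rle_lt_trans; [apply Cmod_triangle|].
  assert (T : Cmod (Ci * J2 - Ci * J1)%C <= 2 * (q * E)).
  { eapply Rle_trans; [apply Cmod_minus_le|]. rewrite !Cmod_mult, Cmod_Ci. lra. }
  assert (T2 : (q + 1) * E <= eps / 4).
  { apply Rle_trans with ((q + 1) * (eps / (q + 1) / 4)); [|right; field; lra].
    apply Rmult_le_compat_l; lra. }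
  assert (0 < E) by apply exp_pos. lra.
Qed.

(** The truncated integrals are holomorphic and bounded by [2 K / tau] uniformly in the truncation,
    so [Cd_lim] applies. *)
Lemma Cd_LI (phi : C -> R -> C) z r K tau : 0 < r -> 0 < tau ->
  (forall h x, Cmod h < r -> Cderivable (fun s => phi s x) (z + h)%C) ->
  (forall h x, Cmod h < r -> rcont (phi (z + h)%C) x) ->
  (forall h, Cmod h < r -> dom (phi (z + h)%C) K tau) ->
  Cderivable (fun s => LI (phi s)) z.
Proof.
  intros Hr Ht Hd Hc HD.
  assert (HK : 0 <= K) by (apply (dom_K_pos (phi (z + 0)%C) K tau), HD; rewrite Cmod_0; auto).
  apply (Cd_lim (fun n s => cRI (phi s) (- INR n) (INR n)) _ z r (2 * K / tau)); auto.
  - intros n h Hh. assert (P := pos_INR n).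
    assert (Hin : forall h0, Cmod h0 < r - Cmod h -> Cmod (h + h0)%C < r).
    { intros h0 H0. eapply Rle_lt_trans; [apply Cmod_triangle|]. lra. }
    apply (Cd_int phi (z + h)%C (r - Cmod h) K); try lra.
    + intros h0 x H0 _. rewrite <- Cplus_assoc. auto.
    + intros h0 x H0 _. rewrite <- Cplus_assoc. auto.
    + intros h0 x H0 _. rewrite <- Cplus_assoc. eapply Rle_trans; [apply HD; auto|].
      rewrite <- (Rmult_1_r K) at 2. apply Rmult_le_compat_l; auto.
      rewrite <- exp_0. apply exp_le_mono. assert (Q := Rabs_pos x). nra.
  - intros n h Hh. assert (P := pos_INR n).
    assert (B := cRI_dom_diff (phi (z + h)%C) K tau 0 0 (INR n) (INR n) Ht).
    rewrite Ropp_0, cRI_point, Rmult_0_r, Ropp_0, exp_0 in B.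
    replace (2 * K / tau) with (K / tau * (1 + 1)) by (field; lra).
    match type of B with _ -> _ -> _ -> _ -> Cmod ?a <= _ =>
      replace a with (cRI (phi (z + h)%C) (- INR n) (INR n)) in B by ring end.
    apply B; auto; lra.
  - intros h Hh. exact (LI_correct (phi (z + h)%C) K tau Ht (fun x => Hc h x Hh) (HD h Hh)).
Qed.

(** ** Half lines *)

Definition isRay (f : R -> C) (A : R) (l : C) : Prop := clim (fun n => cRI f A (A + INR n)) l.
Definition Ray (f : R -> C) (A : R) : C := epsilon (inhabits (RtoC 0)) (isRay f A).

Lemma cRI_ray_diff f K tau A B B' : 0 < tau -> 0 <= K -> (forall x, A <= x -> rcont f x) ->
  (forall x, A <= x -> Cmod (f x) <= K * exp (- (tau * x))) -> A <= B <= B' ->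
  Cmod (cRI f A B' - cRI f A B)%C <= K / tau * exp (- (tau * B)).
Proof.
  intros Ht HK Hc Hd HB.
  rewrite (cRI_chasles f A B B') by (try lra; intros; apply Hc; lra).
  replace (cRI f A B + cRI f B B' - cRI f A B)%C with (cRI f B B') by ring.
  apply cRI_tail_right; auto; try lra; intros; [apply Hc|apply Hd]; lra.
Qed.

Lemma Ray_correct f K tau A : 0 < tau -> 0 <= K -> (forall x, A <= x -> rcont f x) ->
  (forall x, A <= x -> Cmod (f x) <= K * exp (- (tau * x))) -> isRay f A (Ray f A).
Proof.
  intros Ht HK Hc Hd. apply (epsilon_spec (inhabits (RtoC 0)) (isRay f A)). apply clim_cauchy. intros eps He.
  assert (HKt : 0 <= K / tau) by (apply Rmult_le_pos; [auto|left; apply Rinv_0_lt_compat; auto]).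
  destruct (exp_small tau (eps / (K / tau + 1))) as [X [HX0 HX]]; auto.
  { repeat apply div_pos; lra. }
  destruct (INR_ge (X - A)) as [n0 Hn0]. exists n0.
  assert (W : forall n m, (n0 <= n)%nat -> (n <= m)%nat ->
    Cmod (cRI f A (A + INR m) - cRI f A (A + INR n))%C < eps).
  { intros n m Hn Hm. assert (P := pos_INR n). apply le_INR in Hm.
    eapply Rle_lt_trans; [apply (cRI_ray_diff f K tau); auto; lra|].
    specialize (HX (A + INR n) ltac:(specialize (Hn0 n Hn); lra)).
    set (E := exp (- (tau * (A + INR n)))) in *. set (q := K / tau) in *.
    apply Rlt_le_trans with ((q + 1) * (eps / (q + 1))); [|right; field; lra].
    assert (0 < E) by apply exp_pos. nra. }
  intros n m Hn Hm. destruct (Nat.le_gt_cases n m).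
  - rewrite Cmod_minus_sym. apply W; auto.
  - apply W; auto; lia.
Qed.

Lemma Ray_approx f K tau A B : 0 < tau -> 0 <= K -> (forall x, A <= x -> rcont f x) ->
  (forall x, A <= x -> Cmod (f x) <= K * exp (- (tau * x))) -> A <= B ->
  Cmod (Ray f A - cRI f A B)%C <= K / tau * exp (- (tau * B)).
Proof.
  intros Ht HK Hc Hd HB.
  apply clim_le with (u := fun n => (cRI f A (A + INR n) - cRI f A B)%C).
  - apply (clim_plus (fun n => cRI f A (A + INR n)) (fun _ => (- cRI f A B)%C)).
    + apply (Ray_correct f K tau); auto.
    + apply clim_const.
  - destruct (INR_ge (B - A)) as [n0 H0]. exists n0. intros n Hn. specialize (H0 n Hn).
    apply cRI_ray_diff; auto; lra.
Qed.

Lemma Ray_limit f K tau A : 0 < tau -> 0 <= K -> (forall x, A <= x -> rcont f x) ->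
  (forall x, A <= x -> Cmod (f x) <= K * exp (- (tau * x))) ->
  forall eps, 0 < eps -> exists X, A <= X /\ forall B, X <= B -> Cmod (cRI f A B - Ray f A)%C < eps.
Proof.
  intros Ht HK Hc Hd eps He.
  assert (HKt : 0 <= K / tau) by (apply Rmult_le_pos; [auto|left; apply Rinv_0_lt_compat; auto]).
  destruct (exp_small tau (eps / (K / tau + 1))) as [X [HX0 HX]]; auto.
  { repeat apply div_pos; lra. }
  exists (Rmax A X). assert (M1 := Rmax_l A X). assert (M2 := Rmax_r A X).
  split; auto. intros B HB. rewrite Cmod_minus_sym.
  eapply Rle_lt_trans; [apply (Ray_approx f K tau); auto; lra|].
  assert (E2 := HX B ltac:(lra)). set (q := K / tau) in *. assert (P2 := exp_pos (- (tau * B))).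
  apply Rlt_le_trans with ((q + 1) * (eps / (q + 1))); [|right; field; lra]. nra.
Qed.

Lemma Ray_bound f K tau A : 0 < tau -> 0 <= K -> (forall x, A <= x -> rcont f x) ->
  (forall x, A <= x -> Cmod (f x) <= K * exp (- (tau * x))) ->
  Cmod (Ray f A) <= K / tau * exp (- (tau * A)).
Proof.
  intros Ht HK Hc Hd. assert (H := Ray_approx f K tau A A Ht HK Hc Hd (Rle_refl A)).
  rewrite cRI_point in H. replace (Ray f A - 0)%C with (Ray f A) in H by ring. auto.
Qed.

Lemma Cd_Ray (phi : C -> R -> C) z r K tau A : 0 < r -> 0 < tau -> 0 <= K ->
  (forall h x, Cmod h < r -> A <= x -> Cderivable (fun s => phi s x) (z + h)%C) ->
  (forall h x, Cmod h < r -> A <= x -> rcont (phi (z + h)%C) x) ->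
  (forall h x, Cmod h < r -> A <= x -> Cmod (phi (z + h)%C x) <= K * exp (- (tau * x))) ->
  Cderivable (fun s => Ray (phi s) A) z.
Proof.
  intros Hr Ht HK Hd Hc HD.
  apply (Cd_lim (fun n s => cRI (phi s) A (A + INR n)) _ z r (K / tau * exp (- (tau * A)))); auto.
  - intros n h Hh. assert (P := pos_INR n).
    assert (Hin : forall h0, Cmod h0 < r - Cmod h -> Cmod (h + h0)%C < r).
    { intros h0 H0. eapply Rle_lt_trans; [apply Cmod_triangle|]. lra. }
    apply (Cd_int phi (z + h)%C (r - Cmod h) (K * exp (- (tau * A)))); try lra.
    + intros h0 x H0 Hx. rewrite <- Cplus_assoc. apply Hd; auto; lra.
    + intros h0 x H0 Hx. rewrite <- Cplus_assoc. apply Hc; auto; lra.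
    + intros h0 x H0 Hx. rewrite <- Cplus_assoc. eapply Rle_trans; [apply HD; auto; lra|].
      apply Rmult_le_compat_l; auto. apply exp_le_mono. nra.
  - intros n h Hh. assert (P := pos_INR n).
    assert (B := cRI_ray_diff (phi (z + h)%C) K tau A A (A + INR n) Ht HK).
    rewrite cRI_point in B.
    match type of B with _ -> _ -> _ -> Cmod ?a <= _ =>
      replace a with (cRI (phi (z + h)%C) A (A + INR n)) in B by ring end.
    apply B; auto; lra.
  - intros h Hh. exact (Ray_correct (phi (z + h)%C) K tau A Ht HK (fun x => Hc h x Hh) (fun x => HD h x Hh)).
Qed.

(** ** Exponential domination of the integrands *)

Lemma exp_pow x n : exp x ^ n = exp (INR n * x).
Proof.
  induction n as [|n IH]; [simpl; rewrite Rmult_0_l, exp_0; auto|].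
  rewrite S_INR. simpl pow. rewrite IH, <- exp_plus. f_equal. ring.
Qed.

(** For [y = c exp x] one has [exp y >= (1 + y / m)^m >= (y / m)^m]. Thus double exponential decay
    beats any prescribed exponential rate [m]. *)
Lemma exp_decay_right (m : nat) c x : (0 < m)%nat -> 0 < c ->
  exp (- (c * exp x)) <= (INR m / c) ^ m * exp (- (INR m * x)).
Proof.
  intros Hm Hc. apply lt_INR in Hm. simpl in Hm.
  assert (Pe := exp_pos x).
  assert (A : (c * exp x / INR m) ^ m <= exp (c * exp x)).
  { replace (exp (c * exp x)) with (exp (c * exp x / INR m) ^ m).
    - apply pow_incr. split; [left; apply div_pos; nra|].
      assert (L := exp_ineq1_le (c * exp x / INR m)). lra.
    - rewrite exp_pow. f_equal. field. lra. }
  rewrite exp_Ropp.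
  assert (Q : 0 < (c * exp x / INR m) ^ m) by (apply pow_lt, div_pos; nra).
  apply Rinv_le_contravar in A; auto. eapply Rle_trans; [exact A|]. right.
  rewrite exp_Ropp, <- exp_pow, <- !pow_inv, <- Rpow_mult_distr.
  f_equal. field. repeat split; lra.
Qed.

Lemma INR_up (x : R) : exists m, (0 < m)%nat /\ x <= INR m.
Proof.
  destruct (INR_unbounded x) as [n Hn]. exists (S n). split; [lia|]. rewrite S_INR. lra.
Qed.

(** [KL] handles the bounded part [[A, 0]]. For [x >= 0] the choice [m >= S + 1] lets [exp (- m x)]
    absorb [exp (sg x)] and still leave [exp (- x)]. *)
Lemma dom_right N S c A : 0 < c -> exists K, 0 <= K /\ forall sg x, Rabs sg <= S -> A <= x ->
  (1 + exp (- x)) ^ N * exp (sg * x) * exp (- (c * exp x)) <= K * exp (- (1 * x)).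
Proof.
  intros Hc. destruct (INR_up (S + 1)) as [m [Hm HSm]].
  set (KL := (1 + exp (Rabs A)) ^ N * exp (S * Rabs A)).
  set (KR := 2 ^ N * (INR m / c) ^ m).
  assert (Hm' : 0 < INR m) by (apply lt_0_INR; auto).
  assert (P1 : 0 <= KL).
  { apply Rmult_le_pos; [apply pow_le; assert (Z := exp_pos (Rabs A)); lra|left; apply exp_pos]. }
  assert (P2 : 0 <= KR).
  { apply Rmult_le_pos; [apply pow_le; lra|apply pow_le]. left; apply div_pos; auto. }
  exists (KL + KR). split; [lra|]. intros sg x Hsg Hx.
  assert (Pe := exp_pos (- x)). assert (Ps := exp_pos (sg * x)). assert (Pc := exp_pos (- (c * exp x))).
  assert (Hx1 : exp (- (1 * x)) = exp (- x)) by (f_equal; ring).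
  destruct (Rle_dec x 0) as [L|L].
  - assert (HAx : Rabs x <= Rabs A) by (rewrite !Rabs_left1; lra).
    apply Rle_trans with (KL * 1 * 1).
    + apply Rmult_le_compat; [apply Rmult_le_pos; [apply pow_le; lra|lra]|lra| |].
      * rewrite Rmult_1_r. unfold KL. apply Rmult_le_compat; [apply pow_le; lra|lra| |].
        { apply pow_incr. split; [lra|]. apply Rplus_le_compat_l, exp_le_mono.
          rewrite <- (Rabs_left1 x) by lra. auto. }
        { apply exp_le_mono. eapply Rle_trans; [apply Rle_abs|]. rewrite Rabs_mult.
          apply Rmult_le_compat; auto using Rabs_pos. }
      * rewrite <- exp_0. apply exp_le_mono. assert (Z := exp_pos x). nra.
    + rewrite Hx1. assert (1 <= exp (- x)) by (rewrite <- exp_0; apply exp_le_mono; lra). nra.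
  - apply Rle_trans with (KR * exp (- (1 * x))); [|rewrite Hx1; nra].
    unfold KR. rewrite !Rmult_assoc. apply Rmult_le_compat; [apply pow_le; lra|nra| |].
    + apply pow_incr. split; [lra|].
      assert (exp (- x) <= 1) by (rewrite <- exp_0; apply exp_le_mono; lra). lra.
    + apply Rle_trans with (exp (sg * x) * ((INR m / c) ^ m * exp (- (INR m * x)))).
      * apply Rmult_le_compat_l; [lra|]. apply exp_decay_right; auto.
      * rewrite <- Rmult_assoc, (Rmult_comm (exp (sg * x))), Rmult_assoc, <- exp_plus.
        apply Rmult_le_compat_l; [apply pow_le; left; apply div_pos; auto|].
        apply exp_le_mono. apply Rabs_le_between in Hsg. nra.
Qed.

(** For [x < 0] the first factor is at most [2^N exp (- N x)], the pole of order [N] of the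
    integrand at [u = 0]. This is where [Re s > N] is needed: the excess [tau] over [N] is the decay
    rate towards minus infinity. *)
Lemma dom_line N S c tau : 0 < c -> 0 < tau <= 1 -> exists K, 0 <= K /\ forall sg x, INR N + tau <= sg <= S ->
  (1 + exp (- x)) ^ N * exp (sg * x) * exp (- (c * exp x)) <= K * exp (- (tau * Rabs x)).
Proof.
  intros Hc Ht. destruct (dom_right N (Rabs S) c 0 Hc) as [K [HK H]].
  exists (K + 2 ^ N). assert (P2 : 0 <= 2 ^ N) by (apply pow_le; lra). split; [lra|].
  intros sg x Hsg. assert (HN := pos_INR N).
  assert (Pe := exp_pos (- x)). assert (Ps := exp_pos (sg * x)). assert (Pc := exp_pos (- (c * exp x))).
  assert (Pt := exp_pos (- (tau * Rabs x))).
  destruct (Rle_dec 0 x) as [L|L].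
  - rewrite (Rabs_right x) in * by lra.
    apply Rle_trans with (K * exp (- (1 * x))).
    + apply H; auto. rewrite !Rabs_right; lra.
    + assert (exp (- (1 * x)) <= exp (- (tau * x))) by (apply exp_le_mono; nra). nra.
  - rewrite (Rabs_left x) in * by lra.
    apply Rle_trans with (2 ^ N * exp (tau * x) * 1).
    + apply Rmult_le_compat; [apply Rmult_le_pos; [apply pow_le; lra|lra]|lra| |].
      * apply Rle_trans with ((2 * exp (- x)) ^ N * exp (sg * x)).
        { apply Rmult_le_compat_r; [lra|]. apply pow_incr. split; [lra|].
          assert (1 <= exp (- x)) by (rewrite <- exp_0; apply exp_le_mono; lra). lra. }
        rewrite Rpow_mult_distr, exp_pow, Rmult_assoc, <- exp_plus.
        apply Rmult_le_compat_l; auto. apply exp_le_mono. nra.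
      * rewrite <- exp_0. apply exp_le_mono. assert (Z := exp_pos x). nra.
    + replace (- (tau * - x)) with (tau * x) in * by ring. nra.
Qed.

(** * The reciprocal of the Gamma function *)

Lemma clim_filterlim (u : nat -> C) (l : C) : clim u l <-> filterlim u eventually (locally l).
Proof.
  split.
  - intros H. apply filterlim_locally. intros eps.
    destruct (H eps (cond_pos eps)) as [n0 H0]. exists n0. intros n Hn. specialize (H0 n Hn). split.
    + apply Rle_lt_trans with (2 := H0). apply (Re_le_Cmod (u n - l)%C).
    + apply Rle_lt_trans with (2 := H0). apply (Im_le_Cmod (u n - l)%C).
  - intros H eps He. assert (H0 := proj1 (filterlim_locally u l) H).
    destruct (H0 (mkposreal (eps / 2) ltac:(lra))) as [n0 H1].
    exists n0. intros n Hn. destruct (H1 n Hn) as [A B].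
    eapply Rle_lt_trans; [apply Cmod_le_ReIm|].
    change (Rabs (Re (u n - l)%C) < eps / 2) in A.
    change (Rabs (Im (u n - l)%C) < eps / 2) in B. lra.
Qed.

(** The remainder is the integral of [h (exp (t h) - 1)] over [t] in [[0, 1]], whose integrand is at
    most [2 |h|^2] by [one_minus_cexp_ge]. *)
Lemma cexp_quad : exists rho, 0 < rho /\ forall h, Cmod h < rho ->
  Cmod (cexp h - 1 - h)%C <= 2 * (Cmod h * Cmod h).
Proof.
  destruct one_minus_cexp_ge as [rho [Hr H]]. exists rho. split; auto. intros h Hh.
  set (F := fun z => (cexp z - z)%C).
  assert (HF : forall z, Cder F z (cexp z - 1)%C).
  { intros z. assert (D := Cder_plus _ _ _ _ _ (Cder_cexp z)
      (Cder_mult _ _ _ _ _ (Cder_const (- (1))%C z) (Cder_id z))).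
    cbv beta in D.
    replace (cexp z + (0 * z + - (1) * 1))%C with (cexp z - 1)%C in D by ring.
    eapply Cder_ext; [|exact D]. intros u; unfold F. simpl. ring. }
  assert (Hc : forall x, rcont (fun t => h * (cexp (0 + RtoC t * h) - 1))%C x) by (intros; rcontin).
  assert (E : (cexp h - 1 - h)%C = cRI (fun t => h * (cexp (0 + RtoC t * h) - 1))%C 0 1).
  { rewrite (cRI_FTC (fun t => F (0 + RtoC t * h)%C)); [|lra| |auto].
    - unfold F. replace (0 + 1 * h)%C with h by ring. replace (0 + 0 * h)%C with (RtoC 0) by ring.
      rewrite cexp_0. ring.
    - intros x _. apply rder_comp. apply HF. }
  rewrite E. replace (2 * (Cmod h * Cmod h)) with (2 * (Cmod h * Cmod h) * (1 - 0)) by ring.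
  apply cRI_bound; [lra|auto|]. intros x Hx. rewrite Cmod_mult, Cplus_0_l.
  assert (P := Cmod_ge_0 h).
  assert (Q : Cmod (RtoC x * h)%C <= Cmod h).
  { rewrite Cmod_mult, Cmod_R, Rabs_right by lra. nra. }
  destruct (H (RtoC x * h)%C ltac:(lra)) as [_ H1].
  rewrite Cmod_minus_sym in H1.
  apply Rle_trans with (Cmod h * (2 * Cmod h)); [|lra]. apply Rmult_le_compat_l; auto. lra.
Qed.

Lemma ln_one_minus x : 0 <= x <= 1 / 2 -> Rabs (ln (1 - x) + x) <= 2 * (x * x).
Proof.
  intros Hx. apply Rabs_le. split.
  - assert (L : ln (/ (1 - x)) <= x + 2 * (x * x)).
    { apply Rle_trans with (x / (1 - x)).
      - rewrite <- (ln_exp (x / (1 - x))). apply ln_le.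
        + apply Rinv_0_lt_compat; lra.
        + replace (/ (1 - x)) with (1 + x / (1 - x)) by (field; lra). apply exp_ineq1_le.
      - apply Rmult_le_reg_r with (1 - x); [lra|].
        replace (x / (1 - x) * (1 - x)) with x by (field; lra). nra. }
    rewrite ln_Rinv in L by lra. lra.
  - assert (L : ln (1 - x) <= - x); [|nra].
    rewrite <- (ln_exp (- x)). apply ln_le; [lra|].
    assert (Q := exp_ineq1_le (- x)). lra.
Qed.

(** * Convergence of Gauss's limit, locally uniformly in [s] *)

Definition cprod (n : nat) (f : nat -> C) : C := fold_right Cmult (RtoC 1) (map f (seq 0 n)).

Lemma fold_Cmult_app (l l' : list C) :
  fold_right Cmult (RtoC 1) (l ++ l') = (fold_right Cmult (RtoC 1) l * fold_right Cmult (RtoC 1) l')%C.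
Proof. induction l as [|x l IH]; simpl; [ring|rewrite IH; ring]. Qed.

Lemma cprod_S n f : cprod (S n) f = (cprod n f * f n)%C.
Proof. unfold cprod. rewrite seq_S, map_app, fold_Cmult_app. simpl. ring. Qed.

Lemma cprod_bound n f M : (forall j, (j < n)%nat -> Cmod (f j) <= M) -> Cmod (cprod n f) <= M ^ n.
Proof.
  induction n as [|n IH]; intros H.
  - unfold cprod; simpl. rewrite Cmod_1. lra.
  - rewrite cprod_S, Cmod_mult. simpl pow. rewrite Rmult_comm.
    apply Rmult_le_compat; auto using Cmod_ge_0.
Qed.

Lemma cprod_shift n f : cprod (S n) f = (f O * cprod n (fun j => f (S j)))%C.
Proof. unfold cprod. simpl. rewrite <- seq_shift, map_map. reflexivity. Qed.

Lemma Cd_cprod n (f : nat -> C -> C) z : (forall j, (j < n)%nat -> Cderivable (f j) z) ->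
  Cderivable (fun s => cprod n (fun j => f j s)) z.
Proof.
  induction n as [|n IH]; intros H.
  - unfold cprod; simpl. apply Cd_const.
  - apply Cd_ext with (f := fun s => (cprod n (fun j => f j s) * f n s)%C).
    { intros u. rewrite cprod_S; auto. }
    apply Cd_mult; auto.
Qed.

Definition rgseq (s : C) (n : nat) : C :=
  (cprod (S n) (fun j => s + RtoC (INR j)) / (RtoC (INR (fact n)) * cexp (s * RtoC (ln (INR n)))))%C.

Lemma fact_C_nz n : RtoC (INR (fact n)) <> 0%C.
Proof. intros Q. apply RtoC_inj in Q. apply (INR_fact_neq_0 n). auto. Qed.

Lemma INR_S_C_nz n : RtoC (INR (S n)) <> 0%C.
Proof. intros Q. apply RtoC_inj in Q. revert Q. apply not_0_INR. lia. Qed.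

Definition rgratio (s : C) (n : nat) : C :=
  ((1 + s / RtoC (INR (S n))) * cexp (s * RtoC (ln (INR n) - ln (INR (S n)))))%C.

Lemma rgseq_S s n : rgseq s (S n) = (rgseq s n * rgratio s n)%C.
Proof.
  unfold rgseq, rgratio. rewrite cprod_S.
  replace (s * RtoC (ln (INR (S n))))%C with
    (s * RtoC (ln (INR n)) + - (s * RtoC (ln (INR n) - ln (INR (S n)))))%C
    by (rewrite RtoC_minus; ring).
  rewrite cexp_plus, cexp_opp.
  rewrite fact_simpl, mult_INR, RtoC_mult.
  generalize (fact_C_nz n) (INR_S_C_nz n) (cexp_nz (s * RtoC (ln (INR n))))
    (cexp_nz (s * RtoC (ln (INR n) - ln (INR (S n))))).
  intros. field. repeat split; assumption.
Qed.

(** With [u = s / (n + 1)] and [v = s ln (n / (n + 1))] the ratio is [(1 + u) exp v], and [u + v],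
    [u v] and [exp v - 1 - v] are all of order [1 / n^2]. The bound is written as a difference of
    reciprocals so that sums over [n] telescope. *)
Lemma rgratio_bound R0 : 1 <= R0 -> exists n0, (0 < n0)%nat /\ forall n s, (n0 <= n)%nat -> Cmod s <= R0 ->
  Cmod (rgratio s n - 1)%C <= 20 * (R0 * R0) * (/ INR n - / INR (S n)).
Proof.
  intros HR. destruct cexp_quad as [rho [Hr Hq]].
  destruct (INR_up (Rmax (2 * R0) (4 * R0 / rho))) as [n0 [Hn0 Hb]].
  exists n0. split; auto. intros n s Hn Hs.
  assert (Hn1 : (0 < n)%nat) by lia.
  assert (P1 : 0 < INR n) by (apply lt_0_INR; auto).
  assert (P2 : INR (S n) = INR n + 1) by apply S_INR.
  assert (Hnn : INR n0 <= INR n) by (apply le_INR; auto).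
  assert (B1 := Rmax_l (2 * R0) (4 * R0 / rho)). assert (B2 := Rmax_r (2 * R0) (4 * R0 / rho)).
  set (x := / INR (S n)).
  assert (Hx : 0 < x) by (unfold x; apply Rinv_0_lt_compat; lra).
  assert (Ex : x * INR (S n) = 1) by (unfold x; apply Rinv_l; lra).
  assert (HxR : 2 * R0 * x <= 1) by nra.
  assert (Hx2 : x <= 1 / 2) by nra.
  assert (Hxr : 2 * R0 * x < rho).
  { assert (4 * R0 <= INR n * rho).
    { replace (4 * R0) with (4 * R0 / rho * rho) by (field; lra). apply Rmult_le_compat_r; lra. }
    assert (4 * R0 < INR (S n) * rho) by nra.
    assert (x * (4 * R0) < x * (INR (S n) * rho)) by (apply Rmult_lt_compat_l; auto).
    replace (x * (INR (S n) * rho)) with (x * INR (S n) * rho) in H1 by ring. rewrite Ex in H1. nra. }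
  assert (El : ln (INR n) - ln (INR (S n)) = ln (1 - x)).
  { rewrite <- ln_div by lra. f_equal. unfold x. rewrite P2. field. lra. }
  unfold rgratio. rewrite El.
  assert (Hl := ln_one_minus x ltac:(lra)).
  set (l := ln (1 - x)) in *.
  set (u := (s / RtoC (INR (S n)))%C). set (v := (s * RtoC l)%C).
  assert (Eu : u = (s * RtoC x)%C).
  { unfold u, x. rewrite RtoC_inv by lra. reflexivity. }
  assert (Hu : Cmod u <= R0 * x).
  { rewrite Eu, Cmod_mult, Cmod_R, Rabs_right by lra. apply Rmult_le_compat_r; lra. }
  assert (Hla : Rabs l <= 2 * x).
  { apply Rabs_le_between in Hl. apply Rabs_le. nra. }
  assert (Hv : Cmod v <= R0 * (2 * x)).
  { unfold v. rewrite Cmod_mult, Cmod_R. apply Rmult_le_compat; auto using Cmod_ge_0, Rabs_pos. }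
  assert (Huv : Cmod (u + v)%C <= R0 * (2 * (x * x))).
  { rewrite Eu. unfold v. replace (s * x + s * l)%C with (s * RtoC (l + x))%C by (rewrite RtoC_plus; ring).
    rewrite Cmod_mult, Cmod_R. apply Rmult_le_compat; auto using Cmod_ge_0, Rabs_pos. }
  specialize (Hq v ltac:(lra)).
  replace ((1 + u) * cexp v - 1)%C with ((1 + u) * (cexp v - 1 - v) + u * v + (u + v))%C by ring.
  assert (U1 := Cmod_ge_0 u). assert (V1 := Cmod_ge_0 v).
  assert (H1u : Cmod (1 + u)%C <= 2).
  { eapply Rle_trans; [apply Cmod_triangle|]. rewrite Cmod_1. nra. }
  assert (T : Cmod ((1 + u) * (cexp v - 1 - v) + u * v + (u + v))%C <= 20 * (R0 * R0) * (x * x)).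
  { eapply Rle_trans; [apply Cmod_triangle|].
    eapply Rle_trans; [apply Rplus_le_compat_r, Cmod_triangle|]. rewrite !Cmod_mult.
    assert (T1 : Cmod (1 + u)%C * Cmod (cexp v - 1 - v)%C <= 2 * (2 * (R0 * (2 * x) * (R0 * (2 * x))))).
    { apply Rmult_le_compat; auto using Cmod_ge_0. eapply Rle_trans; [exact Hq|].
      apply Rmult_le_compat_l; [lra|]. apply Rmult_le_compat; auto. }
    assert (T2 : Cmod u * Cmod v <= R0 * x * (R0 * (2 * x))) by (apply Rmult_le_compat; auto).
    assert (R0 <= R0 * R0) by nra. assert (0 < x * x) by nra. nra. }
  eapply Rle_trans; [exact T|]. apply Rmult_le_compat_l; [nra|].
  fold x. replace (/ INR n - x) with (x * / INR n) by (unfold x; rewrite P2; field; lra).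
  apply Rmult_le_compat_l; [lra|]. unfold x. apply Rinv_le_contravar; lra.
Qed.

(** Each ratio is at most [exp (c (1/n - 1/(n+1)))], and these exponents telescope; hence
    boundedness, and then the Cauchy estimate. [Q] and [n0] depend only on [R0], which gives
    holomorphy of the limit. *)
Lemma rgseq_growth R0 : 1 <= R0 -> exists n0 Q, (0 < n0)%nat /\ 0 <= Q /\
  forall s, Cmod s <= R0 -> forall n, (n0 <= n)%nat ->
    Cmod (rgseq s n) <= Q /\
    forall m, (n <= m)%nat -> Cmod (rgseq s m - rgseq s n)%C <= Q * (/ INR n - / INR m).
Proof.
  intros HR. destruct (rgratio_bound R0 HR) as [n0 [Hn0 Hb]].
  set (c := 20 * (R0 * R0)) in *. assert (Hc : 0 <= c) by (unfold c; nra).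
  (* A crude bound for the starting term [rgseq s n0], uniform for [Cmod s <= R0]. *)
  set (B0 := (R0 + INR n0 + 1) ^ (S n0) * exp (R0 * Rabs (ln (INR n0)))).
  assert (HN0 := pos_INR n0).
  assert (HB0 : 0 <= B0) by (apply Rmult_le_pos; [apply pow_le; lra|left; apply exp_pos]).
  set (B := B0 * exp (c * / INR n0)).
  assert (HB : 0 <= B) by (apply Rmult_le_pos; [auto|left; apply exp_pos]).
  exists n0, (B * (1 + c)). split; auto. split; [apply Rmult_le_pos; lra|].
  intros s Hs.
  assert (Hinit : Cmod (rgseq s n0) <= B0).
  { unfold rgseq. rewrite Cmod_div by (apply Cmult_neq_0; [apply fact_C_nz|apply cexp_nz]).
    apply Rmult_le_compat; [apply Cmod_ge_0|left; apply Rinv_0_lt_compat, Cmod_gt_0| |].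
    - apply Cmult_neq_0; [apply fact_C_nz|apply cexp_nz].
    - apply cprod_bound. intros j Hj. eapply Rle_trans; [apply Cmod_triangle|].
      rewrite Cmod_R, Rabs_right by (apply Rle_ge, pos_INR).
      assert (INR j <= INR n0) by (apply le_INR; lia). lra.
    - rewrite Cmod_mult, Cmod_cexp, Cmod_R.
      assert (F : 1 <= INR (fact n0)) by (apply (le_INR 1); apply lt_O_fact).
      rewrite Rabs_right by lra. rewrite Rinv_mult, <- exp_Ropp.
      rewrite <- (Rmult_1_l (exp (R0 * _))). apply Rmult_le_compat.
      + left; apply Rinv_0_lt_compat; lra.
      + left; apply exp_pos.
      + rewrite <- Rinv_1. apply Rinv_le_contravar; lra.
      + apply exp_le_mono. eapply Rle_trans; [apply Rle_abs|]. rewrite Rabs_Ropp.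
        rewrite re_scal_r, Rabs_mult. apply Rmult_le_compat_r; [apply Rabs_pos|].
        eapply Rle_trans; [apply Re_le_Cmod|auto]. }
  assert (Hpos : forall n, (n0 <= n)%nat -> 0 < INR n) by (intros; apply lt_0_INR; lia).
  assert (Hbd : forall n, (n0 <= n)%nat -> Cmod (rgseq s n) <= B0 * exp (c * (/ INR n0 - / INR n))).
  { intros n Hn. induction Hn as [|n Hn IH].
    - rewrite Rminus_diag, Rmult_0_r, exp_0. lra.
    - rewrite rgseq_S, Cmod_mult.
      assert (Rt : Cmod (rgratio s n) <= exp (c * (/ INR n - / INR (S n)))).
      { replace (rgratio s n) with ((rgratio s n - 1) + 1)%C by ring.
        eapply Rle_trans; [apply Cmod_triangle|]. rewrite Cmod_1.
        specialize (Hb n s Hn Hs). assert (L := exp_ineq1_le (c * (/ INR n - / INR (S n)))). lra. }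
      replace (c * (/ INR n0 - / INR (S n))) with
        (c * (/ INR n0 - / INR n) + c * (/ INR n - / INR (S n))) by ring.
      rewrite exp_plus, <- Rmult_assoc. apply Rmult_le_compat; auto using Cmod_ge_0. }
  assert (HbB : forall n, (n0 <= n)%nat -> Cmod (rgseq s n) <= B).
  { intros n Hn. eapply Rle_trans; [apply Hbd; auto|]. apply Rmult_le_compat_l; auto.
    apply exp_le_mono, Rmult_le_compat_l; auto.
    assert (0 < / INR n) by (apply Rinv_0_lt_compat; auto). lra. }
  intros n Hn. split.
  - eapply Rle_trans; [apply HbB; auto|]. nra.
  - intros m Hm. induction Hm as [|m Hm IH].
    + replace (rgseq s n - rgseq s n)%C with (RtoC 0) by ring. rewrite Cmod_0, Rminus_diag. lra.
    + replace (rgseq s (S m) - rgseq s n)%C with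
        (rgseq s m * (rgratio s m - 1) + (rgseq s m - rgseq s n))%C by (rewrite rgseq_S; ring).
      eapply Rle_trans; [apply Cmod_triangle|]. rewrite Cmod_mult.
      specialize (Hb m s ltac:(lia) Hs). specialize (HbB m ltac:(lia)).
      assert (D : 0 <= / INR m - / INR (S m)).
      { assert (/ INR (S m) <= / INR m); [|lra]. apply Rinv_le_contravar; [apply Hpos; lia|].
        rewrite S_INR; lra. }
      assert (Cmod (rgseq s m) * Cmod (rgratio s m - 1)%C <= B * (c * (/ INR m - / INR (S m))))
        by (apply Rmult_le_compat; auto using Cmod_ge_0).
      nra.
Qed.

Definition rg (s : C) : C := epsilon (inhabits (RtoC 0)) (clim (rgseq s)).

Lemma rg_lim s : clim (rgseq s) (rg s).
Proof.
  apply (epsilon_spec (inhabits (RtoC 0)) (clim (rgseq s))). apply clim_cauchy. intros eps He.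
  destruct (rgseq_growth (Cmod s + 1)) as [n0 [Q [Hn0 [HQ H]]]]; [assert (Z := Cmod_ge_0 s); lra|].
  destruct (INR_up (Q / eps + 1)) as [n1 [Hn1 Hb]].
  exists (max n0 n1).
  assert (W : forall n m, (max n0 n1 <= n)%nat -> (n <= m)%nat -> Cmod (rgseq s m - rgseq s n)%C < eps).
  { intros n m Hn Hm. destruct (H s ltac:(lra) n ltac:(lia)) as [_ H1].
    eapply Rle_lt_trans; [apply H1; auto|].
    assert (P : INR n1 <= INR n) by (apply le_INR; lia).
    assert (P0 : 0 < INR n) by (apply lt_0_INR; lia).
    assert (Pm : 0 < / INR m) by (apply Rinv_0_lt_compat, lt_0_INR; lia).
    apply Rle_lt_trans with (Q * / INR n); [apply Rmult_le_compat_l; lra|].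
    apply Rmult_lt_reg_r with (INR n); auto. rewrite Rmult_assoc, Rinv_l, Rmult_1_r by lra.
    assert (Q < eps * INR n1); [|nra].
    apply Rlt_le_trans with (eps * (Q / eps + 1)); [|apply Rmult_le_compat_l; lra].
    replace (eps * (Q / eps + 1)) with (Q + eps) by (field; lra). lra. }
  intros n m Hn Hm. destruct (Nat.le_gt_cases n m).
  - rewrite Cmod_minus_sym. apply W; auto.
  - apply W; auto; lia.
Qed.

Lemma rgamma_is_iff s g : rgamma_is s g <-> g = rg s.
Proof.
  split.
  - intros H. apply clim_filterlim in H. exact (clim_unique _ _ _ H (rg_lim s)).
  - intros ->. apply clim_filterlim. exact (rg_lim s).
Qed.

(** The sequence is shifted by [n0] because the uniform bound holds only from that index on. *)
Lemma rg_Cd s : Cderivable rg s.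
Proof.
  destruct (rgseq_growth (Cmod s + 1)) as [n0 [Q [Hn0 [HQ H]]]]; [assert (Z := Cmod_ge_0 s); lra|].
  assert (Hin : forall h, Cmod h < 1 -> Cmod (s + h)%C <= Cmod s + 1).
  { intros h Hh. eapply Rle_trans; [apply Cmod_triangle|]. lra. }
  apply (Cd_lim (fun n z => rgseq z (n0 + n)%nat) rg s 1 Q); [lra| | |].
  - intros n h _. unfold rgseq. apply Cd_div.
    + apply Cmult_neq_0; [apply fact_C_nz|apply cexp_nz].
    + apply (Cd_cprod (S (n0 + n)) (fun j z => z + RtoC (INR j))%C). intros. cderiv.
    + cderiv.
  - intros n h Hh. apply (H (s + h)%C); auto. lia.
  - intros h Hh eps He. destruct (rg_lim (s + h)%C eps He) as [n1 H1].
    exists n1. intros n Hn. apply H1. lia.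
Qed.

(** For finite [n] the identity reads [s * rgseq (s + 1) n = rgseq s n * (1 + (s + 1) / n)], and the
    last factor tends to 1. *)
Lemma rg_rec s : rg s = (s * rg (s + 1))%C.
Proof.
  assert (L1 := clim_scal s _ _ (rg_lim (s + 1)%C)).
  assert (L2 : clim (fun n => (1 + (s + 1) * RtoC (/ INR (S n))))%C 1%C).
  { cut (clim (fun n => (1 + (s + 1) * RtoC (/ INR (S n))))%C (1 + (s + 1) * 0)%C).
    { replace (1 + (s + 1) * 0)%C with (RtoC 1) by ring. auto. }
    apply (clim_plus (fun _ => RtoC 1)); [apply clim_const|]. apply clim_scal.
    intros eps He. destruct (INR_up (/ eps)) as [n0 [_ H0]]. exists n0. intros n Hn.
    replace (RtoC (/ INR (S n)) - 0)%C with (RtoC (/ INR (S n))) by ring.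
    assert (P : 0 < INR (S n)) by (apply lt_0_INR; lia).
    rewrite Cmod_R, Rabs_right by (left; apply Rinv_0_lt_compat; auto).
    rewrite <- (Rinv_inv eps). apply Rinv_lt_contravar.
    - apply Rmult_lt_0_compat; auto. apply Rinv_0_lt_compat; auto.
    - apply le_INR in Hn. rewrite S_INR. lra. }
  assert (L3 : clim (fun n => rgseq s (S n)) (rg s)).
  { intros eps He. destruct (rg_lim s eps He) as [n0 H0]. exists n0. intros; apply H0; lia. }
  assert (L4 := clim_mult _ _ _ _ L3 L2).
  replace (rg s * 1)%C with (rg s) in L4 by ring.
  apply (clim_unique _ _ _ L4).
  intros eps He. destruct (L1 eps He) as [n0 H0]. exists n0. intros n Hn.
  specialize (H0 (S n) ltac:(lia)).
  replace (rgseq s (S n) * (1 + (s + 1) * RtoC (/ INR (S n))))%C with (s * rgseq (s + 1) (S n))%C; auto.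
  unfold rgseq.
  assert (E : cprod (S (S n)) (fun j => s + 1 + RtoC (INR j))%C =
    cprod (S (S n)) (fun j => s + RtoC (INR (S j)))%C).
  { unfold cprod. f_equal. apply map_ext. intros j. rewrite S_INR, RtoC_plus. ring. }
  assert (E2 := cprod_shift (S (S n)) (fun j => s + RtoC (INR j))%C).
  rewrite cprod_S in E2. simpl (RtoC (INR 0)) in E2.
  rewrite Cmult_plus_distr_r, cexp_plus, Cmult_1_l, cexp_ln by (apply lt_0_INR; lia).
  rewrite E. assert (N1 := INR_S_C_nz n). assert (N2 := fact_C_nz (S n)).
  assert (N3 := cexp_nz (s * RtoC (ln (INR (S n))))).
  replace (s + RtoC 0)%C with s in E2 by ring.
  rewrite RtoC_inv by (apply not_0_INR; lia).
  replace (RtoC (INR (S (S n)))) with (RtoC (INR (S n)) + 1)%C in E2 by (rewrite (S_INR (S n)), RtoC_plus; auto).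
  set (c := cexp (s * RtoC (ln (INR (S n))))) in *. set (F := RtoC (INR (fact (S n)))) in *.
  set (k := RtoC (INR (S n))) in *.
  set (p := cprod (S (S n)) (fun j => s + RtoC (INR j))%C) in *.
  set (q := cprod (S (S n)) (fun j => s + RtoC (INR (S j)))%C) in *.
  transitivity (s * q / (F * (c * k)))%C; [field; repeat split; assumption|].
  rewrite <- E2. field. repeat split; assumption.
Qed.

(** * Euler's Beta integral *)

Definition rlim (F : R -> C) (l : C) : Prop :=
  forall eps, 0 < eps -> exists X0, forall X, X0 <= X -> Cmod (F X - l)%C < eps.

Lemma Cder_pow (f : C -> C) (z c : C) m : Cder f z c ->
  Cder (fun u => f u ^ S m)%C z (RtoC (INR (S m)) * f z ^ m * c)%C.
Proof.
  intros H. induction m as [|m IH].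
  - replace (RtoC (INR 1) * f z ^ 0 * c)%C with c by (simpl; ring).
    apply Cder_ext with (f := f); auto. intros u. simpl. ring.
  - assert (D := Cder_mult _ _ _ _ _ H IH). cbv beta in D.
    replace (RtoC (INR (S (S m))) * f z ^ S m * c)%C with
      (c * f z ^ S m + f z * (RtoC (INR (S m)) * f z ^ m * c))%C.
    2:{ rewrite (S_INR (S m)), RtoC_plus, Cpow_S. ring. }
    apply Cder_ext with (f := fun u => (f u * f u ^ S m)%C); auto.
Qed.

Lemma Cd_pow (f : C -> C) (z : C) m : Cderivable f z -> Cderivable (fun u => f u ^ m)%C z.
Proof.
  intros [c Hc]. destruct m as [|m].
  - simpl. apply Cd_const.
  - exact (Cder_Cderivable _ _ _ (Cder_pow f z c m Hc)).
Qed.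

(** Euler's Beta integral in the variable [x = exp xi]. *)
Definition betaX (m : nat) (s : C) (X : R) : C :=
  cRI (fun x => (1 - cexp (RtoC x)) ^ m * cexp (s * RtoC x))%C (- X) 0.

Lemma Cder_beta_prim (s z : C) m :
  Cder (fun u => (1 - cexp u) ^ S m * cexp (s * u))%C z
    (s * ((1 - cexp z) ^ S m * cexp (s * z)) - RtoC (INR (S m)) * ((1 - cexp z) ^ m * cexp ((s + 1) * z)))%C.
Proof.
  assert (D1 : Cder (fun u => 1 - cexp u)%C z (- cexp z)%C).
  { assert (D := Cder_plus _ _ _ _ _ (Cder_const 1%C z)
       (Cder_mult _ _ _ _ _ (Cder_const (- (1))%C z) (Cder_cexp z))).
    cbv beta in D. replace (0 + (0 * cexp z + - (1) * cexp z))%C with (- cexp z)%C in D by ring.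
    apply (Cder_ext (fun u => 1 + - (1) * cexp u)%C); auto. intros; ring. }
  assert (D2 : Cder (fun u => cexp (s * u))%C z (s * cexp (s * z))%C).
  { assert (D := Cder_comp cexp (fun u => s * u)%C z _ _
       (Cder_mult _ _ _ _ _ (Cder_const s z) (Cder_id z)) (Cder_cexp _)).
    cbv beta in D. replace (cexp (s * z) * (0 * z + s * 1))%C with (s * cexp (s * z))%C in D by ring.
    exact D. }
  assert (D := Cder_mult _ _ _ _ _ (Cder_pow _ _ _ m D1) D2). cbv beta in D.
  match type of D with Cder _ _ ?e => match goal with |- Cder _ _ ?e' => replace e' with e; auto end end.
  replace ((s + 1) * z)%C with (s * z + z)%C by ring. rewrite cexp_plus. ring.
Qed.

Lemma beta_rcont m s x : rcont (fun x => (1 - cexp (RtoC x)) ^ m * cexp (s * RtoC x))%C x.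
Proof.
  apply (rcont_comp (fun z => (1 - cexp z) ^ m * cexp (s * z))%C (fun t => RtoC t)); [rcontin|].
  apply Cd_mult; [|cderiv]. apply Cd_pow. cderiv.
Qed.

(** Integration by parts with the primitive of [Cder_beta_prim]. The boundary term at 0 vanishes
    because the power is positive; the one at [- X] is kept and disappears in the limit. *)
Lemma betaX_rec m s X : 0 <= X ->
  (s * betaX (S m) s X = RtoC (INR (S m)) * betaX m (s + 1) X
     - (1 - cexp (RtoC (- X))) ^ S m * cexp (s * RtoC (- X)))%C.
Proof.
  intros HX. unfold betaX. rewrite <- !cRI_scal by (try lra; intros; apply beta_rcont).
  assert (E := cRI_FTC (fun t => (1 - cexp (0 + RtoC t * 1)) ^ S m * cexp (s * (0 + RtoC t * 1)))%C
    (fun x => s * ((1 - cexp (RtoC x)) ^ S m * cexp (s * RtoC x))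
      - RtoC (INR (S m)) * ((1 - cexp (RtoC x)) ^ m * cexp ((s + 1) * RtoC x)))%C (- X) 0 ltac:(lra)).
  rewrite cRI_minus in E; try lra; try (intros; apply rcont_mult; [apply rcont_const|apply beta_rcont]).
  match type of E with _ -> _ -> (?a - ?b = ?c)%C => assert (E' : (a = b + c)%C) end.
  { rewrite <- E.
    - ring.
    - intros x _.
      assert (D := rder_comp _ 0%C 1%C x _ (Cder_beta_prim s (0 + RtoC x * 1)%C m)).
      replace (0 + RtoC x * 1)%C with (RtoC x) in D by ring. rewrite Cmult_1_l in D. exact D.
    - intros x _. apply rcont_minus; (apply rcont_mult; [apply rcont_const|apply beta_rcont]). }
  rewrite E'. replace (0 + 0 * 1)%C with (RtoC 0) by ring.
  replace (0 + RtoC (- X) * 1)%C with (RtoC (- X)) by ring. rewrite cexp_0.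
  replace (1 - 1)%C with (RtoC 0) by ring. rewrite (Cpow_S (RtoC 0)). ring.
Qed.

Lemma betaX_0 s X : 0 <= X -> (s * betaX 0 s X = 1 - cexp (s * RtoC (- X)))%C.
Proof.
  intros HX. unfold betaX. rewrite <- cRI_scal by (try lra; intros; apply beta_rcont).
  rewrite (cRI_FTC (fun t => cexp (0 + RtoC t * s))%C); [|lra| |].
  - replace (0 + 0 * s)%C with (RtoC 0) by ring. rewrite cexp_0. do 2 f_equal. ring.
  - intros x _. assert (D := rder_comp cexp 0%C s x _ (Cder_cexp _)).
    replace (s * ((1 - cexp x) ^ 0 * cexp (s * x)))%C with (s * cexp (0 + x * s))%C; auto.
    simpl. rewrite Cmult_1_l. do 2 f_equal. ring.
  - intros x _. apply rcont_mult; [apply rcont_const|apply beta_rcont].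
Qed.

Lemma rlim_const c : rlim (fun _ => c) c.
Proof.
  intros eps He. exists 0. intros. replace (c - c)%C with (RtoC 0) by ring. rewrite Cmod_0; auto.
Qed.

Lemma rlim_plus F G a b : rlim F a -> rlim G b -> rlim (fun X => F X + G X)%C (a + b)%C.
Proof.
  intros HF HG eps He. destruct (HF (eps / 2)) as [X1 H1]; [lra|].
  destruct (HG (eps / 2)) as [X2 H2]; [lra|]. exists (Rmax X1 X2). intros X HX.
  assert (M1 := Rmax_l X1 X2). assert (M2 := Rmax_r X1 X2).
  specialize (H1 X ltac:(lra)). specialize (H2 X ltac:(lra)).
  replace (F X + G X - (a + b))%C with ((F X - a) + (G X - b))%C by ring.
  eapply Rle_lt_trans; [apply Cmod_triangle|]. lra.
Qed.

Lemma rlim_scal c F a : rlim F a -> rlim (fun X => c * F X)%C (c * a)%C.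
Proof.
  intros HF eps He. destruct (Cd_cont (fun z => c * z)%C a ltac:(cderiv) eps He) as [d [Hd H]].
  destruct (HF d Hd) as [X1 H1]. exists X1. intros X HX. apply H; auto.
Qed.

Lemma rlim_ext F G a : (forall X, 0 <= X -> F X = G X) -> rlim F a -> rlim G a.
Proof.
  intros E HF eps He. destruct (HF eps He) as [X1 H1]. exists (Rmax X1 0). intros X HX.
  assert (M1 := Rmax_l X1 0). assert (M2 := Rmax_r X1 0). rewrite <- E by lra. apply H1; lra.
Qed.

Lemma rlim_decay F tau : 0 < tau -> (forall X, 0 <= X -> Cmod (F X) <= exp (- (tau * X))) -> rlim F 0%C.
Proof.
  intros Ht H eps He. destruct (exp_small tau eps Ht He) as [X0 [P0 H0]].
  exists X0. intros X HX. replace (F X - 0)%C with (F X) by ring.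
  eapply Rle_lt_trans; [apply H; lra|auto].
Qed.

Lemma Re_pos_nz (s : C) : 0 < Re s -> s <> 0%C.
Proof. intros H ->. simpl in H. lra. Qed.

Lemma cprod_nz n (f : nat -> C) : (forall j, (j < n)%nat -> f j <> 0%C) -> cprod n f <> 0%C.
Proof.
  induction n as [|n IH]; intros H.
  - unfold cprod; simpl. apply C1_nz.
  - rewrite cprod_S. apply Cmult_neq_0; [apply IH; intros; apply H; lia|apply H; lia].
Qed.

Lemma cprod_ext n (f g : nat -> C) : (forall j, (j < n)%nat -> f j = g j) -> cprod n f = cprod n g.
Proof.
  induction n as [|n IH]; intros H; [reflexivity|]. rewrite !cprod_S. f_equal; auto.
Qed.

Lemma cprod_shifted_nz n (s : C) : 0 < Re s -> cprod n (fun j => s + RtoC (INR j))%C <> 0%C.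
Proof.
  intros Hs. apply cprod_nz. intros j _. apply Re_pos_nz. rewrite re_plus, re_RtoC.
  assert (Z := pos_INR j). lra.
Qed.

Lemma betaX_lim m : forall s, 0 < Re s ->
  rlim (betaX m s) (RtoC (INR (fact m)) / cprod (S m) (fun j => s + RtoC (INR j)))%C.
Proof.
  assert (Hdec : forall s X, Cmod (cexp (s * RtoC (- X)))%C = exp (- (Re s * X))).
  { intros s X. rewrite Cmod_cexp, re_scal_r. f_equal. ring. }
  induction m as [|m IH]; intros s Hs; assert (Hs0 := Re_pos_nz s Hs).
  - rewrite cprod_S. unfold cprod. simpl.
    replace (1 / (1 * (s + 0)))%C with (/ s * (1 + - (1) * 0))%C by (field; auto).
    apply rlim_ext with (fun X => / s * (1 + - (1) * cexp (s * RtoC (- X))))%C.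
    + intros X HX.
      replace (1 + - (1) * cexp (s * (- X)%R))%C with (1 - cexp (s * (- X)%R))%C by ring.
      rewrite <- betaX_0 by auto. field. auto.
    + apply rlim_scal, rlim_plus; [apply rlim_const|]. apply rlim_scal.
      apply rlim_decay with (Re s); auto. intros X HX. rewrite Hdec. lra.
  - assert (Hs1 : 0 < Re (s + 1)%C) by (rewrite re_plus, re_RtoC; lra).
    specialize (IH (s + 1)%C Hs1).
    assert (Ep : cprod (S (S m)) (fun j => s + RtoC (INR j))%C =
      (s * cprod (S m) (fun j => s + 1 + RtoC (INR j)))%C).
    { rewrite cprod_shift. f_equal; [simpl; ring|]. apply cprod_ext. intros j _.
      rewrite S_INR, RtoC_plus. ring. }
    rewrite Ep. rewrite fact_simpl, mult_INR, RtoC_mult.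
    assert (Hp := cprod_shifted_nz (S m) (s + 1)%C Hs1).
    set (p := cprod (S m) (fun j => s + 1 + RtoC (INR j))%C) in *.
    replace (RtoC (INR (S m)) * RtoC (INR (fact m)) / (s * p))%C with
      (/ s * (RtoC (INR (S m)) * (RtoC (INR (fact m)) / p) + - (1) * 0))%C by (field; auto).
    apply rlim_ext with (fun X => / s * (RtoC (INR (S m)) * betaX m (s + 1) X
        + - (1) * ((1 - cexp (RtoC (- X))) ^ S m * cexp (s * RtoC (- X)))))%C.
    + intros X HX.
      match goal with |- (/ s * ?a = _)%C => replace a with (s * betaX (S m) s X)%C end.
      * field; auto.
      * rewrite betaX_rec by auto. ring.
    + apply rlim_scal, rlim_plus; [apply rlim_scal; auto|]. apply rlim_scal.
      apply rlim_decay with (Re s); auto. intros X HX. rewrite Cmod_mult, Hdec, Cmod_pow.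
      rewrite <- (Rmult_1_l (exp (- (Re s * X)))) at 2.
      apply Rmult_le_compat_r; [left; apply exp_pos|].
      apply Rle_trans with (1 ^ S m); [|rewrite pow1; lra]. apply pow_incr. split; [apply Cmod_ge_0|].
      rewrite cexp_RtoC, <- RtoC_minus, Cmod_R.
      assert (P := exp_pos (- X)). assert (exp (- X) <= 1) by (rewrite <- exp_0; apply exp_le_mono; lra).
      rewrite Rabs_right by lra. lra.
Qed.

(** The integrand of [exp (- u w) u^(s-1) du] in the logarithmic variable [u = exp z]; for [w = 1]
    it is Euler's integrand for [Gamma(s)]. *)
Definition phi (s w z : C) : C := (cexp (- cexp z * w) * cexp (s * z))%C.

Lemma phi_Cd s w z : Cderivable (phi s w) z.
Proof. unfold phi. cderiv. Qed.

Lemma Re_cexp_mult x y w : Re (cexp (cpt x y) * w)%C = exp x * Re (cexp (Ci * RtoC y) * w)%C.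
Proof.
  unfold cpt. rewrite cexp_plus, cexp_RtoC, <- Cmult_assoc, re_scal_l. reflexivity.
Qed.

Lemma Cmod_phi s w x y : Cmod (phi s w (cpt x y)) =
  exp (- (exp x * Re (cexp (Ci * RtoC y) * w)%C)) * (exp (Re s * x) * exp (- (Im s * y))).
Proof.
  unfold phi. rewrite Cmod_mult, !Cmod_cexp. f_equal; [|rewrite <- exp_plus]; f_equal.
  - rewrite <- Re_cexp_mult.
    replace (- cexp (cpt x y) * w)%C with (- (cexp (cpt x y) * w))%C by ring. apply re_opp.
  - rewrite re_mult, Re_cpt, Im_cpt. ring.
Qed.

Lemma bernoulli_neg (y : R) n : 0 <= y <= 1 -> 1 - INR n * y <= (1 - y) ^ n.
Proof.
  intros Hy. induction n as [|n IH]; [simpl; lra|]. rewrite S_INR. simpl pow.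
  assert (P := pos_INR n). assert ((1 - y) * (1 - INR n * y) <= (1 - y) * (1 - y) ^ n)
    by (apply Rmult_le_compat_l; lra). assert (0 <= INR n * (y * y)) by (apply Rmult_le_pos; nra). nra.
Qed.

(** With [t = x / n], the upper bound [1 - t <= exp (- t)] and the lower bound
    [exp (- t) (1 - t^2) <= 1 - t] are raised to the power [n]; Bernoulli's inequality then bounds
    [(1 - t^2)^n] from below by [1 - n t^2]. *)
Lemma exp_approx (x : R) n : (0 < n)%nat -> 0 <= x <= INR n ->
  Rabs (exp (- x) - (1 - x / INR n) ^ n) <= x * x * exp (- x) / INR n.
Proof.
  intros Hn Hx. assert (Pn : 0 < INR n) by (apply lt_0_INR; auto).
  set (t := x / INR n). assert (Et : INR n * t = x) by (unfold t; field; lra).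
  assert (Ht : 0 <= t <= 1).
  { unfold t. split; [apply Rmult_le_pos; [lra|left; apply Rinv_0_lt_compat; auto]|].
    apply Rmult_le_reg_r with (INR n); auto. unfold Rdiv. rewrite Rmult_assoc, Rinv_l; lra. }
  assert (Ee : exp (- x) = exp (- t) ^ n) by (rewrite exp_pow; f_equal; rewrite <- Et; ring).
  assert (U : (1 - t) ^ n <= exp (- x)).
  { rewrite Ee. apply pow_incr. assert (L := exp_ineq1_le (- t)). lra. }
  assert (L : exp (- x) * (1 - INR n * (t * t)) <= (1 - t) ^ n).
  { apply Rle_trans with (exp (- x) * (1 - t * t) ^ n).
    - apply Rmult_le_compat_l; [left; apply exp_pos|]. apply bernoulli_neg. nra.
    - rewrite Ee, <- Rpow_mult_distr. apply pow_incr. split.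
      + apply Rmult_le_pos; [left; apply exp_pos|nra].
      + assert (Q := exp_ineq1_le t). assert (P := exp_pos (- t)).
        assert (exp (- t) * (1 + t) <= 1).
        { apply Rle_trans with (exp (- t) * exp t); [apply Rmult_le_compat_l; lra|].
          rewrite <- exp_plus, Rplus_opp_l, exp_0. lra. }
        replace (exp (- t) * (1 - t * t)) with (exp (- t) * (1 + t) * (1 - t)) by ring.
        nra. }
  rewrite Rabs_right by lra.
  replace (x * x * exp (- x) / INR n) with (exp (- x) * (INR n * (t * t))).
  - lra.
  - rewrite <- Et at 2 3. field. lra.
Qed.

Lemma cRI_dom_bound f K tau A B : 0 < tau -> 0 <= K -> 0 <= A -> 0 <= B ->
  (forall x, rcont f x) -> (forall x, - A <= x <= B -> Cmod (f x) <= K * exp (- (tau * Rabs x))) ->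
  Cmod (cRI f (- A) B) <= 2 * K / tau.
Proof.
  intros Ht HK HA HB Hc Hd.
  rewrite (cRI_chasles f (- A) 0 B) by (auto; lra).
  eapply Rle_trans; [apply Cmod_triangle|].
  replace (2 * K / tau) with (K / tau * exp (tau * 0) + K / tau * exp (- (tau * 0)))
    by (rewrite Rmult_0_r, Ropp_0, exp_0; field; lra).
  apply Rplus_le_compat.
  - apply cRI_tail_left; auto; try lra. intros x Hx. specialize (Hd x ltac:(lra)).
    rewrite Rabs_left1 in Hd by lra. replace (- (tau * - x)) with (tau * x) in Hd by ring. auto.
  - apply cRI_tail_right; auto; try lra. intros x Hx. specialize (Hd x ltac:(lra)).
    rewrite Rabs_right in Hd by lra. auto.
Qed.

Lemma phi1_real s x : phi s 1 (RtoC x) = (RtoC (exp (- exp x)) * cexp (s * RtoC x))%C.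
Proof.
  unfold phi. f_equal. rewrite cexp_RtoC.
  replace (- RtoC (exp x) * 1)%C with (RtoC (- exp x)) by (rewrite RtoC_opp; ring).
  apply cexp_RtoC.
Qed.

Lemma Cmod_cexp_real s x : Cmod (cexp (s * RtoC x)) = exp (Re s * x).
Proof. rewrite Cmod_cexp, re_scal_r. reflexivity. Qed.

Lemma cpt_0 x : cpt x 0 = RtoC x.
Proof. unfold cpt. ring. Qed.

(** The inverse of the Gauss term is the integral of [(1 - u/n)^n u^(s-1)] over [[0, n]]. It differs
    from Euler's integral by the tail beyond [n] and by the error of [exp_approx], both of which
    tend to 0. *)
Theorem rg_Gamma s : 0 < Re s -> (rg s * LI (fun x => phi s 1 (RtoC x)) = 1)%C.
Proof.
  intros Hs. set (sg := Re s) in *.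
  set (tau := Rmin sg 1). assert (Ht : 0 < tau <= 1) by (unfold tau; split; [apply Rmin_pos; lra|apply Rmin_r]).
  assert (Htau : tau <= sg) by apply Rmin_l.
  destruct (dom_line 0 (sg + 2) 1 tau) as [K [HK Hdom]]; try lra.
  assert (HcP : forall x, rcont (fun x => phi s 1 (RtoC x)) x).
  { intros x. apply (rcont_comp (phi s 1%C) (fun t => RtoC t)); [rcontin|apply phi_Cd]. }
  assert (HdP : dom (fun x => phi s 1 (RtoC x)) K tau).
  { intros x. rewrite phi1_real, Cmod_mult, Cmod_cexp_real, Cmod_R, Rabs_right by (left; apply exp_pos).
    specialize (Hdom sg x ltac:(simpl; lra)). simpl in Hdom. fold sg.
    rewrite Rmult_1_l, Rmult_comm, (Rmult_1_l (exp x)) in Hdom. exact Hdom. }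
  set (I := LI (fun x => phi s 1 (RtoC x))).
  set (e := fun n => (RtoC (INR (fact n)) * cexp (s * RtoC (ln (INR n))) / cprod (S n) (fun j => s + RtoC (INR j)))%C).
  assert (Hp := fun n => cprod_shifted_nz n s Hs).
  assert (Hre : forall n, (rgseq s n * e n = 1)%C).
  { intros n. unfold rgseq, e. specialize (Hp (S n)).
    assert (N2 := fact_C_nz n). assert (N3 := cexp_nz (s * RtoC (ln (INR n)))). field. auto. }
  set (Q := K / tau). assert (HQ : 0 <= Q) by (apply Rmult_le_pos; [auto|left; apply Rinv_0_lt_compat; lra]).
  assert (Key : forall n, (0 < n)%nat -> Cmod (I - e n)%C <= Q * exp (- (tau * ln (INR n))) + 2 * Q * / INR n).
  { intros n Hn. assert (Pn : 1 <= INR n) by (apply (le_INR 1); auto).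
    set (l := ln (INR n)).
    assert (Hl : 0 <= l).
    { unfold l. rewrite <- ln_1. apply ln_le; lra. }
    assert (El : exp l = INR n) by (apply exp_ln; lra).
    set (h := fun x => ((1 - cexp (RtoC x) / RtoC (INR n)) ^ n * cexp (s * RtoC x))%C).
    assert (Hnz : RtoC (INR n) <> 0%C) by (intros E; apply RtoC_inj in E; lra).
    assert (Hch : forall x, rcont h x).
    { intros x. apply (rcont_comp (fun z => (1 - cexp z / RtoC (INR n)) ^ n * cexp (s * z))%C (fun t => RtoC t)); [rcontin|].
      apply Cd_mult; [|cderiv]. apply Cd_pow. apply Cd_minus; [cderiv|].
      apply Cd_div; auto; cderiv. }
    assert (Hdiff : forall x, x <= l -> Cmod (phi s 1 (RtoC x) - h x)%C <= K * / INR n * exp (- (tau * Rabs x))).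
    { intros x Hx.
      assert (Hex : 0 <= exp x <= INR n).
      { split; [left; apply exp_pos|]. rewrite <- El. apply exp_le_mono; auto. }
      assert (A := exp_approx (exp x) n Hn Hex).
      rewrite phi1_real. unfold h. rewrite cexp_RtoC.
      replace (1 - RtoC (exp x) / RtoC (INR n))%C with (RtoC (1 - exp x / INR n))
        by (rewrite RtoC_minus, RtoC_div by lra; reflexivity).
      rewrite <- RtoC_pow.
      replace (RtoC (exp (- exp x)) * cexp (s * x) - RtoC ((1 - exp x / INR n) ^ n) * cexp (s * x))%C
        with (RtoC (exp (- exp x) - (1 - exp x / INR n) ^ n) * cexp (s * x))%C by (rewrite RtoC_minus; ring).
      rewrite Cmod_mult, Cmod_cexp_real, Cmod_R. fold sg.
      apply Rle_trans with (exp x * exp x * exp (- exp x) / INR n * exp (sg * x)).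
      { apply Rmult_le_compat_r; [left; apply exp_pos|auto]. }
      (* The factor [u^2] in [exp_approx] raises the exponent by 2, so domination at [sg + 2] is
         needed; this is why [Hdom] was requested up to that exponent. *)
      specialize (Hdom (sg + 2) x ltac:(simpl; lra)). simpl in Hdom.
      replace ((sg + 2) * x) with (x + x + sg * x) in Hdom by ring.
      rewrite !exp_plus, Rmult_1_l, (Rmult_1_l (exp x)) in Hdom.
      apply Rmult_le_compat_r with (r := / INR n) in Hdom; [|left; apply Rinv_0_lt_compat; lra].
      replace (exp x * exp x * exp (- exp x) / INR n * exp (sg * x)) with
        (exp x * exp x * exp (sg * x) * exp (- exp x) * / INR n) by (unfold Rdiv; ring).
      lra. }
    assert (Hbeta := betaX_lim n s Hs).
    (* The substitution [u = n v] is the translation by [l = ln n] in the logarithmic variable, and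
       turns the truncated integral into a Beta integral times [n^s]. *)
    assert (Eh : forall X, 0 <= X -> cRI h (- (X - l)) l = (cexp (s * RtoC l) * betaX n s X)%C).
    { intros X HX. replace (- (X - l)) with (- X + l) by ring. replace l with (0 + l) at 2 by ring.
      rewrite <- cRI_shift by (auto; lra). unfold betaX.
      rewrite <- cRI_scal by (try lra; intros; apply beta_rcont).
      apply cRI_ext; [lra|]. intros x _. unfold h.
      rewrite RtoC_plus, cexp_plus, cexp_RtoC, (cexp_RtoC l), El, Cmult_plus_distr_l, cexp_plus.
      replace (RtoC (exp x) * RtoC (INR n) / RtoC (INR n))%C with (RtoC (exp x)) by (field; auto). ring. }
    apply le_epsilon. intros eps He.
    assert (Hen : rlim (fun X => cexp (s * RtoC l) * betaX n s X)%C (e n)).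
    { replace (e n) with (cexp (s * RtoC l) * (RtoC (INR (fact n)) / cprod (S n) (fun j => s + RtoC (INR j))))%C.
      - apply rlim_scal; auto.
      - unfold e. fold l. specialize (Hp (S n)). field; auto. }
    destruct (Hen (eps / 2)) as [X1 H1]; [lra|].
    destruct (exp_small tau (eps / 2 / (Q + 1))) as [X2 [HX2 H2]]; [lra|repeat apply div_pos; lra|].
    set (Y := Rmax (Rmax X1 X2) l).
    assert (Y1 : X1 <= Y) by (eapply Rle_trans; [apply Rmax_l|apply Rmax_l]).
    assert (Y2 : X2 <= Y) by (eapply Rle_trans; [apply Rmax_r|apply Rmax_l]).
    assert (Y3 : l <= Y) by apply Rmax_r.
    specialize (H1 (Y + l) ltac:(lra)). specialize (H2 Y Y2).
    rewrite <- Eh in H1 by lra. replace (Y + l - l) with Y in H1 by ring.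
    assert (A1 := LI_approx _ K tau Y l (proj1 Ht) HcP HdP ltac:(lra) Hl). fold I in A1.
    assert (A2 : Cmod (cRI (fun x => phi s 1 (RtoC x)) (- Y) l - cRI h (- Y) l)%C <= 2 * (K * / INR n) / tau).
    { rewrite <- cRI_minus by (auto; lra). apply cRI_dom_bound; try lra.
      - apply Rmult_le_pos; auto. left; apply Rinv_0_lt_compat; lra.
      - intros x. apply rcont_minus; auto.
      - intros x Hx. apply Hdiff; lra. }
    replace (I - e n)%C with ((I - cRI (fun x => phi s 1 (RtoC x)) (- Y) l)
      + (cRI (fun x => phi s 1 (RtoC x)) (- Y) l - cRI h (- Y) l) + (cRI h (- Y) l - e n))%C by ring.
    eapply Rle_trans; [apply Cmod_triangle|].
    eapply Rle_trans; [apply Rplus_le_compat_r, Cmod_triangle|].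
    replace (2 * (K * / INR n) / tau) with (2 * Q * / INR n) in A2 by (unfold Q; field; lra).
    fold Q in A1. fold l.
    assert (Q * exp (- (tau * Y)) <= eps / 2).
    { apply Rle_trans with ((Q + 1) * (eps / 2 / (Q + 1))); [|right; field; lra].
      apply Rmult_le_compat; try lra. left; apply exp_pos. }
    rewrite Rmult_plus_distr_l in A1. lra. }
  destruct (rgseq_growth (Cmod s + 1)) as [n0 [B [Hn0 [HB Hg]]]]; [assert (Z := Cmod_ge_0 s); lra|].
  apply (clim_unique (fun n => rgseq s n * I)%C).
  - apply (clim_mult _ (fun _ => I)); [apply rg_lim|apply clim_const].
  - intros eps He.
    set (d := eps / (B + 1) / (4 * Q + 1)).
    assert (Hd : 0 < d) by (unfold d; repeat apply div_pos; lra).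
    destruct (exp_small tau d) as [X [HX0 HX]]; [lra|auto|].
    destruct (INR_up (exp X)) as [n1 [_ Hn1]]. destruct (INR_up (/ d)) as [n2 [Hn2' Hn2]].
    exists (max n0 (max n1 n2)). intros n Hn.
    assert (Hnp : (0 < n)%nat) by lia. assert (Pn : 0 < INR n) by (apply lt_0_INR; auto).
    rewrite <- (Hre n). replace (rgseq s n * I - rgseq s n * e n)%C with (rgseq s n * (I - e n))%C by ring.
    rewrite Cmod_mult. destruct (Hg s ltac:(lra) n ltac:(lia)) as [G _]. specialize (Key n Hnp).
    assert (L1 : exp (- (tau * ln (INR n))) < d).
    { apply HX. rewrite <- (ln_exp X). apply ln_le; [apply exp_pos|].
      eapply Rle_trans; [exact Hn1|]. apply le_INR; lia. }
    assert (L2 : / INR n <= d).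
    { rewrite <- (Rinv_inv d). apply Rinv_le_contravar; [apply Rinv_0_lt_compat; auto|].
      eapply Rle_trans; [exact Hn2|]. apply le_INR; lia. }
    assert (T : Cmod (I - e n)%C <= 3 * Q * d).
    { eapply Rle_trans; [exact Key|]. assert (Q * exp (- (tau * ln (INR n))) <= Q * d) by (apply Rmult_le_compat_l; lra).
      assert (Q * / INR n <= Q * d) by (apply Rmult_le_compat_l; lra). lra. }
    apply Rle_lt_trans with (B * (3 * Q * d)); [apply Rmult_le_compat; auto using Cmod_ge_0|].
    assert (E1 : d * (4 * Q + 1) * (B + 1) = eps) by (unfold d; field; lra).
    assert (0 <= B * d) by nra. assert (0 <= Q * d) by nra. assert (0 <= B * (Q * d)) by nra. nra.
Qed.

(** * Complex powers as Gamma integrals *)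

Lemma cexp_Clog w : 0 < Re w -> cexp (Clog w) = w.
Proof.
  intros Hw. destruct w as [x y]. unfold Re in Hw; simpl in Hw.
  unfold Clog, Carg. unfold Re at 1; simpl fst. destruct (Rlt_dec 0 x) as [_|N]; [|lra].
  unfold cexp. unfold Re, Im; simpl.
  assert (Hm : 0 < Cmod (x, y)).
  { apply Cmod_gt_0. intros E. injection E. intros; lra. }
  rewrite exp_ln by auto. rewrite cos_atan, sin_atan.
  assert (E : Cmod (x, y) = x * sqrt (1 + (y / x)²)).
  { unfold Cmod; simpl. rewrite !Rmult_1_r.
    replace (x * x + y * y) with (x * x * (1 + (y / x)²)) by (unfold Rsqr; field; lra).
    rewrite sqrt_mult; [|nra|unfold Rsqr; nra]. rewrite sqrt_square by lra. reflexivity. }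
  rewrite E. assert (S0 : 0 < sqrt (1 + (y / x)²)) by (apply sqrt_lt_R0; unfold Rsqr; nra).
  f_equal; field; lra.
Qed.

Lemma Im_Clog_bound w : 0 < Re w -> - (PI / 2) < Im (Clog w) < PI / 2.
Proof.
  intros Hw. unfold Clog, Carg. destruct (Rlt_dec 0 (Re w)); [|lra].
  assert (B := atan_bound (Im w / Re w)). unfold Im at 1 3; simpl. lra.
Qed.

(** Multiplication of [u] by [w] is translation by [Clog w] in the logarithmic variable. The real
    part is an ordinary shift, the imaginary part moves the line of integration to height [t]. *)
Theorem cpow_integral s w : 0 < Re s -> 0 < Re w ->
  isLI (fun x => phi s w (RtoC x)) (cexp (- s * Clog w) * LI (fun x => phi s 1 (RtoC x)))%C.
Proof.
  intros Hs Hw. set (sg := Re s) in *.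
  assert (Ew := cexp_Clog w Hw). assert (Hi := Im_Clog_bound w Hw).
  set (v := Re (Clog w)). set (t := Im (Clog w)) in *.
  assert (El : Clog w = cpt v t) by (symmetry; apply cpt_ReIm).
  set (tau := Rmin sg 1). assert (Ht : 0 < tau <= 1) by (unfold tau; split; [apply Rmin_pos; lra|apply Rmin_r]).
  assert (Htau : tau <= sg) by apply Rmin_l.
  set (y1 := Rmin 0 t). set (y2 := Rmax 0 t).
  assert (Hy : y1 <= 0 <= y2 /\ y1 <= t <= y2).
  { unfold y1, y2. assert (A1 := Rmin_l 0 t). assert (A2 := Rmin_r 0 t).
    assert (A3 := Rmax_l 0 t). assert (A4 := Rmax_r 0 t). lra. }
  assert (Hct : 0 < cos t) by (apply cos_gt_0; lra).
  (* On the strip between heights 0 and [t] the cosine stays above [cos t > 0], because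
     [|t| < pi / 2]; this gives one decay constant for all intermediate lines. *)
  assert (Hcos : forall y, y1 <= y <= y2 -> cos t <= cos y).
  { intros y Hyy. unfold y1, y2 in Hyy. destruct (Rle_dec 0 t) as [P|P].
    - rewrite Rmin_left, Rmax_right in Hyy by lra.
      destruct (Req_dec y t) as [->|]; [lra|]. left. apply cos_decreasing_1; lra.
    - rewrite Rmin_right, Rmax_left in Hyy by lra.
      rewrite <- (cos_neg t), <- (cos_neg y).
      destruct (Req_dec y t) as [->|]; [lra|]. left. apply cos_decreasing_1; lra. }
  destruct (dom_line 0 sg (cos t) tau) as [K [HK Hdom]]; try lra.
  set (K' := K * exp (Rabs (Im s) * PI)).
  assert (Hd : forall y, y1 <= y <= y2 -> dom (fun x => phi s 1 (cpt x y)) K' tau).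
  { intros y Hyy x. rewrite Cmod_phi. fold sg.
    replace (Re (cexp (Ci * RtoC y) * 1)%C) with (cos y).
    2:{ rewrite Cmult_1_r. replace (Ci * RtoC y)%C with (cpt 0 y) by (unfold cpt; ring).
        rewrite cpt_pair. unfold cexp, Re, Im; simpl. rewrite exp_0. ring. }
    specialize (Hdom sg x ltac:(simpl; lra)). simpl in Hdom. rewrite Rmult_1_l in Hdom.
    apply Rle_trans with ((exp (sg * x) * exp (- (cos t * exp x))) * exp (Rabs (Im s) * PI)).
    - rewrite <- Rmult_assoc. apply Rmult_le_compat.
      + apply Rmult_le_pos; left; apply exp_pos.
      + left; apply exp_pos.
      + rewrite Rmult_comm. apply Rmult_le_compat_l; [left; apply exp_pos|].
        apply exp_le_mono. specialize (Hcos y Hyy). assert (P := exp_pos x). nra.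
      + apply exp_le_mono. eapply Rle_trans; [apply Rle_abs|]. rewrite Rabs_Ropp, Rabs_mult.
        apply Rmult_le_compat_l; [apply Rabs_pos|]. apply Rabs_le.
        unfold y1, y2 in Hyy. assert (A1 := Rmin_glb 0 t (- PI)). assert (A2 := Rmax_lub 0 t PI).
        assert (PP := PI_RGT_0). specialize (A1 ltac:(lra) ltac:(lra)). specialize (A2 ltac:(lra) ltac:(lra)). lra.
    - unfold K'. assert (P := exp_pos (Rabs (Im s) * PI)). nra. }
  assert (Hc : forall y x, rcont (fun x => phi s 1 (cpt x y)) x) by (intros; apply rcont_cpt_x, phi_Cd).
  assert (EL : LI (fun x => phi s 1 (cpt x t)) = LI (fun x => phi s 1 (RtoC x))).
  { transitivity (LI (fun x => phi s 1 (cpt x y1))).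
    - symmetry. apply (LI_line_shift (phi s 1%C) K' tau); try lra.
      + intros; apply phi_Cd. + intros; apply Hd; lra.
    - transitivity (LI (fun x => phi s 1 (cpt x 0))).
      + apply (LI_line_shift (phi s 1%C) K' tau); try lra.
        * intros; apply phi_Cd. * intros; apply Hd; lra.
      + f_equal. apply functional_extensionality. intros x. rewrite cpt_0. reflexivity. }
  rewrite <- EL.
  apply isLI_ext with (fun x => cexp (- s * Clog w) * phi s 1 (cpt (x + v) t))%C.
  - intros x. unfold phi.
    assert (E : cpt (x + v) t = (RtoC x + Clog w)%C) by (rewrite El; unfold cpt; rewrite RtoC_plus; ring).
    rewrite E, cexp_plus, Ew.
    replace (s * (RtoC x + Clog w))%C with (s * RtoC x + s * Clog w)%C by ring. rewrite cexp_plus.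
    replace (- s * Clog w)%C with (- (s * Clog w))%C by ring. rewrite cexp_opp.
    replace (- (cexp x * w) * 1)%C with (- cexp x * w)%C by ring.
    field. apply cexp_nz.
  - apply isLI_scal.
    + intros x. apply (rcont_ext (fun x => phi s 1 (RtoC x + cpt v t))%C).
      * intros u. f_equal. unfold cpt. rewrite RtoC_plus. ring.
      * apply (rcont_comp (phi s 1%C) (fun u => RtoC u + cpt v t)%C); [rcontin|apply phi_Cd].
    + apply (LI_shift (fun x => phi s 1 (cpt x t)) K' tau v); [lra|intros; apply Hc|apply Hd; lra].
Qed.

Lemma cpow_rg s w : 0 < Re s -> 0 < Re w ->
  isLI (fun x => rg s * phi s w (RtoC x))%C (cpow w (- s)%C).
Proof.
  intros Hs Hw. unfold cpow.
  replace (cexp (- s * Clog w)) with (rg s * (cexp (- s * Clog w) * LI (fun x => phi s 1 (RtoC x))))%C.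
  - apply isLI_scal; [|apply cpow_integral; auto].
    intros x. apply (rcont_comp (phi s w) (fun t => RtoC t)); [rcontin|apply phi_Cd].
  - rewrite (Cmult_comm (cexp _)), Cmult_assoc, rg_Gamma by auto. ring.
Qed.

(** * Estimates for the integrand *)

Definition den (u a : C) (t : R) : C := (1 - ee (RtoC t) * cexp (- u * a))%C.

Lemma FN_cprod N u w a th : FN N u w a th =
  (cexp (- u * w) * cprod N (fun j => / den u (a (S j)) (th (S j))))%C.
Proof. unfold FN, cprod, den. rewrite <- seq_shift, map_map. reflexivity. Qed.

Lemma Cmod_ee t : Cmod (ee (RtoC t)) = 1.
Proof.
  unfold ee. rewrite Cmod_cexp. rewrite <- exp_0. f_equal.
  unfold Re, Ci, RtoC, Cmult; simpl. ring.
Qed.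

Lemma ee_plus a b : ee (a + b)%C = (ee a * ee b)%C.
Proof. unfold ee. rewrite <- cexp_plus. f_equal. ring. Qed.

Lemma ee_0 : ee 0%C = 1%C.
Proof. unfold ee. rewrite Cmult_0_r. apply cexp_0. Qed.

Lemma ee_1 : ee 1%C = 1%C.
Proof.
  unfold ee, cexp. unfold Re, Im, Ci, RtoC, Cmult; simpl.
  match goal with |- (exp ?x * cos ?y, exp ?x' * sin ?y') = _ =>
    replace x with 0 by ring; replace y with (2 * PI) by ring end.
  rewrite exp_0, cos_2PI, sin_2PI. f_equal; ring.
Qed.

Lemma ee_nat n : ee (RtoC (INR n)) = 1%C.
Proof.
  induction n as [|n IH]; [apply ee_0|]. rewrite S_INR, RtoC_plus, ee_plus, IH, ee_1. ring.
Qed.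

Lemma ee_IZR k : ee (RtoC (IZR k)) = 1%C.
Proof.
  destruct k as [|p|p]; [apply ee_0| |].
  - replace (IZR (Zpos p)) with (INR (Pos.to_nat p)) by (rewrite INR_IZR_INZ, positive_nat_Z; auto). apply ee_nat.
  - assert (E : (ee (RtoC (IZR (Zneg p))) * ee (RtoC (INR (Pos.to_nat p))) = 1)%C).
    { rewrite <- ee_plus, <- RtoC_plus. rewrite INR_IZR_INZ, positive_nat_Z, <- plus_IZR.
      replace (Z.neg p + Z.pos p)%Z with 0%Z by lia. apply ee_0. }
    rewrite ee_nat in E. rewrite <- E. ring.
Qed.

Lemma ee_eq_1 z : ee z = 1%C -> exists k : Z, z = RtoC (IZR k).
Proof.
  intros H. destruct z as [x y]. unfold ee, cexp in H.
  unfold Re, Im, Ci, RtoC, Cmult in H; simpl in H.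
  injection H. intros H2 H1. clear H.
  ring_simplify (2 * PI) in H1.
  match type of H1 with exp ?p * cos ?q = 1 =>
    replace p with (- (2 * PI * y)) in * by ring; replace q with (2 * (PI * x)) in * by ring end.
  match type of H2 with exp ?p * sin ?q = 0 =>
    replace p with (- (2 * PI * y)) in * by ring; replace q with (2 * (PI * x)) in * by ring end.
  assert (Hpi := PI_RGT_0). assert (He := exp_pos (- (2 * PI * y))).
  assert (Hs : sin (2 * (PI * x)) = 0) by (apply Rmult_integral in H2; lra).
  assert (Hc1 : cos (2 * (PI * x)) = 1).
  { assert (Q := sin2_cos2 (2 * (PI * x))). rewrite Hs in Q. unfold Rsqr in Q.
    assert (0 < cos (2 * (PI * x))) by nra. nra. }
  assert (Hy : y = 0).
  { rewrite Hc1, Rmult_1_r in H1. rewrite <- exp_0 in H1. apply exp_inv in H1. nra. }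
  rewrite cos_2a_sin in Hc1.
  assert (Hsx : sin (PI * x) = 0) by nra.
  destruct (sin_eq_0_0 _ Hsx) as [k Hk]. exists k. subst y. unfold RtoC. f_equal. nra.
Qed.

Lemma Cd_ee z : Cderivable ee z.
Proof. unfold ee. cderiv. Qed.

(** [Tplus] enlarged by points with some [a_l = 0] and [theta_l] not an integer. No rotation moves a
    zero coordinate, so these points cannot be avoided. *)
Definition Plus (N : nat) (w : C) (a : nat -> C) (th : nat -> R) : Prop :=
  0 < Re w /\ forall l, inPN N l ->
    0 < Re (a l) \/ (a l = RtoC 0 /\ ~ (exists k : Z, th l = IZR k)).

(** Quantitative form of [Plus]: one constant [c] for all coordinates, so that estimates are uniform
    over neighbourhoods and along rotations. *)
Definition PlusC (N : nat) (c : R) (w : C) (a : nat -> C) (th : nat -> R) : Prop :=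
  c <= Re w /\ forall l, inPN N l -> c <= Re (a l) \/ (a l = RtoC 0 /\ c <= Cmod (1 - ee (RtoC (th l)))%C).

Lemma ee_not_int t : ~ (exists k : Z, t = IZR k) -> 0 < Cmod (1 - ee (RtoC t))%C.
Proof.
  intros H. apply Cmod_gt_0. intros E. apply H.
  destruct (ee_eq_1 (RtoC t)) as [k Hk].
  - symmetry. apply Ceq_minus. auto.
  - exists k. apply RtoC_inj. auto.
Qed.

Lemma Plus_PlusC N w a th : Plus N w a th -> exists c, 0 < c <= 1 /\ PlusC N c w a th.
Proof.
  intros [Hw Ha].
  assert (H : exists c, 0 < c <= 1 /\ forall l, inPN N l ->
    c <= Re (a l) \/ (a l = RtoC 0 /\ c <= Cmod (1 - ee (RtoC (th l)))%C)).
  { clear Hw. induction N as [|N IH].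
    - exists 1. split; [lra|]. intros l [H1 H2]. lia.
    - destruct IH as [c [Hc H]].
      { intros l [H1 H2]. apply Ha. split; lia. }
      assert (Q : exists c1, 0 < c1 /\ (c1 <= Re (a (S N)) \/ (a (S N) = RtoC 0 /\ c1 <= Cmod (1 - ee (RtoC (th (S N))))%C))).
      { destruct (Ha (S N)) as [P|[P1 P2]]; [split; lia| |].
        - exists (Re (a (S N))). split; auto. left; lra.
        - exists (Cmod (1 - ee (RtoC (th (S N))))%C). split; [apply ee_not_int; auto|]. right; split; [auto|lra]. }
      destruct Q as [c1 [Hc1 Q]]. assert (M1 := Rmin_l c c1). assert (M2 := Rmin_r c c1).
      exists (Rmin c c1). split; [split; [apply Rmin_pos; lra|lra]|].
      intros l Hl. destruct (Nat.eq_dec l (S N)) as [->|E].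
      + destruct Q as [Q|[Q1 Q2]]; [left|right; split; auto]; lra.
      + destruct (H l) as [Q'|[Q1 Q2]]; [destruct Hl; split; lia|left|right; split; auto]; lra. }
  destruct H as [c [Hc H]]. assert (M1 := Rmin_l c (Re w)). assert (M2 := Rmin_r c (Re w)).
  exists (Rmin c (Re w)). split; [split; [apply Rmin_pos; lra|lra]|]. split; [lra|].
  intros l Hl. destruct (H l Hl) as [Q'|[Q1 Q2]]; [left|right; split; auto]; lra.
Qed.

Lemma PlusC_Plus N c w a th : 0 < c -> PlusC N c w a th -> Plus N w a th.
Proof.
  intros Hc [Hw Ha]. split; [lra|]. intros l Hl. destruct (Ha l Hl) as [P|[P1 P2]]; [left; lra|].
  right; split; auto. intros [k Hk]. rewrite Hk, ee_IZR in P2.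
  replace (1 - 1)%C with (RtoC 0) in P2 by ring. rewrite Cmod_0 in P2. lra.
Qed.

Lemma inPN_S N j : (j < N)%nat -> inPN N (S j).
Proof. intros H. split; lia. Qed.

(** For [Re (a l) >= c] the modulus is at least [1 - exp (- c x) >= 1 - 1 / (1 + c x) = 1 / (1 + 1 /
    (c x))]. The product form separates [c] from [x], and covers the zero coordinates as well. *)
Lemma den_ray_lower N c w a th l x : 0 < c <= 1 -> PlusC N c w a th -> inPN N l -> 0 < x ->
  / ((1 + / c) * (1 + / x)) <= Cmod (den (RtoC x) (a l) (th l)).
Proof.
  intros Hc [_ Ha] Hl Hx. unfold den.
  assert (Pc : 0 < / c) by (apply Rinv_0_lt_compat; lra).
  assert (Px : 0 < / x) by (apply Rinv_0_lt_compat; lra).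
  destruct (Ha l Hl) as [P|[P1 P2]].
  - assert (L := Cmod_sub_ge 1%C (ee (RtoC (th l)) * cexp (- RtoC x * a l))%C).
    rewrite Cmod_1, Cmod_mult, Cmod_ee, Cmod_cexp in L.
    replace (Re (- RtoC x * a l)%C) with (- (x * Re (a l))) in L
      by (rewrite <- RtoC_opp, re_scal_l; ring).
    assert (E : exp (- (x * Re (a l))) <= exp (- (c * x))) by (apply exp_le_mono; nra).
    eapply Rle_trans; [|apply L].
    apply Rle_trans with (1 - exp (- (c * x))); [|lra].
    rewrite exp_Ropp. assert (Q := exp_ineq1_le (c * x)). assert (Hcx : 0 < c * x) by nra.
    assert (/ exp (c * x) <= / (1 + c * x)) by (apply Rinv_le_contravar; lra).
    apply Rle_trans with (1 - / (1 + c * x)); [|lra].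
    replace (1 - / (1 + c * x)) with (/ (1 + / c * / x)) by (field; repeat split; nra).
    apply Rinv_le_contravar; nra.
  - rewrite P1. replace (- RtoC x * 0)%C with (RtoC 0) by ring. rewrite cexp_0, Cmult_1_r.
    eapply Rle_trans; [|exact P2]. rewrite <- (Rinv_inv c) at 2. apply Rinv_le_contravar; nra.
Qed.

Lemma den_ray_nz N c w a th l x : 0 < c <= 1 -> PlusC N c w a th -> inPN N l -> 0 < x ->
  den (RtoC x) (a l) (th l) <> 0%C.
Proof.
  intros Hc HP Hl Hx. apply Cmod_gt_0. eapply Rlt_le_trans; [|eapply den_ray_lower; eauto].
  apply Rinv_0_lt_compat. assert (0 < / c) by (apply Rinv_0_lt_compat; lra).
  assert (0 < / x) by (apply Rinv_0_lt_compat; lra). nra.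
Qed.

Lemma FN_ray_bound N c w a th x : 0 < c <= 1 -> PlusC N c w a th -> 0 < x ->
  Cmod (FN N (RtoC x) w a th) <= (1 + / c) ^ N * ((1 + / x) ^ N * exp (- (c * x))).
Proof.
  intros Hc HP Hx. rewrite FN_cprod, Cmod_mult, Cmod_cexp.
  replace (Re (- RtoC x * w)%C) with (- (x * Re w)) by (rewrite <- RtoC_opp, re_scal_l; ring).
  rewrite <- Rmult_assoc, <- Rpow_mult_distr, Rmult_comm.
  apply Rmult_le_compat; [apply Cmod_ge_0|left; apply exp_pos| |].
  - apply cprod_bound. intros j Hj.
    rewrite Cmod_inv by (eapply den_ray_nz; eauto using inPN_S).
    assert (L := den_ray_lower N c w a th (S j) x Hc HP (inPN_S N j Hj) Hx).
    assert (0 < / c) by (apply Rinv_0_lt_compat; lra).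
    assert (0 < / x) by (apply Rinv_0_lt_compat; lra).
    apply Rinv_le_contravar in L; [rewrite Rinv_inv in L; auto|].
    apply Rinv_0_lt_compat. nra.
  - apply exp_le_mono. destruct HP as [Hw _]. nra.
Qed.

Lemma FN_rot N u w a th om : FN N (u * cexp (Ci * RtoC om))%C w a th = FN N u (rot om w) (rotv om a) th.
Proof.
  rewrite !FN_cprod. f_equal.
  - f_equal. unfold rot. ring.
  - apply cprod_ext. intros j _. f_equal. unfold den, rotv, rot. do 3 f_equal. ring.
Qed.

Lemma FN_Cd N (u w : C -> C) (a : C -> nat -> C) th t :
  Cderivable u t -> Cderivable w t -> (forall l, inPN N l -> Cderivable (fun z => a z l) t) ->
  (forall l, inPN N l -> den (u t) (a t l) (th l) <> 0%C) ->
  Cderivable (fun z => FN N (u z) (w z) (a z) th) t.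
Proof.
  intros Hu Hw Ha Hd.
  apply Cd_ext with (f := fun z => (cexp (- u z * w z) * cprod N (fun j => / den (u z) (a z (S j)) (th (S j))))%C).
  { intros z. rewrite FN_cprod; auto. }
  apply Cd_mult.
  - apply Cd_cexp, Cd_mult; [apply Cd_opp|]; auto.
  - apply (Cd_cprod N (fun j z => / den (u z) (a z (S j)) (th (S j)))%C). intros j Hj.
    apply Cd_inv; [apply Hd, inPN_S; auto|]. unfold den.
    apply Cd_minus; [apply Cd_const|]. apply Cd_mult; [apply Cd_const|].
    apply Cd_cexp, Cd_mult; [apply Cd_opp; auto|]. apply Ha, inPN_S; auto.
Qed.

(** The condition of [inE] at a single point, for a radius [r] instead of a function of all
    points. *)
Definition valid (N : nat) (r : R) (a : nat -> C) (th : nat -> R) : Prop :=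
  0 < r /\ forall l u, inPN N l -> 0 < Cmod u -> Cmod u <= r -> ee (RtoC (th l)) <> cexp (u * a l)%C.

Lemma valid_den N r a th l u : valid N r a th -> inPN N l -> 0 < Cmod u -> Cmod u <= r ->
  den u (a l) (th l) <> 0%C.
Proof.
  intros [_ H] Hl H1 H2 E. apply (H l u Hl H1 H2). unfold den in E.
  replace (- u * a l)%C with (- (u * a l))%C in E by ring. rewrite cexp_opp in E.
  assert (Hz := cexp_nz (u * a l)%C).
  replace (ee (RtoC (th l))) with ((1 - (1 - ee (RtoC (th l)) * / cexp (u * a l))) * cexp (u * a l))%C
    by (field; auto).
  rewrite E. ring.
Qed.

(** If [e(theta)] differs from 1 the denominator stays away from 0 for small [u]; otherwise
    [Re a0 > 0] and it has a simple zero at [u = 0]. The bound [k |u|] fits both cases. *)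
Lemma den_near_one (a0 : C) t : 0 < Re a0 \/ (a0 = RtoC 0 /\ ~ (exists k : Z, t = IZR k)) ->
  exists d r k, 0 < d /\ 0 < r /\ 0 < k /\ forall a u, Cmod (a - a0)%C < d -> (a0 = RtoC 0 -> a = RtoC 0) ->
    0 < Cmod u <= r -> k * Cmod u <= Cmod (den u a t).
Proof.
  intros H. destruct one_minus_cexp_ge as [rho [Hr Hq]].
  set (A := Cmod a0 + 1). assert (HA : 1 <= A) by (unfold A; assert (Z := Cmod_ge_0 a0); lra).
  assert (Hcr : 0 < Cmod (1 - ee (RtoC t))%C \/ (ee (RtoC t) = 1%C /\ 0 < Re a0)).
  { destruct (Ceq_dec (ee (RtoC t)) 1%C) as [E|E].
    - right. split; auto. destruct H as [H|[H1 H2]]; auto.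
      apply ee_not_int in H2. rewrite E in H2. replace (1 - 1)%C with (RtoC 0) in H2 by ring.
      rewrite Cmod_0 in H2. lra.
    - left. apply Cmod_gt_0. intros Q. apply E. symmetry. apply Ceq_minus; auto. }
  destruct Hcr as [Hm|[E Ha]].
  - set (m := Cmod (1 - ee (RtoC t))%C) in *.
    set (r := Rmin (rho / (2 * A)) (m / (4 * A))).
    assert (Hr0 : 0 < r) by (unfold r; apply Rmin_pos; apply div_pos; lra).
    assert (R1 : r <= rho / (2 * A)) by apply Rmin_l. assert (R2 : r <= m / (4 * A)) by apply Rmin_r.
    exists 1, r, (m / 2 / r). split; [lra|]. split; auto. split; [repeat apply div_pos; lra|].
    intros a u Hda _ [Hu Hur].
    assert (HaA : Cmod a <= A).
    { replace a with ((a - a0) + a0)%C by ring. eapply Rle_trans; [apply Cmod_triangle|]. unfold A; lra. }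
    assert (Hua : Cmod (- u * a)%C <= r * A).
    { rewrite Cmod_mult, Cmod_opp. apply Rmult_le_compat; auto using Cmod_ge_0. }
    assert (B1 : r * A <= rho / 2).
    { apply Rle_trans with (rho / (2 * A) * A); [apply Rmult_le_compat_r; lra|right; field; lra]. }
    assert (B2 : r * A <= m / 4).
    { apply Rle_trans with (m / (4 * A) * A); [apply Rmult_le_compat_r; lra|right; field; lra]. }
    destruct (Hq (- u * a)%C ltac:(lra)) as [_ Q].
    apply Rle_trans with (m / 2).
    { apply Rle_trans with (m / 2 / r * r); [apply Rmult_le_compat_l; [left; repeat apply div_pos; lra|auto]|right; field; lra]. }
    unfold den.
    replace (1 - ee (RtoC t) * cexp (- u * a))%C with ((1 - ee (RtoC t)) - (- (ee (RtoC t) * (1 - cexp (- u * a)))))%C by ring.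
    eapply Rle_trans; [|apply Cmod_sub_ge]. fold m. rewrite Cmod_opp, Cmod_mult, Cmod_ee. lra.
  - set (d := Rmin 1 (Re a0 / 2)).
    assert (Hd : 0 < d) by (unfold d; apply Rmin_pos; lra).
    assert (D1 : d <= 1) by apply Rmin_l. assert (D2 : d <= Re a0 / 2) by apply Rmin_r.
    exists d, (rho / (2 * A)), (Re a0 / 4). split; auto. split; [apply div_pos; lra|]. split; [lra|].
    intros a u Hda _ [Hu Hur].
    assert (HaA : Cmod a <= A).
    { replace a with ((a - a0) + a0)%C by ring. eapply Rle_trans; [apply Cmod_triangle|]. unfold A; lra. }
    assert (Hal : Re a0 / 2 <= Cmod a).
    { assert (P := Re_le_Cmod (a - a0)%C). assert (P2 := Re_le_Cmod a). assert (P3 := Rle_abs (Re a)).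
      unfold Cminus in P. rewrite re_plus, re_opp in P. apply Rabs_le_between in P. fold (a - a0)%C in P. lra. }
    assert (Hua : Cmod (- u * a)%C <= rho / 2).
    { rewrite Cmod_mult, Cmod_opp. apply Rle_trans with (rho / (2 * A) * A); [|right; field; lra].
      apply Rmult_le_compat; auto using Cmod_ge_0. }
    destruct (Hq (- u * a)%C ltac:(lra)) as [Q _].
    unfold den. rewrite E, Cmult_1_l. eapply Rle_trans; [|exact Q].
    rewrite Cmod_mult, Cmod_opp. nra.
Qed.

(** Zero coordinates are kept at zero: moving them could give [a_l] a negative real part, and the
    decay of the integrand would be lost. *)
Definition NearA (N : nat) (d : R) (a0 a : nat -> C) : Prop :=
  forall l, inPN N l -> Cmod (a l - a0 l)%C < d /\ (a0 l = RtoC 0 -> a l = RtoC 0).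

Lemma NearA_refl N d a : 0 < d -> NearA N d a a.
Proof.
  intros Hd l _. split; auto. replace (a l - a l)%C with (RtoC 0) by ring. rewrite Cmod_0; auto.
Qed.

Lemma den_near N w a0 th : Plus N w a0 th ->
  exists d r k, 0 < d /\ 0 < r /\ 0 < k /\ forall a u l, NearA N d a0 a -> inPN N l ->
    0 < Cmod u <= r -> k * Cmod u <= Cmod (den u (a l) (th l)).
Proof.
  intros [_ Ha]. induction N as [|N IH].
  - exists 1, 1, 1. repeat split; try lra. intros a u l _ [H1 H2]. lia.
  - destruct IH as [d [r [k [Hd [Hr [Hk H]]]]]].
    { intros l [H1 H2]. apply Ha. split; lia. }
    destruct (den_near_one (a0 (S N)) (th (S N))) as [d' [r' [k' [Hd' [Hr' [Hk' H']]]]]].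
    { apply Ha. split; lia. }
    assert (D1 := Rmin_l d d'). assert (D2 := Rmin_r d d').
    assert (R1 := Rmin_l r r'). assert (R2 := Rmin_r r r').
    assert (K1 := Rmin_l k k'). assert (K2 := Rmin_r k k').
    exists (Rmin d d'), (Rmin r r'), (Rmin k k').
    repeat split; try (apply Rmin_pos; auto).
    intros a u l HN Hl Hu. destruct (Nat.eq_dec l (S N)) as [->|E].
    + destruct (HN (S N) Hl) as [A B].
      apply Rle_trans with (k' * Cmod u); [apply Rmult_le_compat_r; lra|]. apply H'; auto; lra.
    + apply Rle_trans with (k * Cmod u); [apply Rmult_le_compat_r; lra|]. apply H; try lra.
      * intros l' Hl'. destruct (HN l') as [A B]; [destruct Hl'; split; lia|]. split; auto. lra.
      * destruct Hl; split; lia.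
Qed.

Lemma valid_exists N w a th : Plus N w a th -> exists r, valid N r a th.
Proof.
  intros HP. destruct (den_near N w a th HP) as [d [r [k [Hd [Hr [Hk H]]]]]].
  exists r. split; auto. intros l u Hl H1 H2 E.
  specialize (H a u l (NearA_refl N d a Hd) Hl (conj H1 H2)).
  unfold den in H. rewrite E in H. replace (- u * a l)%C with (- (u * a l))%C in H by ring.
  rewrite cexp_opp in H. assert (Hz := cexp_nz (u * a l)%C).
  replace (1 - cexp (u * a l) * / cexp (u * a l))%C with (RtoC 0) in H by (field; auto).
  rewrite Cmod_0 in H. assert (0 < k * Cmod u) by (apply Rmult_lt_0_compat; auto). lra.
Qed.

Lemma FN_near_bound N k u w a th : 0 < k -> 0 < Cmod u ->
  (forall l, inPN N l -> k * Cmod u <= Cmod (den u (a l) (th l))) ->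
  Cmod (FN N u w a th) <= exp (Cmod u * Cmod w) * (/ (k * Cmod u)) ^ N.
Proof.
  intros Hk Hu H. rewrite FN_cprod, Cmod_mult, Cmod_cexp.
  assert (Hku : 0 < k * Cmod u) by (apply Rmult_lt_0_compat; auto).
  apply Rmult_le_compat; [left; apply exp_pos|apply Cmod_ge_0| |].
  - apply exp_le_mono. eapply Rle_trans; [apply Rle_abs|]. eapply Rle_trans; [apply Re_le_Cmod|].
    rewrite Cmod_mult, Cmod_opp. lra.
  - apply cprod_bound. intros j Hj. specialize (H (S j) (inPN_S N j Hj)).
    rewrite Cmod_inv by (apply Cmod_gt_0; lra). apply Rinv_le_contravar; auto.
Qed.

Lemma PlusC_near N c w0 a0 th w a : 0 < c -> PlusC N c w0 a0 th -> Cmod (w - w0)%C < c / 2 ->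
  NearA N (c / 2) a0 a -> PlusC N (c / 2) w a th.
Proof.
  intros Hc [Hw Ha] Hdw Hda.
  assert (Q : forall z z0, Cmod (z - z0)%C < c / 2 -> c <= Re z0 -> c / 2 <= Re z).
  { intros z z0 H1 H2. assert (P := Re_le_Cmod (z - z0)%C).
    unfold Cminus in P at 1. rewrite re_plus, re_opp in P. apply Rabs_le_between in P. lra. }
  split; [apply Q with w0; auto|]. intros l Hl. destruct (Hda l Hl) as [A B].
  destruct (Ha l Hl) as [P|[P1 P2]]; [left; apply Q with (a0 l); auto|]. right; split; auto. lra.
Qed.

(** * The Mellin and Hankel integrals *)

(** With [u = exp z] the form [F_N(u) u^(s-1) du] becomes [Gz z dz], single valued in [z];
    the Hankel contour becomes three sides of a half strip of height [2 pi]. *)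
Definition Gz N (s w : C) (a : nat -> C) (th : nat -> R) (z : C) : C :=
  (FN N (cexp z) w a th * cexp (s * z))%C.

Lemma Gz_curve_Cd N (s w z : C -> C) (a : C -> nat -> C) th t :
  Cderivable s t -> Cderivable w t -> Cderivable z t ->
  (forall l, inPN N l -> Cderivable (fun t => a t l) t) ->
  (forall l, inPN N l -> den (cexp (z t)) (a t l) (th l) <> 0%C) ->
  Cderivable (fun t => Gz N (s t) (w t) (a t) th (z t)) t.
Proof.
  intros Hs Hw Hz Ha Hd. unfold Gz. apply Cd_mult.
  - apply (FN_Cd N (fun t => cexp (z t)) w a th t); auto. apply Cd_cexp; auto.
  - apply Cd_cexp, Cd_mult; auto.
Qed.

Lemma Gz_Cd N s w a th z : (forall l, inPN N l -> den (cexp z) (a l) (th l) <> 0%C) ->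
  Cderivable (Gz N s w a th) z.
Proof.
  intros H. apply (Gz_curve_Cd N (fun _ => s) (fun _ => w) (fun z => z) (fun _ => a) th z);
    auto using Cd_const, Cd_id.
Qed.

Lemma Gz_ray_Cd N c s w a th x : 0 < c <= 1 -> PlusC N c w a th -> Cderivable (Gz N s w a th) (RtoC x).
Proof.
  intros Hc HP. apply Gz_Cd. intros l Hl. rewrite cexp_RtoC.
  eapply (den_ray_nz N c); eauto. apply exp_pos.
Qed.

Lemma Gz_ray_rcont N c s w a th x : 0 < c <= 1 -> PlusC N c w a th ->
  rcont (fun x => Gz N s w a th (RtoC x)) x.
Proof.
  intros Hc HP. apply (rcont_comp (Gz N s w a th) (fun x => RtoC x)); [rcontin|].
  apply (Gz_ray_Cd N c); auto.
Qed.

Lemma Gz_ray_bound N c s w a th x : 0 < c <= 1 -> PlusC N c w a th ->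
  Cmod (Gz N s w a th (RtoC x)) <=
    (1 + / c) ^ N * ((1 + exp (- x)) ^ N * exp (Re s * x) * exp (- (c * exp x))).
Proof.
  intros Hc HP. unfold Gz. rewrite Cmod_mult, Cmod_cexp_real, cexp_RtoC.
  assert (B := FN_ray_bound N c w a th (exp x) Hc HP (exp_pos x)).
  rewrite exp_Ropp. assert (P := exp_pos (Re s * x)).
  apply Rmult_le_compat_r with (r := exp (Re s * x)) in B; [|lra].
  eapply Rle_trans; [exact B|]. right. ring.
Qed.

Lemma Gz_dom N c tau S : 0 < c <= 1 -> 0 < tau <= 1 -> exists K, 0 <= K /\ forall s w a th,
  PlusC N c w a th -> INR N + tau <= Re s <= S -> dom (fun x => Gz N s w a th (RtoC x)) K tau.
Proof.
  intros Hc Ht. destruct (dom_line N S c tau) as [K [HK H]]; try lra.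
  assert (P : 0 <= (1 + / c) ^ N) by (apply pow_le; assert (0 < / c) by (apply Rinv_0_lt_compat; lra); lra).
  exists ((1 + / c) ^ N * K). split; [apply Rmult_le_pos; auto|].
  intros s w a th HP Hs x. eapply Rle_trans; [apply (Gz_ray_bound N c); auto|].
  rewrite (Rmult_assoc ((1 + / c) ^ N) K). apply Rmult_le_compat_l; auto.
Qed.

Lemma Gz_right N c S A : 0 < c <= 1 -> exists K, 0 <= K /\ forall s w a th,
  PlusC N c w a th -> Rabs (Re s) <= S -> forall x, A <= x ->
  Cmod (Gz N s w a th (RtoC x)) <= K * exp (- (1 * x)).
Proof.
  intros Hc. destruct (dom_right N S c A) as [K [HK H]]; try lra.
  assert (P : 0 <= (1 + / c) ^ N) by (apply pow_le; assert (0 < / c) by (apply Rinv_0_lt_compat; lra); lra).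
  exists ((1 + / c) ^ N * K). split; [apply Rmult_le_pos; auto|].
  intros s w a th HP Hs x Hx. eapply Rle_trans; [apply (Gz_ray_bound N c); auto|].
  rewrite (Rmult_assoc ((1 + / c) ^ N) K). apply Rmult_le_compat_l; auto.
Qed.

Definition Mell N s w a th : C := LI (fun x => Gz N s w a th (RtoC x)).

Definition Circ N r s w a th : C := (Ci * cRI (fun y => Gz N s w a th (cpt (ln r) y)) 0 (2 * PI))%C.

(** By [Gz_period] the outgoing ray is [e(s)] times the incoming one, and the two are merged into
    one term with factor [e(s) - 1]. *)
Definition Han N r s w a th : C :=
  (Circ N r s w a th + (ee s - 1) * Ray (fun x => Gz N s w a th (RtoC x)) (ln r))%C.

(** All parameters move along a holomorphic curve in one variable [t], so that the same lemma gives
    holomorphy in [s] and along complex lines in [(s, w, a)]. *)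
Lemma Mell_curve_Cd N (s w : C -> C) (a : C -> nat -> C) th t0 rho c tau S :
  0 < rho -> 0 < c <= 1 -> 0 < tau <= 1 ->
  (forall t, Cderivable s t) -> (forall t, Cderivable w t) ->
  (forall t l, inPN N l -> Cderivable (fun t => a t l) t) ->
  (forall h, Cmod h < rho -> PlusC N c (w (t0 + h)%C) (a (t0 + h)%C) th /\ INR N + tau <= Re (s (t0 + h)%C) <= S) ->
  Cderivable (fun t => Mell N (s t) (w t) (a t) th) t0.
Proof.
  intros Hrho Hc Ht Hs Hw Ha H. destruct (Gz_dom N c tau S Hc Ht) as [K [HK HD]].
  apply (Cd_LI (fun t x => Gz N (s t) (w t) (a t) th (RtoC x)) t0 rho K tau); auto; try lra.
  - intros h x Hh. destruct (H h Hh) as [HP _].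
    apply (Gz_curve_Cd N s w (fun _ => RtoC x) a th (t0 + h)%C); auto using Cd_const.
    intros l Hl. rewrite cexp_RtoC. eapply (den_ray_nz N c); eauto. apply exp_pos.
  - intros h x Hh. destruct (H h Hh) as [HP _]. apply (Gz_ray_rcont N c); auto.
  - intros h Hh. destruct (H h Hh) as [HP Hre]. apply HD; auto.
Qed.

Lemma Mell_bound N c tau S : 0 < c <= 1 -> 0 < tau <= 1 -> exists M, 0 <= M /\ forall s w a th,
  PlusC N c w a th -> INR N + tau <= Re s <= S -> Cmod (Mell N s w a th) <= M.
Proof.
  intros Hc Ht. destruct (Gz_dom N c tau S Hc Ht) as [K [HK HD]].
  exists (2 * K / tau). split.
  - apply Rmult_le_pos; [lra|left; apply Rinv_0_lt_compat; lra].
  - intros s w a th HP Hs. apply LI_bound; try lra; auto.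
    intros x. apply (Gz_ray_rcont N c); auto.
Qed.

Lemma Cmod_cexp_cpt r y : 0 < r -> Cmod (cexp (cpt (ln r) y)) = r.
Proof. intros H. rewrite Cmod_cexp, Re_cpt. apply exp_ln; auto. Qed.

Lemma Gz_circle_den N r a th y l : valid N r a th -> inPN N l ->
  den (cexp (cpt (ln r) y)) (a l) (th l) <> 0%C.
Proof.
  intros HV Hl. assert (Hr := proj1 HV). eapply valid_den; eauto; rewrite Cmod_cexp_cpt by auto; lra.
Qed.

Lemma Gz_circle_rcont N r s w a th y : valid N r a th -> rcont (fun y => Gz N s w a th (cpt (ln r) y)) y.
Proof.
  intros HV. apply rcont_cpt_y, Gz_Cd. intros l Hl. eapply Gz_circle_den; eauto.
Qed.

Lemma Han_curve_Cd N r (s w : C -> C) (a : C -> nat -> C) th t0 rho c S M :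
  0 < rho -> 0 < c <= 1 ->
  (forall t, Cderivable s t) -> (forall t, Cderivable w t) ->
  (forall t l, inPN N l -> Cderivable (fun t => a t l) t) ->
  (forall h, Cmod h < rho -> PlusC N c (w (t0 + h)%C) (a (t0 + h)%C) th /\ Rabs (Re (s (t0 + h)%C)) <= S /\
     valid N r (a (t0 + h)%C) th /\
     forall y, 0 <= y <= 2 * PI -> Cmod (Gz N (s (t0 + h)%C) (w (t0 + h)%C) (a (t0 + h)%C) th (cpt (ln r) y)) <= M) ->
  Cderivable (fun t => Han N r (s t) (w t) (a t) th) t0.
Proof.
  intros Hrho Hc Hs Hw Ha H. assert (Hpi := PI_RGT_0).
  destruct (Gz_right N c S (ln r) Hc) as [K [HK HD]].
  unfold Han, Circ. apply Cd_plus; [|apply Cd_mult].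
  - apply Cd_mult; [apply Cd_const|].
    apply (Cd_int (fun t y => Gz N (s t) (w t) (a t) th (cpt (ln r) y)) t0 rho M 0 (2 * PI)); auto; try lra.
    + intros h y Hh _. destruct (H h Hh) as [_ [_ [HV _]]].
      apply (Gz_curve_Cd N s w (fun _ => cpt (ln r) y) a th (t0 + h)%C); auto using Cd_const.
      intros l Hl. eapply Gz_circle_den; eauto.
    + intros h y Hh _. destruct (H h Hh) as [_ [_ [HV _]]]. apply Gz_circle_rcont; auto.
    + intros h y Hh Hy. apply (H h Hh); auto.
  - apply Cd_minus; [|apply Cd_const]. apply (Cd_comp ee s); auto using Cd_ee.
  - apply (Cd_Ray (fun t x => Gz N (s t) (w t) (a t) th (RtoC x)) t0 rho K 1); auto; try lra.
    + intros h x Hh _. destruct (H h Hh) as [HP _].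
      apply (Gz_curve_Cd N s w (fun _ => RtoC x) a th (t0 + h)%C); auto using Cd_const.
      intros l Hl. rewrite cexp_RtoC. eapply (den_ray_nz N c); eauto. apply exp_pos.
    + intros h x Hh _. destruct (H h Hh) as [HP _]. apply (Gz_ray_rcont N c); auto.
    + intros h x Hh Hx. destruct (H h Hh) as [HP [HS _]]. apply HD; auto.
Qed.

Lemma Han_bound N c S r M B : 0 < c <= 1 -> exists M', 0 <= M' /\ forall s w a th,
  PlusC N c w a th -> Rabs (Re s) <= S -> valid N r a th -> Cmod (ee s - 1)%C <= B ->
  (forall y, 0 <= y <= 2 * PI -> Cmod (Gz N s w a th (cpt (ln r) y)) <= M) ->
  Cmod (Han N r s w a th) <= M'.
Proof.
  intros Hc. assert (Hpi := PI_RGT_0). destruct (Gz_right N c S (ln r) Hc) as [K [HK HD]].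
  set (RB := K / 1 * exp (- (1 * ln r))).
  assert (HRB : 0 <= RB).
  { apply Rmult_le_pos; [apply Rmult_le_pos; [auto|lra]|left; apply exp_pos]. }
  exists (Rabs M * (2 * PI - 0) + Rabs B * RB). split.
  { assert (P1 := Rabs_pos M). assert (P2 := Rabs_pos B).
    apply Rplus_le_le_0_compat; apply Rmult_le_pos; lra. }
  intros s w a th HP HS HV HB HM. unfold Han, Circ.
  eapply Rle_trans; [apply Cmod_triangle|]. rewrite !Cmod_mult, Cmod_Ci, Rmult_1_l.
  apply Rplus_le_compat.
  - apply cRI_bound; try lra.
    + intros y _. apply Gz_circle_rcont; auto.
    + intros y Hy. eapply Rle_trans; [apply HM; auto|apply Rle_abs].
  - apply Rmult_le_compat; auto using Cmod_ge_0.
    + eapply Rle_trans; [exact HB|apply Rle_abs].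
    + apply Ray_bound; auto; try lra. intros x _. apply (Gz_ray_rcont N c); auto.
Qed.

Lemma cexp_2pii z : cexp (z + Ci * RtoC (2 * PI))%C = cexp z.
Proof.
  rewrite cexp_plus. replace (Ci * RtoC (2 * PI))%C with (2 * PI * Ci * 1)%C by (rewrite RtoC_mult; ring).
  fold (ee 1%C). rewrite ee_1. ring.
Qed.

Lemma Gz_period N s w a th x : Gz N s w a th (cpt x (2 * PI)) = (ee s * Gz N s w a th (RtoC x))%C.
Proof.
  unfold Gz, cpt. rewrite cexp_2pii.
  replace (s * (RtoC x + Ci * RtoC (2 * PI)))%C with (s * RtoC x + 2 * PI * Ci * s)%C
    by (rewrite RtoC_mult; ring).
  rewrite cexp_plus. fold (ee s). ring.
Qed.

Lemma Cmod_cexp_le z : Cmod (cexp z) <= exp (Cmod z).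
Proof.
  rewrite Cmod_cexp. apply exp_le_mono. eapply Rle_trans; [apply Rle_abs|apply Re_le_Cmod].
Qed.

(** Goursat's theorem on [[-X, ln r] x [0, 2 pi]], where [valid] excludes singularities. The upper
    side is [e(s)] times the lower one, and the left side, a circle of radius [exp (- X)] in the
    variable [u], tends to 0 because [Re s > N]. *)
Lemma Han_Mell N r s w a th : Plus N w a th -> valid N r a th -> INR N < Re s ->
  Han N r s w a th = ((ee s - 1) * Mell N s w a th)%C.
Proof.
  intros HP HV Hs. assert (Hpi := PI_RGT_0). assert (Hr := proj1 HV).
  destruct (Plus_PlusC N w a th HP) as [c [Hc HPc]].
  destruct (den_near N w a th HP) as [d [r1 [k [Hd [Hr1 [Hk Hnear]]]]]].
  set (g := Gz N s w a th).
  assert (Hcont : forall x, rcont (fun x => g (RtoC x)) x) by (intros; apply (Gz_ray_rcont N c); auto).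
  set (tau := Rmin 1 (Re s - INR N)).
  assert (Ht : 0 < tau <= 1) by (unfold tau; split; [apply Rmin_pos; lra|apply Rmin_l]).
  assert (Hts : tau <= Re s - INR N) by apply Rmin_r.
  destruct (Gz_dom N c tau (Re s) Hc Ht) as [K [HK HD]].
  specialize (HD s w a th HPc ltac:(lra)). fold g in HD.
  destruct (Gz_right N c (Rabs (Re s)) (ln r) Hc) as [K2 [HK2 HD2]].
  specialize (HD2 s w a th HPc (Rle_refl _)). fold g in HD2.
  set (Q := exp (r1 * Cmod w) * (/ k) ^ N * exp (Rabs (Im s) * (2 * PI))).
  assert (HQ : 0 <= Q).
  { apply Rmult_le_pos; [apply Rmult_le_pos|]; try (left; apply exp_pos).
    apply pow_le. left; apply Rinv_0_lt_compat; auto. }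
  (* The bound combines the order [N] of the pole at [u = 0] with [exp (Re s * x)]. Replacing
     [Re s - N] by [tau] needs [x <= 0], hence the alternative. *)
  assert (Hedge : forall x y, x <= ln r1 -> 0 <= y <= 2 * PI -> Cmod (g (cpt x y)) <= Q * exp (tau * x) \/ 0 < x).
  { intros x y Hx Hy. destruct (Rlt_dec 0 x) as [L|L]; [right; auto|left].
    assert (Eu : Cmod (cexp (cpt x y)) = exp x) by (rewrite Cmod_cexp, Re_cpt; auto).
    assert (Hex : 0 < exp x <= r1).
    { split; [apply exp_pos|]. rewrite <- (exp_ln r1) by auto. apply exp_le_mono; auto. }
    assert (B := FN_near_bound N k (cexp (cpt x y)) w a th Hk ltac:(rewrite Eu; lra)
      ltac:(intros l Hl; apply Hnear; [apply NearA_refl; auto|auto|rewrite Eu; auto])).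
    unfold g, Gz. rewrite Cmod_mult. rewrite Eu in B.
    replace (Cmod (cexp (s * cpt x y))) with (exp (Re s * x) * exp (- (Im s * y))).
    2:{ rewrite Cmod_cexp, re_mult, Re_cpt, Im_cpt, <- exp_plus. f_equal; ring. }
    apply Rle_trans with ((exp (r1 * Cmod w) * ((/ k) ^ N * exp (- (INR N * x)))) *
       (exp (Re s * x) * exp (Rabs (Im s) * (2 * PI)))).
    - apply Rmult_le_compat; [apply Cmod_ge_0|apply Rmult_le_pos; left; apply exp_pos| |].
      + eapply Rle_trans; [exact B|]. apply Rmult_le_compat.
        * left; apply exp_pos.
        * apply pow_le. left; apply Rinv_0_lt_compat. apply Rmult_lt_0_compat; lra.
        * apply exp_le_mono. apply Rmult_le_compat_r; [apply Cmod_ge_0|lra].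
        * right. rewrite Rinv_mult, Rpow_mult_distr, <- exp_Ropp, exp_pow. do 2 f_equal. ring.
      + apply Rmult_le_compat_l; [left; apply exp_pos|]. apply exp_le_mono.
        eapply Rle_trans; [apply Rle_abs|]. rewrite Rabs_Ropp, Rabs_mult.
        apply Rmult_le_compat_l; [apply Rabs_pos|]. rewrite Rabs_right; lra.
    - unfold Q.
      replace (exp (r1 * Cmod w) * ((/ k) ^ N * exp (- (INR N * x))) * (exp (Re s * x) * exp (Rabs (Im s) * (2 * PI))))
        with (exp (r1 * Cmod w) * (/ k) ^ N * exp (Rabs (Im s) * (2 * PI)) * (exp (- (INR N * x)) * exp (Re s * x))) by ring.
      apply Rmult_le_compat_l; auto. rewrite <- exp_plus. apply exp_le_mono. nra. }
  assert (HCd : forall x y, x <= ln r -> Cderivable g (cpt x y)).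
  { intros x y Hx. apply Gz_Cd. intros l Hl. eapply valid_den; eauto; rewrite Cmod_cexp, Re_cpt.
    - apply exp_pos.
    - rewrite <- (exp_ln r) by auto. apply exp_le_mono; auto. }
  apply Cmod_zero_eq. intros eps He.
  set (E := Cmod (ee s - 1)%C). assert (HE : 0 <= E) by apply Cmod_ge_0.
  destruct (LI_limit _ K tau (proj1 Ht) Hcont HD (eps / 3 / (E + 1))) as [X1 [HX1 L1]].
  { repeat apply div_pos; lra. }
  destruct (Ray_limit (fun x => g (RtoC x)) K2 1 (ln r) Rlt_0_1 HK2 ltac:(auto) HD2 (eps / 3 / (E + 1))) as [X2 [HX2 L2]].
  { repeat apply div_pos; lra. }
  destruct (exp_small tau (eps / 3 / (Q * (2 * PI) + 1)) (proj1 Ht)) as [X3 [HX3 L3]].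
  { assert (0 <= Q * (2 * PI)) by (apply Rmult_le_pos; lra). repeat apply div_pos; lra. }
  set (X := Rabs (ln r1) + Rabs (ln r) + X1 + X3 + 1).
  assert (A1 := Rle_abs (- ln r1)). rewrite Rabs_Ropp in A1. assert (A2 := Rle_abs (- ln r)). rewrite Rabs_Ropp in A2.
  assert (A3 := Rabs_pos (ln r1)). assert (A4 := Rabs_pos (ln r)). assert (A5 := Rle_abs (ln r)).
  set (B := Rmax X1 X2). assert (M1 := Rmax_l X1 X2). assert (M2 := Rmax_r X1 X2). fold B in M1, M2.
  specialize (L1 X B ltac:(unfold X; lra) M1). specialize (L2 B M2). specialize (L3 X ltac:(unfold X; lra)).
  assert (G := goursat g (- X) (ln r) 0 (2 * PI) ltac:(unfold X; lra) ltac:(lra)).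
  unfold rectI in G. specialize (G ltac:(intros x y Hx _; apply HCd; lra)).
  set (J := cRI (fun y => g (cpt (- X) y)) 0 (2 * PI)) in *.
  assert (HJ : Cmod J <= Q * exp (tau * - X) * (2 * PI - 0)).
  { apply cRI_bound; try lra.
    - intros y _. apply rcont_cpt_y, HCd. unfold X; lra.
    - intros y Hy. destruct (Hedge (- X) y ltac:(unfold X; lra) Hy) as [Z|Z]; auto. unfold X in Z; lra. }
  replace (cRI (fun x => g (cpt x 0)) (- X) (ln r)) with (cRI (fun x => g (RtoC x)) (- X) (ln r)) in G.
  2:{ f_equal. apply functional_extensionality. intros x. rewrite cpt_0; auto. }
  replace (cRI (fun x => g (cpt x (2 * PI))) (- X) (ln r)) with (ee s * cRI (fun x => g (RtoC x)) (- X) (ln r))%C in G.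
  2:{ rewrite <- cRI_scal; [|unfold X; lra|intros; apply Hcont]. f_equal. apply functional_extensionality.
      intros x. symmetry. apply Gz_period. }
  fold (Circ N r s w a th) in G. unfold Han, Mell. fold g.
  assert (Ech := cRI_chasles (fun x => g (RtoC x)) (- X) (ln r) B ltac:(unfold X; lra) ltac:(intros; apply Hcont)).
  set (I1 := cRI (fun x => g (RtoC x)) (- X) (ln r)) in *.
  set (I2 := cRI (fun x => g (RtoC x)) (ln r) B) in *.
  set (R0 := Ray (fun x => g (RtoC x)) (ln r)) in *.
  set (L0 := LI (fun x => g (RtoC x))) in *.
  rewrite Ech in L1. fold g in G.
  change (Ci * cRI (fun y => g (cpt (ln r) y)) 0 (2 * PI))%C with (Circ N r s w a th) in G.
  set (Cc := Circ N r s w a th) in *.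
  replace (Cc + (ee s - 1) * R0 - (ee s - 1) * L0)%C with
    ((ee s - 1) * (I1 + I2 - L0) - (ee s - 1) * (I2 - R0) + Ci * J)%C.
  2:{ replace Cc with ((I1 + Cc - ee s * I1 - Ci * J) + (ee s - 1) * I1 + Ci * J)%C by ring. rewrite G. ring. }
  eapply Rle_lt_trans; [apply Cmod_triangle|].
  eapply Rle_lt_trans; [apply Rplus_le_compat_r, Cmod_minus_le|].
  rewrite !Cmod_mult, Cmod_Ci. fold E.
  assert (T1 : E * Cmod (I1 + I2 - L0)%C <= eps / 3).
  { apply Rle_trans with ((E + 1) * (eps / 3 / (E + 1))); [|right; field; lra].
    apply Rmult_le_compat; try lra; apply Cmod_ge_0. }
  assert (T2 : E * Cmod (I2 - R0)%C <= eps / 3).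
  { apply Rle_trans with ((E + 1) * (eps / 3 / (E + 1))); [|right; field; lra].
    apply Rmult_le_compat; try lra; apply Cmod_ge_0. }
  assert (HQp : 0 <= Q * (2 * PI)) by (apply Rmult_le_pos; lra).
  assert (T3 : Cmod J < eps / 3).
  { eapply Rle_lt_trans; [exact HJ|]. replace (tau * - X) with (- (tau * X)) by ring.
    apply Rlt_le_trans with ((Q * (2 * PI) + 1) * (eps / 3 / (Q * (2 * PI) + 1))); [|right; field; lra].
    assert (P := exp_pos (- (tau * X))). nra. }
  lra.
Qed.

(** * The factor [1 / (Gamma(s) (e(s) - 1))] *)

(** [(e(z) - 1) / z], written as an integral so that holomorphy at 0 is immediate. *)
Definition Efun (z : C) : C := cRI (fun x => 2 * PI * Ci * cexp (2 * PI * Ci * z * RtoC x))%C 0 1.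

Lemma Efun_mult z : (z * Efun z = ee z - 1)%C.
Proof.
  unfold Efun. rewrite <- cRI_scal; [|lra|intros; rcontin].
  rewrite (cRI_FTC (fun t => cexp (0 + RtoC t * (2 * PI * Ci * z)))%C); [|lra| |intros; rcontin].
  - unfold ee. replace (0 + 1 * (2 * PI * Ci * z))%C with (2 * PI * Ci * z)%C by ring.
    replace (0 + 0 * (2 * PI * Ci * z))%C with (RtoC 0) by ring. rewrite cexp_0. ring.
  - intros x _.
    assert (D := rder_comp cexp 0%C (2 * PI * Ci * z)%C x _ (Cder_cexp _)).
    replace (z * (2 * PI * Ci * cexp (2 * PI * Ci * z * x)))%C with
      (2 * PI * Ci * z * cexp (0 + RtoC x * (2 * PI * Ci * z)))%C; [exact D|].
    replace (0 + x * (2 * PI * Ci * z))%C with (2 * PI * Ci * z * x)%C by ring. ring.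
Qed.

Lemma Efun_0 : Efun 0%C = (2 * PI * Ci)%C.
Proof.
  unfold Efun. replace (fun x : R => (2 * PI * Ci * cexp (2 * PI * Ci * 0 * x))%C)
    with (fun _ : R => (2 * PI * Ci)%C).
  - rewrite cRI_const. replace (1 - 0) with 1 by ring. ring.
  - apply functional_extensionality. intros x.
    replace (2 * PI * Ci * 0 * x)%C with (RtoC 0) by ring. rewrite cexp_0. ring.
Qed.

Lemma Efun_Cd z : Cderivable Efun z.
Proof.
  apply (Cd_int (fun z x => 2 * PI * Ci * cexp (2 * PI * Ci * z * RtoC x))%C z 1
    (2 * PI * exp (2 * PI * (Cmod z + 1)))); try lra.
  - intros; cderiv.
  - intros; rcontin.
  - intros h x Hh Hx. assert (Hpi := PI_RGT_0). rewrite Cmod_mult, Cmod_2pii.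
    apply Rmult_le_compat_l; [lra|]. eapply Rle_trans; [apply Cmod_cexp_le|]. apply exp_le_mono.
    rewrite !(Cmod_mult _ (RtoC x)), (Cmod_mult _ (z + h)%C), Cmod_2pii, Cmod_R, Rabs_right by lra.
    assert (Cmod (z + h)%C <= Cmod z + 1) by (eapply Rle_trans; [apply Cmod_triangle|lra]).
    assert (Z := Cmod_ge_0 (z + h)%C).
    apply Rle_trans with (2 * PI * Cmod (z + h)%C * 1); [apply Rmult_le_compat_l; [apply Rmult_le_pos|]; lra|].
    rewrite Rmult_1_r. apply Rmult_le_compat_l; lra.
Qed.

(** * The prefactor at the integers *)

Definition posint (s : C) : Prop := exists k, (1 <= k)%nat /\ s = RtoC (INR k).
Definition npint (s : C) : Prop := exists n : nat, s = RtoC (- INR n).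

Lemma npint_ee s : npint s -> ee s = 1%C.
Proof. intros [n ->]. rewrite INR_IZR_INZ, <- opp_IZR. apply ee_IZR. Qed.

Lemma posint_ee s : posint s -> ee s = 1%C.
Proof. intros [n [_ ->]]. apply ee_nat. Qed.

Lemma ee_int_cases s : ee s = 1%C -> posint s \/ npint s.
Proof.
  intros H. destruct (ee_eq_1 s H) as [k ->]. destruct (Z_lt_le_dec 0 k) as [L|L].
  - left. exists (Z.to_nat k). split; [lia|]. rewrite INR_IZR_INZ, Z2Nat.id by lia. auto.
  - right. exists (Z.to_nat (- k)). rewrite INR_IZR_INZ, Z2Nat.id, <- opp_IZR by lia.
    do 2 f_equal. lia.
Qed.

Lemma ee_not_1_near s : ee s <> 1%C -> exists d, 0 < d /\ forall h, Cmod h < d -> ee (s + h)%C <> 1%C.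
Proof.
  intros H. destruct (Cd_nonzero_near (fun s => ee s - 1)%C s) as [d [Hd Hn]].
  - apply Cd_minus; [apply Cd_ee|apply Cd_const].
  - intros E. apply H. apply Ceq_minus; auto.
  - exists d. split; auto. intros h Hh E. apply (Hn h Hh). rewrite E. ring.
Qed.

Lemma int_isolated k h : ee (RtoC (IZR k) + h)%C = 1%C -> Cmod h < 1 -> h = 0%C.
Proof.
  intros E Hh. rewrite ee_plus, ee_IZR, Cmult_1_l in E. destruct (ee_eq_1 h E) as [m ->].
  rewrite Cmod_R, <- abs_IZR in Hh. apply lt_IZR in Hh. replace m with 0%Z by lia. auto.
Qed.

Lemma rg_rec_n n s : rg s = (cprod n (fun j => s + RtoC (INR j)) * rg (s + RtoC (INR n)))%C.
Proof.
  induction n as [|n IH].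
  - unfold cprod; simpl. replace (s + 0)%C with s by ring. ring.
  - rewrite IH, cprod_S, (rg_rec (s + RtoC (INR n))%C), S_INR, RtoC_plus, !Cplus_assoc. ring.
Qed.

(** A formula for the prefactor that is regular at [s = - n]. It comes from [1/Gamma(s) = s (s+1)
    ... (s+n) / Gamma(s+n+1)] and [e(s) - 1 = (s+n) Efun(s+n)] by cancelling the factor [s + n]. *)
Definition Bfun (n : nat) (s : C) : C :=
  (cprod n (fun j => s + RtoC (INR j)) * rg (s + RtoC (INR n) + 1) * / Efun (s + RtoC (INR n)))%C.

Lemma Bfun_eq n s : ee s <> 1%C -> Bfun n s = (rg s / (ee s - 1))%C.
Proof.
  intros H. assert (E := Efun_mult (s + RtoC (INR n))%C).
  rewrite ee_plus, ee_nat, Cmult_1_r in E.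
  assert (Hn : (ee s - 1)%C <> 0%C) by (intros Q; apply H, Ceq_minus; auto).
  assert (Rn := rg_rec_n (S n) s). rewrite cprod_S, S_INR, RtoC_plus, Cplus_assoc in Rn.
  unfold Bfun. rewrite Rn, <- E.
  assert (H1 : (s + RtoC (INR n))%C <> 0%C) by (intros Q; rewrite Q in E; apply Hn; rewrite <- E; ring).
  assert (H2 : Efun (s + RtoC (INR n))%C <> 0%C) by (intros Q; rewrite Q in E; apply Hn; rewrite <- E; ring).
  field. auto.
Qed.

Lemma Bfun_Cd n s : Efun (s + RtoC (INR n))%C <> 0%C -> Cderivable (Bfun n) s.
Proof.
  intros H. unfold Bfun. apply Cd_mult; [apply Cd_mult|].
  - apply (Cd_cprod n (fun j s => s + RtoC (INR j))%C). intros; cderiv.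
  - apply (Cd_comp rg (fun s => s + RtoC (INR n) + 1)%C); [cderiv|apply rg_Cd].
  - apply Cd_inv; auto. apply (Cd_comp Efun (fun s => s + RtoC (INR n))%C); [cderiv|apply Efun_Cd].
Qed.

(** At the integers [s <= 0] the literal quotient divides by zero, so there the value of the
    regularized formula is inserted. *)
Definition Bf (s : C) : C :=
  match excluded_middle_informative (npint s) with
  | left _ => Bfun (epsilon (inhabits O) (fun n => s = RtoC (- INR n))) s
  | right _ => (rg s / (ee s - 1))%C
  end.

Lemma Bf_eq s : ee s <> 1%C -> Bf s = (rg s / (ee s - 1))%C.
Proof.
  intros H. unfold Bf. destruct (excluded_middle_informative (npint s)) as [P|P]; auto.
  exfalso. apply H, npint_ee; auto.
Qed.

Lemma Bf_npint n : Bf (RtoC (- INR n)) = Bfun n (RtoC (- INR n)).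
Proof.
  unfold Bf. destruct (excluded_middle_informative _) as [P|P].
  - f_equal. assert (E := epsilon_spec (inhabits O) _ P). cbv beta in E.
    apply RtoC_inj in E. apply INR_eq. lra.
  - exfalso. apply P. exists n; auto.
Qed.

Lemma Bf_Cd s : ~ posint s -> Cderivable Bf s.
Proof.
  intros Hp. destruct (excluded_middle_informative (npint s)) as [[n Hn]|Hn].
  - apply (Cd_ext_loc (Bfun n) Bf s 1); [lra| |].
    + intros h Hh. destruct (excluded_middle_informative (ee (s + h)%C = 1%C)) as [E|E].
      * assert (H0 : h = 0%C).
        { apply (int_isolated (- Z.of_nat n) h); auto. rewrite opp_IZR, <- INR_IZR_INZ, <- Hn; auto. }
        rewrite H0. replace (s + 0)%C with s by ring. rewrite Hn. symmetry. apply Bf_npint.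
      * rewrite Bfun_eq, Bf_eq; auto.
    + apply Bfun_Cd. rewrite Hn, <- RtoC_plus, Rplus_opp_l, Efun_0. apply two_pi_i_nz.
  - assert (He : ee s <> 1%C) by (intros E; destruct (ee_int_cases s E); auto).
    destruct (ee_not_1_near s He) as [d [Hd H]].
    apply (Cd_ext_loc (fun s => rg s / (ee s - 1))%C Bf s d); auto.
    + intros h Hh. rewrite Bf_eq; auto.
    + apply Cd_div; [|apply rg_Cd|apply Cd_minus; [apply Cd_ee|apply Cd_const]].
      intros Q. apply He, Ceq_minus; auto.
Qed.

Lemma not_posint_near s : ~ posint s -> exists d, 0 < d /\ forall h, Cmod h < d -> ~ posint (s + h)%C.
Proof.
  intros Hp. destruct (excluded_middle_informative (npint s)) as [[n Hn]|Hn].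
  - exists 1. split; [lra|]. intros h Hh [k [Hk E]].
    assert (P := Re_le_Cmod h). assert (Q := f_equal Re E).
    rewrite re_plus, re_RtoC, Hn, re_RtoC in Q. assert (Z := pos_INR n).
    apply (le_INR 1) in Hk. simpl in Hk. assert (W := Rle_abs (Re h)). lra.
  - assert (He : ee s <> 1%C) by (intros E; destruct (ee_int_cases s E); auto).
    destruct (ee_not_1_near s He) as [d [Hd H]]. exists d. split; auto.
    intros h Hh Q. apply (H h Hh). apply posint_ee; auto.
Qed.

(** The two regions on which [Lp] has a holomorphic formula: the Mellin half plane, and the
    complement of the positive integers for the Hankel form. *)
Lemma posint_not_PN N s : ~ PN N s -> INR N < Re s \/ ~ posint s.
Proof.
  intros H. destruct (Rlt_dec (INR N) (Re s)) as [L|L]; [left; auto|right].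
  intros [k [Hk E]]. apply H. exists k. split; auto. split; auto.
  apply INR_le. rewrite E, re_RtoC in L. lra.
Qed.

(** * The zeta function on the points where the integrand decays *)

Definition rsel N a th : R := epsilon (inhabits 1) (fun r => valid N r a th).

(** The prefactor has poles at the integers beyond [N], so the Hankel form is used only for
    [Re s <= N]. The Mellin form takes over for [Re s > N]; [Lp_BHan] shows that they agree at every
    [s] that is not a positive integer. *)
Definition Lp N s w a th : C :=
  if Rlt_dec (INR N) (Re s) then (rg s * Mell N s w a th)%C
  else (Bf s * Han N (rsel N a th) s w a th)%C.

Lemma rsel_valid N w a th : Plus N w a th -> valid N (rsel N a th) a th.
Proof. intros H. apply (epsilon_spec (inhabits 1) (fun r => valid N r a th)). eapply valid_exists; eauto. Qed.

Lemma Han_s_Cd N r w a th s : Plus N w a th -> valid N r a th -> Cderivable (fun s => Han N r s w a th) s.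
Proof.
  intros HP HV. destruct (Plus_PlusC N w a th HP) as [c [Hc HPc]]. assert (Hpi := PI_RGT_0).
  destruct (rcont_bounded (fun y => Gz N 0 w a th (cpt (ln r) y)) 0 (2 * PI)) as [M HM]; [lra| |].
  { intros; apply Gz_circle_rcont; auto. }
  (* The dependence on [s] is the single factor [exp (s z)], and [|z| <= |ln r| + 2 pi] on the
     segment that represents the circle; [M] bounds the rest, which is the case [s = 0]. *)
  set (B := exp ((Cmod s + 1) * (Rabs (ln r) + 2 * PI))).
  apply (Han_curve_Cd N r (fun s => s) (fun _ => w) (fun _ => a) th s 1 c (Cmod s + 1) (Rabs M * B));
    auto using Cd_id, Cd_const; try lra.
  intros h Hh. split; [auto|]. split; [|split; auto].
  - eapply Rle_trans; [apply Re_le_Cmod|]. eapply Rle_trans; [apply Cmod_triangle|]. lra.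
  - intros y Hy. specialize (HM y Hy). unfold Gz in HM |- *.
    rewrite Cmult_0_l, cexp_0, Cmult_1_r in HM. rewrite Cmod_mult.
    apply Rmult_le_compat; auto using Cmod_ge_0.
    + eapply Rle_trans; [exact HM|apply Rle_abs].
    + eapply Rle_trans; [apply Cmod_cexp_le|]. apply exp_le_mono. rewrite Cmod_mult.
      apply Rmult_le_compat; auto using Cmod_ge_0.
      * eapply Rle_trans; [apply Cmod_triangle|]. lra.
      * eapply Rle_trans; [apply Cmod_le_ReIm|]. rewrite Re_cpt, Im_cpt, (Rabs_right y); lra.
Qed.

Lemma Mell_s_Cd N w a th s : Plus N w a th -> INR N < Re s -> Cderivable (fun s => Mell N s w a th) s.
Proof.
  intros HP Hs. destruct (Plus_PlusC N w a th HP) as [c [Hc HPc]].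
  set (d := Rmin 1 ((Re s - INR N) / 2)).
  assert (Hd : 0 < d) by (unfold d; apply Rmin_pos; lra).
  assert (D1 : d <= 1) by apply Rmin_l. assert (D2 : d <= (Re s - INR N) / 2) by apply Rmin_r.
  apply (Mell_curve_Cd N (fun s => s) (fun _ => w) (fun _ => a) th s d c d (Re s + 1));
    auto using Cd_id, Cd_const; try lra.
  intros h Hh. split; auto. rewrite re_plus. assert (P := Re_le_Cmod h). apply Rabs_le_between in P. lra.
Qed.

Lemma Han_indep N r1 r2 w a th s : Plus N w a th -> valid N r1 a th -> valid N r2 a th -> ~ PN N s ->
  Han N r1 s w a th = Han N r2 s w a th.
Proof.
  intros HP H1 H2. apply (continuation_unique N (fun s => Han N r1 s w a th) (fun s => Han N r2 s w a th)).
  - intros; apply Han_s_Cd; auto.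
  - intros; apply Han_s_Cd; auto.
  - intros s' Hs'. rewrite !Han_Mell; auto.
Qed.

Lemma Lp_Mell N s w a th : INR N < Re s -> Lp N s w a th = (rg s * Mell N s w a th)%C.
Proof. intros H. unfold Lp. destruct (Rlt_dec (INR N) (Re s)); [auto|contradiction]. Qed.

Lemma Lp_BHan N r s w a th : Plus N w a th -> valid N r a th -> ~ posint s ->
  Lp N s w a th = (Bf s * Han N r s w a th)%C.
Proof.
  intros HP HV Hs. unfold Lp. destruct (Rlt_dec (INR N) (Re s)) as [L|L].
  - assert (He : ee s <> 1%C).
    { intros E. destruct (ee_int_cases s E) as [Q|[n Q]]; auto.
      rewrite Q, re_RtoC in L. assert (Z1 := pos_INR n). assert (Z2 := pos_INR N). lra. }
    rewrite Bf_eq, Han_Mell by auto. field. intros Q; apply He, Ceq_minus; auto.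
  - f_equal. apply Han_indep; auto.
    + apply (rsel_valid N w); auto.
    + intros [k [[H1 H2] H3]]. apply Hs. exists k; auto.
Qed.

Lemma Lp_formula N r s w a th : Plus N w a th -> valid N r a th -> ee s <> 1%C ->
  Lp N s w a th = (rg s * Han N r s w a th / (ee s - 1))%C.
Proof.
  intros HP HV He. rewrite (Lp_BHan N r); auto.
  - rewrite Bf_eq by auto. field. intros Q; apply He, Ceq_minus; auto.
  - intros Q. apply He, posint_ee; auto.
Qed.

Lemma Lp_s_Cd N w a th s : Plus N w a th -> ~ PN N s -> Cderivable (fun s => Lp N s w a th) s.
Proof.
  intros HP Hs. destruct (posint_not_PN N s Hs) as [L|L].
  - apply (Cd_ext_loc (fun s => rg s * Mell N s w a th)%C _ s (Re s - INR N)); [lra| |].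
    + intros h Hh. rewrite Lp_Mell; auto. rewrite re_plus. assert (P := Re_le_Cmod h).
      apply Rabs_le_between in P. lra.
    + apply Cd_mult; [apply rg_Cd|apply Mell_s_Cd; auto].
  - destruct (not_posint_near s L) as [d [Hd H]]. destruct (valid_exists N w a th HP) as [r HV].
    apply (Cd_ext_loc (fun s => Bf s * Han N r s w a th)%C _ s d); auto.
    + intros h Hh. rewrite (Lp_BHan N r); auto.
    + apply Cd_mult; [apply Bf_Cd; auto|apply Han_s_Cd; auto].
Qed.

(** By periodicity [e(s) - 1 = (s - k) Efun(s - k)], and [Efun(0)] is nonzero. Multiplying by
    [s - k] therefore leaves a function that is holomorphic at [k]. *)
Lemma Lp_pole N w a th k : Plus N w a th -> exists l : C, forall eta, 0 < eta ->
  exists delta, 0 < delta /\ forall s,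
    0 < Cmod (s - RtoC (INR k))%C -> Cmod (s - RtoC (INR k))%C < delta ->
    Cmod ((s - RtoC (INR k)) * Lp N s w a th - l)%C < eta.
Proof.
  intros HP. destruct (valid_exists N w a th HP) as [r HV].
  set (k0 := RtoC (INR k)).
  set (H := fun s => (rg s * Han N r s w a th * / Efun (s - k0))%C).
  assert (HH : Cderivable H k0).
  { apply Cd_mult; [apply Cd_mult; [apply rg_Cd|apply Han_s_Cd; auto]|].
    apply Cd_inv.
    - replace (k0 - k0)%C with (RtoC 0) by ring. rewrite Efun_0. apply two_pi_i_nz.
    - apply (Cd_comp Efun (fun s => s - k0)%C); [cderiv|apply Efun_Cd]. }
  exists (H k0). intros eta He. destruct (Cd_cont H k0 HH eta He) as [d [Hd Hc]].
  exists (Rmin d 1). split; [apply Rmin_pos; lra|]. intros s H0 H1.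
  assert (A := Rlt_le_trans _ _ _ H1 (Rmin_l _ _)). assert (B := Rlt_le_trans _ _ _ H1 (Rmin_r _ _)).
  assert (Hne : ee s <> 1%C).
  { intros E. assert (Z : (s - k0)%C = 0%C).
    { apply (int_isolated (Z.of_nat k)); auto. rewrite <- INR_IZR_INZ. fold k0.
      replace (k0 + (s - k0))%C with s by ring. auto. }
    rewrite Z, Cmod_0 in H0. lra. }
  replace ((s - k0) * Lp N s w a th)%C with (H s); [apply Hc; auto|].
  rewrite (Lp_formula N r) by auto. unfold H.
  assert (E := Efun_mult (s - k0)%C).
  replace (ee (s - k0)%C) with (ee s) in E.
  2:{ replace s with ((s - k0) + k0)%C at 1 by ring. rewrite ee_plus. unfold k0 at 2. rewrite ee_nat. ring. }
  assert (Hn : (ee s - 1)%C <> 0%C) by (intros Q; apply Hne, Ceq_minus; auto).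
  rewrite <- E in Hn |- *.
  assert (N1 : (s - k0)%C <> 0%C) by (apply Cmod_gt_0; auto).
  assert (N2 : Efun (s - k0)%C <> 0%C) by (intros Q; apply Hn; rewrite Q; ring).
  field. auto.
Qed.

(** * Rotation invariance *)

Lemma Re_rot om z : Re (rot om z) = cos om * Re z - sin om * Im z.
Proof.
  unfold rot. replace (Ci * RtoC om)%C with (cpt 0 om) by (unfold cpt; ring).
  rewrite cpt_pair. unfold cexp, Re, Im, Cmult; simpl. rewrite exp_0. ring.
Qed.

Lemma rot_rot b c z : rot b (rot c z) = rot (b + c) z.
Proof.
  unfold rot. rewrite Cmult_assoc, <- cexp_plus. do 2 f_equal. rewrite RtoC_plus. ring.
Qed.

Lemma rotv_rotv b c a : rotv b (rotv c a) = rotv (b + c) a.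
Proof. unfold rotv. apply functional_extensionality. intros l. apply rot_rot. Qed.

Lemma rot_0 z : rot 0 z = z.
Proof. unfold rot. rewrite Cmult_0_r, cexp_0. ring. Qed.

Lemma rotv_0 a : rotv 0 a = a.
Proof. unfold rotv. apply functional_extensionality. intros l. apply rot_0. Qed.

Lemma rot_eq_0 om z : rot om z = 0%C -> z = 0%C.
Proof.
  unfold rot. intros H. assert (N := cexp_nz (Ci * RtoC om)%C).
  replace z with (/ cexp (Ci * RtoC om) * (cexp (Ci * RtoC om) * z))%C by (field; auto).
  rewrite H. ring.
Qed.

(** [sin om * Re (rot y z)] equals [sin (om - y) * Re z + sin y * Re (rot om z)]. The two
    coefficients are nonnegative and add up to at least [sin om], so the bound [c] at both ends
    holds in between. *)
Lemma Re_rot_between c om y z : 0 <= y <= om -> 0 < om < PI -> 0 < c ->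
  c <= Re z -> c <= Re (rot om z) -> c <= Re (rot y z).
Proof.
  intros Hy Ho Hc H1 H2.
  assert (Hs : 0 < sin om) by (apply sin_gt_0; lra).
  assert (S1 : 0 <= sin y) by (apply sin_ge_0; lra).
  assert (S2 : 0 <= sin (om - y)) by (apply sin_ge_0; lra).
  assert (E : sin om * Re (rot y z) = sin (om - y) * Re z + sin y * Re (rot om z)).
  { rewrite !Re_rot, sin_minus.
    assert (Q := sin2_cos2 y). unfold Rsqr in Q.
    replace (sin om * (cos y * Re z - sin y * Im z)) with
      ((sin om * cos y) * Re z - sin om * sin y * Im z) by ring. ring. }
  assert (T : sin om <= sin (om - y) + sin y).
  { replace (sin om) with (sin (om - y + y)) by (f_equal; ring). rewrite sin_plus.
    assert (B1 := COS_bound y). assert (B2 := COS_bound (om - y)). nra. }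
  assert (sin om * c <= sin om * Re (rot y z)); [|nra]. rewrite E. nra.
Qed.

(** For [Re s > N], rotating [(w, a)] by [om] amounts to moving the line of the Mellin integral to
    height [om]; [Re_rot_between] ensures decay on all lines between. Uniqueness of the continuation
    extends the identity to all [s]. *)
Lemma Lp_rot_pos N om s w a th : 0 < om < PI -> Plus N w a th -> Plus N (rot om w) (rotv om a) th ->
  ~ PN N s -> Lp N s w a th = (cexp (Ci * s * RtoC om) * Lp N s (rot om w) (rotv om a) th)%C.
Proof.
  intros Hom HP HP'. revert s.
  apply (continuation_unique N (fun s => Lp N s w a th)
    (fun s => cexp (Ci * s * RtoC om) * Lp N s (rot om w) (rotv om a) th)%C).
  - intros; apply Lp_s_Cd; auto.
  - intros; apply Cd_mult; [cderiv|apply Lp_s_Cd; auto].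
  - intros s Hs. rewrite !Lp_Mell by auto.
    destruct (Plus_PlusC N w a th HP) as [c1 [Hc1 HP1]].
    destruct (Plus_PlusC _ _ _ _ HP') as [c2 [Hc2 HP2]].
    set (c := Rmin c1 c2). assert (M1 : c <= c1) by apply Rmin_l. assert (M2 : c <= c2) by apply Rmin_r.
    assert (Hc : 0 < c <= 1) by (unfold c; split; [apply Rmin_pos; lra|fold c; lra]).
    assert (HPy : forall y, 0 <= y <= om -> PlusC N c (rot y w) (rotv y a) th).
    { intros y Hy. destruct HP1 as [W1 A1]. destruct HP2 as [W2 A2]. split.
      - apply (Re_rot_between c om y w); lra.
      - intros l Hl. destruct (A1 l Hl) as [P|[P1 P2]].
        + destruct (A2 l Hl) as [Q|[Q1 Q2]].
          * left. apply (Re_rot_between c om y (a l)); try lra. unfold rotv in Q. lra.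
          * apply rot_eq_0 in Q1. rewrite Q1, re_RtoC in P. lra.
        + right. split; [|lra]. unfold rotv. rewrite P1. unfold rot. ring. }
    set (tau := Rmin 1 (Re s - INR N)).
    assert (Ht : 0 < tau <= 1) by (unfold tau; split; [apply Rmin_pos; lra|apply Rmin_l]).
    assert (Hts : tau <= Re s - INR N) by apply Rmin_r.
    destruct (Gz_dom N c tau (Re s) Hc Ht) as [K [HK HD]].
    assert (EG : forall x y, Gz N s w a th (cpt x y) = (cexp (Ci * s * RtoC y) * Gz N s (rot y w) (rotv y a) th (RtoC x))%C).
    { intros x y. unfold Gz. rewrite <- FN_rot. unfold cpt. rewrite cexp_plus.
      replace (s * (RtoC x + Ci * RtoC y))%C with (Ci * s * RtoC y + s * RtoC x)%C by ring.
      rewrite cexp_plus. ring. }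
    assert (EL : LI (fun x => Gz N s w a th (cpt x 0)) = LI (fun x => Gz N s w a th (cpt x om))).
    { apply (LI_line_shift (Gz N s w a th) (exp (Cmod s * om) * K) tau); try lra.
      - intros x y Hy. apply Gz_Cd. intros l Hl.
        assert (D := den_ray_nz N c _ _ th l (exp x) Hc (HPy y Hy) Hl (exp_pos x)).
        intros Q. apply D. rewrite <- Q. unfold den, rotv, rot, cpt. rewrite cexp_plus, cexp_RtoC. do 3 f_equal. ring.
      - intros y Hy x. rewrite EG, Cmod_mult, Rmult_assoc.
        apply Rmult_le_compat; auto using Cmod_ge_0.
        + eapply Rle_trans; [apply Cmod_cexp_le|]. apply exp_le_mono.
          rewrite !Cmod_mult, Cmod_Ci, Cmod_R, Rabs_right by lra. rewrite Rmult_1_l.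
          apply Rmult_le_compat_l; [apply Cmod_ge_0|lra].
        + apply (HD s (rot y w) (rotv y a) th); auto. lra. }
    unfold Mell.
    replace (LI (fun x => Gz N s w a th (RtoC x))) with (LI (fun x => Gz N s w a th (cpt x 0)))
      by (f_equal; apply functional_extensionality; intros; rewrite cpt_0; auto).
    rewrite EL.
    replace (LI (fun x => Gz N s w a th (cpt x om))) with
      (cexp (Ci * s * RtoC om) * LI (fun x => Gz N s (rot om w) (rotv om a) th (RtoC x)))%C.
    + ring.
    + symmetry. apply LI_unique. apply isLI_ext with
        (fun x => cexp (Ci * s * RtoC om) * Gz N s (rot om w) (rotv om a) th (RtoC x))%C.
      * intros x. rewrite EG. auto.
      * specialize (HPy om ltac:(lra)).
        apply isLI_scal; [intros; apply (Gz_ray_rcont N c); auto|].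
        apply (LI_correct _ K tau); try lra.
        -- intros; apply (Gz_ray_rcont N c); auto.
        -- apply HD; auto. lra.
Qed.

Lemma Lp_rot N om s w a th : - PI < om < PI -> Plus N w a th -> Plus N (rot om w) (rotv om a) th ->
  ~ PN N s -> Lp N s w a th = (cexp (Ci * s * RtoC om) * Lp N s (rot om w) (rotv om a) th)%C.
Proof.
  intros Hom HP HP' Hs. destruct (Rlt_dec 0 om) as [L|L]; [apply Lp_rot_pos; auto; lra|].
  destruct (Req_dec om 0) as [E|E].
  - subst. rewrite rot_0, rotv_0, Cmult_0_r, cexp_0. ring.
  - assert (H := Lp_rot_pos N (- om) s (rot om w) (rotv om a) th ltac:(lra) HP').
    rewrite rot_rot, rotv_rotv, Rplus_opp_l, rot_0, rotv_0 in H. rewrite (H HP Hs).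
    rewrite Cmult_assoc, <- cexp_plus.
    replace (Ci * s * RtoC om + Ci * s * RtoC (- om))%C with (RtoC 0) by (rewrite RtoC_opp; ring).
    rewrite cexp_0. ring.
Qed.

(** * Local boundedness and holomorphy along lines *)

(** [d], [c] and [r] are fixed before [S]: one radius serves all points near [(w0, a0)], and only
    the bound on the circle depends on the range of [s]. *)
Lemma Gz_local N w0 a0 th : Plus N w0 a0 th -> exists d c r, 0 < d /\ 0 < c <= 1 /\ 0 < r /\
  forall S, exists M, forall s w a, Cmod (w - w0)%C < d -> NearA N d a0 a ->
    PlusC N c w a th /\ valid N r a th /\
    (Cmod s <= S -> forall y, 0 <= y <= 2 * PI -> Cmod (Gz N s w a th (cpt (ln r) y)) <= M).
Proof.
  intros HP. destruct (Plus_PlusC _ _ _ _ HP) as [c [Hc HPc]]. assert (Hpi := PI_RGT_0).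
  destruct (den_near N w0 a0 th HP) as [d1 [r [k [Hd1 [Hr [Hk Hden]]]]]].
  set (d := Rmin d1 (c / 2)). assert (Hd : 0 < d) by (unfold d; apply Rmin_pos; lra).
  assert (D1 : d <= d1) by apply Rmin_l. assert (D2 : d <= c / 2) by apply Rmin_r.
  exists d, (c / 2), r. repeat split; try lra. intros S.
  exists (exp (r * (Cmod w0 + d)) * (/ (k * r)) ^ N * exp (S * (Rabs (ln r) + 2 * PI))).
  intros s w a Hw Ha.
  assert (Ha1 : NearA N d1 a0 a) by (intros l Hl; destruct (Ha l Hl); split; auto; lra).
  split; [|split].
  - apply (PlusC_near N c w0 a0); auto; try lra. intros l Hl; destruct (Ha l Hl); split; auto; lra.
  - split; auto. intros l u Hl H1 H2 E.
    specialize (Hden a u l Ha1 Hl (conj H1 H2)).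
    unfold den in Hden. rewrite E in Hden. replace (- u * a l)%C with (- (u * a l))%C in Hden by ring.
    rewrite cexp_opp in Hden. assert (Hz := cexp_nz (u * a l)%C).
    replace (1 - cexp (u * a l) * / cexp (u * a l))%C with (RtoC 0) in Hden by (field; auto).
    rewrite Cmod_0 in Hden. assert (0 < k * Cmod u) by (apply Rmult_lt_0_compat; auto). lra.
  - intros HS y Hy. unfold Gz. rewrite Cmod_mult.
    assert (Eu := Cmod_cexp_cpt r y Hr).
    assert (Hkr : 0 < k * r) by (apply Rmult_lt_0_compat; auto).
    apply Rmult_le_compat; auto using Cmod_ge_0.
    + assert (B := FN_near_bound N k (cexp (cpt (ln r) y)) w a th Hk ltac:(rewrite Eu; auto)
        ltac:(intros l Hl; apply Hden; auto; rewrite Eu; lra)).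
      rewrite Eu in B. eapply Rle_trans; [exact B|].
      apply Rmult_le_compat_r; [apply pow_le; left; apply Rinv_0_lt_compat; auto|].
      apply exp_le_mono, Rmult_le_compat_l; [lra|].
      replace w with ((w - w0) + w0)%C by ring. eapply Rle_trans; [apply Cmod_triangle|]. lra.
    + eapply Rle_trans; [apply Cmod_cexp_le|]. apply exp_le_mono. rewrite Cmod_mult.
      apply Rmult_le_compat; auto using Cmod_ge_0.
      eapply Rle_trans; [apply Cmod_le_ReIm|]. rewrite Re_cpt, Im_cpt, (Rabs_right y); lra.
Qed.

Lemma line_near (z0 z1 v : C) d : Cmod (z1 - z0)%C < d ->
  exists rho, 0 < rho /\ forall t, Cmod t < rho -> Cmod (z1 + t * v - z0)%C < d.
Proof.
  intros H. assert (Hv := Cmod_ge_0 v).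
  exists ((d - Cmod (z1 - z0)%C) / (Cmod v + 1)). split; [apply div_pos; lra|].
  intros t Ht. replace (z1 + t * v - z0)%C with ((z1 - z0) + t * v)%C by ring.
  eapply Rle_lt_trans; [apply Cmod_triangle|]. rewrite Cmod_mult.
  apply Rmult_lt_compat_r with (r := Cmod v + 1) in Ht; [|lra].
  replace ((d - Cmod (z1 - z0)%C) / (Cmod v + 1) * (Cmod v + 1)) with (d - Cmod (z1 - z0)%C) in Ht by (field; lra).
  assert (Z := Cmod_ge_0 t). lra.
Qed.

Lemma lineA_near N d a0 a1 v : NearA N d a0 a1 -> (forall l, inPN N l -> a0 l = RtoC 0 -> v l = RtoC 0) ->
  exists rho, 0 < rho /\ forall t, Cmod t < rho -> NearA N d a0 (fun l => a1 l + t * v l)%C.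
Proof.
  intros H Hv. induction N as [|N IH].
  - exists 1. split; [lra|]. intros t _ l [H1 H2]; lia.
  - destruct IH as [r [Hr HI]].
    { intros l [H1 H2]. apply H. split; lia. } { intros l [H1 H2]. apply Hv. split; lia. }
    assert (HS : inPN (S N) (S N)) by (split; lia).
    destruct (H (S N) HS) as [A B].
    destruct (line_near (a0 (S N)) (a1 (S N)) (v (S N)) d A) as [r' [Hr' H']].
    assert (R1 := Rmin_l r r'). assert (R2 := Rmin_r r r').
    exists (Rmin r r'). split; [apply Rmin_pos; auto|]. intros t Ht l Hl.
    destruct (Nat.eq_dec l (S N)) as [->|E].
    + split; [apply H'; lra|]. intros Z. rewrite (B Z), (Hv _ HS Z). ring.
    + apply HI; [lra|]. destruct Hl; split; lia.
Qed.

(** This supplies the two hypotheses of [osgood], local boundedness and holomorphy along complex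
    lines. The Mellin and the Hankel formula are treated separately, as in [posint_not_PN]. *)
Lemma Lp_local N s0 w0 a0 th : Plus N w0 a0 th -> ~ PN N s0 -> exists d M, 0 < d /\
  forall s w a, Cmod (s - s0)%C < d -> Cmod (w - w0)%C < d -> NearA N d a0 a ->
    Cmod (Lp N s w a th) <= M /\
    forall sg om v, (forall l, inPN N l -> a0 l = RtoC 0 -> v l = RtoC 0) ->
      Cderivable (fun t => Lp N (s + t * sg) (w + t * om) (fun l => a l + t * v l) th)%C 0%C.
Proof.
  intros HP Hs0. destruct (Gz_local N w0 a0 th HP) as [d1 [c [r [Hd1 [Hc [Hr HG]]]]]].
  destruct (HG (Cmod s0 + 1)) as [M0 HM0].
  assert (Hline : forall d s w a sg om v, Cmod (s - s0)%C < d -> Cmod (w - w0)%C < d -> NearA N d a0 a ->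
     (forall l, inPN N l -> a0 l = RtoC 0 -> v l = RtoC 0) ->
     exists rho, 0 < rho /\ forall t, Cmod t < rho -> Cmod (s + t * sg - s0)%C < d /\
       Cmod (w + t * om - w0)%C < d /\ NearA N d a0 (fun l => a l + t * v l)%C).
  { intros d s w a sg om v H1 H2 H3 H4.
    destruct (line_near s0 s sg d H1) as [r1 [P1 Q1]]. destruct (line_near w0 w om d H2) as [r2 [P2 Q2]].
    destruct (lineA_near N d a0 a v H3 H4) as [r3 [P3 Q3]].
    exists (Rmin r1 (Rmin r2 r3)). split; [repeat apply Rmin_pos; auto|]. intros t Ht.
    assert (A1 := Rmin_l r1 (Rmin r2 r3)). assert (A2 := Rmin_r r1 (Rmin r2 r3)).
    assert (A3 := Rmin_l r2 r3). assert (A4 := Rmin_r r2 r3).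
    split; [apply Q1; lra|split; [apply Q2; lra|apply Q3; lra]]. }
  assert (Hsize : forall s, Cmod (s - s0)%C < 1 -> Cmod s <= Cmod s0 + 1).
  { intros s H. replace s with ((s - s0) + s0)%C by ring. eapply Rle_trans; [apply Cmod_triangle|]. lra. }
  destruct (posint_not_PN N s0 Hs0) as [L|L].
  (* Half of the distance to the line [Re s = N]: points within [tau] of [s0] still satisfy
     [Re s >= N + tau]. *)
  - set (tau := Rmin 1 ((Re s0 - INR N) / 2)).
    assert (Ht : 0 < tau <= 1) by (unfold tau; split; [apply Rmin_pos; lra|apply Rmin_l]).
    assert (Ht2 : tau <= (Re s0 - INR N) / 2) by apply Rmin_r.
    destruct (Cd_cont rg s0 (rg_Cd s0) 1 Rlt_0_1) as [d2 [Hd2 Hrg]].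
    destruct (Mell_bound N c tau (Re s0 + 1) Hc Ht) as [MM [HMM HB]].
    set (d := Rmin d1 (Rmin d2 tau)).
    assert (Hd : 0 < d) by (unfold d; repeat apply Rmin_pos; lra).
    assert (D1 : d <= d1) by apply Rmin_l.
    assert (D2 : d <= d2) by (eapply Rle_trans; [apply Rmin_r|apply Rmin_l]).
    assert (D3 : d <= tau) by (eapply Rle_trans; [apply Rmin_r|apply Rmin_r]).
    exists d, ((Cmod (rg s0) + 1) * MM). split; auto.
    assert (Hre : forall s, Cmod (s - s0)%C < d -> INR N + tau <= Re s <= Re s0 + 1).
    { intros s Hs. assert (P := Re_le_Cmod (s - s0)%C). unfold Cminus in P at 1.
      rewrite re_plus, re_opp in P. apply Rabs_le_between in P. lra. }
    assert (HPc : forall w a, Cmod (w - w0)%C < d -> NearA N d a0 a -> PlusC N c w a th).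
    { intros w a H1 H2. apply (HM0 s0 w a); [lra|]. intros l Hl; destruct (H2 l Hl); split; auto; lra. }
    intros s w a H1 H2 H3. split.
    + rewrite Lp_Mell by (specialize (Hre s H1); lra). rewrite Cmod_mult.
      apply Rmult_le_compat; auto using Cmod_ge_0.
      replace (rg s) with ((rg s - rg s0) + rg s0)%C by ring.
      eapply Rle_trans; [apply Cmod_triangle|]. specialize (Hrg s ltac:(lra)). lra.
    + intros sg om v Hv. destruct (Hline d s w a sg om v H1 H2 H3 Hv) as [rho [Hrho HL]].
      apply (Cd_ext_loc (fun t => rg (s + t * sg) * Mell N (s + t * sg) (w + t * om) (fun l => a l + t * v l) th)%C _ 0%C rho); auto.
      * intros h Hh. replace (0 + h)%C with h by ring. destruct (HL h Hh) as [Q1 _].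
        rewrite Lp_Mell; auto. specialize (Hre _ Q1). lra.
      * apply Cd_mult.
        { apply (Cd_comp rg (fun t => s + t * sg)%C); [cderiv|apply rg_Cd]. }
        apply (Mell_curve_Cd N (fun t => s + t * sg)%C (fun t => w + t * om)%C (fun t l => a l + t * v l)%C
           th 0%C rho c tau (Re s0 + 1)); auto; try solve [intros; cderiv].
        intros h Hh. replace (0 + h)%C with h by ring. destruct (HL h Hh) as [Q1 [Q2 Q3]]. split; auto.
  - destruct (not_posint_near s0 L) as [d2 [Hd2 Hnp]].
    destruct (Cd_cont Bf s0 (Bf_Cd s0 L) 1 Rlt_0_1) as [d3 [Hd3 HBf]].
    set (S := Cmod s0 + 1).
    destruct (Han_bound N c S r M0 (exp (2 * PI * S) + 1) Hc) as [MH [HMH HB]].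
    set (d := Rmin (Rmin d1 1) (Rmin d2 d3)).
    assert (Hd : 0 < d) by (unfold d; repeat apply Rmin_pos; lra).
    assert (D1 : d <= d1) by (eapply Rle_trans; [apply Rmin_l|apply Rmin_l]).
    assert (D0 : d <= 1) by (eapply Rle_trans; [apply Rmin_l|apply Rmin_r]).
    assert (D2 : d <= d2) by (eapply Rle_trans; [apply Rmin_r|apply Rmin_l]).
    assert (D3 : d <= d3) by (eapply Rle_trans; [apply Rmin_r|apply Rmin_r]).
    exists d, ((Cmod (Bf s0) + 1) * MH). split; auto.
    assert (Hnp' : forall s, Cmod (s - s0)%C < d -> ~ posint s).
    { intros s Hs. replace s with (s0 + (s - s0))%C by ring. apply Hnp. lra. }
    assert (HPc : forall s w a, Cmod (s - s0)%C < d -> Cmod (w - w0)%C < d -> NearA N d a0 a ->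
       PlusC N c w a th /\ valid N r a th /\ Rabs (Re s) <= S /\
       forall y, 0 <= y <= 2 * PI -> Cmod (Gz N s w a th (cpt (ln r) y)) <= M0).
    { intros s w a H1 H2 H3. specialize (Hsize s ltac:(lra)).
      destruct (HM0 s w a) as [A1 [A2 A3]]; [lra| |].
      - intros l Hl; destruct (H3 l Hl); split; auto; lra.
      - split; auto. split; auto. split; [|auto].
        eapply Rle_trans; [apply Re_le_Cmod|auto]. }
    intros s w a H1 H2 H3. destruct (HPc s w a H1 H2 H3) as [A1 [A2 [A3 A4]]]. split.
    + rewrite (Lp_BHan N r) by (auto; apply (PlusC_Plus N c); auto; lra). rewrite Cmod_mult.
      apply Rmult_le_compat; auto using Cmod_ge_0.
      * replace (Bf s) with ((Bf s - Bf s0) + Bf s0)%C by ring.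
        eapply Rle_trans; [apply Cmod_triangle|]. specialize (HBf s ltac:(lra)). lra.
      * apply HB; auto. eapply Rle_trans; [apply Cmod_minus_le|]. rewrite Cmod_1.
        apply Rplus_le_compat_r. unfold ee. eapply Rle_trans; [apply Cmod_cexp_le|]. apply exp_le_mono.
        rewrite (Cmod_mult _ s), Cmod_2pii. apply Rmult_le_compat_l; [assert (Hpi := PI_RGT_0); lra|].
        apply Hsize; lra.
    + intros sg om v Hv. destruct (Hline d s w a sg om v H1 H2 H3 Hv) as [rho [Hrho HL]].
      apply (Cd_ext_loc (fun t => Bf (s + t * sg) * Han N r (s + t * sg) (w + t * om) (fun l => a l + t * v l) th)%C _ 0%C rho); auto.
      * intros h Hh. replace (0 + h)%C with h by ring. destruct (HL h Hh) as [Q1 [Q2 Q3]].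
        destruct (HPc _ _ _ Q1 Q2 Q3) as [B1 [B2 _]].
        rewrite (Lp_BHan N r); auto. apply (PlusC_Plus N c); auto; lra.
      * apply Cd_mult.
        { apply (Cd_comp Bf (fun t => s + t * sg)%C); [cderiv|]. apply Bf_Cd.
          replace (s + 0 * sg)%C with s by ring. auto. }
        apply (Han_curve_Cd N r (fun t => s + t * sg)%C (fun t => w + t * om)%C (fun t l => a l + t * v l)%C
           th 0%C rho c S M0); auto; try solve [intros; cderiv].
        intros h Hh. replace (0 + h)%C with h by ring. destruct (HL h Hh) as [Q1 [Q2 Q3]].
        destruct (HPc _ _ _ Q1 Q2 Q3) as [B1 [B2 [B3 B4]]]. auto.
Qed.

(** * The Barnes series *)

Lemma boxsum_ext k M f g : (forall m, f m = g m) -> boxsum k M f = boxsum k M g.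
Proof. intros H. f_equal. apply functional_extensionality; auto. Qed.

Definition gsum (M : nat) (f : nat -> C) : C := fold_right Cplus (RtoC 0) (map f (seq 0 (S M))).

Lemma fold_Cplus_scal c (f : nat -> C) l :
  fold_right Cplus (RtoC 0) (map (fun j => c * f j)%C l) = (c * fold_right Cplus (RtoC 0) (map f l))%C.
Proof. induction l as [|x l IH]; simpl; [ring|rewrite IH; ring]. Qed.

Lemma boxsum_S k M f :
  boxsum (S k) M f = gsum M (fun j => boxsum k M (fun m => f (set_coord m (S k) j))).
Proof. reflexivity. Qed.

Lemma gsum_ext M f g : (forall j, f j = g j) -> gsum M f = gsum M g.
Proof. intros H. f_equal. apply functional_extensionality; auto. Qed.

(** A sum over a box of a product over coordinates is the product of the one-variable sums. The
    constant [c] is general so that the induction can move the factor of the last coordinate into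
    it. *)
Lemma boxsum_prod k M (h : nat -> nat -> C) : forall c,
  boxsum k M (fun m => c * cprod k (fun i => h (S i) (m (S i))))%C =
  (c * cprod k (fun i => gsum M (h (S i))))%C.
Proof.
  induction k as [|k IH]; intros c; [reflexivity|].
  rewrite boxsum_S, cprod_S, Cmult_assoc.
  unfold gsum at 3. rewrite <- fold_Cplus_scal. apply gsum_ext. intros j.
  rewrite (boxsum_ext k M _ (fun m => (c * h (S k) j) * cprod k (fun i => h (S i) (m (S i))))%C).
  - rewrite IH. ring.
  - intros m. rewrite cprod_S. unfold set_coord at 2. rewrite Nat.eqb_refl.
    rewrite (cprod_ext k (fun i => h (S i) (set_coord m (S k) j (S i))) (fun i => h (S i) (m (S i)))).
    + ring.
    + intros i Hi. unfold set_coord. destruct (Nat.eqb_spec (S i) (S k)); [lia|auto].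
Qed.

Lemma isLI_fold (l : list nat) (g : nat -> R -> C) (f : nat -> C) :
  (forall j x, rcont (g j) x) -> (forall j, isLI (g j) (f j)) ->
  (forall x, rcont (fun x => fold_right Cplus (RtoC 0) (map (fun j => g j x) l)) x) /\
  isLI (fun x => fold_right Cplus (RtoC 0) (map (fun j => g j x) l)) (fold_right Cplus (RtoC 0) (map f l)).
Proof.
  intros Hc Hg. induction l as [|j l [IH1 IH2]]; simpl.
  - split; [intros; apply rcont_const|].
    apply clim_ext with (u := fun _ => RtoC 0); [|apply clim_const].
    intros n. rewrite cRI_const. ring.
  - split; [intros; apply rcont_plus; auto|]. apply isLI_plus; auto.
Qed.

Lemma isLI_boxsum k M : forall (g : (nat -> nat) -> R -> C) (f : (nat -> nat) -> C),
  (forall m x, rcont (g m) x) -> (forall m, isLI (g m) (f m)) ->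
  (forall x, rcont (fun x => boxsum k M (fun m => g m x)) x) /\
  isLI (fun x => boxsum k M (fun m => g m x)) (boxsum k M f).
Proof.
  induction k as [|k IH]; intros g f Hc Hg.
  - split; [intros x; apply Hc|apply Hg].
  - apply (isLI_fold (seq 0 (S M)) (fun j x => boxsum k M (fun m => g (set_coord m (S k) j) x))
      (fun j => boxsum k M (fun m => f (set_coord m (S k) j)))).
    + intros j. apply (IH (fun m => g (set_coord m (S k) j)) (fun m => f (set_coord m (S k) j))); auto.
    + intros j. apply (IH (fun m => g (set_coord m (S k) j)) (fun m => f (set_coord m (S k) j))); auto.
Qed.

Lemma sumPN_csum0 N f : sumPN N f = csum0 N (fun i => f (S i)).
Proof. unfold sumPN, csum0. rewrite <- seq_shift, map_map. reflexivity. Qed.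

Lemma rsumPN N f : fold_right Rplus 0 (map f (seq 1 N)) = rsum N (fun i => f (S i)).
Proof. unfold rsum. rewrite <- seq_shift, map_map. reflexivity. Qed.

Lemma cexp_csum0 N f : cexp (csum0 N f) = cprod N (fun i => cexp (f i)).
Proof.
  induction N as [|N IH]; [apply cexp_0|]. rewrite csum0_S, cprod_S, cexp_plus, IH. auto.
Qed.

Lemma csum0_scal N c f : csum0 N (fun i => c * f i)%C = (c * csum0 N f)%C.
Proof. unfold csum0. apply fold_Cplus_scal. Qed.

Lemma ee_rsum N f : ee (RtoC (rsum N f)) = cprod N (fun i => ee (RtoC (f i))).
Proof.
  induction N as [|N IH]; [apply ee_0|]. rewrite rsum_S, cprod_S, RtoC_plus, ee_plus, IH. auto.
Qed.

Lemma cprod_mult N f g : cprod N (fun i => f i * g i)%C = (cprod N f * cprod N g)%C.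
Proof. induction N as [|N IH]; [unfold cprod; simpl; ring|]. rewrite !cprod_S, IH. ring. Qed.

Lemma cexp_INR_pow n z : cexp (RtoC (INR n) * z)%C = (cexp z ^ n)%C.
Proof.
  induction n as [|n IH]; [simpl; rewrite Cmult_0_l; apply cexp_0|].
  rewrite S_INR, RtoC_plus, Cpow_S, <- IH, <- cexp_plus. f_equal. ring.
Qed.

Lemma ee_INR_pow n t : ee (RtoC (INR n * t)) = (ee (RtoC t) ^ n)%C.
Proof.
  unfold ee. rewrite <- cexp_INR_pow. f_equal. rewrite RtoC_mult. ring.
Qed.

Lemma gsum_geom M q : (gsum M (fun j => q ^ j) * (1 - q) = 1 - q ^ S M)%C.
Proof.
  change (gsum M (fun j => q ^ j)%C) with (csum0 (S M) (fun j => q ^ j)%C).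
  induction M as [|M IH]; [unfold csum0; simpl; ring|].
  rewrite csum0_S, Cmult_plus_distr_r, IH, (Cpow_S q (S M)). ring.
Qed.

(** The integrand of one Barnes term splits over the coordinates into powers of
    [e(theta_l) exp (- u a_l)], which prepares for geometric sums. The argument [s] is later
    instantiated with [s * x]. *)
Lemma barnes_integrand N s w a th u m :
  (ee (RtoC (fold_right Rplus 0 (map (fun l => (INR (m l) * th l)%R) (seq 1 N)))) *
   cexp (- u * (w + sumPN N (fun l => RtoC (INR (m l)) * a l))) * cexp s)%C =
  (cexp s * cexp (- u * w) * cprod N (fun i => (ee (RtoC (th (S i))) * cexp (- u * a (S i))) ^ m (S i)))%C.
Proof.
  rewrite rsumPN, ee_rsum, sumPN_csum0, Cmult_plus_distr_l, cexp_plus, <- csum0_scal, cexp_csum0.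
  replace (cprod N (fun i => (ee (RtoC (th (S i))) * cexp (- u * a (S i))) ^ m (S i)))%C with
    (cprod N (fun i => ee (RtoC (INR (m (S i)) * th (S i)))) *
     cprod N (fun i => cexp (- u * (RtoC (INR (m (S i))) * a (S i)))))%C.
  - ring.
  - rewrite <- cprod_mult. apply cprod_ext. intros i _.
    rewrite Cpow_mult_l, ee_INR_pow, <- cexp_INR_pow. do 2 f_equal. ring.
Qed.

(** In the induction each partial product is at most [2^N], so a new factor adds at most [2^N e] to
    the error. *)
Lemma cprod_one_minus_close N (z : nat -> C) e : 0 <= e <= 1 ->
  (forall i, (i < N)%nat -> Cmod (z i) <= e) ->
  Cmod (cprod N (fun i => 1 - z i) - 1)%C <= 2 ^ N * e.
Proof.
  intros He. induction N as [|N IH]; intros H.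
  - unfold cprod; simpl. replace (1 - 1)%C with (RtoC 0) by ring. rewrite Cmod_0. lra.
  - assert (H1 := H N ltac:(lia)). specialize (IH ltac:(intros; apply H; lia)).
    assert (Q : Cmod (cprod N (fun i => 1 - z i) - 1)%C <= (2 ^ N) * e) by auto.
    rewrite cprod_S.
    replace (cprod N (fun i => 1 - z i) * (1 - z N) - 1)%C with
      ((cprod N (fun i => 1 - z i) - 1) - (cprod N (fun i => 1 - z i)) * z N)%C by ring.
    assert (B : Cmod (cprod N (fun i => 1 - z i)%C) <= 2 ^ N).
    { apply cprod_bound. intros j Hj. eapply Rle_trans; [apply Cmod_minus_le|]. rewrite Cmod_1.
      specialize (H j ltac:(lia)). lra. }
    eapply Rle_trans; [apply Cmod_minus_le|]. rewrite Cmod_mult. simpl pow.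
    assert (Cmod (cprod N (fun i => 1 - z i)%C) * Cmod (z N) <= 2 ^ N * e)
      by (apply Rmult_le_compat; auto using Cmod_ge_0).
    lra.
Qed.

Lemma Tplus_Plus N w a th : Tplus N w a th -> Plus N w a th.
Proof. intros [H1 H2]. split; auto. Qed.

Lemma Re_csum0_nonneg N f : (forall i, (i < N)%nat -> 0 <= Re (f i)) -> 0 <= Re (csum0 N f).
Proof.
  induction N as [|N IH]; intros H; [unfold csum0; simpl; lra|].
  rewrite csum0_S, re_plus. assert (0 <= Re (csum0 N f)) by (apply IH; intros; apply H; lia).
  assert (0 <= Re (f N)) by (apply H; lia). lra.
Qed.

(** Each power is written as a Gamma integral, and the box sum is summed under the integral as
    geometric series. The result is the Mellin integral with the extra factor [PM M], which tends to
    1; no convergence of the series is assumed. *)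
Lemma barnes_series_Lp N s w a th : Tplus N w a th -> INR N < Re s ->
  barnes_series_is N s w a th (Lp N s w a th).
Proof.
  intros HT Hs. assert (HP := Tplus_Plus _ _ _ _ HT). destruct HT as [Hw Ha].
  assert (HN := pos_INR N).
  destruct (Plus_PlusC _ _ _ _ HP) as [c [Hc HPc]].
  set (q := fun x i => (ee (RtoC (th (S i))) * cexp (- RtoC (exp x) * a (S i)))%C).
  set (g := fun x => Gz N s w a th (RtoC x)).
  assert (Hgc : forall x, rcont g x) by (intros x; exact (Gz_ray_rcont N c s w a th x Hc HPc)).
  (* The numerators left by the geometric sums; the denominators are those of [F_N]. *)
  set (PM := fun M x => cprod N (fun i => 1 - q x i ^ S M)%C).
  assert (HqPM : forall M x, rcont (PM M) x).
  { intros M x. unfold PM, q.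
    apply rcont_ext with (fun t => cprod N (fun i => 1 - (ee (RtoC (th (S i))) * cexp (- cexp (RtoC t) * a (S i))) ^ S M)%C).
    { intros t. apply cprod_ext. intros i _. rewrite cexp_RtoC. auto. }
    apply (rcont_comp (fun z => cprod N (fun i => 1 - (ee (RtoC (th (S i))) * cexp (- cexp z * a (S i))) ^ S M)%C)
      (fun x => RtoC x)); [rcontin|].
    apply (Cd_cprod N (fun i z => 1 - (ee (RtoC (th (S i))) * cexp (- cexp z * a (S i))) ^ S M)%C).
    intros i _. apply Cd_minus; [cderiv|]. apply Cd_pow. cderiv. }
  assert (Hbox : forall M, isLI (fun x => rg s * (g x * PM M x))%C (boxsum N M (barnes_term N s w a th))).
  { intros M.
    destruct (isLI_boxsum N M
      (fun m x => ee (RtoC (fold_right Rplus 0 (map (fun l => (INR (m l) * th l)%R) (seq 1 N)))) *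
         (rg s * phi s (w + sumPN N (fun l => RtoC (INR (m l)) * a l)) (RtoC x)))%C
      (barnes_term N s w a th)) as [_ H].
    - intros m x. apply rcont_mult; [apply rcont_const|]. apply rcont_mult; [apply rcont_const|].
      apply (rcont_comp (phi s (w + sumPN N (fun l => RtoC (INR (m l)) * a l))%C) (fun x => RtoC x)); [rcontin|apply phi_Cd].
    - intros m. unfold barnes_term. apply isLI_scal.
      + intros x. apply rcont_mult; [apply rcont_const|].
        apply (rcont_comp (phi s (w + sumPN N (fun l => RtoC (INR (m l)) * a l))%C) (fun x => RtoC x)); [rcontin|apply phi_Cd].
      + apply cpow_rg; [lra|]. rewrite re_plus, sumPN_csum0.
        assert (Q : 0 <= Re (csum0 N (fun i => RtoC (INR (m (S i))) * a (S i))%C)); [|lra].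
        apply Re_csum0_nonneg. intros i Hi. rewrite re_scal_l.
        apply Rmult_le_pos; [apply pos_INR|left; apply Ha, inPN_S; auto].
    - eapply isLI_ext; [|exact H]. intros x. cbv beta.
      rewrite (boxsum_ext N M _ (fun m => (rg s * cexp (s * RtoC x) * cexp (- RtoC (exp x) * w)) *
         cprod N (fun i => q x i ^ m (S i)))%C).
      + rewrite (boxsum_prod N M (fun l j => q x (pred l) ^ j)%C).
        unfold g, Gz. rewrite FN_cprod, cexp_RtoC. simpl pred.
        replace (PM M x) with (cprod N (fun i => gsum M (fun j => q x i ^ j)) *
           cprod N (fun i => den (RtoC (exp x)) (a (S i)) (th (S i))))%C.
        2:{ rewrite <- cprod_mult. apply cprod_ext. intros i _. apply gsum_geom. }
        assert (Einv : (cprod N (fun j => / den (RtoC (exp x)) (a (S j)) (th (S j))) *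
           cprod N (fun i => den (RtoC (exp x)) (a (S i)) (th (S i))) = 1)%C).
        { rewrite <- cprod_mult. clear - HPc Hc. 
          assert (Hd : forall i, (i < N)%nat -> den (RtoC (exp x)) (a (S i)) (th (S i)) <> 0%C).
          { intros i Hi. apply (den_ray_nz N c w); auto using inPN_S, exp_pos. }
          clear HPc. induction N as [|n IH]; [reflexivity|]. rewrite cprod_S, IH by (intros; apply Hd; lia).
          specialize (Hd n ltac:(lia)). field. auto. }
        set (A := cprod N (fun i => gsum M (fun j => q x i ^ j)%C)) in *.
        set (B := cprod N (fun i => den (RtoC (exp x)) (a (S i)) (th (S i)))) in *.
        set (D := cprod N (fun j => / den (RtoC (exp x)) (a (S j)) (th (S j)))%C) in *.
        transitivity (rg s * cexp (s * RtoC x) * cexp (- RtoC (exp x) * w) * A * (D * B))%C; [rewrite Einv|]; ring.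
      + intros m. unfold phi. rewrite cexp_RtoC.
        assert (E := barnes_integrand N (s * RtoC x)%C w a th (RtoC (exp x)) m).
        unfold q.
        match goal with |- (?e1 * (?r * (?e2 * ?e3)))%C = _ =>
          replace (e1 * (r * (e2 * e3)))%C with (r * (e1 * e2 * e3))%C by ring end.
        rewrite E. ring. }
  set (tau := Rmin 1 (Re s - INR N)).
  assert (Ht : 0 < tau <= 1) by (unfold tau; split; [apply Rmin_pos; lra|apply Rmin_l]).
  assert (Hts : tau <= Re s - INR N) by apply Rmin_r.
  destruct (Gz_dom N c tau (Re s) Hc Ht) as [K [HK HD]].
  specialize (HD s w a th HPc ltac:(lra)). fold g in HD.
  assert (Hpt : forall M x, Cmod (PM M x - 1)%C <= 2 ^ N * exp (- (c * exp x * INR (S M)))).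
  { intros M x. apply cprod_one_minus_close.
    - split; [left; apply exp_pos|]. rewrite <- exp_0. apply exp_le_mono.
      assert (P := exp_pos x). assert (Q := pos_INR (S M)).
      assert (0 <= c * exp x * INR (S M)) by (repeat apply Rmult_le_pos; lra). lra.
    - intros i Hi. unfold q. rewrite Cmod_pow, Cmod_mult, Cmod_ee, Rmult_1_l, Cmod_cexp, exp_pow.
      apply exp_le_mono. rewrite <- RtoC_opp, re_scal_l.
      assert (P := exp_pos x). assert (Q := pos_INR (S M)).
      assert (c <= Re (a (S i))).
      { destruct HPc as [_ HA]. destruct (HA (S i) (inPN_S N i Hi)) as [R1|[R1 R2]]; auto.
        specialize (Ha (S i) (inPN_S N i Hi)). rewrite R1, re_RtoC in Ha. lra. }
      assert (exp x * INR (S M) * c <= exp x * INR (S M) * Re (a (S i)))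
        by (apply Rmult_le_compat_l; auto; apply Rmult_le_pos; lra). lra. }
  (* With [y = c (M + 1) exp x], the inequality [exp (- y) <= y^(-p)] yields the decaying factor
     [(c (M + 1))^(-p)] at the price of [exp (- p x)]. Half of the decay [exp (- tau |x|)] pays for
     this and the other half keeps the integral convergent. *)
  set (p := tau / 2).
  assert (Hdom : forall M, dom (fun x => g x * (PM M x - 1))%C (K * 2 ^ N * exp (- (p * ln (c * INR (S M))))) p).
  { intros M x. rewrite Cmod_mult.
    apply Rle_trans with (K * exp (- (tau * Rabs x)) * (2 ^ N * exp (- (c * exp x * INR (S M))))).
    { apply Rmult_le_compat; auto using Cmod_ge_0. }
    assert (P2 : 0 <= 2 ^ N) by (apply pow_le; lra).
    replace (K * exp (- (tau * Rabs x)) * (2 ^ N * exp (- (c * exp x * INR (S M))))) with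
      (K * 2 ^ N * (exp (- (tau * Rabs x)) * exp (- (c * exp x * INR (S M))))) by ring.
    rewrite (Rmult_assoc (K * 2 ^ N)). apply Rmult_le_compat_l; [apply Rmult_le_pos; auto|].
    rewrite <- !exp_plus. apply exp_le_mono.
    assert (HM : 0 < INR (S M)) by (apply lt_0_INR; lia).
    set (y := c * INR (S M) * exp x).
    assert (Hy : 0 < y) by (unfold y; repeat apply Rmult_lt_0_compat; try apply exp_pos; lra).
    assert (Ly : ln y = ln (c * INR (S M)) + x).
    { unfold y. rewrite ln_mult, ln_exp; auto; [nra|apply exp_pos]. }
    assert (L1 : ln y <= y - 1).
    { assert (Z := exp_ineq1_le (ln y)). rewrite exp_ln in Z by auto. lra. }
    replace (c * exp x * INR (S M)) with y by (unfold y; ring).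
    assert (p * ln y <= y) by (unfold p; nra).
    rewrite Ly in H. assert (A1 := Rle_abs x). assert (A2 := Rle_abs (- x)). rewrite Rabs_Ropp in A2.
    unfold p in *. nra. }
  apply clim_filterlim. intros eps He.
  set (Q := Cmod (rg s) * (2 * (K * 2 ^ N) / p)).
  assert (HQ : 0 <= Q).
  { apply Rmult_le_pos; [apply Cmod_ge_0|]. apply Rmult_le_pos; [|left; apply Rinv_0_lt_compat; unfold p; lra].
    apply Rmult_le_pos; [lra|]. apply Rmult_le_pos; [auto|apply pow_le; lra]. }
  destruct (exp_small p (eps / (Q + 1))) as [X [HX0 HX]]; [unfold p; lra|apply div_pos; lra|].
  destruct (INR_up (exp X / c)) as [n0 [_ Hn0]]. exists n0. intros M HM.
  rewrite Lp_Mell by auto. unfold Mell. fold g.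
  assert (L2 := LI_correct g K tau ltac:(lra) Hgc HD).
  assert (L3 : isLI (fun x => rg s * (g x * (PM M x - 1)))%C
    (boxsum N M (barnes_term N s w a th) + - (1) * (rg s * LI g))%C).
  { apply isLI_ext with (fun x => rg s * (g x * PM M x) + - (1) * (rg s * g x))%C; [intros; ring|].
    apply isLI_plus; auto.
    - intros; apply rcont_mult; [apply rcont_const|apply rcont_mult; auto].
    - intros; apply rcont_mult; [apply rcont_const|apply rcont_mult; auto; apply rcont_const].
    - apply isLI_scal; [intros; apply rcont_mult; auto; apply rcont_const|]. apply isLI_scal; auto. }
  assert (Hcd : forall x, rcont (fun x => g x * (PM M x - 1))%C x).
  { intros x. apply rcont_mult; auto. apply rcont_minus; auto. apply rcont_const. }
  assert (L4 := isLI_scal (rg s) _ _ Hcd (LI_correct _ _ p ltac:(unfold p; lra) Hcd (Hdom M))).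
  assert (E := clim_unique _ _ _ L3 L4).
  replace (boxsum N M (barnes_term N s w a th) - rg s * LI g)%C with
    (boxsum N M (barnes_term N s w a th) + - (1) * (rg s * LI g))%C by ring.
  rewrite E, Cmod_mult.
  assert (B := LI_bound _ _ p ltac:(unfold p; lra) Hcd (Hdom M)).
  assert (Z1 := Cmod_ge_0 (rg s)).
  eapply Rle_lt_trans; [apply Rmult_le_compat_l; [auto|exact B]|].
  assert (L5 : exp (- (p * ln (c * INR (S M)))) < eps / (Q + 1)).
  { apply HX. rewrite <- (ln_exp X). apply ln_le; [apply exp_pos|].
    assert (INR n0 <= INR (S M)) by (apply le_INR; lia).
    apply Rmult_le_reg_r with (/ c); [apply Rinv_0_lt_compat; lra|].
    replace (c * INR (S M) * / c) with (INR (S M)) by (field; lra). fold (exp X / c). lra. }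
  set (ex := exp (- (p * ln (c * INR (S M))))) in *. assert (Hex : 0 < ex) by apply exp_pos.
  apply Rle_lt_trans with (Q * ex).
  - right. unfold Q. field. unfold p; lra.
  - apply Rlt_le_trans with ((Q + 1) * (eps / (Q + 1))); [nra|right; field; lra].
Qed.

(** * The contour integral over C(r) *)

Lemma is_RInt_gen_rlim (f : R -> C) (r : R) (l : C) :
  (forall x, r <= x -> rcont f x) -> rlim (cRI f r) l ->
  is_RInt_gen (V := C_R_NormedModule) f (at_point r) (Rbar_locally p_infty) l.
Proof.
  intros Hc Hl P HP.
  destruct HP as [e He].
  assert (HP' : forall y, Cmod (y - l)%C < e -> P y).
  { intros y Hy. apply He. split.
    - apply Rle_lt_trans with (2 := Hy). apply (Re_le_Cmod (y - l)%C).
    - apply Rle_lt_trans with (2 := Hy). apply (Im_le_Cmod (y - l)%C). }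
  destruct (Hl e (cond_pos e)) as [X0 HX].
  apply (Filter_prod _ _ _ (fun x => x = r) (fun b => Rmax X0 r < b)).
  - reflexivity.
  - exists (Rmax X0 r). auto.
  - intros x b -> Hb. simpl. assert (M1 := Rmax_l X0 r). assert (M2 := Rmax_r X0 r).
    exists (cRI f r b). split.
    + apply (RInt_correct (V := C_R_CompleteNormedModule)). apply cRI_ex_le; [lra|].
      intros y Hy. apply Hc; lra.
    + apply HP', HX. lra.
Qed.

Lemma rcont_ln x : 0 < x -> rcont (fun x => RtoC (ln x)) x.
Proof.
  intros H. apply rcont_RtoC. apply derivable_continuous_pt. exists (/ x). apply derivable_pt_lim_ln; auto.
Qed.

(** The constant [k] collects the reflection factor and, on the outgoing ray, also [e(s)]; both rays
    are then instances of one statement. *)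
Lemma Ray_subst N r s w a th k (F : R -> C) : 0 < r -> Plus N w a th ->
  (forall x, 0 < x -> rcont F x) ->
  (forall x, (RtoC (exp x) * F (exp x) = k * Gz N s w a th (RtoC x))%C) ->
  is_RInt_gen (V := C_R_NormedModule) F (at_point r) (Rbar_locally p_infty)
    (k * Ray (fun x => Gz N s w a th (RtoC x)) (ln r))%C.
Proof.
  intros Hr HP Hc HF. destruct (Plus_PlusC _ _ _ _ HP) as [c [Hc1 HPc]].
  apply is_RInt_gen_rlim; [intros; apply Hc; lra|].
  destruct (Gz_right N c (Rabs (Re s)) (ln r) Hc1) as [K [HK HD]].
  specialize (HD s w a th HPc (Rle_refl _)).
  assert (Hcg : forall x, rcont (fun x => Gz N s w a th (RtoC x)) x)
    by (intros x; exact (Gz_ray_rcont N c s w a th x Hc1 HPc)).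
  intros eps He.
  destruct (Cd_cont (fun z => k * z)%C (Ray (fun x => Gz N s w a th (RtoC x)) (ln r)) ltac:(cderiv) eps He) as [d [Hd Hk]].
  destruct (Ray_limit _ K 1 (ln r) Rlt_0_1 HK (fun x _ => Hcg x) HD d Hd) as [X [HX1 HX2]].
  exists (exp X). intros Y HY.
  assert (HY0 : 0 < Y) by (eapply Rlt_le_trans; [apply exp_pos|exact HY]).
  assert (HlY : X <= ln Y) by (rewrite <- (ln_exp X); apply ln_le; [apply exp_pos|auto]).
  replace (cRI F r Y) with (k * cRI (fun x => Gz N s w a th (RtoC x)) (ln r) (ln Y))%C.
  - apply Hk. apply HX2. auto.
  - rewrite <- (exp_ln r) at 2 by auto. rewrite <- (exp_ln Y) at 2 by auto.
    rewrite <- cRI_exp_subst; [|lra|].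
    + rewrite <- cRI_scal by (auto; lra). f_equal. apply functional_extensionality. intros x. auto.
    + intros x [Hx _]. apply Hc. rewrite exp_ln in Hx by auto. lra.
Qed.

Lemma isgen_unique (f : R -> C) (r : R) (l l' : C) :
  is_RInt_gen (V := C_R_NormedModule) f (at_point r) (Rbar_locally p_infty) l ->
  is_RInt_gen (V := C_R_NormedModule) f (at_point r) (Rbar_locally p_infty) l' -> l = l'.
Proof.
  intros H H'.
  transitivity (RInt_gen (V := C_R_CompleteNormedModule) f (at_point r) (Rbar_locally p_infty)).
  - symmetry. apply (is_RInt_gen_unique (V := C_R_CompleteNormedModule)). exact H.
  - apply (is_RInt_gen_unique (V := C_R_CompleteNormedModule)). exact H'.
Qed.
Lemma isRInt_C_unique (f : R -> C) (a b : R) (l l' : C) :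
  is_RInt (V := C_R_NormedModule) f a b l -> is_RInt (V := C_R_NormedModule) f a b l' -> l = l'.
Proof.
  intros H H'. transitivity (cRI f a b).
  - symmetry. apply (is_RInt_unique (V := C_R_CompleteNormedModule)). exact H.
  - apply (is_RInt_unique (V := C_R_CompleteNormedModule)). exact H'.
Qed.
Lemma hankel_unique r s G I I' : hankel_is r s G I -> hankel_is r s G I' -> I = I'.
Proof.
  intros [I1 [I2 [I3 [H1 [H2 [H3 ->]]]]]] [J1 [J2 [J3 [K1 [K2 [K3 ->]]]]]].
  rewrite (isgen_unique _ _ _ _ H1 K1), (isRInt_C_unique _ _ _ _ _ H2 K2), (isgen_unique _ _ _ _ H3 K3).
  reflexivity.
Qed.

(** The three pieces of the contour in the variable [u] correspond to the three sides in the
    variable [z = log u]. The constant [k] will be the factor [chi] of a reflection. *)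
Lemma hankel_Han N r s w a th k : Plus N w a th -> valid N r a th ->
  hankel_is r s (fun u => k * FN N u w a th)%C (k * Han N r s w a th)%C.
Proof.
  intros HP HV. assert (Hr := proj1 HV). assert (Hpi := PI_RGT_0).
  destruct (Plus_PlusC _ _ _ _ HP) as [c [Hc HPc]].
  set (R0 := Ray (fun x => Gz N s w a th (RtoC x)) (ln r)).
  assert (HcF : forall x, 0 < x -> rcont (fun x => k * FN N (RtoC x) w a th)%C x).
  { intros x Hx. apply rcont_mult; [apply rcont_const|].
    apply (rcont_comp (fun u => FN N u w a th) (fun x => RtoC x)); [rcontin|].
    apply (FN_Cd N (fun u => u) (fun _ => w) (fun _ => a) th); auto using Cd_id, Cd_const.
    intros l Hl. exact (den_ray_nz N c w a th l x Hc HPc Hl Hx). }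
  exists (k * R0)%C, (k * Circ N r s w a th)%C, (k * ee s * R0)%C.
  split; [|split; [|split]].
  - apply (Ray_subst N r s w a th k); auto.
    + intros x Hx. apply rcont_mult; auto. apply rcont_cexp, rcont_mult; [apply rcont_const|apply rcont_ln; auto].
    + intros x. rewrite ln_exp. unfold Gz. rewrite cexp_RtoC, <- cexp_RtoC.
      replace (s * RtoC x)%C with (RtoC x + (s - 1) * RtoC x)%C by ring. rewrite (cexp_plus (RtoC x)), cexp_RtoC. ring.
  - apply (is_RInt_ext (V := C_R_NormedModule) (fun t => k * Ci * Gz N s w a th (cpt (ln r) t))%C).
    + intros t _. match goal with |- ?x = ?y => change (@eq C x y) end. unfold Gz.
      assert (E1 : cexp (cpt (ln r) t) = (RtoC r * cexp (Ci * RtoC t))%C).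
      { unfold cpt. rewrite cexp_plus, cexp_ln; auto. }
      rewrite <- E1, <- (cpt_pair (ln r) t).
      replace (s * cpt (ln r) t)%C with ((s - 1) * cpt (ln r) t + cpt (ln r) t)%C by ring.
      rewrite cexp_plus, E1. ring.
    + unfold Circ. replace (k * (Ci * cRI (fun y => Gz N s w a th (cpt (ln r) y)) 0 (2 * PI)))%C
        with (cRI (fun t => k * Ci * Gz N s w a th (cpt (ln r) t))%C 0 (2 * PI)).
      * apply (RInt_correct (V := C_R_CompleteNormedModule)). apply cRI_ex_le; [lra|].
        intros y _. apply rcont_mult; [apply rcont_const|apply Gz_circle_rcont; auto].
      * rewrite cRI_scal; [ring|lra|]. intros; apply Gz_circle_rcont; auto.
  - apply (Ray_subst N r s w a th (k * ee s)%C); auto.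
    + intros x Hx. apply rcont_mult; auto. apply rcont_cexp, rcont_mult; [apply rcont_const|].
      apply (rcont_ext (fun x => RtoC (ln x) + Ci * RtoC (2 * PI))%C).
      * intros t. apply (cpt_pair (ln t) (2 * PI)).
      * apply rcont_plus; [apply rcont_ln; auto|apply rcont_const].
    + intros x. rewrite ln_exp, <- cpt_pair. unfold Gz. rewrite cexp_RtoC.
      unfold cpt.
      replace ((s - 1) * (RtoC x + Ci * RtoC (2 * PI)))%C with
        (s * RtoC x + - RtoC x + (2 * PI * Ci * s + - (2 * PI * Ci * 1)))%C by (rewrite RtoC_mult; ring).
      rewrite !cexp_plus, !cexp_opp, cexp_RtoC. fold (ee s). fold (ee 1%C). rewrite ee_1.
      assert (Nz : RtoC (exp x) <> 0%C) by (intros Q; apply RtoC_inj in Q; assert (Z := exp_pos x); lra).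
      field. auto.
  - unfold Han. fold R0. ring.
Qed.

(** * The reflections [T_Lambda] *)

Definition flipa (Lam : nat -> Prop) (a : nat -> C) : nat -> C :=
  fun l => if excluded_middle_informative (Lam l) then (- a l)%C else a l.

Definition flipth (Lam : nat -> Prop) (th : nat -> R) : nat -> R :=
  fun l => if excluded_middle_informative (Lam l) then - th l else th l.

(** The constant by which a reflection changes [F_N]. Each reflected coordinate contributes
    [- e(- theta_l)], from [1 / (1 - q) = - (1/q) / (1 - 1/q)] with
    [q = e(theta_l) exp (- u a_l)]. *)
Definition chi N (Lam : nat -> Prop) (th : nat -> R) : C :=
  cprod N (fun i => if excluded_middle_informative (Lam (S i)) then (- ee (RtoC (- th (S i))))%C else 1%C).

Lemma Cinv_0 : (/ 0 = 0)%C.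
Proof. apply Ceq; unfold Cinv, Re, Im, RtoC, Rdiv; simpl; ring. Qed.

(** At [q = 1] both sides are 0 by the convention for inverting zero, so [FN_flip] holds at every
    [u], singular or not. *)
Lemma inv_one_minus (q : C) : q <> 0%C -> (/ (1 - q) = - / q * / (1 - / q))%C.
Proof.
  intros Hq. destruct (Ceq_dec q 1%C) as [->|E].
  - replace (/ 1)%C with (RtoC 1) by (field; apply C1_nz).
    replace (1 - 1)%C with (RtoC 0) by ring. rewrite Cinv_0. ring.
  - assert ((1 - q)%C <> 0%C) by (intros Q; apply E; symmetry; apply Ceq_minus; auto).
    assert ((q - 1)%C <> 0%C) by (intros Q; apply E; apply Ceq_minus; auto).
    field. auto.
Qed.

Lemma ee_opp z : ee (- z)%C = (/ ee z)%C.
Proof. unfold ee. rewrite <- cexp_opp. f_equal. ring. Qed.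

(** The part [exp (u a_l)] of each factor [1 / q] is absorbed in the shift of [w] by the trace; what
    remains is [chi]. *)
Lemma FN_flip N Lam u w a th :
  FN N u w a th = (chi N Lam th * FN N u (w - Tr N a Lam) (flipa Lam a) (flipth Lam th))%C.
Proof.
  rewrite !FN_cprod. unfold Tr. rewrite sumPN_csum0.
  replace (- u * (w - csum0 N (fun i => if excluded_middle_informative (Lam (S i)) then a (S i) else 0)))%C
    with (- u * w + u * csum0 N (fun i => if excluded_middle_informative (Lam (S i)) then a (S i) else 0))%C by ring.
  rewrite <- csum0_scal, cexp_plus, cexp_csum0.
  match goal with |- (_ * ?p = _ * (_ * ?x * ?y))%C => replace p with (chi N Lam th * x * y)%C; [ring|] end.
  unfold chi. rewrite <- !cprod_mult. apply cprod_ext. intros i _.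
  unfold flipa, flipth. destruct (excluded_middle_informative (Lam (S i))) as [H|H].
  - unfold den.
    rewrite (inv_one_minus (ee (RtoC (th (S i))) * cexp (- u * a (S i)))%C)
      by (apply Cmult_neq_0; [unfold ee|]; apply cexp_nz).
    rewrite RtoC_opp, ee_opp.
    replace (- u * - a (S i))%C with (- (- u * a (S i)))%C by ring.
    replace (u * a (S i))%C with (- (- u * a (S i)))%C by ring. rewrite cexp_opp.
    assert (N1 : ee (RtoC (th (S i))) <> 0%C) by (unfold ee; apply cexp_nz).
    assert (N2 := cexp_nz (- u * a (S i))%C).
    replace (/ (ee (RtoC (th (S i))) * cexp (- u * a (S i))))%C with
      (/ ee (RtoC (th (S i))) * / cexp (- u * a (S i)))%C by (field; auto).
    ring.
  - rewrite Cmult_0_r, cexp_0. ring.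
Qed.

Lemma rot_Tr N om w a Lam : rot om (w - Tr N a Lam)%C = (rot om w - Tr N (rotv om a) Lam)%C.
Proof.
  unfold Tr. rewrite !sumPN_csum0. unfold rot at 1.
  replace (csum0 N (fun i => if excluded_middle_informative (Lam (S i)) then rotv om a (S i) else 0))%C
    with (cexp (Ci * RtoC om) * csum0 N (fun i => if excluded_middle_informative (Lam (S i)) then a (S i) else 0))%C.
  - unfold rot. ring.
  - rewrite <- csum0_scal. f_equal. apply functional_extensionality. intros i.
    destruct (excluded_middle_informative (Lam (S i))); [reflexivity|ring].
Qed.

Lemma rotv_flipa om Lam a : rotv om (flipa Lam a) = flipa Lam (rotv om a).
Proof.
  apply functional_extensionality. intros l. unfold rotv, flipa.
  destruct (excluded_middle_informative (Lam l)); [unfold rot; ring|auto].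
Qed.

Lemma valid_flip N r Lam a th : 0 < r ->
  (forall l (u : C), inPN N l -> 0 < Cmod u -> Cmod u <= r -> ee (RtoC (th l)) <> cexp (u * a l)%C) ->
  valid N r (flipa Lam a) (flipth Lam th).
Proof.
  intros Hr H. split; auto. intros l u Hl H1 H2 E. apply (H l u Hl H1 H2).
  unfold flipa, flipth in E. destruct (excluded_middle_informative (Lam l)); auto.
  rewrite RtoC_opp, ee_opp in E. replace (u * - a l)%C with (- (u * a l))%C in E by ring.
  rewrite cexp_opp in E.
  assert (N1 : ee (RtoC (th l)) <> 0%C) by (unfold ee; apply cexp_nz).
  assert (N2 := cexp_nz (u * a l)%C).
  replace (ee (RtoC (th l))) with (/ / ee (RtoC (th l)))%C by (field; auto).
  rewrite E. field. auto.
Qed.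

(** * Points of the domain *)

(** Every nonzero number lies in the cone or in its negative, so after reflection each coordinate is
    in the cone or is zero. *)
Lemma Ccone_cases (z : C) : z <> 0%C -> ~ Ccone (- z)%C -> Ccone z.
Proof.
  intros Hz H. unfold Ccone in *. rewrite re_opp, im_opp in H.
  destruct (Rlt_dec 0 (Re z)) as [L|L]; [left; auto|]. right.
  assert (E : Re z = 0).
  { destruct (Req_dec (Re z) 0); auto. exfalso. apply H. left. lra. }
  split; auto. destruct (Rlt_dec 0 (Im z)) as [L2|L2]; auto. exfalso.
  destruct (Req_dec (Im z) 0) as [E2|E2].
  - apply Hz. apply Ceq; auto.
  - apply H. right. split; lra.
Qed.

(** On the positive imaginary axis the rotated real part is [- sin om * Im z], which is positive
    exactly because [om] is negative; in the open half plane a small angle does no harm. *)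
Lemma Ccone_rot z : Ccone z -> exists d, 0 < d /\ forall om, - d < om < 0 -> 0 < Re (rot om z).
Proof.
  intros H. assert (Hpi := PI2_1).
  destruct H as [H|[H1 H2]].
  - set (d := Rmin 1 (Re z / (2 * (Rabs (Im z) + 1)))).
    assert (P := Rabs_pos (Im z)).
    assert (Hd : 0 < d) by (unfold d; apply Rmin_pos; [lra|apply div_pos; lra]).
    assert (D1 : d <= 1) by apply Rmin_l. assert (D2 : d <= Re z / (2 * (Rabs (Im z) + 1))) by apply Rmin_r.
    exists d. split; auto. intros om Hom. rewrite Re_rot.
    assert (C := one_minus_cos_le om).
    assert (S1 : sin (- om) < - om) by (apply sin_lt_x; lra).
    assert (S2 : 0 < sin (- om)) by (apply sin_gt_0; lra).
    rewrite sin_neg in S1, S2.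
    assert (T : d * (2 * (Rabs (Im z) + 1)) <= Re z).
    { apply Rmult_le_compat_r with (r := 2 * (Rabs (Im z) + 1)) in D2; [|lra].
      replace (Re z / (2 * (Rabs (Im z) + 1)) * (2 * (Rabs (Im z) + 1))) with (Re z) in D2 by (field; lra). auto. }
    assert (A1 := Rle_abs (- Im z)). rewrite Rabs_Ropp in A1.
    assert (Q : - (sin om * Im z) >= - (d * (Rabs (Im z)))).
    { assert (0 <= (- sin om) * (Im z + Rabs (Im z))) by (apply Rmult_le_pos; lra).
      assert ((- sin om) * Rabs (Im z) <= d * Rabs (Im z)) by (apply Rmult_le_compat_r; lra). lra. }
    assert (1 / 2 <= cos om) by nra. nra.
  - exists 1. split; [lra|]. intros om Hom. rewrite Re_rot, H1, Rmult_0_r.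
    assert (S2 : 0 < sin (- om)) by (apply sin_gt_0; lra). rewrite sin_neg in S2. nra.
Qed.

Lemma uniform_delta N (P : nat -> R -> Prop) :
  (forall l, inPN N l -> exists d, 0 < d /\ forall om, - d < om < 0 -> P l om) ->
  exists d, 0 < d /\ forall om, - d < om < 0 -> forall l, inPN N l -> P l om.
Proof.
  induction N as [|N IH]; intros H.
  - exists 1. split; [lra|]. intros om _ l [H1 H2]. lia.
  - destruct IH as [d [Hd HI]]. { intros l [H1 H2]. apply H. split; lia. }
    destruct (H (S N)) as [d' [Hd' H']]; [split; lia|].
    assert (D1 := Rmin_l d d'). assert (D2 := Rmin_r d d').
    exists (Rmin d d'). split; [apply Rmin_pos; auto|]. intros om Hom l Hl.
    destruct (Nat.eq_dec l (S N)) as [->|E]; [apply H'; lra|].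
    apply HI; [lra|]. destruct Hl; split; lia.
Qed.

(** Restricted to [P_N], so that the predicate is determined by the relevant coordinates and can be
    equal to a given [Lam], as [LN_Lp] requires. *)
Definition Lam0 N (a : nat -> C) : nat -> Prop := fun l => inPN N l /\ Ccone (- a l)%C.

Lemma csum0_ext N f g : (forall i, (i < N)%nat -> f i = g i) -> csum0 N f = csum0 N g.
Proof.
  induction N as [|N IH]; intros H; [reflexivity|]. rewrite !csum0_S. f_equal; auto.
Qed.

Lemma Tr_ext N a Lam Lam' : (forall l, inPN N l -> (Lam l <-> Lam' l)) -> Tr N a Lam = Tr N a Lam'.
Proof.
  intros H. unfold Tr. rewrite !sumPN_csum0. apply csum0_ext. intros i Hi.
  specialize (H (S i) (inPN_S N i Hi)).
  destruct (excluded_middle_informative (Lam (S i))), (excluded_middle_informative (Lam' (S i))); tauto.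
Qed.

Lemma Dtilde_Plus N w a th : Dtilde N w a th -> exists d, 0 < d <= PI / 2 /\ forall om, - d < om < 0 ->
  Plus N (rot om (w - Tr N a (Lam0 N a))%C) (rotv om (flipa (Lam0 N a) a)) (flipth (Lam0 N a) th).
Proof.
  intros [HD Hpi].
  assert (Epi : (w - Tr N a (Lam0 N a))%C = piD N w a).
  { unfold piD. f_equal. apply Tr_ext. intros l Hl. unfold Lam0. tauto. }
  rewrite Epi. destruct (Ccone_rot _ Hpi) as [d1 [Hd1 H1]].
  destruct (uniform_delta N (fun l om => 0 < Re (rotv om (flipa (Lam0 N a) a) l) \/
     (rotv om (flipa (Lam0 N a) a) l = RtoC 0 /\ ~ (exists k : Z, flipth (Lam0 N a) th l = IZR k)))) as [d2 [Hd2 H2]].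
  - intros l Hl. unfold rotv, flipa, flipth.
    destruct (excluded_middle_informative (Lam0 N a l)) as [Q|Q].
    + destruct (Ccone_rot _ (proj2 Q)) as [d [Hd H]]. exists d; split; auto.
    + destruct (Ceq_dec (a l) 0%C) as [E|E].
      * exists 1. split; [lra|]. intros om _. right. rewrite E. split; [unfold rot; ring|].
        apply (HD l Hl E).
      * destruct (Ccone_rot (a l)) as [d [Hd H]].
        { apply Ccone_cases; auto. intros Z. apply Q. split; auto. }
        exists d; split; auto.
  - assert (P := PI_RGT_0). assert (M1 := Rmin_l (PI / 2) (Rmin d1 d2)). assert (M2 := Rmin_r (PI / 2) (Rmin d1 d2)).
    assert (M3 := Rmin_l d1 d2). assert (M4 := Rmin_r d1 d2).
    exists (Rmin (PI / 2) (Rmin d1 d2)). split; [split; [repeat apply Rmin_pos; lra|auto]|].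
    intros om Hom. split; [apply H1; lra|]. intros l Hl. apply H2; auto. lra.
Qed.

(** * The function [L_N] *)

Definition goodom N w a th (om : R) : Prop :=
  - (PI / 2) < om < PI / 2 /\ Plus N (rot om w) (rotv om a) th.

(** Two admissible angles differ by less than [pi], so [Lp_rot] makes the value independent of the
    choice ([L0_eq]). The chosen angle does not depend on [s], so holomorphy in [s] can be read off
    directly. *)
Definition L0 N s w a th : C :=
  let om := epsilon (inhabits 0) (goodom N w a th) in
  (cexp (Ci * s * RtoC om) * Lp N s (rot om w) (rotv om a) th)%C.

Lemma L0_eq N s w a th om : goodom N w a th om -> ~ PN N s ->
  L0 N s w a th = (cexp (Ci * s * RtoC om) * Lp N s (rot om w) (rotv om a) th)%C.
Proof.
  intros Hom Hs. unfold L0. set (om0 := epsilon (inhabits 0) (goodom N w a th)).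
  assert (H0 : goodom N w a th om0) by (apply (epsilon_spec (inhabits 0) (goodom N w a th)); eauto).
  destruct Hom as [B HP]. destruct H0 as [B0 HP0].
  assert (HP' : Plus N (rot (om - om0) (rot om0 w)) (rotv (om - om0) (rotv om0 a)) th).
  { rewrite rot_rot, rotv_rotv. replace (om - om0 + om0) with om by ring. auto. }
  rewrite (Lp_rot N (om - om0) s (rot om0 w)) by (auto; lra).
  rewrite rot_rot, rotv_rotv, Cmult_assoc, <- cexp_plus. replace (om - om0 + om0) with om by ring.
  do 2 f_equal. rewrite RtoC_minus. ring.
Qed.

Definition LN N s w a th : C :=
  (chi N (Lam0 N a) th * L0 N s (w - Tr N a (Lam0 N a)) (flipa (Lam0 N a) a) (flipth (Lam0 N a) th))%C.

Lemma Dtilde_goodom N w a th : Dtilde N w a th -> exists om,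
  goodom N (w - Tr N a (Lam0 N a))%C (flipa (Lam0 N a) a) (flipth (Lam0 N a) th) om.
Proof.
  intros H. destruct (Dtilde_Plus N w a th H) as [d [Hd Hp]].
  exists (- d / 2). split; [lra|]. apply Hp. lra.
Qed.

(** * The limit along [omega -> 0] *)

(** At noninteger [s'] the contour expression equals the reflected [Lp], whose right side does not
    mention the radius. Continuity of [Lp] at [s] then identifies the limit, at integers outside
    [P_N] too. *)
Lemma LNeps_is_value N eps s w a th Lam : ~ PN N s ->
  0 < eps w a th ->
  (forall l (u : C), inPN N l -> 0 < Cmod u -> Cmod u <= eps w a th -> ee (RtoC (th l)) <> cexp (u * a l)%C) ->
  Plus N (w - Tr N a Lam)%C (flipa Lam a) (flipth Lam th) ->
  forall v, LNeps_is N eps s w a th v <->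
    v = (chi N Lam th * Lp N s (w - Tr N a Lam) (flipa Lam a) (flipth Lam th))%C.
Proof.
  intros Hs Heps Hval HP.
  assert (HV := valid_flip N _ Lam a th Heps Hval). set (r := eps w a th) in *.
  set (F := fun s => (chi N Lam th * Lp N s (w - Tr N a Lam) (flipa Lam a) (flipth Lam th))%C).
  assert (HF : Cderivable F s) by (apply Cd_mult; [apply Cd_const|apply Lp_s_Cd; auto]).
  assert (Hnint : forall s', (forall k : Z, s' <> RtoC (IZR k)) -> ee s' <> 1%C).
  { intros s' H E. destruct (ee_eq_1 s' E) as [k Hk]. apply (H k Hk). }
  assert (Hh : forall s', hankel_is r s' (fun u => FN N u w a th)
     (chi N Lam th * Han N r s' (w - Tr N a Lam) (flipa Lam a) (flipth Lam th))%C).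
  { intros s'. replace (fun u => FN N u w a th) with
      (fun u => chi N Lam th * FN N u (w - Tr N a Lam) (flipa Lam a) (flipth Lam th))%C.
    - apply hankel_Han; auto.
    - apply functional_extensionality. intros u. symmetry. apply FN_flip. }
  assert (HFv : forall s', (forall k : Z, s' <> RtoC (IZR k)) ->
    F s' = (rg s' * (chi N Lam th * Han N r s' (w - Tr N a Lam) (flipa Lam a) (flipth Lam th)) / (ee s' - 1))%C).
  { intros s' H. unfold F. rewrite (Lp_formula N r) by auto. field.
    intros Q. apply (Hnint s' H), Ceq_minus; auto. }
  intros v. fold (F s). split.
  - intros Hv. apply Cmod_zero_eq. intros eta He.
    destruct (Hv (eta / 2) ltac:(lra)) as [d1 [Hd1 H1]].
    destruct (Cd_cont F s HF (eta / 2) ltac:(lra)) as [d2 [Hd2 H2]].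
    (* The test point [s + i d / 2] must not be an integer. It is nonreal: for [Im s >= 0] clearly,
       and for [Im s < 0] because [d / 2] is smaller than [- Im s]. *)
    set (d := Rmin (Rmin d1 d2) (if Rlt_dec (Im s) 0 then - Im s else 1)).
    assert (Hd : 0 < d).
    { unfold d. repeat apply Rmin_pos; auto. destruct (Rlt_dec (Im s) 0); lra. }
    assert (D1 : d <= d1) by (eapply Rle_trans; [apply Rmin_l|apply Rmin_l]).
    assert (D2 : d <= d2) by (eapply Rle_trans; [apply Rmin_l|apply Rmin_r]).
    assert (D3 : d <= (if Rlt_dec (Im s) 0 then - Im s else 1)) by apply Rmin_r.
    set (s' := (s + Ci * RtoC (d / 2))%C).
    assert (Es : Cmod (s' - s)%C = d / 2).
    { replace (s' - s)%C with (Ci * RtoC (d / 2))%C by (unfold s'; ring).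
      rewrite Cmod_mult, Cmod_Ci, Cmod_R, Rabs_right; lra. }
    assert (Hn : forall k : Z, s' <> RtoC (IZR k)).
    { intros k E. assert (Q : Im s' = 0) by (rewrite E; reflexivity).
      unfold s' in Q. destruct s as [x y]. unfold Im in *; simpl in *. destruct (Rlt_dec y 0); lra. }
    destruct (H1 s' ltac:(lra) ltac:(lra) Hn) as [g [I [Hg [HI HvI]]]].
    apply rgamma_is_iff in Hg. rewrite (hankel_unique _ _ _ _ _ HI (Hh s')), Hg, <- HFv in HvI by auto.
    specialize (H2 s' ltac:(lra)).
    replace (v - F s)%C with ((F s' - F s) - (F s' - v))%C by ring.
    eapply Rle_lt_trans; [apply Cmod_minus_le|]. lra.
  - intros ->. intros eta He. destruct (Cd_cont F s HF eta He) as [d [Hd H]].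
    exists d. split; auto. intros s' _ Hs' Hn.
    exists (rg s'), (chi N Lam th * Han N r s' (w - Tr N a Lam) (flipa Lam a) (flipth Lam th))%C.
    split; [apply rgamma_is_iff; auto|]. split; [apply Hh|]. rewrite <- HFv; auto.
Qed.

(** At each admissible [om] the value is known exactly: the rotation contributes only
    [exp (- i s om)], and neither [eps] nor [om] occurs elsewhere. *)
Lemma rot_point N eps om s w a th : inE N eps -> ~ PN N s -> Dtilde N w a th -> - (PI / 2) < om < 0 ->
  Plus N (rot om (w - Tr N a (Lam0 N a))%C) (rotv om (flipa (Lam0 N a) a)) (flipth (Lam0 N a) th) ->
  forall v, LNeps_is N eps s (rot om w) (rotv om a) th v <->
    v = (cexp (- (Ci * s * RtoC om)) * LN N s w a th)%C.
Proof.
  intros [E1 E2] Hs [HD Hpi] Hom HP v.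
  assert (HD' : DN N (rot om w) (rotv om a) th).
  { intros l Hl E. apply (HD l Hl). apply (rot_eq_0 om). exact E. }
  rewrite rot_Tr, rotv_flipa in HP.
  rewrite (LNeps_is_value N eps s (rot om w) (rotv om a) th (Lam0 N a)); auto.
  - unfold LN. rewrite (L0_eq N s _ _ _ om); auto.
    + rewrite rot_Tr, rotv_flipa, cexp_opp. assert (Nz := cexp_nz (Ci * s * RtoC om)%C).
      match goal with |- (v = ?x <-> v = ?y) => replace y with x by (field; auto) end. tauto.
    + split; [lra|]. rewrite rot_Tr, rotv_flipa. auto.
  - intros l u Hl H1 H2. apply (E2 (rot om w) (rotv om a) th l u); auto.
Qed.

Lemma LN_limit N eps : inE N eps -> forall s w a th, ~ PN N s -> Dtilde N w a th ->
  (exists delta, 0 < delta /\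
     forall om, - delta < om < 0 -> exists v, LNeps_is N eps s (rot om w) (rotv om a) th v) /\
  (forall eta, 0 < eta -> exists delta, 0 < delta /\
     forall om v, - delta < om < 0 ->
       LNeps_is N eps s (rot om w) (rotv om a) th v -> Cmod (v - LN N s w a th)%C < eta).
Proof.
  intros HE s w a th Hs HD. destruct (Dtilde_Plus N w a th HD) as [d [Hd HP]].
  assert (Hv : forall om, - d < om < 0 -> forall v, LNeps_is N eps s (rot om w) (rotv om a) th v <->
    v = (cexp (- (Ci * s * RtoC om)) * LN N s w a th)%C).
  { intros om Hom. apply rot_point; auto. lra. }
  split.
  - exists d. split; [lra|]. intros om Hom. eexists. apply Hv; auto.
  - intros eta He.
    destruct (Cd_cont (fun z => cexp (- (Ci * s * z)) * LN N s w a th)%C 0%C ltac:(cderiv) eta He) as [d' [Hd' H]].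
    exists (Rmin d d'). split; [apply Rmin_pos; lra|]. intros om v Hom Hlim.
    assert (D1 := Rmin_l d d'). assert (D2 := Rmin_r d d').
    rewrite (proj1 (Hv om ltac:(lra) v) Hlim).
    specialize (H (RtoC om)). replace (RtoC om - 0)%C with (RtoC om) in H by ring.
    rewrite Cmod_R, Rabs_left in H by lra. specialize (H ltac:(lra)).
    replace (- (Ci * s * 0))%C with (RtoC 0) in H by ring. rewrite cexp_0, Cmult_1_l in H. exact H.
Qed.

(** * Dependence on [s] *)

Lemma LN_s_Cd N w a th s : Dtilde N w a th -> ~ PN N s -> Cderivable (fun s => LN N s w a th) s.
Proof.
  intros HD Hs. destruct (Dtilde_goodom N w a th HD) as [om Hom].
  assert (H := epsilon_spec (inhabits 0) _ (ex_intro _ om Hom)). destruct H as [_ HP].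
  unfold LN, L0. apply Cd_mult; [apply Cd_const|]. apply Cd_mult; [cderiv|apply Lp_s_Cd; auto].
Qed.

Lemma LN_pole N w a th k : Dtilde N w a th -> exists l : C, forall eta, 0 < eta ->
  exists delta, 0 < delta /\ forall s,
    0 < Cmod (s - RtoC (INR k))%C -> Cmod (s - RtoC (INR k))%C < delta ->
    Cmod ((s - RtoC (INR k)) * LN N s w a th - l)%C < eta.
Proof.
  intros HD. destruct (Dtilde_goodom N w a th HD) as [om Hom].
  assert (H := epsilon_spec (inhabits 0) _ (ex_intro _ om Hom)). destruct H as [_ HP].
  unfold LN, L0. set (om0 := epsilon _ _) in *.
  destruct (Lp_pole N _ _ _ k HP) as [l Hl].
  set (c := fun s => (chi N (Lam0 N a) th * cexp (Ci * s * RtoC om0))%C).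
  set (k0 := RtoC (INR k)) in *.
  exists (c k0 * l)%C. intros eta He.
  (* The limit of the product [c s * x] is obtained by polarization,
     [c x = ((c + x) / 2)^2 - ((c - x) / 2)^2], from continuity of the square. *)
  destruct (Cd_cont (fun z => z * z)%C ((c k0 + l) / 2)%C ltac:(cderiv) (eta / 2) ltac:(lra)) as [e1 [He1 H1]].
  destruct (Cd_cont (fun z => z * z)%C ((c k0 - l) / 2)%C ltac:(cderiv) (eta / 2) ltac:(lra)) as [e2 [He2 H2]].
  set (e := Rmin e1 e2). assert (Hep : 0 < e) by (unfold e; apply Rmin_pos; auto).
  assert (E1 : e <= e1) by apply Rmin_l. assert (E2 : e <= e2) by apply Rmin_r.
  destruct (Hl e Hep) as [d1 [Hd1 HL]].
  destruct (Cd_cont c k0 ltac:(unfold c; cderiv) e Hep) as [d2 [Hd2 Hc]].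
  exists (Rmin d1 d2). split; [apply Rmin_pos; auto|]. intros s Hs0 Hs.
  specialize (HL s Hs0 (Rlt_le_trans _ _ _ Hs (Rmin_l _ _))).
  specialize (Hc s (Rlt_le_trans _ _ _ Hs (Rmin_r _ _))).
  match type of HL with Cmod (?X - l)%C < _ => set (x := X) in * end.
  replace ((s - k0) * (chi N (Lam0 N a) th * (cexp (Ci * s * om0) * Lp N s _ _ _)))%C with (c s * x)%C
    by (unfold c, x; ring).
  assert (Hhalf : Cmod (/ 2)%C = / 2).
  { rewrite <- RtoC_inv, Cmod_R, Rabs_right; lra. }
  specialize (H1 ((c s + x) / 2)%C). specialize (H2 ((c s - x) / 2)%C).
  replace ((c s + x) / 2 - (c k0 + l) / 2)%C with (((c s - c k0) + (x - l)) * / 2)%C in H1 by field.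
  replace ((c s - x) / 2 - (c k0 - l) / 2)%C with (((c s - c k0) - (x - l)) * / 2)%C in H2 by field.
  rewrite Cmod_mult, Hhalf in H1, H2.
  assert (T1 := Cmod_triangle (c s - c k0)%C (x - l)%C). assert (T2 := Cmod_minus_le (c s - c k0)%C (x - l)%C).
  specialize (H1 ltac:(lra)). specialize (H2 ltac:(lra)).
  match type of H1 with Cmod ?A < _ => match type of H2 with Cmod ?B < _ =>
    replace (c s * x - c k0 * l)%C with (A - B)%C by field end end.
  eapply Rle_lt_trans; [apply Cmod_minus_le|]. lra.
Qed.

(** * Joint holomorphy *)

Lemma Tplus_goodom0 N w a th : Plus N w a th -> goodom N w a th 0.
Proof. intros H. split; [assert (P := PI_RGT_0); lra|]. rewrite rot_0, rotv_0. auto. Qed.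

(** On [p(T_Lambda(T_N^+))] the set of reflected coordinates is [Lam] itself, hence locally
    constant, and the angle 0 is admissible; so [LN] is given by one formula in [(s, w, a)]. *)
Lemma LN_Lp N Lam s w a th : (forall l, Lam l -> inPN N l) -> ~ PN N s ->
  0 < Re (w - Tr N a Lam)%C -> (forall l, inPN N l -> 0 < Re (flipa Lam a l)) ->
  LN N s w a th = (chi N Lam th * Lp N s (w - Tr N a Lam) (flipa Lam a) (flipth Lam th))%C.
Proof.
  intros HL Hs Hw Ha.
  assert (E : Lam0 N a = Lam).
  { apply functional_extensionality. intros l. apply propositional_extensionality.
    unfold Lam0. split.
    - intros [Hl Hc]. specialize (Ha l Hl). unfold flipa in Ha.
      destruct (excluded_middle_informative (Lam l)); auto.
      destruct Hc as [Q|[Q _]]; rewrite re_opp in Q; lra.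
    - intros H. split; auto. specialize (Ha l (HL l H)). unfold flipa in Ha.
      destruct (excluded_middle_informative (Lam l)); [left; auto|contradiction]. }
  unfold LN. rewrite E. rewrite (L0_eq N s _ _ _ 0); auto.
  - rewrite rot_0, rotv_0, Cmult_0_r, cexp_0. ring.
  - apply Tplus_goodom0. split; auto.
Qed.

Lemma Tr_line N a v Lam t : Tr N (fun l => a l + t * v l)%C Lam = (Tr N a Lam + t * Tr N v Lam)%C.
Proof.
  unfold Tr. rewrite !sumPN_csum0. induction N as [|N IH].
  - unfold csum0; simpl; ring.
  - rewrite !csum0_S, IH. destruct (excluded_middle_informative (Lam (S N))); ring.
Qed.

Lemma Tr_bound N a Lam M : 0 <= M -> (forall l, inPN N l -> Cmod (a l) <= M) -> Cmod (Tr N a Lam) <= INR N * M.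
Proof.
  intros HM. unfold Tr. rewrite sumPN_csum0. induction N as [|N IH]; intros H.
  - unfold csum0; simpl. rewrite Cmod_0. lra.
  - rewrite csum0_S, S_INR. eapply Rle_trans; [apply Cmod_triangle|].
    rewrite Rmult_plus_distr_r, Rmult_1_l. apply Rplus_le_compat.
    + apply IH. intros l [H1 H2]. apply H. split; lia.
    + destruct (excluded_middle_informative (Lam (S N))); [apply H; split; lia|rewrite Cmod_0; auto].
Qed.

Lemma avec_in N z l : inPN N l -> avec N z l = z (S l).
Proof.
  intros [H1 H2]. unfold avec. destruct (Nat.leb_spec 1 l), (Nat.leb_spec l N); simpl; auto; lia.
Qed.

Lemma avec_line N z h t : avec N (fun j => z j + t * h j)%C = (fun l => avec N z l + t * avec N h l)%C.
Proof.
  apply functional_extensionality. intros l. unfold avec.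
  destruct (andb (Nat.leb 1 l) (Nat.leb l N)); ring.
Qed.

Lemma flipa_line Lam a v t : flipa Lam (fun l => a l + t * v l)%C = (fun l => flipa Lam a l + t * flipa Lam v l)%C.
Proof.
  apply functional_extensionality. intros l. unfold flipa.
  destruct (excluded_middle_informative (Lam l)); ring.
Qed.

Lemma Cmod_flipa Lam a l : Cmod (flipa Lam a l) = Cmod (a l).
Proof. unfold flipa. destruct (excluded_middle_informative (Lam l)); [apply Cmod_opp|auto]. Qed.

Lemma pTLam_Plus N Lam w a : (forall l, Lam l -> inPN N l) -> pTLam N Lam w a ->
  0 < Re (w - Tr N a Lam)%C /\ forall l, inPN N l -> 0 < Re (flipa Lam a l).
Proof.
  intros HL [w0 [a0 [th0 [[Hw Ha] [E1 E2]]]]]. split.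
  - replace (w - Tr N a Lam)%C with w0; auto. rewrite E1.
    replace (Tr N a Lam) with (- Tr N a0 Lam)%C; [ring|].
    unfold Tr. rewrite !sumPN_csum0.
    replace (- csum0 N (fun i => if excluded_middle_informative (Lam (S i)) then a0 (S i) else 0))%C with
      (- (1) * csum0 N (fun i => if excluded_middle_informative (Lam (S i)) then a0 (S i) else 0))%C by ring.
    rewrite <- csum0_scal. apply csum0_ext. intros i Hi. rewrite (E2 (S i) (inPN_S N i Hi)).
    destruct (excluded_middle_informative (Lam (S i))); ring.
  - intros l Hl. unfold flipa. rewrite (E2 l Hl). specialize (Ha l Hl).
    destruct (excluded_middle_informative (Lam l)); auto.
    replace (- - a0 l)%C with (a0 l) by ring. auto.
Qed.

(** The reflection is linear in [(w, a)], so complex lines go to complex lines and the local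
    statement for [Lp] transfers to [LN]. Osgood's lemma concludes. *)
Lemma LN_holo N th Lam : (forall l, Lam l -> inPN N l) ->
  holo_on (S (S N))
    (fun z => ~ PN N (z O) /\ pTLam N Lam (z 1%nat) (avec N z))
    (fun z => LN N (z O) (z 1%nat) (avec N z) th).
Proof.
  intros HL z [Hs HpT]. destruct (pTLam_Plus N Lam _ _ HL HpT) as [Hw Ha].
  set (W := fun z => (z 1%nat - Tr N (avec N z) Lam)%C). set (A := fun z => flipa Lam (avec N z)).
  set (Th := flipth Lam th).
  fold (W z) in Hw. fold (A z) in Ha.
  assert (HP : Plus N (W z) (A z) Th) by (split; auto).
  destruct (Plus_PlusC _ _ _ _ HP) as [c [Hc HPc]].
  destruct (Lp_local N (z O) (W z) (A z) Th HP Hs) as [d [M [Hd HLp]]].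
  destruct (PN_isolated N (z O)) as [dp [Hdp Hiso]].
  set (D := Rmin (Rmin d (c / 2)) dp).
  assert (HD : 0 < D) by (unfold D; repeat apply Rmin_pos; lra).
  assert (D1 : D <= d) by (eapply Rle_trans; [apply Rmin_l|apply Rmin_l]).
  assert (D2 : D <= c / 2) by (eapply Rle_trans; [apply Rmin_l|apply Rmin_r]).
  assert (D3 : D <= dp) by apply Rmin_r.
  (* The reflected [w] is a combination of at most [N + 1] coordinates with coefficients of modulus
     1, so moving each coordinate by less than [r] moves it by less than [D]. *)
  set (r := D / (INR N + 2)). assert (HN := pos_INR N).
  assert (Hr : 0 < r) by (apply div_pos; lra).
  assert (ErD : r * (INR N + 2) = D) by (unfold r; field; lra).
  assert (HrD : r <= D) by nra.
  assert (EW : forall z h t, W (fun j => z j + t * h j)%C = (W z + t * W h)%C).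
  { intros z1 h t. unfold W. rewrite avec_line, Tr_line. ring. }
  assert (EA : forall z h t, A (fun j => z j + t * h j)%C = (fun l => A z l + t * A h l)%C).
  { intros z1 h t. unfold A. rewrite avec_line. apply flipa_line. }
  assert (Hnear : forall h, (forall j, (j < S (S N))%nat -> Cmod (h j) < r) ->
     Cmod (z O + h O - z O)%C < D /\ Cmod (W (fun j => z j + h j)%C - W z)%C < D /\
     NearA N D (A z) (A (fun j => z j + h j)%C)).
  { intros h Hh.
    assert (Eh : (fun j => z j + h j)%C = (fun j => z j + 1 * h j)%C)
      by (apply functional_extensionality; intros; ring).
    rewrite Eh, EW, EA. split; [|split].
    - replace (z O + h O - z O)%C with (h O) by ring. specialize (Hh O ltac:(lia)). lra.
    - replace (W z + 1 * W h - W z)%C with (W h) by ring. unfold W.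
      eapply Rle_lt_trans; [apply Cmod_minus_le|].
      assert (B : Cmod (Tr N (avec N h) Lam) <= INR N * r).
      { apply Tr_bound; [lra|]. intros l Hl. rewrite avec_in by auto. left. apply Hh.
        destruct Hl; lia. }
      specialize (Hh 1%nat ltac:(lia)). nra.
    - intros l Hl. split.
      + replace (A z l + 1 * A h l - A z l)%C with (A h l) by ring. unfold A.
        rewrite Cmod_flipa, avec_in by auto. eapply Rlt_le_trans; [apply Hh; destruct Hl; lia|auto].
      + intros E. specialize (Ha l Hl). rewrite E, re_RtoC in Ha. lra. }
  assert (Hval : forall h, (forall j, (j < S (S N))%nat -> Cmod (h j) < r) ->
     LN N (z O + h O)%C (z 1%nat + h 1%nat)%C (avec N (fun j => z j + h j)%C) th =
     (chi N Lam th * Lp N (z O + h O) (W (fun j => z j + h j)) (A (fun j => z j + h j)) Th)%C).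
  { intros h Hh. destruct (Hnear h Hh) as [N1 [N2 N3]].
    assert (HP2 : PlusC N (c / 2) (W (fun j => z j + h j)%C) (A (fun j => z j + h j)%C) Th).
    { apply (PlusC_near N c (W z) (A z)); auto; try lra.
      intros l Hl; destruct (N3 l Hl); split; auto; lra. }
    apply (LN_Lp N Lam); auto.
    - destruct (Ceq_dec (h O) 0%C) as [E|E].
      + rewrite E. replace (z O + 0)%C with (z O) by ring. auto.
      + apply Hiso; [lra|]. intros Q. apply E. replace (h O) with ((z O + h O) - z O)%C by ring. rewrite Q. ring.
    - destruct HP2 as [Q _]. unfold W in Q. lra.
    - intros l Hl. destruct HP2 as [_ Q]. destruct (Q l Hl) as [Q1|[Q1 _]]; [unfold A in Q1; lra|].
      destruct (N3 l Hl) as [N4 _]. rewrite Q1 in N4. specialize (Ha l Hl).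
      assert (B := Re_le_Cmod (A z l)). replace (0 - A z l)%C with (- A z l)%C in N4 by ring. rewrite Cmod_opp in N4.
      assert (B2 := Rle_abs (Re (A z l))). destruct HPc as [_ HPc2]. destruct (HPc2 l Hl) as [B3|[B3 _]].
      + lra. + rewrite B3, re_RtoC in Ha. lra. }
  apply (osgood (S (S N)) (fun z => LN N (z O) (z 1%nat) (avec N z) th) z r (Cmod (chi N Lam th) * M) Hr).
  - intros h _ Hh. rewrite (Hval h Hh), Cmod_mult. apply Rmult_le_compat_l; [apply Cmod_ge_0|].
    destruct (Hnear h Hh) as [N1 [N2 N3]].
    apply HLp; try lra. intros l Hl; destruct (N3 l Hl); split; auto; lra.
  - intros p v _ _ Hp. destruct (Hnear p Hp) as [N1 [N2 N3]].
    assert (Hrho : exists rho, 0 < rho /\ forall t, Cmod t < rho ->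
       forall j, (j < S (S N))%nat -> Cmod (p j + t * v j)%C < r).
    { assert (G : forall n, (n <= S (S N))%nat -> exists rho, 0 < rho /\ forall t, Cmod t < rho ->
         forall j, (j < n)%nat -> Cmod (p j + t * v j)%C < r).
      { induction n as [|n IH]; intros Hn.
        - exists 1. split; [lra|]. intros; lia.
        - destruct (IH ltac:(lia)) as [r1 [Hr1 H1]].
          destruct (line_near 0%C (p n) (v n) r) as [r2 [Hr2 H2]].
          { replace (p n - 0)%C with (p n) by ring. apply Hp; lia. }
          assert (M1 := Rmin_l r1 r2). assert (M2 := Rmin_r r1 r2).
          exists (Rmin r1 r2). split; [apply Rmin_pos; auto|]. intros t Ht j Hj.
          destruct (Nat.eq_dec j n) as [->|E].
          + specialize (H2 t ltac:(lra)). replace (p n + t * v n - 0)%C with (p n + t * v n)%C in H2 by ring. auto.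
          + apply H1; [lra|lia]. }
      apply (G (S (S N))); lia. }
    destruct Hrho as [rho [Hrho Hline]].
    apply (Cd_ext_loc (fun t => chi N Lam th * Lp N (z O + p O + t * v O)
       (W (fun j => z j + p j) + t * W v) (fun l => A (fun j => z j + p j) l + t * A v l) Th)%C _ 0%C rho); auto.
    + intros t Ht. replace (0 + t)%C with t by ring.
      rewrite (Hval (fun j => p j + t * v j)%C) by (apply Hline; auto).
      assert (Ez : (fun j => z j + (p j + t * v j))%C = (fun j => (z j + p j) + t * v j)%C)
        by (apply functional_extensionality; intros; ring).
      rewrite Ez, (EW (fun j => z j + p j)%C), (EA (fun j => z j + p j)%C).
      do 2 f_equal. ring.
    + apply Cd_mult; [apply Cd_const|].
      destruct (HLp (z O + p O)%C (W (fun j => z j + p j)%C) (A (fun j => z j + p j)%C)) as [_ HC]; try lra.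
      * intros l Hl; destruct (N3 l Hl); split; auto; lra.
      * apply HC. intros l Hl E. specialize (Ha l Hl). rewrite E, re_RtoC in Ha. lra.
Qed.

(** * Comparison with the Barnes zeta function *)

Lemma barnes_cont_Lp N : is_barnes_cont N (Lp N).
Proof.
  intros w a th HT. split.
  - intros s Hs. apply Lp_s_Cd; auto. apply Tplus_Plus; auto.
  - intros s Hs. apply barnes_series_Lp; auto.
Qed.

(** [Lp] shows that a continuation exists, so the choice in [zetaN] is a genuine one. Both have the
    same Barnes series for [Re s > N], hence agree off [P_N]. *)
Lemma zetaN_Lp N s w a th : Tplus N w a th -> ~ PN N s -> zetaN N s w a th = Lp N s w a th.
Proof.
  intros HT. assert (HZ : is_barnes_cont N (zetaN N)).
  { apply (epsilon_spec (inhabits (fun _ _ _ _ => RtoC 0)) (is_barnes_cont N)).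
    exists (Lp N). apply barnes_cont_Lp. }
  destruct (HZ w a th HT) as [Z1 Z2]. destruct (barnes_cont_Lp N w a th HT) as [B1 B2].
  apply (continuation_unique N (fun s => zetaN N s w a th) (fun s => Lp N s w a th)); auto.
  intros s' Hs'. specialize (Z2 s' Hs'). specialize (B2 s' Hs').
  apply clim_filterlim in Z2. apply clim_filterlim in B2. exact (clim_unique _ _ _ Z2 B2).
Qed.

(** When [w] and all [a_l] lie in the cone nothing is reflected, [chi] is 1, and both sides are
    rotated values of the same function. *)
Lemma LN_zeta N s w a th : ~ PN N s -> Ccone w -> (forall l, inPN N l -> Ccone (a l)) ->
  LN N s w a th = zeta_ext N s w a th.
Proof.
  intros Hs Hw Ha.
  assert (E : Lam0 N a = fun _ => False).
  { apply functional_extensionality. intros l. apply propositional_extensionality. split; [|tauto].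
    intros [Hl Hc]. specialize (Ha l Hl). unfold Ccone in Ha, Hc. rewrite re_opp, im_opp in Hc. lra. }
  assert (E1 : Tr N a (fun _ => False) = 0%C).
  { unfold Tr. rewrite sumPN_csum0. induction N as [|n IH]; [reflexivity|].
    clear - n. induction (S n) as [|m IH]; [reflexivity|]. rewrite csum0_S, IH.
    destruct (excluded_middle_informative False); [tauto|ring]. }
  assert (E2 : flipa (fun _ => False) a = a).
  { apply functional_extensionality. intros l. unfold flipa.
    destruct (excluded_middle_informative False); tauto. }
  assert (E3 : flipth (fun _ => False) th = th).
  { apply functional_extensionality. intros l. unfold flipth.
    destruct (excluded_middle_informative False); tauto. }
  assert (E4 : chi N (fun _ => False) th = 1%C).
  { unfold chi. clear. induction N as [|m IH]; [reflexivity|]. rewrite cprod_S, IH.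
    destruct (excluded_middle_informative False); [tauto|ring]. }
  unfold LN. rewrite E, E1, E2, E3, E4. replace (w - 0)%C with w by ring. rewrite Cmult_1_l.
  unfold zeta_ext.
  (* The very predicate in [zeta_ext], so the angle selected here is the one used there; by [L0_eq]
     it may also be used for [L0]. *)
  set (P := fun om => - (PI / 2) < om < PI / 2 /\ Tplus N (rot om w) (rotv om a) th).
  assert (Hex : exists om, P om).
  { destruct (Ccone_rot w Hw) as [d1 [Hd1 H1]].
    destruct (uniform_delta N (fun l om => 0 < Re (rotv om a l))) as [d2 [Hd2 H2]].
    { intros l Hl. apply (Ccone_rot (a l)); auto. }
    assert (Hpi := PI2_1). set (d := Rmin 1 (Rmin d1 d2)).
    assert (Hd : 0 < d) by (unfold d; repeat apply Rmin_pos; lra).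
    assert (D1 : d <= 1) by apply Rmin_l.
    assert (D2 : d <= d1) by (eapply Rle_trans; [apply Rmin_r|apply Rmin_l]).
    assert (D3 : d <= d2) by (eapply Rle_trans; [apply Rmin_r|apply Rmin_r]).
    exists (- d / 2). split; [lra|]. split; [apply H1; lra|]. intros l Hl. apply H2; auto; lra. }
  assert (Hom := epsilon_spec (inhabits 0) P Hex). set (om := epsilon (inhabits 0) P) in *.
  destruct Hom as [B HT]. rewrite zetaN_Lp by auto.
  apply L0_eq; auto. split; auto. apply Tplus_Plus; auto.
Qed.

Theorem theorem1 (N : nat) (HN : (1 <= N)%nat) :
  exists L : C -> C -> (nat -> C) -> (nat -> R) -> C,
    (* L_N is the limit omega -> 0^- of L_{N,eps}(s, e^{i omega}w, e^{i omega}a, theta),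
       for every eps in E (so the limit exists and is independent of eps) *)
    (forall eps, inE N eps ->
      forall s w a th, ~ PN N s -> Dtilde N w a th ->
        (exists delta, 0 < delta /\
           forall om, - delta < om < 0 ->
             exists v, LNeps_is N eps s (rot om w) (rotv om a) th v) /\
        (forall eta, 0 < eta -> exists delta, 0 < delta /\
           forall om v, - delta < om < 0 ->
             LNeps_is N eps s (rot om w) (rotv om a) th v ->
             Cmod (v - L s w a th)%C < eta)) /\
    (* (i) meromorphic in s with at most simple poles at P_N *)
    (forall w a th, Dtilde N w a th ->
       (forall s, ~ PN N s -> Cderivable (fun s => L s w a th) s) /\
       (forall k, inPN N k -> exists l : C, forall eta, 0 < eta ->
          exists delta, 0 < delta /\ forall s,
            0 < Cmod (s - RtoC (INR k))%C -> Cmod (s - RtoC (INR k))%C < delta ->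
            Cmod ((s - RtoC (INR k)) * L s w a th - l)%C < eta)) /\
    (* (ii) holomorphic in (s,w,a) on (C \ P_N) x p(T_Lambda(T_N^+)) *)
    (forall (th : nat -> R) (Lam : nat -> Prop), (forall l, Lam l -> inPN N l) ->
       holo_on (S (S N))
         (fun z => ~ PN N (z O) /\ pTLam N Lam (z 1%nat) (avec N z))
         (fun z => L (z O) (z 1%nat) (avec N z) th)) /\
    (* (iii) agreement with the (extended) Barnes zeta function *)
    (forall s w a th, ~ PN N s -> Ccone w -> (forall l, inPN N l -> Ccone (a l)) ->
       L s w a th = zeta_ext N s w a th).
Proof.
  exists (LN N). split; [|split; [|split]].
  - intros eps HE. apply LN_limit; auto.
  - intros w a th HD. split.
    + intros s Hs. apply LN_s_Cd; auto.
    + intros k _. apply LN_pole; auto.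
  - intros th Lam HL. apply LN_holo; auto.
  - intros. apply LN_zeta; auto.
Qed.
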